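(* Let $(T,t,s)$ be a bistrong vertical double monad on a monoidal double category $\mathbb D$ such that the vertical transformations $\alpha,\lambda,\rho$ (of $\mathbb D$), $t,s$ (left and right strength) and $\mu,\eta$ (of $T$) are invertible and liftable. Then the Kleisli pseudodouble category $\mathbb{K}l(\hat T)$ is premonoidal.
   Context: Double categories are strict: objects, 1h-cells (horizontal), 1v-cells (vertical), squares (2-cells); in a pseudodouble category horizontal composition is associative and unital up to coherent isomorphism (notions below are used for these as well). $[a|b|\cdots]$: horizontal composition (left to right), also for 1h-cells; $a/b$: vertical composition ($a$ on top), also for 1v-cells and transformations. Pseudodouble functors preserve vertical structure strictly and horizontal composition up to coherent natural invertible compositors/unitors. A horizontal pseudonatural transformation $\alpha:F\Rightarrow G$ has 1h-components $\alpha(A)$, squares $\alpha^u$ (top $\alpha(A)$, bottom $\alpha(\tilde A)$, left $F(u)$, right $G(u)$) and invertible horizontally globular 2-cells $\alpha(B)F(f)\Rightarrow G(f)\alpha(A)$, coherent and natural. A vertical pseudonatural transformation has 1v-components $\alpha(A)$, squares $\alpha_f$ (top $F(f)$, bottom $G(f)$, left $\alpha(A)$, right $\alpha(B)$) and horizontally invertible vertically globular 2-cells between $\alpha(A)/G(u)$ and $F(u)/\alpha(\tilde A)$, coherent and natural; strict if these are identities, and then invertible if all $\alpha_f$ are vertically invertible. Companion of $u:A\to B$ (vertical): 1h-cell $\hat u:A\to B$ with 2-cells $\varepsilon_u$ (top $\hat u$, left $u$, other sides identities), $\iota_u$ (bottom $\hat u$, right $u$, other sides identities), $[\iota_u|\varepsilon_u]=\mathrm{Id}$,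 $\iota_u/\varepsilon_u=\mathrm{Id}$. Liftable: all 1v-components have companions. Companion-lift $\hat\alpha$ of an invertible liftable vertical strict $\alpha$: horizontal pseudonatural transformation with components $\hat\alpha(A)$, $[\iota_{\alpha(A)}|\alpha_f|\varepsilon_{\alpha(B)}]$, $[\mathrm{Id}^{F(u)}/\iota_{\alpha(\tilde A)}|\varepsilon_{\alpha(A)}/\mathrm{Id}^{G(u)}]$. Monoidal double category: pseudodouble functors $\otimes,I$ and invertible vertical strict $\alpha:(AB)C\to A(BC)$, $\lambda:IA\to A$, $\rho:AI\to A$ ($AB=A\otimes B$) satisfying strictly the pentagon and unit triangles. Vertical double monad: pseudodouble functor $T:\mathbb D\to\mathbb D$ with vertical strict $\mu:TT\Rightarrow T$, $\eta:\mathrm{Id}\Rightarrow T$ satisfying the monad laws strictly; if $\mu,\eta$ are invertible and liftable, $\hat T=(T,\hat\mu,\hat\eta)$ is a horizontal double monad (monad laws up to coherent invertible horizontal modifications, lifted from the strict laws). Left vertical strength: vertical strict $t_{A,B}:A\otimes T(B)\to T(A\otimes B)$ with $\lambda_{T(A)}=t_{I,A}/T\lambda_A$, $\alpha_{A,B,T(C)}/(At_{B,C})/t_{A,BC}=t_{AB,C}/T(\alpha_{A,B,C})$, $(A\mu_B)/t_{A,B}=t_{A,T(B)}/T(t_{A,B})/\mu_{AB}$, $\eta_{AB}=(A\eta_B)/t_{A,B}$. Right vertical strength: vertical strict $s_{A,B}:T(A)\otimes B\to T(A\otimes B)$ with $\rho_{T(A)}=s_{A,I}/T\rho_A$, $\alpha_{T(A),B,C}/s_{A,BC}=(s_{A,B}C)/s_{AB,C}/T(\alpha_{A,B,C})$,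 $(\mu_AB)/s_{A,B}=s_{T(A),B}/T(s_{A,B})/\mu_{AB}$, $\eta_{AB}=(\eta_AB)/s_{A,B}$. $(T,t,s)$ is (vertically) bistrong if $(t_{A,B}\otimes C)/s_{AB,C}/T(\alpha_{A,B,C})=\alpha_{A,T(B),C}/(A\otimes s_{B,C})/t_{A,BC}$ (an identity vertical modification $q$). All these are equalities of vertical strict transformations. Kleisli pseudodouble category $\mathbb{K}l(S)$ of a horizontal double monad $(S,\mu,\eta)$: objects and 1v-cells of $\mathbb D$; 1h-cells $f^K:A\to B$ are 1h-cells $f:A\to S(B)$; 2-cells with right side $v$ are 2-cells of $\mathbb D$ with right side $S(v)$; vertical composition as in $\mathbb D$; horizontal composition $[f|S(g)|\mu_C]$, $[\phi|S(\psi)|\mu^w]$; identities $\eta_A,\eta^u$. Premonoidal (pseudo)double category $\mathbb B$: pseudodouble functors $A\ltimes-,-\rtimes B:\mathbb B\to\mathbb B$ for all objects with $A\ltimes B=A\rtimes B=:A\bowtie B$ (binoidal), an object $I$, and invertible vertical strict transformations $\lambda:I\ltimes-\Rightarrow\mathrm{Id}$, $\rho:-\rtimes I\Rightarrow\mathrm{Id}$, $\alpha_{-,B,C}:(-\rtimes B)\rtimes C\Rightarrow-\rtimes(B\bowtie C)$, $\alpha_{A,-,C}:(A\ltimes-)\rtimes C\Rightarrow A\ltimes(-\rtimes C)$, $\alpha_{A,B,-}:(A\bowtie B)\ltimes-\Rightarrow A\ltimes(B\ltimes-)$ with inversely central 1v-components, the three $\alpha$'s having common 1v-components $\alpha_{A,B,C}$,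 satisfying, as equalities of vertical transformations, the pentagon $\alpha_{W,X,Y}Z/\alpha_{W,XY,Z}/W\alpha_{X,Y,Z}=\alpha_{WX,Y,Z}/\alpha_{W,X,YZ}$ in each of its four variables and the triangles $\alpha_{W,I,Y}/W\lambda_Y=\rho_WY$, $\alpha_{I,W,Y}/\lambda_{WY}=\lambda_WY$, $\alpha_{W,Y,I}/W\rho_Y=\rho_{WY}$ in each of $W,Y$. Here a 1v-cell $v:A\to\tilde A$ is central if equipped with vertical pseudonatural transformations $v\ltimes-:A\ltimes-\Rightarrow\tilde A\ltimes-$ and $-\rtimes v:-\rtimes A\Rightarrow-\rtimes\tilde A$ with $v\ltimes B=v\rtimes B$, $B\rtimes v=B\ltimes v$; an invertible 1v-cell is inversely central if it and its inverse are central with mutually inverse components at 1h-cells. *)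

(* Defs.v *)
Set Implicit Arguments.
Unset Strict Implicit.
Unset Printing Implicit Defensive.

(* All compositions are written in diagrammatic order.  A square
     a : Sq f g u v
   has top f, bottom g, left side u and right side v.  Records whose name ends
   in "Data" carry operations together with the strict laws for 1v-cells only;
   the laws for squares are collected in separate predicates. *)

Record RawData := {
  Ob :> Type;
  Hor : Ob -> Ob -> Type;
  Ver : Ob -> Ob -> Type;
  Sq : forall A B A' B', Hor A B -> Hor A' B' -> Ver A A' -> Ver B B' -> Type;
  vid : forall A, Ver A A;
  vc : forall A B C, Ver A B -> Ver B C -> Ver A C;
  vc_idl : forall A B (u : Ver A B), vc (vid A) u = u;
  vc_idr : forall A B (u : Ver A B), vc u (vid B) = u;
  vc_assoc : forall A B C E (u : Ver A B) (v : Ver B C) (w : Ver C E),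
    vc (vc u v) w = vc u (vc v w);
  hid : forall A, Hor A A;
  hc : forall A B C, Hor A B -> Hor B C -> Hor A C;
  sqv : forall A B (f : Hor A B), Sq f f (vid A) (vid B);
  sqh : forall A B (u : Ver A B), Sq (hid A) (hid B) u u;
  vs : forall A B A' B' A'' B'' (f : Hor A B) (g : Hor A' B') (h : Hor A'' B'')
    (u : Ver A A') (v : Ver B B') (u' : Ver A' A'') (v' : Ver B' B''),
    Sq f g u v -> Sq g h u' v' -> Sq f h (vc u u') (vc v v');
  hs : forall A B C A' B' C' (f : Hor A B) (f' : Hor B C)
    (g : Hor A' B') (g' : Hor B' C')
    (u : Ver A A') (v : Ver B B') (w : Ver C C'),
    Sq f g u v -> Sq f' g' v w -> Sq (hc f f') (hc g g') u w
}.

Arguments vid {r} A.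
Arguments hid {r} A.
Arguments sqv {r A B} f.
Arguments sqh {r A B} u.

Declare Scope dbl_scope.
Open Scope dbl_scope.
Infix "//" := vc (at level 40, left associativity) : dbl_scope.
Infix "///" := vs (at level 40, left associativity) : dbl_scope.
Infix "**" := hc (at level 38, right associativity) : dbl_scope.
Infix "***" := hs (at level 38, right associativity) : dbl_scope.

(* Equality of squares in which the boundaries may be only propositionally
   equal: it says that the boundaries coincide and so do the squares. *)
Inductive sqeq (D : RawData) (A B A' B' : D) (f : Hor A B) (g : Hor A' B')
    (u : Ver A A') (v : Ver B B') (a : Sq f g u v) :
    forall (C E C' E' : D) (h : Hor C E) (k : Hor C' E')
      (w : Ver C C') (x : Ver E E'), Sq h k w x -> Prop :=
  sqeq_refl : sqeq a a.

Infix "~=" := sqeq (at level 70, no associativity) : dbl_scope.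

Definition castv (D : RawData) (A B A' B' : D) (f : Hor A B) (g : Hor A' B')
    (u u' : Ver A A') (v v' : Ver B B') (eu : u = u') (ev : v = v')
    (a : Sq f g u v) : Sq f g u' v' :=
  match eu in _ = x, ev in _ = y return Sq f g x y with
  | eq_refl, eq_refl => a
  end.

(* A pair of horizontally globular squares in opposite directions, inverse to
   each other only under [is_giso]. *)
Record Giso (D : RawData) (A B : D) (f g : Hor A B) := {
  fwd : Sq f g (vid A) (vid B);
  bwd : Sq g f (vid A) (vid B)
}.

Definition is_giso (D : RawData) (A B : D) (f g : Hor A B) (p : Giso f g) : Prop :=
  (fwd p /// bwd p ~= sqv f) /\ (bwd p /// fwd p ~= sqv g).

Section Globular.
Variable D : RawData.

Definition gtop (A B A' B' : D) (f' f : Hor A B) (g : Hor A' B')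
    (u : Ver A A') (v : Ver B B') (p : Sq f' f (vid A) (vid B)) (a : Sq f g u v) :
    Sq f' g u v :=
  castv (vc_idl u) (vc_idl v) (p /// a).

Definition gbot (A B A' B' : D) (f : Hor A B) (g g' : Hor A' B')
    (u : Ver A A') (v : Ver B B') (a : Sq f g u v) (p : Sq g g' (vid A') (vid B')) :
    Sq f g' u v :=
  castv (vc_idr u) (vc_idr v) (a /// p).

Definition gid (A B : D) (f : Hor A B) : Giso f f :=
  {| fwd := sqv f; bwd := sqv f |}.

Definition ginv (A B : D) (f g : Hor A B) (p : Giso f g) : Giso g f :=
  {| fwd := bwd p; bwd := fwd p |}.

Definition gcomp (A B : D) (f g h : Hor A B) (p : Giso f g) (q : Giso g h) : Giso f h :=
  {| fwd := gtop (fwd p) (fwd q); bwd := gtop (bwd q) (bwd p) |}.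

Definition gh (A B C : D) (f g : Hor A B) (h k : Hor B C) (p : Giso f g) (q : Giso h k) :
    Giso (f ** h) (g ** k) :=
  {| fwd := fwd p *** fwd q; bwd := bwd p *** bwd q |}.

End Globular.

Infix ">>" := gcomp (at level 45, right associativity) : dbl_scope.

Record DblData := {
  raw :> RawData;
  assoc : forall (A B C E : raw) (f : Hor A B) (g : Hor B C) (h : Hor C E),
    Giso ((f ** g) ** h) (f ** (g ** h));
  lunit : forall (A B : raw) (f : Hor A B), Giso (hid A ** f) f;
  runit : forall (A B : raw) (f : Hor A B), Giso (f ** hid B) f
}.

Record is_pseudodouble (D : DblData) : Prop := {
  vs_idl : forall (A B A' B' : D) (f : Hor A B) (g : Hor A' B')
    (u : Ver A A') (v : Ver B B') (a : Sq f g u v), sqv f /// a ~= a;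
  vs_idr : forall (A B A' B' : D) (f : Hor A B) (g : Hor A' B')
    (u : Ver A A') (v : Ver B B') (a : Sq f g u v), a /// sqv g ~= a;
  vs_assoc : forall (A B A1 B1 A2 B2 A3 B3 : D)
    (f : Hor A B) (f1 : Hor A1 B1) (f2 : Hor A2 B2) (f3 : Hor A3 B3)
    (u1 : Ver A A1) (v1 : Ver B B1) (u2 : Ver A1 A2) (v2 : Ver B1 B2)
    (u3 : Ver A2 A3) (v3 : Ver B2 B3)
    (a : Sq f f1 u1 v1) (b : Sq f1 f2 u2 v2) (c : Sq f2 f3 u3 v3),
    (a /// b) /// c ~= a /// (b /// c);
  interchange : forall (A B C A' B' C' A'' B'' C'' : D)
    (f : Hor A B) (f' : Hor B C) (g : Hor A' B') (g' : Hor B' C')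
    (h : Hor A'' B'') (h' : Hor B'' C'')
    (u : Ver A A') (v : Ver B B') (w : Ver C C')
    (u' : Ver A' A'') (v' : Ver B' B'') (w' : Ver C' C'')
    (a : Sq f g u v) (b : Sq f' g' v w) (c : Sq g h u' v') (d : Sq g' h' v' w'),
    (a *** b) /// (c *** d) = (a /// c) *** (b /// d);
  hs_sqv : forall (A B C : D) (f : Hor A B) (g : Hor B C), sqv f *** sqv g = sqv (f ** g);
  vs_sqh : forall (A B C : D) (u : Ver A B) (v : Ver B C), sqh u /// sqh v = sqh (u // v);
  sqh_vid : forall A : D, sqh (vid A) = sqv (hid A);
  assoc_iso : forall (A B C E : D) (f : Hor A B) (g : Hor B C) (h : Hor C E),
    is_giso (assoc f g h);
  lunit_iso : forall (A B : D) (f : Hor A B), is_giso (lunit f);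
  runit_iso : forall (A B : D) (f : Hor A B), is_giso (runit f);
  assoc_nat : forall (A B C E A' B' C' E' : D)
    (f : Hor A B) (g : Hor B C) (h : Hor C E)
    (f' : Hor A' B') (g' : Hor B' C') (h' : Hor C' E')
    (u : Ver A A') (v : Ver B B') (w : Ver C C') (x : Ver E E')
    (a : Sq f f' u v) (b : Sq g g' v w) (c : Sq h h' w x),
    ((a *** b) *** c) /// fwd (assoc f' g' h') ~= fwd (assoc f g h) /// (a *** (b *** c));
  lunit_nat : forall (A B A' B' : D) (f : Hor A B) (g : Hor A' B')
    (u : Ver A A') (v : Ver B B') (a : Sq f g u v),
    (sqh u *** a) /// fwd (lunit g) ~= fwd (lunit f) /// a;
  runit_nat : forall (A B A' B' : D) (f : Hor A B) (g : Hor A' B')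
    (u : Ver A A') (v : Ver B B') (a : Sq f g u v),
    (a *** sqh v) /// fwd (runit g) ~= fwd (runit f) /// a;
  pentagon : forall (A B C E F : D) (f : Hor A B) (g : Hor B C) (h : Hor C E) (k : Hor E F),
    (fwd (assoc f g h) *** sqv k) /// fwd (assoc f (g ** h) k)
      /// (sqv f *** fwd (assoc g h k))
    ~= fwd (assoc (f ** g) h k) /// fwd (assoc f g (h ** k));
  triangle : forall (A B C : D) (f : Hor A B) (g : Hor B C),
    fwd (assoc f (hid B) g) /// (sqv f *** fwd (lunit g)) ~= fwd (runit f) *** sqv g
}.

(* A strict double category is a pseudodouble category whose associativity and
   unit constraints are identity squares. *)
Record is_double (D : DblData) : Prop := {
  double_pseudo : is_pseudodouble D;
  assoc_strict : forall (A B C E : D) (f : Hor A B) (g : Hor B C) (h : Hor C E),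
    fwd (assoc f g h) ~= sqv ((f ** g) ** h);
  lunit_strict : forall (A B : D) (f : Hor A B), fwd (lunit f) ~= sqv f;
  runit_strict : forall (A B : D) (f : Hor A B), fwd (runit f) ~= sqv f
}.

Definition hv (D : DblData) (A B : D) (u v w : Ver A B)
    (a : Sq (hid A) (hid B) u v) (b : Sq (hid A) (hid B) v w) : Sq (hid A) (hid B) u w :=
  gtop (bwd (lunit (hid A))) (gbot (a *** b) (fwd (lunit (hid B)))).

(* Functors are indexed by their object map, so that functors agreeing on
   objects (as required of a binoidal structure) have a common type.  [PreFun]
   contains no proofs, and has primitive projections, so that its composition
   is definitionally associative and unital. *)
Local Set Primitive Projections.
Record PreFun (C D : DblData) (F0 : C -> D) := {
  fh : forall A B : C, Hor A B -> Hor (F0 A) (F0 B);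
  fv : forall A B : C, Ver A B -> Ver (F0 A) (F0 B);
  fsq : forall (A B A' B' : C) (f : Hor A B) (g : Hor A' B') (u : Ver A A') (v : Ver B B'),
    Sq f g u v -> Sq (fh f) (fh g) (fv u) (fv v)
}.
Local Unset Primitive Projections.

Arguments fh {C D F0} F {A B} f : rename.
Arguments fv {C D F0} F {A B} u : rename.
Arguments fsq {C D F0} F {A B A' B' f g u v} a : rename.

Record FunData (C D : DblData) (F0 : C -> D) := {
  pre :> PreFun F0;
  fv_id : forall A : C, fv pre (vid A) = vid (F0 A);
  fv_vc : forall (A B E : C) (u : Ver A B) (v : Ver B E), fv pre (u // v) = fv pre u // fv pre v;
  cmp : forall (A B E : C) (f : Hor A B) (g : Hor B E),
    Giso (fh pre f ** fh pre g) (fh pre (f ** g));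
  unt : forall A : C, Giso (hid (F0 A)) (fh pre (hid A))
}.

Arguments fv_id {C D F0} F A : rename.
Arguments fv_vc {C D F0} F {A B E} u v : rename.
Arguments cmp {C D F0} F {A B E} f g : rename.
Arguments unt {C D F0} F A : rename.

Record is_psfun (C D : DblData) (F0 : C -> D) (F : FunData F0) : Prop := {
  fsq_vs : forall (A B A' B' A'' B'' : C) (f : Hor A B) (g : Hor A' B') (h : Hor A'' B'')
    (u : Ver A A') (v : Ver B B') (u' : Ver A' A'') (v' : Ver B' B'')
    (a : Sq f g u v) (b : Sq g h u' v'), fsq F (a /// b) ~= fsq F a /// fsq F b;
  fsq_sqv : forall (A B : C) (f : Hor A B), fsq F (sqv f) ~= sqv (fh F f);
  cmp_iso : forall (A B E : C) (f : Hor A B) (g : Hor B E), is_giso (cmp F f g);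
  unt_iso : forall A : C, is_giso (unt F A);
  cmp_nat : forall (A B E A' B' E' : C) (f : Hor A B) (g : Hor B E)
    (f' : Hor A' B') (g' : Hor B' E') (u : Ver A A') (v : Ver B B') (w : Ver E E')
    (a : Sq f f' u v) (b : Sq g g' v w),
    (fsq F a *** fsq F b) /// fwd (cmp F f' g') ~= fwd (cmp F f g) /// fsq F (a *** b);
  unt_nat : forall (A A' : C) (u : Ver A A'),
    sqh (fv F u) /// fwd (unt F A') ~= fwd (unt F A) /// fsq F (sqh u);
  cmp_assoc : forall (A B E G : C) (f : Hor A B) (g : Hor B E) (h : Hor E G),
    (fwd (cmp F f g) *** sqv (fh F h)) /// fwd (cmp F (f ** g) h) /// fsq F (fwd (assoc f g h))
    ~= fwd (assoc (fh F f) (fh F g) (fh F h)) /// (sqv (fh F f) *** fwd (cmp F g h))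
       /// fwd (cmp F f (g ** h));
  cmp_lunit : forall (A B : C) (f : Hor A B),
    (fwd (unt F A) *** sqv (fh F f)) /// fwd (cmp F (hid A) f) /// fsq F (fwd (lunit f))
    ~= fwd (lunit (fh F f));
  cmp_runit : forall (A B : C) (f : Hor A B),
    (sqv (fh F f) *** fwd (unt F B)) /// fwd (cmp F f (hid B)) /// fsq F (fwd (runit f))
    ~= fwd (runit (fh F f))
}.

Definition gmap (C D : DblData) (F0 : C -> D) (F : FunData F0) (A B : C) (f g : Hor A B)
    (p : Giso f g) : Giso (fh F f) (fh F g) :=
  {| fwd := castv (fv_id F A) (fv_id F B) (fsq F (fwd p));
     bwd := castv (fv_id F A) (fv_id F B) (fsq F (bwd p)) |}.

Definition idP (C : DblData) : PreFun (fun A : C => A) :=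
  {| fh := fun _ _ f => f; fv := fun _ _ u => u; fsq := fun _ _ _ _ _ _ _ _ a => a |}.

Definition idF (C : DblData) : FunData (fun A : C => A) :=
  {| pre := idP C;
     fv_id := fun _ => eq_refl;
     fv_vc := fun _ _ _ _ _ => eq_refl;
     cmp := fun _ _ _ f g => gid (f ** g);
     unt := fun A => gid (hid A) |}.

Definition compP (C D E : DblData) (G0 : D -> E) (F0 : C -> D) (G : PreFun G0) (F : PreFun F0) :
    PreFun (fun A => G0 (F0 A)) :=
  {| fh := fun _ _ f => fh G (fh F f);
     fv := fun _ _ u => fv G (fv F u);
     fsq := fun _ _ _ _ _ _ _ _ a => fsq G (fsq F a) |}.

Definition compF (C D E : DblData) (G0 : D -> E) (F0 : C -> D) (G : FunData G0) (F : FunData F0) :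
    FunData (fun A => G0 (F0 A)) :=
  {| pre := compP G F;
     fv_id := fun A => eq_trans (f_equal (fv G (A:=_) (B:=_)) (fv_id F A)) (fv_id G (F0 A));
     fv_vc := fun A B C u v =>
       eq_trans (f_equal (fv G (A:=_) (B:=_)) (fv_vc F u v)) (fv_vc G (fv F u) (fv F v));
     cmp := fun _ _ _ f g => cmp G (fh F f) (fh F g) >> gmap G (cmp F f g);
     unt := fun A => unt G (F0 A) >> gmap G (unt F A) |}.

Definition OneRaw : RawData :=
  {| Ob := unit;
     Hor := fun _ _ => unit;
     Ver := fun _ _ => unit;
     Sq := fun _ _ _ _ _ _ _ _ => unit;
     vid := fun _ => tt;
     vc := fun _ _ _ _ _ => tt;
     vc_idl := fun _ _ u => match u with tt => eq_refl end;
     vc_idr := fun _ _ u => match u with tt => eq_refl end;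
     vc_assoc := fun _ _ _ _ _ _ _ => eq_refl;
     hid := fun _ => tt;
     hc := fun _ _ _ _ _ => tt;
     sqv := fun _ _ _ => tt;
     sqh := fun _ _ _ => tt;
     vs := fun _ _ _ _ _ _ _ _ _ _ _ _ _ _ _ => tt;
     hs := fun _ _ _ _ _ _ _ _ _ _ _ _ _ _ _ => tt |}.

Definition one_giso (A B : OneRaw) (f g : Hor A B) : Giso f g :=
  @Build_Giso OneRaw A B f g tt tt.

Definition One : DblData :=
  {| raw := OneRaw;
     assoc := fun _ _ _ _ _ _ _ => one_giso _ _;
     lunit := fun _ _ _ => one_giso _ _;
     runit := fun _ _ _ => one_giso _ _ |}.

Definition ProdRaw (C D : RawData) : RawData :=
  {| Ob := (Ob C * Ob D)%type;
     Hor := fun p q => (Hor (fst p) (fst q) * Hor (snd p) (snd q))%type;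
     Ver := fun p q => (Ver (fst p) (fst q) * Ver (snd p) (snd q))%type;
     Sq := fun _ _ _ _ f g u v =>
       (Sq (fst f) (fst g) (fst u) (fst v) * Sq (snd f) (snd g) (snd u) (snd v))%type;
     vid := fun p => (vid (fst p), vid (snd p));
     vc := fun _ _ _ u v => (fst u // fst v, snd u // snd v);
     vc_idl := fun _ _ u =>
       match u with (u1, u2) => f_equal2 pair (vc_idl u1) (vc_idl u2) end;
     vc_idr := fun _ _ u =>
       match u with (u1, u2) => f_equal2 pair (vc_idr u1) (vc_idr u2) end;
     vc_assoc := fun _ _ _ _ u v w =>
       f_equal2 pair (vc_assoc (fst u) (fst v) (fst w)) (vc_assoc (snd u) (snd v) (snd w));
     hid := fun p => (hid (fst p), hid (snd p));
     hc := fun _ _ _ f g => (fst f ** fst g, snd f ** snd g);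
     sqv := fun _ _ f => (sqv (fst f), sqv (snd f));
     sqh := fun _ _ u => (sqh (fst u), sqh (snd u));
     vs := fun _ _ _ _ _ _ _ _ _ _ _ _ _ a b => (fst a /// fst b, snd a /// snd b);
     hs := fun _ _ _ _ _ _ _ _ _ _ _ _ _ a b => (fst a *** fst b, snd a *** snd b) |}.

Definition prod_giso (C D : RawData) (p q : ProdRaw C D) (f g : Hor p q)
    (x : Giso (fst f) (fst g)) (y : Giso (snd f) (snd g)) : Giso f g :=
  @Build_Giso (ProdRaw C D) p q f g (fwd x, fwd y) (bwd x, bwd y).

Definition Prod (C D : DblData) : DblData :=
  {| raw := ProdRaw C D;
     assoc := fun p q r s (f : Hor p q) (g : Hor q r) (h : Hor r s) =>
       @prod_giso C D p s ((f ** g) ** h) (f ** (g ** h))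
         (assoc (fst f) (fst g) (fst h)) (assoc (snd f) (snd g) (snd h));
     lunit := fun p q (f : Hor p q) =>
       @prod_giso C D p q (hid p ** f) f (lunit (fst f)) (lunit (snd f));
     runit := fun p q (f : Hor p q) =>
       @prod_giso C D p q (f ** hid q) f (runit (fst f)) (runit (snd f)) |}.

Definition bangF (C : DblData) : @FunData C One (fun _ => tt) :=
  {| pre := @Build_PreFun C One (fun _ => tt)
       (fun _ _ _ => tt) (fun _ _ _ => tt) (fun _ _ _ _ _ _ _ _ _ => tt);
     fv_id := fun _ => eq_refl;
     fv_vc := fun _ _ _ _ _ => eq_refl;
     cmp := fun _ _ _ _ _ => one_giso _ _;
     unt := fun _ => one_giso _ _ |}.

Definition fstF (C D : DblData) : @FunData (Prod C D) C (fun p => fst p) :=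
  {| pre := @Build_PreFun (Prod C D) C (fun p => fst p)
       (fun _ _ f => fst f) (fun _ _ u => fst u) (fun _ _ _ _ _ _ _ _ a => fst a);
     fv_id := fun _ => eq_refl;
     fv_vc := fun _ _ _ _ _ => eq_refl;
     cmp := fun _ _ _ f g => gid (fst f ** fst g);
     unt := fun p => gid (hid (fst p)) |}.

Definition sndF (C D : DblData) : @FunData (Prod C D) D (fun p => snd p) :=
  {| pre := @Build_PreFun (Prod C D) D (fun p => snd p)
       (fun _ _ f => snd f) (fun _ _ u => snd u) (fun _ _ _ _ _ _ _ _ a => snd a);
     fv_id := fun _ => eq_refl;
     fv_vc := fun _ _ _ _ _ => eq_refl;
     cmp := fun _ _ _ f g => gid (snd f ** snd g);
     unt := fun p => gid (hid (snd p)) |}.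

Definition pairF (B C D : DblData) (F0 : B -> C) (G0 : B -> D)
    (F : FunData F0) (G : FunData G0) : @FunData B (Prod C D) (fun A => (F0 A, G0 A)) :=
  {| pre := @Build_PreFun B (Prod C D) (fun A => (F0 A, G0 A))
       (fun _ _ f => (fh F f, fh G f)) (fun _ _ u => (fv F u, fv G u))
       (fun _ _ _ _ _ _ _ _ a => (fsq F a, fsq G a));
     fv_id := fun A => f_equal2 pair (fv_id F A) (fv_id G A);
     fv_vc := fun _ _ _ u v => f_equal2 pair (fv_vc F u v) (fv_vc G u v);
     cmp := fun A A' A'' f g =>
       @prod_giso C D (F0 A, G0 A) (F0 A'', G0 A'')
         (fh F f ** fh F g, fh G f ** fh G g) (fh F (f ** g), fh G (f ** g))
         (cmp F f g) (cmp G f g);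
     unt := fun A =>
       @prod_giso C D (F0 A, G0 A) (F0 A, G0 A)
         (hid (F0 A), hid (G0 A)) (fh F (hid A), fh G (hid A)) (unt F A) (unt G A) |}.

Arguments fstF {C D}.
Arguments sndF {C D}.

(* The 2-cells [pcell] are oriented from F(u)/al(A') on the left to al(A)/G(u)
   on the right; they are required to be invertible, so the choice of
   orientation is immaterial. *)
Record VPs (C D : DblData) (F0 G0 : C -> D) (F : PreFun F0) (G : PreFun G0) := {
  pv : forall A : C, Ver (F0 A) (G0 A);
  psq : forall (A B : C) (f : Hor A B), Sq (fh F f) (fh G f) (pv A) (pv B);
  pcell : forall (A A' : C) (u : Ver A A'),
    Sq (hid (F0 A)) (hid (G0 A')) (fv F u // pv A') (pv A // fv G u)
}.

Arguments pv {C D F0 G0 F G} v A : rename.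
Arguments psq {C D F0 G0 F G} v {A B} f : rename.
Arguments pcell {C D F0 G0 F G} v {A A'} u : rename.

(* In [psq_nat] the two sides are
     [F(a)/al_g | al^v] = [al^u | al_f/G(a)],
   and in [pcell_vc] the right-hand side is
     [Id^F(u)/al^v | al^u/Id^G(v)],
   both up to the unit constraints. *)
Record is_vps (C D : DblData) (F0 G0 : C -> D) (F : FunData F0) (G : FunData G0)
    (al : VPs F G) : Prop := {
  pcell_inv : forall (A A' : C) (u : Ver A A'),
    exists b : Sq (hid (F0 A)) (hid (G0 A')) (pv al A // fv G u) (fv F u // pv al A'),
      hv (pcell al u) b = sqh (fv F u // pv al A') /\
      hv b (pcell al u) = sqh (pv al A // fv G u);
  psq_hc : forall (A B E : C) (f : Hor A B) (g : Hor B E),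
    fwd (cmp F f g) /// psq al (f ** g) ~= (psq al f *** psq al g) /// fwd (cmp G f g);
  psq_hid : forall A : C,
    fwd (unt F A) /// psq al (hid A) ~= sqh (pv al A) /// fwd (unt G A);
  pcell_vid : forall A : C, pcell al (vid A) ~= sqh (pv al A);
  pcell_vc : forall (A B E : C) (u : Ver A B) (v : Ver B E),
    pcell al (u // v) ~=
      hv (castv eq_refl (eq_sym (vc_assoc (fv F u) (pv al B) (fv G v)))
            (sqh (fv F u) /// pcell al v))
         (pcell al u /// sqh (fv G v));
  psq_nat : forall (A B A' B' : C) (f : Hor A B) (g : Hor A' B')
    (u : Ver A A') (v : Ver B B') (a : Sq f g u v),
    gtop (bwd (runit (fh F f)))
      (gbot ((fsq F a /// psq al g) *** pcell al v) (fwd (runit (fh G g))))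
    = gtop (bwd (lunit (fh F f)))
        (gbot (pcell al u *** (psq al f /// fsq G a)) (fwd (lunit (fh G g))))
}.

Record vps_eq (C D : DblData) (F0 G0 : C -> D) (F : PreFun F0) (G : PreFun G0)
    (al be : VPs F G) : Prop := {
  eq_pv : forall A : C, pv al A = pv be A;
  eq_psq : forall (A B : C) (f : Hor A B), psq al f ~= psq be f;
  eq_pcell : forall (A A' : C) (u : Ver A A'), pcell al u ~= pcell be u
}.

Definition vps_comp (C D : DblData) (F0 G0 H0 : C -> D)
    (F : PreFun F0) (G : PreFun G0) (H : PreFun H0) (al : VPs F G) (be : VPs G H) : VPs F H :=
  {| pv := fun A => pv al A // pv be A;
     psq := fun _ _ f => psq al f /// psq be f;
     pcell := fun A A' u =>
       hv (castv (vc_assoc (fv F u) (pv al A') (pv be A')) (vc_assoc (pv al A) (fv G u) (pv be A'))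
             (pcell al u /// sqh (pv be A')))
          (castv eq_refl (eq_sym (vc_assoc (pv al A) (pv be A) (fv H u)))
             (sqh (pv al A) /// pcell be u)) |}.

Infix "//>" := vps_comp (at level 50, left associativity) : dbl_scope.

Definition whl (C D E : DblData) (K0 : D -> E) (F0 G0 : C -> D)
    (K : FunData K0) (F : PreFun F0) (G : PreFun G0) (al : VPs F G) :
    VPs (compP K F) (compP K G) :=
  @Build_VPs C E _ _ (compP K F) (compP K G)
    (fun A => fv K (pv al A))
    (fun _ _ f => fsq K (psq al f))
    (fun A A' u =>
       gtop (fwd (unt K (F0 A)))
         (gbot (castv (fv_vc K (fv F u) (pv al A')) (fv_vc K (pv al A) (fv G u))
                  (fsq K (pcell al u)))
               (bwd (unt K (G0 A'))))).

Definition whr (B C D : DblData) (K0 : B -> C) (F0 G0 : C -> D)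
    (F : PreFun F0) (G : PreFun G0) (al : VPs F G) (K : PreFun K0) :
    VPs (compP F K) (compP G K) :=
  @Build_VPs B D _ _ (compP F K) (compP G K)
    (fun A => pv al (K0 A))
    (fun _ _ f => psq al (fh K f))
    (fun _ _ u => pcell al (fv K u)).

(* A vertical strict transformation is a vertical pseudonatural one whose
   vertically globular 2-cells are identities. *)
Record VTData (C D : DblData) (F0 G0 : C -> D) (F : PreFun F0) (G : PreFun G0) := {
  tv : forall A : C, Ver (F0 A) (G0 A);
  tsq : forall (A B : C) (f : Hor A B), Sq (fh F f) (fh G f) (tv A) (tv B);
  tv_nat : forall (A A' : C) (u : Ver A A'), fv F u // tv A' = tv A // fv G u
}.

Arguments tv {C D F0 G0 F G} v A : rename.
Arguments tsq {C D F0 G0 F G} v {A B} f : rename.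
Arguments tv_nat {C D F0 G0 F G} v {A A'} u : rename.

Definition vps_of_vt (C D : DblData) (F0 G0 : C -> D) (F : PreFun F0) (G : PreFun G0)
    (al : VTData F G) : VPs F G :=
  {| pv := tv al;
     psq := fun _ _ f => tsq al f;
     pcell := fun A A' u => castv eq_refl (tv_nat al u) (sqh (fv F u // tv al A')) |}.

Coercion vps_of_vt : VTData >-> VPs.

Record VT (C D : DblData) (F0 G0 : C -> D) (F : FunData F0) (G : FunData G0) := {
  vt :> VTData F G;
  vt_ok : is_vps (F:=F) (G:=G) vt
}.

Record VInv (D : RawData) (A B A' B' : D) (f : Hor A B) (g : Hor A' B')
    (u : Ver A A') (v : Ver B B') (a : Sq f g u v) := {
  inv_l : Ver A' A;
  inv_r : Ver B' B;
  inv_sq : Sq g f inv_l inv_r;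
  inv_l1 : u // inv_l = vid A;
  inv_l2 : inv_l // u = vid A';
  inv_r1 : v // inv_r = vid B;
  inv_r2 : inv_r // v = vid B';
  inv_sq1 : a /// inv_sq ~= sqv f;
  inv_sq2 : inv_sq /// a ~= sqv g
}.

Definition Invertible (C D : DblData) (F0 G0 : C -> D) (F : PreFun F0) (G : PreFun G0)
    (al : VTData F G) : Type :=
  forall (A B : C) (f : Hor A B), VInv (tsq al f).

Record CompData (D : RawData) (A B : D) (u : Ver A B) := {
  ch : Hor A B;
  ceps : Sq ch (hid B) u (vid B);
  ciota : Sq (hid A) ch (vid A) u
}.

Record is_companion (D : DblData) (A B : D) (u : Ver A B) (c : CompData u) : Prop := {
  comp_h : gtop (bwd (lunit (ch c))) (gbot (ciota c *** ceps c) (fwd (runit (ch c)))) = sqv (ch c);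
  comp_v : ciota c /// ceps c ~= sqh u
}.

Record Companion (D : DblData) (A B : D) (u : Ver A B) := {
  cdata :> CompData u;
  companion_ok : is_companion cdata
}.

Definition Liftable (C D : DblData) (F0 G0 : C -> D) (F : PreFun F0) (G : PreFun G0)
    (al : VTData F G) : Type :=
  forall A : C, Companion (tv al A).

Definition cd_id (D : RawData) (A : D) : CompData (vid A) :=
  {| ch := hid A; ceps := sqh (vid A); ciota := sqh (vid A) |}.

Definition cd_comp (D : DblData) (A B C : D) (u : Ver A B) (v : Ver B C)
    (c : CompData u) (d : CompData v) : CompData (u // v) :=
  {| ch := ch c ** ch d;
     ceps := castv eq_refl (vc_idl (vid C))
       ((ceps c *** sqv (ch d)) /// gtop (fwd (lunit (ch d))) (ceps d));
     ciota := castv (vc_idl (vid A)) eq_refl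
       (gbot (ciota c) (bwd (runit (ch c))) /// (sqv (ch c) *** ciota d)) |}.

Definition cd_map (C D : DblData) (F0 : C -> D) (F : FunData F0) (A B : C) (u : Ver A B)
    (c : CompData u) : CompData (fv F u) :=
  {| ch := fh F (ch c);
     ceps := gbot (castv eq_refl (fv_id F B) (fsq F (ceps c))) (bwd (unt F B));
     ciota := gtop (fwd (unt F A)) (castv (fv_id F A) eq_refl (fsq F (ciota c))) |}.

Definition cd_compare (D : DblData) (A B : D) (u u' : Ver A B) (e : u = u')
    (c : CompData u) (c' : CompData u') : Giso (ch c) (ch c') :=
  {| fwd := gtop (bwd (lunit (ch c)))
       (gbot (ciota c' *** castv e eq_refl (ceps c)) (fwd (runit (ch c'))));
     bwd := gtop (bwd (lunit (ch c')))
       (gbot (ciota c *** castv (eq_sym e) eq_refl (ceps c')) (fwd (runit (ch c)))) |}.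

Record HTData (C D : DblData) (F0 G0 : C -> D) (F : PreFun F0) (G : PreFun G0) := {
  hh : forall A : C, Hor (F0 A) (G0 A);
  hsq : forall (A A' : C) (u : Ver A A'), Sq (hh A) (hh A') (fv F u) (fv G u);
  hcell : forall (A B : C) (f : Hor A B), Giso (fh F f ** hh B) (hh A ** fh G f)
}.

Arguments hh {C D F0 G0 F G} h A : rename.
Arguments hsq {C D F0 G0 F G} h {A A'} u : rename.
Arguments hcell {C D F0 G0 F G} h {A B} f : rename.

(* The inverse of [iota | al_f | eps] is [eps/Id | (al_f)^-1 | Id/iota]. *)
Definition lift (C D : DblData) (F0 G0 : C -> D) (F : PreFun F0) (G : PreFun G0)
    (al : VTData F G) (i : Invertible al) (c : Liftable al) : HTData F G :=
  @Build_HTData C D F0 G0 F G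
    (fun A => ch (c A))
    (fun A A' u =>
       gtop (bwd (lunit (ch (c A))))
         (gbot (castv (vc_idr (fv F u)) (vc_idl (fv G u))
                  ((sqh (fv F u) /// ciota (c A'))
                   *** castv (eq_sym (tv_nat al u)) eq_refl (ceps (c A) /// sqh (fv G u))))
               (fwd (runit (ch (c A'))))))
    (fun A B f =>
       {| fwd :=
            gtop (bwd (lunit (fh F f ** ch (c B))))
              (gbot (ciota (c A) *** tsq al f *** ceps (c B))
                    (fwd (gh (gid (ch (c A))) (runit (fh G f)))));
          bwd :=
            gtop (bwd (gh (gid (ch (c A))) (runit (fh G f))))
              (gbot (castv (inv_l1 (i A B f)) (vc_idl (inv_l (i A B f)))
                       (ceps (c A) /// sqh (inv_l (i A B f)))
                     *** inv_sq (i A B f)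
                     *** castv (vc_idr (inv_r (i A B f))) (inv_r2 (i A B f))
                           (sqh (inv_r (i A B f)) /// ciota (c B)))
                    (fwd (lunit (fh F f ** ch (c B))))) |}).

Record HMonadData (D : DblData) := {
  hm0 : D -> D;
  hmT :> FunData hm0;
  hmu : HTData (compF hmT hmT) hmT;
  heta : HTData (idF D) hmT;
  hm_assoc : forall A : D, Giso (fh hmT (hh hmu A) ** hh hmu A) (hh hmu (hm0 A) ** hh hmu A);
  hm_lunit : forall A : D, Giso (hh heta (hm0 A) ** hh hmu A) (hid (hm0 A));
  hm_runit : forall A : D, Giso (fh hmT (hh heta A) ** hh hmu A) (hid (hm0 A))
}.

Record VMonad (D : DblData) := {
  T0 : D -> D;
  T :> FunData T0;
  T_ok : is_psfun T;
  mu : VT (compF T T) T;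
  eta : VT (idF D) T;
  mu_assoc_v : forall A : D, fv T (tv mu A) // tv mu A = tv mu (T0 A) // tv mu A;
  mu_assoc_sq : forall (A B : D) (f : Hor A B),
    fsq T (tsq mu f) /// tsq mu f ~= tsq mu (fh T f) /// tsq mu f;
  mu_lunit_v : forall A : D, tv eta (T0 A) // tv mu A = vid (T0 A);
  mu_lunit_sq : forall (A B : D) (f : Hor A B), tsq eta (fh T f) /// tsq mu f ~= sqv (fh T f);
  mu_runit_v : forall A : D, fv T (tv eta A) // tv mu A = vid (T0 A);
  mu_runit_sq : forall (A B : D) (f : Hor A B), fsq T (tsq eta f) /// tsq mu f ~= sqv (fh T f)
}.

(* The monad laws of the lift are the canonical isomorphisms between the two
   companions of each side of the strict monad laws. *)
Definition lift_monad (D : DblData) (M : VMonad D)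
    (imu : Invertible (mu M)) (cmu : Liftable (mu M))
    (ieta : Invertible (eta M)) (ceta : Liftable (eta M)) : HMonadData D :=
  @Build_HMonadData D (T0 M) (T M) (lift imu cmu) (lift ieta ceta)
    (fun A =>
       cd_compare (mu_assoc_v M A)
         (cd_comp (cd_map (T M) (cmu A)) (cmu A)) (cd_comp (cmu (T0 M A)) (cmu A)))
    (fun A =>
       cd_compare (mu_lunit_v M A) (cd_comp (ceta (T0 M A)) (cmu A)) (cd_id (T0 M A)))
    (fun A =>
       cd_compare (mu_runit_v M A)
         (cd_comp (cd_map (T M) (ceta A)) (cmu A)) (cd_id (T0 M A))).

(* Only the data of a horizontal double monad enter the definition of its
   Kleisli data. *)
Section Kleisli.
Variables (D : DblData) (S : HMonadData D).
Let S0 : D -> D := hm0 S.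

Definition KlRaw : RawData :=
  {| Ob := Ob D;
     Hor := fun A B => Hor A (S0 B);
     Ver := fun A B => Ver A B;
     Sq := fun A B A' B' f g u v => Sq f g u (fv S v);
     vid := fun A => vid A;
     vc := fun _ _ _ u v => u // v;
     vc_idl := fun _ _ u => vc_idl u;
     vc_idr := fun _ _ u => vc_idr u;
     vc_assoc := fun _ _ _ _ u v w => vc_assoc u v w;
     hid := fun A => hh (heta S) A;
     hc := fun _ _ C f g => f ** fh S g ** hh (hmu S) C;
     sqv := fun _ B f => castv eq_refl (eq_sym (fv_id S B)) (sqv f);
     sqh := fun _ _ u => hsq (heta S) u;
     vs := fun _ _ _ _ _ _ _ _ _ _ v _ v' a b =>
       castv eq_refl (eq_sym (fv_vc S v v')) (a /// b);
     hs := fun _ _ _ _ _ _ _ _ _ _ _ _ w a b => a *** fsq S b *** hsq (hmu S) w |}.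

Definition kl_giso (A B : D) (f g : Hor A (S0 B)) (p : Giso f g) : @Giso KlRaw A B f g :=
  @Build_Giso KlRaw A B f g
    (castv eq_refl (eq_sym (fv_id S B)) (fwd p))
    (castv eq_refl (eq_sym (fv_id S B)) (bwd p)).

(* The composite of (fg)h to f(gh) uses, in this order and besides the
   constraints of D and the compositors of S, the inverse of the 2-cell of the
   multiplication at h and the inverse of the associativity modification. *)
Definition kl_assoc (A B C E : D) (f : Hor A (S0 B)) (g : Hor B (S0 C)) (h : Hor C (S0 E)) :
    Giso ((f ** fh S g ** hh (hmu S) C) ** fh S h ** hh (hmu S) E)
         (f ** fh S (g ** fh S h ** hh (hmu S) E) ** hh (hmu S) E) :=
  let m := hh (hmu S) in
  assoc f (fh S g ** m C) (fh S h ** m E) >>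
  gh (gid f)
    (assoc (fh S g) (m C) (fh S h ** m E) >>
     gh (gid (fh S g))
       (ginv (assoc (m C) (fh S h) (m E)) >>
        gh (ginv (hcell (hmu S) h)) (gid (m E)) >>
        assoc (fh S (fh S h)) (m (S0 E)) (m E) >>
        gh (gid (fh S (fh S h))) (ginv (hm_assoc S E)) >>
        ginv (assoc (fh S (fh S h)) (fh S (m E)) (m E)) >>
        gh (cmp S (fh S h) (m E)) (gid (m E))) >>
     ginv (assoc (fh S g) (fh S (fh S h ** m E)) (m E)) >>
     gh (cmp S g (fh S h ** m E)) (gid (m E))).

Definition kl_lunit (A B : D) (f : Hor A (S0 B)) :
    Giso (hh (heta S) A ** fh S f ** hh (hmu S) B) f :=
  ginv (assoc (hh (heta S) A) (fh S f) (hh (hmu S) B)) >>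
  gh (ginv (hcell (heta S) f)) (gid (hh (hmu S) B)) >>
  assoc f (hh (heta S) (S0 B)) (hh (hmu S) B) >>
  gh (gid f) (hm_lunit S B) >>
  runit f.

Definition kl_runit (A B : D) (f : Hor A (S0 B)) :
    Giso (f ** fh S (hh (heta S) B) ** hh (hmu S) B) f :=
  gh (gid f) (hm_runit S B) >> runit f.

Definition Kl : DblData :=
  {| raw := KlRaw;
     assoc := fun _ _ _ _ f g h => kl_giso (kl_assoc f g h);
     lunit := fun _ _ f => kl_giso (kl_lunit f);
     runit := fun _ _ f => kl_giso (kl_runit f) |}.

End Kleisli.

Record TensorData (D : DblData) := {
  ten0 : D -> D -> D;
  ten : @FunData (Prod D D) D (fun p => ten0 (fst p) (snd p));
  I0 : D;
  unitF : @FunData One D (fun _ => I0)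
}.

Arguments ten0 {D} t A B : rename.

Section Tensor.
Variables (D : DblData) (M : TensorData D).

Definition tenv (A A' B B' : D) (u : Ver A A') (v : Ver B B') :
    Ver (ten0 M A B) (ten0 M A' B') :=
  fv (ten M) (A:=(A, B)) (B:=(A', B')) (u, v).

Definition tenh (A A' B B' : D) (f : Hor A A') (g : Hor B B') :
    Hor (ten0 M A B) (ten0 M A' B') :=
  fh (ten M) (A:=(A, B)) (B:=(A', B')) (f, g).

Definition tensq (A A' C C' B B' E E' : D) (f : Hor A A') (g : Hor C C') (u : Ver A C)
    (v : Ver A' C') (h : Hor B B') (k : Hor E E') (w : Ver B E) (x : Ver B' E')
    (a : Sq f g u v) (b : Sq h k w x) :
    Sq (tenh f h) (tenh g k) (tenv u w) (tenv v x) :=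
  fsq (ten M) (A:=(A, B)) (B:=(A', B')) (A':=(C, E)) (B':=(C', E'))
    (f:=(f, h)) (g:=(g, k)) (u:=(u, w)) (v:=(v, x)) (a, b).

Definition Ih : Hor (I0 M) (I0 M) := fh (unitF M) (A:=tt) (B:=tt) tt.

Definition tenF (C : DblData) (F0 G0 : C -> D) (F : FunData F0) (G : FunData G0) :
    FunData (fun A => ten0 M (F0 A) (G0 A)) :=
  compF (ten M) (pairF F G).

Definition constI (C : DblData) : FunData (fun _ : C => I0 M) :=
  compF (unitF M) (bangF C).

End Tensor.

Arguments tenv {D} M {A A' B B'} u v.
Arguments tenh {D} M {A A' B B'} f g.
Arguments tensq {D} M {A A' C C' B B' E E' f g u v h k w x} a b.

(* The components of mal at (A, B, C), of mlam and mrho at A are the 1v-cells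
   (AB)C -> A(BC), IA -> A and AI -> A. *)
Record MonoidalData (D : DblData) := {
  tens :> TensorData D;
  mal : @VT (Prod (Prod D D) D) D _ _
    (tenF tens (tenF tens (compF fstF fstF) (compF sndF fstF)) sndF)
    (tenF tens (compF fstF fstF) (tenF tens (compF sndF fstF) sndF));
  mlam : VT (tenF tens (constI tens D) (idF D)) (idF D);
  mrho : VT (tenF tens (idF D) (constI tens D)) (idF D)
}.

Definition malv (D : DblData) (M : MonoidalData D) (A B C : D) :
    Ver (ten0 M (ten0 M A B) C) (ten0 M A (ten0 M B C)) :=
  tv (mal M) (A, B, C).

Definition malsq (D : DblData) (M : MonoidalData D) (A B C A' B' C' : D)
    (f : Hor A A') (g : Hor B B') (h : Hor C C') :
    Sq (tenh M (tenh M f g) h) (tenh M f (tenh M g h)) (malv M A B C) (malv M A' B' C') :=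
  tsq (mal M) (A:=(A, B, C)) (B:=(A', B', C')) (f, g, h).

Definition mlamv (D : DblData) (M : MonoidalData D) (A : D) : Ver (ten0 M (I0 M) A) A :=
  tv (mlam M) A.

Definition mlamsq (D : DblData) (M : MonoidalData D) (A A' : D) (f : Hor A A') :
    Sq (tenh M (Ih M) f) f (mlamv M A) (mlamv M A') :=
  tsq (mlam M) f.

Definition mrhov (D : DblData) (M : MonoidalData D) (A : D) : Ver (ten0 M A (I0 M)) A :=
  tv (mrho M) A.

Definition mrhosq (D : DblData) (M : MonoidalData D) (A A' : D) (f : Hor A A') :
    Sq (tenh M f (Ih M)) f (mrhov M A) (mrhov M A') :=
  tsq (mrho M) f.

Record Monoidal (D : DblData) := {
  md :> MonoidalData D;
  ten_ok : is_psfun (ten md);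
  unitF_ok : is_psfun (unitF md);
  mal_inv : Invertible (mal md);
  mlam_inv : Invertible (mlam md);
  mrho_inv : Invertible (mrho md);
  m_pentagon_v : forall A B C E : D,
    tenv md (malv md A B C) (vid E) // malv md A (ten0 md B C) E // tenv md (vid A) (malv md B C E)
    = malv md (ten0 md A B) C E // malv md A B (ten0 md C E);
  m_pentagon_sq : forall (A B C E A' B' C' E' : D)
    (f : Hor A A') (g : Hor B B') (h : Hor C C') (k : Hor E E'),
    tensq md (malsq md f g h) (sqv k) /// malsq md f (tenh md g h) k
      /// tensq md (sqv f) (malsq md g h k)
    ~= malsq md (tenh md f g) h k /// malsq md f g (tenh md h k);
  m_triangle_v : forall A B : D,
    malv md A (I0 md) B // tenv md (vid A) (mlamv md B) = tenv md (mrhov md A) (vid B);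
  m_triangle_sq : forall (A B A' B' : D) (f : Hor A A') (g : Hor B B'),
    malsq md f (Ih md) g /// tensq md (sqv f) (mlamsq md g) ~= tensq md (mrhosq md f) (sqv g);
  m_triangle_l_v : forall A B : D,
    malv md (I0 md) A B // mlamv md (ten0 md A B) = tenv md (mlamv md A) (vid B);
  m_triangle_l_sq : forall (A B A' B' : D) (f : Hor A A') (g : Hor B B'),
    malsq md (Ih md) f g /// mlamsq md (tenh md f g) ~= tensq md (mlamsq md f) (sqv g);
  m_triangle_r_v : forall A B : D,
    malv md A B (I0 md) // tenv md (vid A) (mrhov md B) = mrhov md (ten0 md A B);
  m_triangle_r_sq : forall (A B A' B' : D) (f : Hor A A') (g : Hor B B'),
    malsq md f g (Ih md) /// tensq md (sqv f) (mrhosq md g) ~= mrhosq md (tenh md f g)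
}.

Section Strength.
Variables (D : DblData) (M : Monoidal D) (T : VMonad D).
Let T0 : D -> D := T0 T.

Definition LStrengthT : Type :=
  @VT (Prod D D) D _ _ (tenF M fstF (compF T sndF)) (compF T (ten M)).

Definition RStrengthT : Type :=
  @VT (Prod D D) D _ _ (tenF M (compF T fstF) sndF) (compF T (ten M)).

Definition ltv (t : LStrengthT) (A B : D) : Ver (ten0 M A (T0 B)) (T0 (ten0 M A B)) :=
  tv t (A, B).

Definition ltsq (t : LStrengthT) (A B A' B' : D) (f : Hor A A') (g : Hor B B') :
    Sq (tenh M f (fh T g)) (fh T (tenh M f g)) (ltv t A B) (ltv t A' B') :=
  tsq t (A:=(A, B)) (B:=(A', B')) (f, g).

Definition rtv (s : RStrengthT) (A B : D) : Ver (ten0 M (T0 A) B) (T0 (ten0 M A B)) :=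
  tv s (A, B).

Definition rtsq (s : RStrengthT) (A B A' B' : D) (f : Hor A A') (g : Hor B B') :
    Sq (tenh M (fh T f) g) (fh T (tenh M f g)) (rtv s A B) (rtv s A' B') :=
  tsq s (A:=(A, B)) (B:=(A', B')) (f, g).

Record LStrength := {
  lst :> LStrengthT;
  lst_lam_v : forall A : D, mlamv M (T0 A) = ltv lst (I0 M) A // fv T (mlamv M A);
  lst_lam_sq : forall (A A' : D) (f : Hor A A'),
    mlamsq M (fh T f) ~= ltsq lst (Ih M) f /// fsq T (mlamsq M f);
  lst_al_v : forall A B C : D,
    malv M A B (T0 C) // tenv M (vid A) (ltv lst B C) // ltv lst A (ten0 M B C)
    = ltv lst (ten0 M A B) C // fv T (malv M A B C);
  lst_al_sq : forall (A B C A' B' C' : D) (f : Hor A A') (g : Hor B B') (h : Hor C C'),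
    malsq M f g (fh T h) /// tensq M (sqv f) (ltsq lst g h) /// ltsq lst f (tenh M g h)
    ~= ltsq lst (tenh M f g) h /// fsq T (malsq M f g h);
  lst_mu_v : forall A B : D,
    tenv M (vid A) (tv (mu T) B) // ltv lst A B
    = ltv lst A (T0 B) // fv T (ltv lst A B) // tv (mu T) (ten0 M A B);
  lst_mu_sq : forall (A B A' B' : D) (f : Hor A A') (g : Hor B B'),
    tensq M (sqv f) (tsq (mu T) g) /// ltsq lst f g
    ~= ltsq lst f (fh T g) /// fsq T (ltsq lst f g) /// tsq (mu T) (tenh M f g);
  lst_eta_v : forall A B : D,
    tv (eta T) (ten0 M A B) = tenv M (vid A) (tv (eta T) B) // ltv lst A B;
  lst_eta_sq : forall (A B A' B' : D) (f : Hor A A') (g : Hor B B'),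
    tsq (eta T) (tenh M f g) ~= tensq M (sqv f) (tsq (eta T) g) /// ltsq lst f g
}.

Record RStrength := {
  rst :> RStrengthT;
  rst_rho_v : forall A : D, mrhov M (T0 A) = rtv rst A (I0 M) // fv T (mrhov M A);
  rst_rho_sq : forall (A A' : D) (f : Hor A A'),
    mrhosq M (fh T f) ~= rtsq rst f (Ih M) /// fsq T (mrhosq M f);
  rst_al_v : forall A B C : D,
    malv M (T0 A) B C // rtv rst A (ten0 M B C)
    = tenv M (rtv rst A B) (vid C) // rtv rst (ten0 M A B) C // fv T (malv M A B C);
  rst_al_sq : forall (A B C A' B' C' : D) (f : Hor A A') (g : Hor B B') (h : Hor C C'),
    malsq M (fh T f) g h /// rtsq rst f (tenh M g h)
    ~= tensq M (rtsq rst f g) (sqv h) /// rtsq rst (tenh M f g) h /// fsq T (malsq M f g h);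
  rst_mu_v : forall A B : D,
    tenv M (tv (mu T) A) (vid B) // rtv rst A B
    = rtv rst (T0 A) B // fv T (rtv rst A B) // tv (mu T) (ten0 M A B);
  rst_mu_sq : forall (A B A' B' : D) (f : Hor A A') (g : Hor B B'),
    tensq M (tsq (mu T) f) (sqv g) /// rtsq rst f g
    ~= rtsq rst (fh T f) g /// fsq T (rtsq rst f g) /// tsq (mu T) (tenh M f g);
  rst_eta_v : forall A B : D,
    tv (eta T) (ten0 M A B) = tenv M (tv (eta T) A) (vid B) // rtv rst A B;
  rst_eta_sq : forall (A B A' B' : D) (f : Hor A A') (g : Hor B B'),
    tsq (eta T) (tenh M f g) ~= tensq M (tsq (eta T) f) (sqv g) /// rtsq rst f g
}.

Record Bistrong (t : LStrength) (s : RStrength) : Prop := {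
  bistrong_v : forall A B C : D,
    tenv M (ltv t A B) (vid C) // rtv s (ten0 M A B) C // fv T (malv M A B C)
    = malv M A (T0 B) C // tenv M (vid A) (rtv s B C) // ltv t A (ten0 M B C);
  bistrong_sq : forall (A B C A' B' C' : D) (f : Hor A A') (g : Hor B B') (h : Hor C C'),
    tensq M (ltsq t f g) (sqv h) /// rtsq s (tenh M f g) h /// fsq T (malsq M f g h)
    ~= malsq M f (fh T g) h /// tensq M (sqv f) (rtsq s g h) /// ltsq t f (tenh M g h)
}.

End Strength.

Record Binoidal (B : DblData) := {
  bow : B -> B -> B;
  lt : forall A : B, FunData (fun X => bow A X);
  rt : forall A : B, FunData (fun X => bow X A);
  lt_ok : forall A : B, is_psfun (lt A);
  rt_ok : forall A : B, is_psfun (rt A)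
}.

Arguments bow {B} b A X : rename.
Arguments lt {B} b A : rename.
Arguments rt {B} b A : rename.

Section Center.
Variables (B : DblData) (X : Binoidal B).

Record Central (A A' : B) (v : Ver A A') := {
  cen_l : VPs (lt X A) (lt X A');
  cen_r : VPs (rt X A) (rt X A');
  cen_l_ok : is_vps (F:=lt X A) (G:=lt X A') cen_l;
  cen_r_ok : is_vps (F:=rt X A) (G:=rt X A') cen_r;
  cen_l_v : forall C : B, pv cen_l C = fv (rt X C) v;
  cen_r_v : forall C : B, pv cen_r C = fv (lt X C) v
}.

Record InvCentral (A A' : B) (v : Ver A A') := {
  ic_inv : Ver A' A;
  ic_inv1 : v // ic_inv = vid A;
  ic_inv2 : ic_inv // v = vid A';
  ic_c :> Central v;
  ic_ci : Central ic_inv;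
  ic_l1 : forall (C C' : B) (f : Hor C C'),
    psq (cen_l ic_c) f /// psq (cen_l ic_ci) f ~= sqv (fh (lt X A) f);
  ic_l2 : forall (C C' : B) (f : Hor C C'),
    psq (cen_l ic_ci) f /// psq (cen_l ic_c) f ~= sqv (fh (lt X A') f);
  ic_r1 : forall (C C' : B) (f : Hor C C'),
    psq (cen_r ic_c) f /// psq (cen_r ic_ci) f ~= sqv (fh (rt X A) f);
  ic_r2 : forall (C C' : B) (f : Hor C C'),
    psq (cen_r ic_ci) f /// psq (cen_r ic_c) f ~= sqv (fh (rt X A') f)
}.

End Center.

(* [pal1 B C], [pal2 A C] and [pal3 A B] are the associativity transformations
   in the first, second and third variable.  A suffix _i of [p_pentagon] or
   [p_triangle] names the variable in which the identity holds. *)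
Record Premonoidal (B : DblData) := {
  bin :> Binoidal B;
  pI : B;
  plam : VT (lt bin pI) (idF B);
  prho : VT (rt bin pI) (idF B);
  pal : forall X Y Z : B, Ver (bow bin (bow bin X Y) Z) (bow bin X (bow bin Y Z));
  pal1 : forall Y Z : B, VT (compF (rt bin Z) (rt bin Y)) (rt bin (bow bin Y Z));
  pal2 : forall X Z : B, VT (compF (rt bin Z) (lt bin X)) (compF (lt bin X) (rt bin Z));
  pal3 : forall X Y : B, VT (lt bin (bow bin X Y)) (compF (lt bin X) (lt bin Y));
  pal1_v : forall X Y Z : B, tv (pal1 Y Z) X = pal X Y Z;
  pal2_v : forall X Y Z : B, tv (pal2 X Z) Y = pal X Y Z;
  pal3_v : forall X Y Z : B, tv (pal3 X Y) Z = pal X Y Z;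
  plam_inv : Invertible plam;
  prho_inv : Invertible prho;
  pal1_inv : forall Y Z : B, Invertible (pal1 Y Z);
  pal2_inv : forall X Z : B, Invertible (pal2 X Z);
  pal3_inv : forall X Y : B, Invertible (pal3 X Y);
  plam_cen : forall X : B, InvCentral bin (tv plam X);
  prho_cen : forall X : B, InvCentral bin (tv prho X);
  pal_cen : forall X Y Z : B, InvCentral bin (pal X Y Z);
  p_pentagon_W : forall X Y Z : B,
    vps_eq (whl (rt bin Z) (pal1 X Y) //> pal1 (bow bin X Y) Z //> cen_r (pal_cen X Y Z))
           (whr (pal1 Y Z) (rt bin X) //> pal1 X (bow bin Y Z));
  p_pentagon_X : forall W Y Z : B,
    vps_eq (whl (rt bin Z) (pal2 W Y) //> whr (pal2 W Z) (rt bin Y) //> whl (lt bin W) (pal1 Y Z))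
           (whr (pal1 Y Z) (lt bin W) //> pal2 W (bow bin Y Z));
  p_pentagon_Y : forall W X Z : B,
    vps_eq (whl (rt bin Z) (pal3 W X) //> whr (pal2 W Z) (lt bin X) //> whl (lt bin W) (pal2 X Z))
           (pal2 (bow bin W X) Z //> whr (pal3 W X) (rt bin Z));
  p_pentagon_Z : forall W X Y : B,
    vps_eq (cen_l (pal_cen W X Y) //> pal3 W (bow bin X Y) //> whl (lt bin W) (pal3 X Y))
           (pal3 (bow bin W X) Y //> whr (pal3 W X) (lt bin Y));
  p_triangle_W : forall Y : B,
    vps_eq (pal1 pI Y //> cen_r (plam_cen Y)) (whl (rt bin Y) prho);
  p_triangle_Y : forall W : B,
    vps_eq (pal3 W pI //> whl (lt bin W) plam) (cen_l (prho_cen W));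
  p_triangle_l_W : forall Y : B,
    vps_eq (pal2 pI Y //> whr plam (rt bin Y)) (whl (rt bin Y) plam);
  p_triangle_l_Y : forall W : B,
    vps_eq (pal3 pI W //> whr plam (lt bin W)) (cen_l (plam_cen W));
  p_triangle_r_W : forall Y : B,
    vps_eq (pal1 Y pI //> cen_r (prho_cen Y)) (whr prho (rt bin Y));
  p_triangle_r_Y : forall W : B,
    vps_eq (pal2 W pI //> whl (lt bin W) prho) (whr prho (lt bin W))
}.

(* Main.v *)
(** Composition in the Kleisli double category is determined by universal
    squares.  The companion of [mu] provides, for [f : A -> TB] and
    [g : B -> TC], an invertible square from [f ; Tg] to the Kleisli composite,
    with left side an identity and right side [mu].  Every constraint cell is
    characterised by its pasting with these squares, so that each coherence law
    becomes an equation in D and is proved there after cancelling an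
    invertible square.

    In the same way, a functor F with an invertible distributive law
    [t : F T => T F] having companions extends to the Kleisli category: [f] is sent
    to [F f] followed by the companion of [t], there is an invertible square from
    [F f] to this composite with right side [t], and an invertible strict
    transformation compatible with two such laws lifts uniquely along these
    squares.  The strengths are distributive laws for [X (x) -] and [- (x) X];
    bistrength and the strength axioms say exactly that associators and unitors,
    with all variables but one fixed, are compatible with them, and tensoring with
    any invertible vertical cell is compatible by naturality, whence centrality.
    By uniqueness of lifts, the pentagons and triangles follow from those of D
    with all variables but one set to identities. *)

From Stdlib Require Import JMeq FunctionalExtensionality PropExtensionality ClassicalEpsilon ProofIrrelevance.
Require Import Defs.
Set Implicit Arguments.
Unset Strict Implicit.
Unset Printing Implicit Defensive.

(** * Pasting squares with varying boundaries *)

(** The laws of the Kleisli category are never computed inside it: it is only pseudodouble, and its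
    squares have right sides of the form [fv T v]. They are read in [D] through [pkK], where the
    horizontal constraints are identities and can be rewritten away. Invertibility of the
    1v-components is what makes cancellation possible: it turns the unit of a companion into a
    vertically invertible square, with inverse the counit over the inverse cell. Lifts of functors
    and transformations are handled only through the equations that characterise them ([Rep],
    [Lifts]), so that composite functors and the identity functor, which are not outputs of the
    lifting construction, are treated alike. The main obstacle is that the tensor preserves identity
    1h-cells only up to isomorphism: [tenh M (hid X) (hid Y)] need not be [hid (ten0 M X Y)], and
    the unit 1h-cell [Ih M] need not be an identity. The one-variable associators and unitors
    therefore carry unitors of the tensor or of the monoidal unit, and the associator at identity
    1h-cells has to be exchanged with identity squares on its components. *)

Record SQ (D : RawData) := mkSQ {
  qA : D; qB : D; qA' : D; qB' : D;
  qf : Hor qA qB; qg : Hor qA' qB'; qu : Ver qA qA'; qv : Ver qB qB';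
  qs : Sq qf qg qu qv
}.

Arguments mkSQ {D qA qB qA' qB' qf qg qu qv} qs.

Lemma mkSQ_sqeq (D : RawData) (A B A' B' C E C' E' : D) (f : Hor A B) (g : Hor A' B')
    (u : Ver A A') (v : Ver B B') (h : Hor C E) (k : Hor C' E') (w : Ver C C') (x : Ver E E')
    (a : Sq f g u v) (b : Sq h k w x) : mkSQ a = mkSQ b <-> a ~= b.
Proof.
  split.
  - intro e. change (qs (mkSQ a) ~= qs (mkSQ b)). rewrite <- e. apply sqeq_refl.
  - intro e. destruct e. reflexivity.
Qed.

(** Rests on uniqueness of identity proofs, through [JMeq_eq]: over one fixed boundary,
    heterogeneous equality is equality. *)
Lemma sqeq_eq (D : RawData) (A B A' B' : D) (f : Hor A B) (g : Hor A' B')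
    (u : Ver A A') (v : Ver B B') (a b : Sq f g u v) : a ~= b -> a = b.
Proof.
  intro e. apply JMeq_eq. destruct e. reflexivity.
Qed.

Lemma sqeq_bounds (D : RawData) (A B A' B' : D) (f h : Hor A B) (g k : Hor A' B')
    (u w : Ver A A') (v x : Ver B B') (a : Sq f g u v) (b : Sq h k w x) :
  a ~= b -> (f = h /\ g = k) /\ (u = w /\ v = x).
Proof.
  intro e; repeat split; apply JMeq_eq; destruct e; reflexivity.
Qed.

(* Pasting is extended to sets of squares of arbitrary boundary, so that it is
   total and strictly associative: equations of squares are then rewritten
   without transports, and [Is] keeps track of the boundary. *)
Definition S (D : RawData) := SQ D -> Prop.

(** Singletons embed squares into [S D]. Two of them paste to a singleton when the shared boundary
    matches and to the empty set otherwise, so an equation between pastings with matching boundaries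
    is an equation of squares. *)
Definition pk (D : RawData) (A B A' B' : D) (f : Hor A B) (g : Hor A' B')
  (u : Ver A A') (v : Ver B B') (a : Sq f g u v) : S D := fun x => x = mkSQ a.

Lemma pk_sqeq (D : RawData) (A B A' B' C E C' E' : D) (f : Hor A B) (g : Hor A' B')
    (u : Ver A A') (v : Ver B B') (h : Hor C E) (k : Hor C' E') (w : Ver C C') (x : Ver E E')
    (a : Sq f g u v) (b : Sq h k w x) : pk a = pk b <-> a ~= b.
Proof.
  split; intro e.
  - apply mkSQ_sqeq. assert (pk b (mkSQ a)) by (rewrite <- e; reflexivity). assumption.
  - destruct e; reflexivity.
Qed.

Lemma pk_eq (D : RawData) (A B A' B' : D) (f : Hor A B) (g : Hor A' B')
    (u : Ver A A') (v : Ver B B') (a b : Sq f g u v) : pk a = pk b -> a = b.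
Proof. intro e. apply sqeq_eq, pk_sqeq, e. Qed.

Definition V (D : RawData) (s t : S D) : S D := fun x =>
  exists (A B A' B' A'' B'' : D) (f : Hor A B) (g : Hor A' B') (h : Hor A'' B'')
    (u : Ver A A') (v : Ver B B') (u' : Ver A' A'') (v' : Ver B' B'')
    (a : Sq f g u v) (b : Sq g h u' v'), s (mkSQ a) /\ t (mkSQ b) /\ x = mkSQ (a /// b).

Definition H (D : RawData) (s t : S D) : S D := fun x =>
  exists (A B C A' B' C' : D) (f : Hor A B) (f' : Hor B C)
    (g : Hor A' B') (g' : Hor B' C') (u : Ver A A') (v : Ver B B') (w : Ver C C')
    (a : Sq f g u v) (b : Sq f' g' v w), s (mkSQ a) /\ t (mkSQ b) /\ x = mkSQ (a *** b).

Definition Fs (C D : DblData) (F0 : C -> D) (F : PreFun F0) (s : S C) : S D := fun x =>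
  exists (A B A' B' : C) (f : Hor A B) (g : Hor A' B')
    (u : Ver A A') (v : Ver B B') (a : Sq f g u v), s (mkSQ a) /\ x = mkSQ (fsq F a).

Definition sv (D : RawData) (A B : D) (f : Hor A B) : S D := pk (sqv f).
Definition sh (D : RawData) (A B : D) (u : Ver A B) : S D := pk (sqh u).

Definition Is (D : RawData) (s : S D) (A B A' B' : D) (f : Hor A B) (g : Hor A' B')
  (u : Ver A A') (v : Ver B B') : Prop := exists a : Sq f g u v, s = pk a.

(** Cleans up after [inversion] on [sqeq], whose indices depend on one another: the equalities of
    dependent pairs that it leaves are stripped by [inj_pair2]. *)
Ltac injpairs :=
  repeat (subst; match goal with e : existT _ _ _ = existT _ _ _ |- _ => apply inj_pair2 in e end);
  subst.

Lemma V_pk (D : RawData) (A B A' B' A'' B'' : D) (f : Hor A B) (g : Hor A' B') (h : Hor A'' B'')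
    (u : Ver A A') (v : Ver B B') (u' : Ver A' A'') (v' : Ver B' B'')
    (a : Sq f g u v) (b : Sq g h u' v') : V (pk a) (pk b) = pk (a /// b).
Proof.
  apply functional_extensionality; intro x; apply propositional_extensionality; split.
  - intros (A1 & B1 & A1' & B1' & A1'' & B1'' & f1 & g1 & h1 & u1 & v1 & u1' & v1' & a1 & b1 & e1 & e2 & e3).
    unfold pk in *. subst x. apply mkSQ_sqeq in e1. apply mkSQ_sqeq in e2. apply mkSQ_sqeq.
    destruct e1. inversion e2. injpairs. apply sqeq_refl.
  - intro e. unfold pk in e.
    exists A, B, A', B', A'', B'', f, g, h, u, v, u', v', a, b. repeat split; assumption.
Qed.
Lemma H_pk (D : RawData) (A B C A' B' C' : D) (f : Hor A B) (f' : Hor B C)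
    (g : Hor A' B') (g' : Hor B' C') (u : Ver A A') (v : Ver B B') (w : Ver C C')
    (a : Sq f g u v) (b : Sq f' g' v w) : H (pk a) (pk b) = pk (a *** b).
Proof.
  apply functional_extensionality; intro x; apply propositional_extensionality; split.
  - intros (A1 & B1 & C1 & A1' & B1' & C1' & f1 & f1' & g1 & g1' & u1 & v1 & w1 & a1 & b1 & e1 & e2 & e3).
    unfold pk in *. subst x. apply mkSQ_sqeq in e1. apply mkSQ_sqeq.
    destruct e1.
    inversion e2. injpairs. apply sqeq_refl.
  - intro e. unfold pk in e.
    exists A, B, C, A', B', C', f, f', g, g', u, v, w, a, b. repeat split; assumption.
Qed.
Lemma Fs_pk (C D : DblData) (F0 : C -> D) (F : PreFun F0)  (A B A' B' : C) (f : Hor A B) (g : Hor A' B')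
    (u : Ver A A') (v : Ver B B') (a : Sq f g u v) : Fs F (pk a) = pk (fsq F a).
Proof.
  apply functional_extensionality; intro x; apply propositional_extensionality; split.
  - intros (A1 & B1 & A1' & B1' & f1 & g1 & u1 & v1 & a1 & e1 & e2).
    unfold pk in *. subst x. apply mkSQ_sqeq in e1. apply mkSQ_sqeq. destruct e1. apply sqeq_refl.
  - intro e. unfold pk in e.
    exists A, B, A', B', f, g, u, v, a. repeat split; assumption.
Qed.

Lemma set_ext (X : Type) (P Q : X -> Prop) : (forall x, P x <-> Q x) -> P = Q.
Proof.
  intro h. apply functional_extensionality; intro x. apply propositional_extensionality, h.
Qed.

Section Engine.
Variable (D : RawData).

Lemma pk_is (A B A' B' : D) (f : Hor A B) (g : Hor A' B')
    (u : Ver A A') (v : Ver B B') (a : Sq f g u v) : Is (pk a) f g u v.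
Proof. exists a; reflexivity. Qed.

Lemma sv_is (A B : D) (f : Hor A B) : Is (sv f) f f (vid A) (vid B).
Proof. apply pk_is. Qed.

Lemma sh_is (A B : D) (u : Ver A B) : Is (sh u) (hid A) (hid B) u u.
Proof. apply pk_is. Qed.

Lemma pk_castv (A B A' B' : D) (f : Hor A B) (g : Hor A' B')
    (u u' : Ver A A') (v v' : Ver B B') (eu : u = u') (ev : v = v')
    (a : Sq f g u v) : pk (castv eu ev a) = pk a.
Proof. destruct eu, ev; reflexivity. Qed.

(** The shared boundary may differ by a propositional equality, passed as a premise, because
    composites such as [(f ** g) ** h] and [f ** g ** h] agree only in this sense. The rewriting
    lemmas below follow the same pattern. *)
Lemma V_is (s t : S D) (A B A' B' A'' B'' : D) (f : Hor A B) (g g' : Hor A' B') (h : Hor A'' B'')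
    (u : Ver A A') (v : Ver B B') (u' : Ver A' A'') (v' : Ver B' B'') :
  Is s f g u v -> Is t g' h u' v' -> g = g' -> Is (V s t) f h (u // u') (v // v').
Proof.
  intros [a ea] [b eb] e. subst. rewrite V_pk. apply pk_is.
Qed.

Lemma H_is (s t : S D) (A B C A' B' C' : D) (f : Hor A B) (f' : Hor B C)
    (g : Hor A' B') (g' : Hor B' C') (u : Ver A A') (v v' : Ver B B') (w : Ver C C') :
  Is s f g u v -> Is t f' g' v' w -> v = v' -> Is (H s t) (f ** f') (g ** g') u w.
Proof.
  intros [a ea] [b eb] e. subst. rewrite H_pk. apply pk_is.
Qed.

Lemma Is_conv (s : S D) (A B A' B' : D) (f f' : Hor A B) (g g' : Hor A' B')
    (u u' : Ver A A') (v v' : Ver B B') :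
  Is s f g u v -> f = f' -> g = g' -> u = u' -> v = v' -> Is s f' g' u' v'.
Proof. intros. subst. assumption. Qed.

Lemma Is_bounds (s : S D) (A B A' B' : D) (f f' : Hor A B) (g g' : Hor A' B')
    (u u' : Ver A A') (v v' : Ver B B') :
  Is s f g u v -> Is s f' g' u' v' -> (f = f' /\ g = g') /\ (u = u' /\ v = v').
Proof. intros [a ea] [b eb]. subst. apply pk_sqeq in eb. exact (sqeq_bounds eb). Qed.

Lemma pk_gtop (A B A' B' : D) (f' f : Hor A B) (g : Hor A' B')
    (u : Ver A A') (v : Ver B B') (p : Sq f' f (vid A) (vid B)) (a : Sq f g u v) :
  pk (gtop p a) = V (pk p) (pk a).
Proof. unfold gtop. rewrite pk_castv, V_pk. reflexivity. Qed.

Lemma pk_gbot (A B A' B' : D) (f : Hor A B) (g g' : Hor A' B')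
    (u : Ver A A') (v : Ver B B') (a : Sq f g u v) (p : Sq g g' (vid A') (vid B')) :
  pk (gbot a p) = V (pk a) (pk p).
Proof. unfold gbot. rewrite pk_castv, V_pk. reflexivity. Qed.

End Engine.

Lemma Fs_is (C D : DblData) (F0 : C -> D) (F : PreFun F0) (s : S C) (A B A' B' : C)
    (f : Hor A B) (g : Hor A' B') (u : Ver A A') (v : Ver B B') :
  Is s f g u v -> Is (Fs F s) (fh F f) (fh F g) (fv F u) (fv F v).
Proof. intros [a ea]. subst. rewrite Fs_pk. apply pk_is. Qed.

Existing Class is_pseudodouble.
Existing Class is_double.
Existing Class is_psfun.
#[export] Existing Instance double_pseudo.

Section Pseudo.
Context {D : DblData} {P : is_pseudodouble D}.

(** An element of either side comes from a vertically composable triple of squares, and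
    composability of a triple does not depend on the bracketing; hence the equation holds for
    arbitrary sets. *)
Lemma V_assoc (s t r : S D) : V (V s t) r = V s (V t r).
Proof.
  apply set_ext; intro x; split.
  - intros (A & B & A' & B' & A'' & B'' & f & g & h & u & v & u' & v' & a & b & e1 & e2 & e3).
    destruct e1 as (A1 & B1 & A1' & B1' & A1'' & B1'' & f1 & g1 & h1 & u1 & v1 & u1' & v1' & a1 & b1 & d1 & d2 & d3).
    apply mkSQ_sqeq in d3. revert e2 e3.
    inversion d3. injpairs. intros.
    exists A1, B1, A1', B1', A'', B'', f1, g1, h, u1, v1, (u1' // u'), (v1' // v'), a1, (b1 /// b).
    split; [assumption|]. split.
    + exists A1', B1', A1'', B1'', A'', B'', g1, h1, h, u1', v1', u', v', b1, b. auto.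
    + subst. apply mkSQ_sqeq, (vs_assoc P).
  - intros (A & B & A' & B' & A'' & B'' & f & g & h & u & v & u' & v' & a & b & e1 & e2 & e3).
    destruct e2 as (A1 & B1 & A1' & B1' & A1'' & B1'' & f1 & g1 & h1 & u1 & v1 & u1' & v1' & a1 & b1 & d1 & d2 & d3).
    apply mkSQ_sqeq in d3. revert e1 e3.
    inversion d3. injpairs. intros.
    exists A, B, A1', B1', A1'', B1'', f, g1, h1, (u // u1), (v // v1), u1', v1', (a /// a1), b1.
    split.
    + exists A, B, A1, B1, A1', B1', f, f1, g1, u, v, u1, v1, a, a1. auto.
    + split; [assumption|]. rewrite e3. symmetry. apply mkSQ_sqeq, (vs_assoc P).
Qed.

Lemma Vidl (s : S D) (A B A' B' : D) (f f' : Hor A B) (g : Hor A' B') (u : Ver A A') (v : Ver B B') :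
  Is s f' g u v -> f' = f -> V (sv f) s = s.
Proof.
  intros [a ea] e. subst. unfold sv. rewrite V_pk. apply pk_sqeq, (vs_idl P).
Qed.

Lemma Vidr (s : S D) (A B A' B' : D) (f : Hor A B) (g g' : Hor A' B') (u : Ver A A') (v : Ver B B') :
  Is s f g' u v -> g' = g -> V s (sv g) = s.
Proof.
  intros [a ea] e. subst. unfold sv. rewrite V_pk. apply pk_sqeq, (vs_idr P).
Qed.

Lemma VH (a b c d : S D) (A B C A' B' C' A'' B'' C'' : D)
    (f : Hor A B) (f' : Hor B C) (g g1 : Hor A' B') (g' g1' : Hor B' C')
    (h : Hor A'' B'') (h' : Hor B'' C'')
    (u : Ver A A') (v v1 : Ver B B') (w : Ver C C')
    (u' : Ver A' A'') (v' v1' : Ver B' B'') (w' : Ver C' C'') :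
  Is a f g u v -> Is b f' g' v1 w -> v1 = v -> Is c g1 h u' v' -> g1 = g ->
  Is d g1' h' v1' w' -> g1' = g' -> v1' = v' ->
  V (H a b) (H c d) = H (V a c) (V b d).
Proof.
  intros [xa ea] [xb eb] e1 [xc ec] e2 [xd ed] e3 e4. subst.
  rewrite !H_pk, !V_pk, H_pk. f_equal. apply (interchange P).
Qed.

Lemma H_sv (A B C : D) (f : Hor A B) (g : Hor B C) : H (sv f) (sv g) = sv (f ** g).
Proof. unfold sv. rewrite H_pk, (hs_sqv P). reflexivity. Qed.

Lemma V_sh (A B C : D) (u : Ver A B) (v : Ver B C) : V (sh u) (sh v) = sh (u // v).
Proof. unfold sh. rewrite V_pk, (vs_sqh P). reflexivity. Qed.

Lemma sh_vid (A : D) : sh (vid A) = sv (hid A).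
Proof. unfold sh, sv. rewrite (sqh_vid P). reflexivity. Qed.

End Pseudo.

Section Strict.
Context {D : DblData} {hD : is_double D}.

Lemma hc_assoc (A B C E : D) (f : Hor A B) (g : Hor B C) (h : Hor C E) :
  (f ** g) ** h = f ** (g ** h).
Proof. symmetry. exact (proj2 (proj1 (sqeq_bounds (assoc_strict hD f g h)))). Qed.

Lemma hc_idl (A B : D) (f : Hor A B) : hid A ** f = f.
Proof. exact (proj1 (proj1 (sqeq_bounds (lunit_strict hD f)))). Qed.

Lemma hc_idr (A B : D) (f : Hor A B) : f ** hid B = f.
Proof. exact (proj1 (proj1 (sqeq_bounds (runit_strict hD f)))). Qed.

Lemma pk_assoc (A B C E : D) (f : Hor A B) (g : Hor B C) (h : Hor C E) :
  pk (fwd (assoc f g h)) = sv (f ** g ** h).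
Proof.
  transitivity (sv ((f ** g) ** h)); [apply pk_sqeq, (assoc_strict hD)|].
  rewrite hc_assoc. reflexivity.
Qed.

Lemma pk_lunit (A B : D) (f : Hor A B) : pk (fwd (lunit f)) = sv f.
Proof. apply pk_sqeq, (lunit_strict hD). Qed.

Lemma pk_runit (A B : D) (f : Hor A B) : pk (fwd (runit f)) = sv f.
Proof. apply pk_sqeq, (runit_strict hD). Qed.

(** Strictness is stated for the forward constraint cells; the backward ones are identities because
    the inverse of an identity square is an identity. *)
Lemma giso_bwd_sv (A B : D) (f g : Hor A B) (p : Giso f g) :
  is_giso p -> pk (fwd p) = sv g -> pk (bwd p) = sv g.
Proof.
  intros [e1 e2] e. apply pk_sqeq in e2. rewrite <- V_pk, e in e2.
  assert (f = g) as <-.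
  { apply pk_sqeq in e. exact (proj1 (proj1 (sqeq_bounds e))). }
  rewrite (Vidr (pk_is _) eq_refl) in e2. exact e2.
Qed.

Lemma pk_assoc' (A B C E : D) (f : Hor A B) (g : Hor B C) (h : Hor C E) :
  pk (bwd (assoc f g h)) = sv (f ** g ** h).
Proof. exact (giso_bwd_sv (assoc_iso (double_pseudo hD) f g h) (pk_assoc f g h)). Qed.

Lemma pk_lunit' (A B : D) (f : Hor A B) : pk (bwd (lunit f)) = sv f.
Proof. exact (giso_bwd_sv (lunit_iso (double_pseudo hD) f) (pk_lunit f)). Qed.

Lemma pk_runit' (A B : D) (f : Hor A B) : pk (bwd (runit f)) = sv f.
Proof. exact (giso_bwd_sv (runit_iso (double_pseudo hD) f) (pk_runit f)). Qed.

(** Naturality of the associator, whose components are identities by strictness, gives the equation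
    on squares; the sets then agree triple by triple as in [V_assoc]. *)
Lemma H_assoc (s t r : S D) : H (H s t) r = H s (H t r).
Proof.
  assert (pkassoc : forall (A B C E A' B' C' E' : D) (f : Hor A B) (g : Hor B C) (h : Hor C E)
    (f' : Hor A' B') (g' : Hor B' C') (h' : Hor C' E')
    (u : Ver A A') (v : Ver B B') (w : Ver C C') (x : Ver E E')
    (a : Sq f f' u v) (b : Sq g g' v w) (c : Sq h h' w x), mkSQ ((a *** b) *** c) = mkSQ (a *** (b *** c))).
  { intros. apply mkSQ_sqeq, pk_sqeq.
    pose proof (proj2 (pk_sqeq _ _) (assoc_nat (double_pseudo hD) a b c)) as e.
    rewrite <- !V_pk, !pk_assoc in e.
    rewrite (Vidl (pk_is _) eq_refl), (Vidr (pk_is _) (hc_assoc _ _ _)) in e. exact e. }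
  apply set_ext; intro x; split.
  - intros (A & B & C & A' & B' & C' & f & f' & g & g' & u & v & w & a & b & e1 & e2 & e3).
    destruct e1 as (A1 & B1 & C1 & A1' & B1' & C1' & f1 & f1' & g1 & g1' & u1 & v1 & w1 & a1 & b1 & d1 & d2 & d3).
    apply mkSQ_sqeq in d3. revert e2 e3.
    inversion d3. injpairs. intros.
    exists A1, B1, C, A1', B1', C', f1, (f1' ** f'), g1, (g1' ** g'), u1, v1, w, a1, (b1 *** b).
    split; [assumption|]. split.
    + exists B1, C1, C, B1', C1', C', f1', f', g1', g', v1, w1, w, b1, b. auto.
    + subst. apply pkassoc.
  - intros (A & B & C & A' & B' & C' & f & f' & g & g' & u & v & w & a & b & e1 & e2 & e3).
    destruct e2 as (A1 & B1 & C1 & A1' & B1' & C1' & f1 & f1' & g1 & g1' & u1 & v1 & w1 & a1 & b1 & d1 & d2 & d3).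
    apply mkSQ_sqeq in d3. revert e1 e3.
    inversion d3. injpairs. intros.
    exists A, B1, C1, A', B1', C1', (f ** f1), f1', (g ** g1), g1', u, v1, w1, (a *** a1), b1.
    split.
    + exists A, A1, B1, A', A1', B1', f, f1, g, g1, u, u1, v1, a, a1. auto.
    + split; [assumption|]. rewrite e3. symmetry. apply pkassoc.
Qed.

Lemma Hidl (s : S D) (A B A' B' : D) (f : Hor A B) (g : Hor A' B') (u u' : Ver A A') (v : Ver B B') :
  Is s f g u' v -> u' = u -> H (sh u) s = s.
Proof.
  intros [a ea] e. subst. unfold sh. rewrite H_pk.
  pose proof (proj2 (pk_sqeq _ _) (lunit_nat (double_pseudo hD) a)) as e.
  rewrite <- !V_pk, !pk_lunit, (Vidl (pk_is _) eq_refl), (Vidr (pk_is _) (hc_idl _)) in e. exact e.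
Qed.

Lemma Hidr (s : S D) (A B A' B' : D) (f : Hor A B) (g : Hor A' B') (u : Ver A A') (v v' : Ver B B') :
  Is s f g u v' -> v' = v -> H s (sh v) = s.
Proof.
  intros [a ea] e. subst. unfold sh. rewrite H_pk.
  pose proof (proj2 (pk_sqeq _ _) (runit_nat (double_pseudo hD) a)) as e.
  rewrite <- !V_pk, !pk_runit, (Vidl (pk_is _) eq_refl), (Vidr (pk_is _) (hc_idr _)) in e. exact e.
Qed.

End Strict.

(** * Pseudodouble functors acting on sets of squares *)

Section Functor.
Context {C D : DblData} {F0 : C -> D} {F : FunData F0} {hF : is_psfun F}.

Lemma F_V (s t : S C) (A B A' B' A'' B'' : C) (f : Hor A B) (g g' : Hor A' B') (h : Hor A'' B'')
    (u : Ver A A') (v : Ver B B') (u' : Ver A' A'') (v' : Ver B' B'') :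
  Is s f g u v -> Is t g' h u' v' -> g' = g -> Fs F (V s t) = V (Fs F s) (Fs F t).
Proof.
  intros [a ea] [b eb] e. subst. rewrite V_pk, !Fs_pk, V_pk. apply pk_sqeq, (fsq_vs hF).
Qed.

Lemma F_sv (A B : C) (f : Hor A B) : Fs F (sv f) = sv (fh F f).
Proof. unfold sv. rewrite Fs_pk. apply pk_sqeq, (fsq_sqv hF). Qed.

Lemma F_cmp (s t : S C) (A B E A' B' E' : C) (f : Hor A B) (g : Hor B E)
    (f' : Hor A' B') (g' : Hor B' E') (u : Ver A A') (v v' : Ver B B') (w : Ver E E') :
  Is s f f' u v -> Is t g g' v' w -> v' = v ->
  V (H (Fs F s) (Fs F t)) (pk (fwd (cmp F f' g'))) = V (pk (fwd (cmp F f g))) (Fs F (H s t)).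
Proof.
  intros [a ea] [b eb] e. subst. rewrite H_pk, !Fs_pk, H_pk, !V_pk. apply pk_sqeq, (cmp_nat hF).
Qed.

Lemma F_unt (A A' : C) (u : Ver A A') :
  V (sh (fv F u)) (pk (fwd (unt F A'))) = V (pk (fwd (unt F A))) (Fs F (sh u)).
Proof.
  unfold sh. rewrite Fs_pk, !V_pk. apply pk_sqeq, (unt_nat hF).
Qed.

End Functor.

Hint Rewrite @hc_assoc @hc_idl @hc_idr using typeclasses eauto : hor.
Hint Rewrite @vc_assoc @vc_idl @vc_idr : ver.

Ltac heq := first [reflexivity | eassumption | autorewrite with hor; reflexivity | solve [autorewrite with hor; eauto]].
Ltac veq := first [reflexivity | eassumption | autorewrite with ver; reflexivity | solve [autorewrite with ver; eauto]].
Create HintDb isdb.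

Ltac leaf := first [eassumption | solve [eauto with isdb nocore]].
(** Computes the boundary of a pasting expression from its leaves, filling boundary variables by
    unification. [ty] below moreover compares the result with a prescribed boundary, up to the
    equations in [hor] and [ver]. *)
Ltac inf := lazymatch goal with
 | |- Is (V _ _) _ _ _ _ => eapply V_is; [inf | inf | heq]
 | |- Is (H _ _) _ _ _ _ => eapply H_is; [inf | inf | veq]
 | |- Is (Fs _ _) _ _ _ _ => eapply Fs_is; inf
 | |- Is (sv _) _ _ _ _ => eapply sv_is
 | |- Is (sh _) _ _ _ _ => eapply sh_is
 | |- Is (pk _) _ _ _ _ => eapply pk_is
 | |- _ => leaf
end.
Ltac ty := lazymatch goal with
 | |- Is _ _ _ _ _ => first [leaf | eapply Is_conv; [inf | heq | heq | veq | veq]]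
 | |- @eq (Hor _ _) _ _ => heq
 | |- @eq (Ver _ _) _ _ => veq
 | |- _ => try typeclasses eauto
end.
Ltac tinf := lazymatch goal with
 | |- Is _ _ _ _ _ => inf
 | |- @eq (Hor _ _) _ _ => heq
 | |- @eq (Ver _ _) _ _ => veq
end.

(** * Vertically invertible squares *)

Section Iso.
Context {D : DblData} {P : is_pseudodouble D}.

(** The sides may be arbitrary 1v-cells, and those of the inverse are existential: [Iso_sides]
    recovers from the two equations that they are inverse to [u] and [v]. *)
Definition Iso (s : S D) (A B A' B' : D) (f : Hor A B) (g : Hor A' B') (u : Ver A A') (v : Ver B B') :=
  Is s f g u v /\ exists (s' : S D) (u' : Ver A' A) (v' : Ver B' B),
    Is s' g f u' v' /\ V s s' = sv f /\ V s' s = sv g.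

Lemma Iso_is (s : S D) (A B A' B' : D) (f : Hor A B) (g : Hor A' B') (u : Ver A A') (v : Ver B B') :
  Iso s f g u v -> Is s f g u v.
Proof. intro h; apply h. Qed.

Lemma Is_sv_bounds (s : S D) (A B : D) (f : Hor A B) (g h : Hor A B) (u : Ver A A) (v : Ver B B) :
  Is s g h u v -> s = sv f -> u = vid A /\ v = vid B.
Proof. intros h1 e. rewrite e in h1. apply (Is_bounds h1 (sv_is f)). Qed.

Lemma Iso_conv (s : S D) (A B A' B' : D) (f f' : Hor A B) (g g' : Hor A' B')
    (u u' : Ver A A') (v v' : Ver B B') :
  Iso s f g u v -> f = f' -> g = g' -> u = u' -> v = v' -> Iso s f' g' u' v'.
Proof. intros. subst. assumption. Qed.

Lemma Iso_sides (s s' : S D) (A B A' B' : D) (f : Hor A B) (g : Hor A' B') (u : Ver A A') (v : Ver B B')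
  (u' : Ver A' A) (v' : Ver B' B) :
  Is s f g u v -> Is s' g f u' v' -> V s s' = sv f -> u // u' = vid A /\ v // v' = vid B.
Proof.
  intros h1 h2 e.
  assert (h : Is (V s s') f f (u // u') (v // v')) by tinf.
  exact (Is_sv_bounds h e).
Qed.

Lemma vinv_unique (A B : D) (u : Ver A B) (v w : Ver B A) :
  u // v = vid A -> w // u = vid B -> v = w.
Proof.
  intros e1 e2. rewrite <- (vc_idl v), <- e2, vc_assoc, e1, vc_idr. reflexivity.
Qed.

Lemma Iso_V (s t : S D) (A B A' B' A'' B'' : D) (f : Hor A B) (g g' : Hor A' B') (h : Hor A'' B'')
    (u : Ver A A') (v : Ver B B') (u' : Ver A' A'') (v' : Ver B' B'') :
  Iso s f g u v -> Iso t g' h u' v' -> g = g' -> Iso (V s t) f h (u // u') (v // v').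
Proof.
  intros [h1 (s' & x1 & y1 & k1 & a1 & b1)] [h2 (t' & x2 & y2 & k2 & a2 & b2)] e; subst g'.
  split; [tinf|]. exists (V t' s'), (x2 // x1), (y2 // y1). split; [tinf|]. split.
  - rewrite V_assoc, <- (V_assoc t), a2, (Vidl k1 eq_refl). exact a1.
  - rewrite V_assoc, <- (V_assoc s'), b1, (Vidl h2 eq_refl). exact b2.
Qed.

Lemma Iso_H (s t : S D) (A B C A' B' C' : D) (f : Hor A B) (f' : Hor B C)
    (g : Hor A' B') (g' : Hor B' C') (u : Ver A A') (v v' : Ver B B') (w : Ver C C') :
  Iso s f g u v -> Iso t f' g' v' w -> v = v' -> Iso (H s t) (f ** f') (g ** g') u w.
Proof.
  intros [h1 (s' & x1 & y1 & k1 & a1 & b1)] [h2 (t' & x2 & y2 & k2 & a2 & b2)] e; subst v'.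
  split; [tinf|].
  (* The two inverses paste horizontally because their middle sides are both inverse to [v], hence
     equal. *)
  assert (x2 = y1).
  { apply (@vinv_unique _ _ v); [apply (Iso_sides h2 k2 a2) | apply (Iso_sides k1 h1 b1)]. }
  subst. exists (H s' t'), x1, y2. split; [tinf|]. split.
  - rewrite (VH h1 h2 eq_refl k1 eq_refl k2 eq_refl eq_refl), a1, a2. apply H_sv.
  - rewrite (VH k1 k2 eq_refl h1 eq_refl h2 eq_refl eq_refl), b1, b2. apply H_sv.
Qed.

Lemma Iso_sv (A B : D) (f : Hor A B) : Iso (sv f) f f (vid A) (vid B).
Proof.
  split; [tinf|]. exists (sv f), (vid A), (vid B). split; [tinf|].
  split; apply (Vidl (sv_is f) eq_refl).
Qed.

Lemma Iso_sh (A B : D) (u : Ver A B) (u' : Ver B A) :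
  u // u' = vid A -> u' // u = vid B -> Iso (sh u) (hid A) (hid B) u u.
Proof.
  intros e1 e2. split; [tinf|]. exists (sh u'), u', u'. split; [tinf|].
  rewrite !V_sh, e1, e2. split; apply sh_vid.
Qed.

Lemma Iso_VInv (A B A' B' : D) (f : Hor A B) (g : Hor A' B') (u : Ver A A') (v : Ver B B')
  (a : Sq f g u v) : VInv a -> Iso (pk a) f g u v.
Proof.
  intros [u' v' b e1 e2 e3 e4 e5 e6]. split; [tinf|]. exists (pk b), u', v'. split; [tinf|].
  rewrite !V_pk. split; apply pk_sqeq; assumption.
Qed.

Lemma Iso_giso (A B : D) (f g : Hor A B) (p : Giso f g) :
  is_giso p -> Iso (pk (fwd p)) f g (vid A) (vid B).
Proof.
  intros [e1 e2]. split; [tinf|]. exists (pk (bwd p)), (vid A), (vid B). split; [tinf|].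
  rewrite !V_pk. split; apply pk_sqeq; assumption.
Qed.

Lemma Iso_cancel (r a b : S D) (A B A' B' A'' B'' : D) (f : Hor A B) (g g1 g2 : Hor A' B')
    (h h' : Hor A'' B'') (u : Ver A A') (v : Ver B B') (u1 u2 : Ver A' A'') (v1 v2 : Ver B' B'') :
  V r a = V r b -> Iso r f g u v -> Is a g1 h u1 v1 -> g1 = g -> Is b g2 h' u2 v2 -> g2 = g -> a = b.
Proof.
  intros e [h1 (r' & x & y & k & e1 & e2)] ha -> hb ->.
  rewrite <- (Vidl ha eq_refl), <- (Vidl hb eq_refl), <- e2, !V_assoc, e. reflexivity.
Qed.

End Iso.

Lemma Iso_F (C D : DblData) {PC : is_pseudodouble C} {PD : is_pseudodouble D}
    (F0 : C -> D) (F : FunData F0) {hF : is_psfun F} (s : S C) (A B A' B' : C)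
    (f : Hor A B) (g : Hor A' B') (u : Ver A A') (v : Ver B B') :
  Iso s f g u v -> Iso (Fs F s) (fh F f) (fh F g) (fv F u) (fv F v).
Proof.
  intros [h (s' & u' & v' & h' & e1 & e2)]. split; [tinf|].
  exists (Fs F s'), (fv F u'), (fv F v'). split; [tinf|].
  rewrite <- (F_V h h' eq_refl), <- (F_V h' h eq_refl), e1, e2. split; apply F_sv.
Qed.

#[export] Hint Resolve Iso_is : isdb.

Create HintDb isodb.
Ltac isoinf := lazymatch goal with
 | |- Iso (V _ _) _ _ _ _ => eapply Iso_V; [isoinf | isoinf | heq]
 | |- Iso (H _ _) _ _ _ _ => eapply Iso_H; [isoinf | isoinf | veq]
 | |- Iso (Fs _ _) _ _ _ _ => eapply Iso_F; isoinf
 | |- Iso (sv _) _ _ _ _ => eapply Iso_sv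
 | |- _ => first [eassumption | solve [eauto with isodb nocore typeclass_instances]]
end.
Ltac iso := first [solve [eauto with isodb nocore] | eapply Iso_conv; [isoinf | heq | heq | veq | veq]].

Section Companion.
Context {D : DblData} {hD : is_double D}.
Variables (A B : D) (u : Ver A B).

Lemma comp_hS (c : CompData u) : is_companion c -> H (pk (ciota c)) (pk (ceps c)) = sv (ch c).
Proof.
  intros [e _]. apply (f_equal (@pk _ _ _ _ _ _ _ _ _)) in e.
  rewrite pk_gtop, pk_gbot, pk_lunit', pk_runit, <- H_pk in e.
  erewrite Vidr, Vidl in e by ty. exact e.
Qed.

Lemma comp_vS (c : CompData u) : is_companion c -> V (pk (ciota c)) (pk (ceps c)) = sh u.
Proof. intros [_ e]. rewrite V_pk. apply pk_sqeq, e. Qed.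

End Companion.

Section StrictFunctor.
Context {C D : DblData} {hC : is_double C} {hD : is_double D}
  {F0 : C -> D} {F : FunData F0} {hF : is_psfun F}.

Lemma F_lunit (A B : C) (f : Hor A B) :
  V (H (pk (fwd (unt F A))) (sv (fh F f))) (pk (fwd (cmp F (hid A) f))) = sv (fh F f).
Proof.
  pose proof (proj2 (pk_sqeq _ _) (cmp_lunit hF f)) as e.
  rewrite <- !V_pk, <- H_pk, <- Fs_pk, !pk_lunit, F_sv in e.
  erewrite (Vidr (g := fh F f)) in e; [exact e| ty | rewrite hc_idl; reflexivity].
Qed.

Lemma F_runit (A B : C) (f : Hor A B) :
  V (H (sv (fh F f)) (pk (fwd (unt F B)))) (pk (fwd (cmp F f (hid B)))) = sv (fh F f).
Proof.
  pose proof (proj2 (pk_sqeq _ _) (cmp_runit hF f)) as e.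
  rewrite <- !V_pk, <- H_pk, <- Fs_pk, !pk_runit, F_sv in e.
  erewrite (Vidr (g := fh F f)) in e; [exact e| ty | rewrite hc_idr; reflexivity].
Qed.

Lemma F_assoc (A B E G : C) (f : Hor A B) (g : Hor B E) (h : Hor E G) :
  V (H (pk (fwd (cmp F f g))) (sv (fh F h))) (pk (fwd (cmp F (f ** g) h)))
  = V (H (sv (fh F f)) (pk (fwd (cmp F g h)))) (pk (fwd (cmp F f (g ** h)))).
Proof.
  pose proof (proj2 (pk_sqeq _ _) (cmp_assoc hF f g h)) as e.
  rewrite <- !V_pk, <- !H_pk, <- Fs_pk, !pk_assoc, F_sv in e. fold (sv (fh F h)) (sv (fh F f)) in e.
  erewrite (Vidr (g := fh F (f ** g ** h))) in e; [|ty|rewrite hc_assoc; reflexivity].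
  rewrite e. rewrite V_assoc. erewrite Vidl; [reflexivity| tinf| heq].
Qed.

End StrictFunctor.

(** * Companions *)

Section CompS.
Context {D : DblData} {hD : is_double D}.

Record CompS (A B : D) (u : Ver A B) (c : Hor A B) (e i : S D) : Prop := {
  cs_e : Is e c (hid B) u (vid B);
  cs_i : Is i (hid A) c (vid A) u;
  cs_h : H i e = sv c;
  cs_v : V i e = sh u
}.

Lemma CompS_of (A B : D) (u : Ver A B) (c : CompData u) :
  is_companion c -> CompS u (ch c) (pk (ceps c)) (pk (ciota c)).
Proof. split; [tinf | tinf | apply comp_hS | apply comp_vS]; assumption. Qed.

Lemma CompS_to (A B : D) (u : Ver A B) (c : CompData u) :
  CompS u (ch c) (pk (ceps c)) (pk (ciota c)) -> is_companion c.
Proof.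
  intros [e i h v]. split.
  - apply pk_eq. rewrite pk_gtop, pk_gbot, pk_lunit', pk_runit, <- H_pk.
    erewrite Vidr, Vidl by ty. exact h.
  - apply pk_sqeq. rewrite <- V_pk. exact v.
Qed.

Lemma CompS_id (A : D) : CompS (vid A) (hid A) (sh (vid A)) (sh (vid A)).
Proof.
  split; try tinf.
  - erewrite Hidl; [apply sh_vid | tinf | tinf].
  - rewrite V_sh, vc_idl. reflexivity.
Qed.

Lemma CompS_comp (A B C : D) (u : Ver A B) (v : Ver B C) c e i d e' i' :
  CompS u c e i -> CompS v d e' i' ->
  CompS (u // v) (c ** d) (V (H e (sv d)) e') (V i (H (sv c) i')).
Proof.
  intros [he hi hh hv] [he' hi' hh' hv']. split.
  - ty.
  - ty.
  - transitivity (V (H i (H e (sv d))) (H (H (sv c) i') e')).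
    { symmetry. eapply VH; ty. }
    rewrite <- H_assoc, hh, H_assoc, hh', !H_sv. erewrite Vidl; [reflexivity|ty|ty].
  - rewrite V_assoc, <- (V_assoc (H (sv c) i')).
    erewrite VH by tinf. erewrite Vidl, Vidr by tinf.
    transitivity (V i (V (V e i') e')).
    (* [e] ends at [hid B] and [i'] starts there, so side by side and one above the other they give
       the same square. *)
    { f_equal. f_equal. transitivity (V (H e (sv (hid B))) (H (sv (hid B)) i')).
      - erewrite VH by tinf. erewrite Vidl, Vidr by tinf. reflexivity.
      - rewrite <- !sh_vid. erewrite Hidl, Hidr by tinf. reflexivity. }
    rewrite V_assoc, hv', <- V_assoc, hv, V_sh. reflexivity.
Qed.

(** Invertibility of [u] makes the companion unit [i] invertible, its inverse being the counit [e]
    over the identity square on [u']. This is the source of all universal squares used later. *)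
Lemma CompS_Iso (A B : D) (u : Ver A B) (u' : Ver B A) c e i :
  CompS u c e i -> u // u' = vid A -> u' // u = vid B ->
  Iso i (hid A) c (vid A) u /\ V (V e (sh u')) i = sv c /\ V i (V e (sh u')) = sv (hid A).
Proof.
  intros [he hi hh hv] e1 e2.
  assert (k : V (V e (sh u')) i = sv c).
  { rewrite V_assoc, <- hh.
    (* Padded with identity squares, the three rows have columns [sh u], [sh u'], [i] and [e],
       [sh u'], [sh u], which cancel to [i] and [e]; the horizontal companion identity finishes. *)
    transitivity (V (H (sh u) e) (V (H (sh u') (sh u')) (H i (sh u)))).
    { erewrite !(Hidl (g := hid B)) by tinf. erewrite !Hidl, Hidr by tinf. reflexivity. }
    erewrite (VH (a := sh u')) by tinf. erewrite VH by ty.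
    rewrite <- V_assoc, !V_sh, e1, e2, !sh_vid. erewrite Vidl, Vidr by tinf. reflexivity. }
  assert (k' : V i (V e (sh u')) = sv (hid A)).
  { rewrite <- V_assoc, hv, V_sh, e1. apply sh_vid. }
  split; [|split; assumption].
  split; [assumption|]. exists (V e (sh u')), (u // u'), (vid B // u'). split; [ty|].
  split; assumption.
Qed.

Section Compare.
Variables (A B : D) (u u' : Ver A B) (eu : u = u') (c : CompData u) (c' : CompData u').
Hypotheses (hc : is_companion c) (hc' : is_companion c').

Lemma pk_compare : pk (fwd (cd_compare eu c c')) = H (pk (ciota c')) (pk (ceps c)).
Proof.
  unfold cd_compare; cbn [fwd]. rewrite pk_gtop, pk_gbot, pk_lunit', pk_runit, <- H_pk, pk_castv.
  erewrite Vidr, Vidl by ty. reflexivity.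
Qed.

Lemma pk_compare' : pk (bwd (cd_compare eu c c')) = H (pk (ciota c)) (pk (ceps c')).
Proof.
  unfold cd_compare; cbn [bwd]. rewrite pk_gtop, pk_gbot, pk_lunit', pk_runit, <- H_pk, pk_castv.
  erewrite Vidr, Vidl by ty. reflexivity.
Qed.
End Compare.

(** The comparison of two companions of one cell is the unit of the target beside the counit of the
    source. Carrying one unit to the other is the property by which the monad constraints are
    recognised later. *)
Lemma CompS_compare (A B : D) (u : Ver A B) c e i c' e' i' :
  CompS u c e i -> CompS u c' e' i' ->
  V i (H i' e) = i' /\ V (H i' e) (H i e') = sv c.
Proof.
  intros [he hi hh hv] [he' hi' hh' hv']. split.
  - transitivity (V (H (sh (vid A)) i) (H i' e)).
    { erewrite Hidl by tinf. reflexivity. }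
    erewrite VH by tinf. rewrite hv, sh_vid. erewrite Vidl, Hidr by tinf. reflexivity.
  - transitivity (V (H (sh (vid A)) (H i' e)) (H i (H e' (sh (vid B))))).
    { erewrite (Hidr (s := e')) by tinf. erewrite Hidl by ty. reflexivity. }
    erewrite !VH by tinf. rewrite hv', !sh_vid. erewrite Vidl, Vidr by tinf.
    erewrite Hidl by tinf. exact hh.
Qed.

Lemma compare_spec (A B : D) (u u' : Ver A B) (eu : u = u') (c : CompData u) (c' : CompData u') :
  is_companion c -> is_companion c' ->
  V (pk (ciota c)) (pk (fwd (cd_compare eu c c'))) = pk (ciota c') /\
  is_giso (cd_compare eu c c').
Proof.
  intros h h'. subst u'.
  pose proof (CompS_of h) as k. pose proof (CompS_of h') as k'.
  split; [|split].
  - rewrite pk_compare. apply (CompS_compare k k').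
  - apply pk_sqeq. rewrite <- V_pk, pk_compare, pk_compare'. apply (CompS_compare k k').
  - apply pk_sqeq. rewrite <- V_pk, pk_compare, pk_compare'. apply (CompS_compare k' k).
Qed.

Lemma companion_id (A : D) : is_companion (cd_id A).
Proof. apply CompS_to, CompS_id. Qed.

Lemma pk_comp_iota (A B C : D) (u : Ver A B) (v : Ver B C) (c : CompData u) (d : CompData v) :
  pk (ciota (cd_comp c d)) = V (pk (ciota c)) (H (sv (ch c)) (pk (ciota d))).
Proof.
  unfold cd_comp; cbn [ciota]. rewrite pk_castv, <- V_pk, <- H_pk, pk_gbot, pk_runit'.
  rewrite V_assoc. erewrite Vidl by ty. reflexivity.
Qed.

Lemma companion_comp (A B C : D) (u : Ver A B) (v : Ver B C) (c : CompData u) (d : CompData v) :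
  is_companion c -> is_companion d -> is_companion (cd_comp c d).
Proof.
  intros h h'. apply CompS_to. rewrite pk_comp_iota.
  replace (pk (ceps (cd_comp c d))) with (V (H (pk (ceps c)) (sv (ch d))) (pk (ceps d))).
  - apply CompS_comp; apply CompS_of; assumption.
  - unfold cd_comp; cbn [ceps]. rewrite pk_castv, <- V_pk, <- H_pk, pk_gtop, pk_lunit.
    erewrite (Vidl (s := pk (ceps d))) by ty. reflexivity.
Qed.
End CompS.

Section CompMap.
Context {C D : DblData} {hC : is_double C} {hD : is_double D}
  {F0 : C -> D} {F : FunData F0} {hF : is_psfun F}.

Lemma pk_map_iota (A B : C) (u : Ver A B) (c : CompData u) :
  pk (ciota (cd_map F c)) = V (pk (fwd (unt F A))) (Fs F (pk (ciota c))).
Proof. unfold cd_map; cbn [ciota]. rewrite pk_gtop, pk_castv, <- Fs_pk. reflexivity. Qed.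

(** The images of unit and counit paste only up to compositors. Since the pasting of unit and counit
    is an identity, naturality of the compositor turns the pasting of their images into the
    compositor at [(hid A, ch c)] followed by the inverse one at [(ch c, hid B)]; the unit laws of
    [F] cancel both against the unitors. *)
Lemma companion_map (A B : C) (u : Ver A B) (c : CompData u) :
  is_companion c -> is_companion (cd_map F c).
Proof.
  intro h. pose proof (CompS_of h) as [he hi hh hv]. apply CompS_to.
  rewrite pk_map_iota.
  replace (pk (ceps (cd_map F c))) with (V (Fs F (pk (ceps c))) (pk (bwd (unt F B))));
    [|unfold cd_map; cbn [ceps]; rewrite pk_gbot, pk_castv, <- Fs_pk; reflexivity].
  set (i := pk (ciota c)) in *. set (e := pk (ceps c)) in *.
  destruct (unt_iso hF B) as [u1 _]. apply pk_sqeq in u1. rewrite <- V_pk in u1.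
  assert (ids : forall A, fv F (vid A) = vid (F0 A)) by apply fv_id.
  assert (hFi : Is (Fs F i) (fh F (hid A)) (fh F (ch c)) (vid (F0 A)) (fv F u)).
  { eapply Is_conv; [eapply Fs_is, hi|..]; ty. }
  assert (hFe : Is (Fs F e) (fh F (ch c)) (fh F (hid B)) (fv F u) (vid (F0 B))).
  { eapply Is_conv; [eapply Fs_is, he|..]; ty. }
  split.
  - cbn. ty.
  - cbn. ty.
  - cbn [ch cd_map].
    transitivity (V (H (pk (fwd (unt F A))) (sv (fh F (ch c))))
      (V (H (Fs F i) (Fs F e)) (H (sv (fh F (ch c))) (pk (bwd (unt F B)))))).
    { erewrite !VH by ty. erewrite Vidl, Vidr by ty. reflexivity. }
    assert (k : V (H (Fs F i) (Fs F e)) (pk (fwd (cmp F (ch c) (hid B)))) = pk (fwd (cmp F (hid A) (ch c)))).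
    { erewrite F_cmp by tinf. rewrite hh, F_sv. erewrite Vidr by ty. reflexivity. }
    destruct (cmp_iso hF (ch c) (hid B)) as [k1 k2]. apply pk_sqeq in k1, k2. rewrite <- V_pk in k1, k2.
    set (p := pk (fwd (cmp F (ch c) (hid B)))) in *. set (p' := pk (bwd (cmp F (ch c) (hid B)))) in *.
    assert (ip : Is p (fh F (ch c) ** fh F (hid B)) (fh F (ch c ** hid B)) (vid _) (vid _)) by apply pk_is.
    assert (ip' : Is p' (fh F (ch c ** hid B)) (fh F (ch c) ** fh F (hid B)) (vid _) (vid _)) by apply pk_is.
    assert (k' : H (Fs F i) (Fs F e) = V (pk (fwd (cmp F (hid A) (ch c)))) p').
    { rewrite <- k, V_assoc. fold (sv (fh F (ch c) ** fh F (hid B))) in k1. rewrite k1. erewrite Vidr by ty. reflexivity. }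
    rewrite k', V_assoc, <- V_assoc, F_lunit.
    pose proof (F_runit (F:=F) (ch c)) as r. fold p in r.
    assert (r' : V p' (H (sv (fh F (ch c))) (pk (bwd (unt F B)))) = sv (fh F (ch c))).
    { erewrite <- (Vidl (s := V p' _) (f := fh F (ch c))) by ty. rewrite <- r at 1.
      rewrite V_assoc, <- (V_assoc p). fold (sv (fh F (ch c) ** fh F (hid B))) in k1. rewrite k1.
      erewrite (Vidl (s := H _ _)) by tinf. erewrite VH by tinf.
      fold (sv (hid (F0 B))) in u1. rewrite u1. erewrite Vidl by tinf. rewrite H_sv, hc_idr. reflexivity. }
    rewrite r'. erewrite Vidl by tinf. reflexivity.
  - rewrite V_assoc, <- (V_assoc (Fs F i)). erewrite <- F_V by tinf. rewrite hv, <- V_assoc, <- F_unt, V_assoc.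
    change (pk (sqv (hid (F0 B)))) with (sv (hid (F0 B))) in u1. rewrite u1.
    erewrite Vidr by tinf. reflexivity.
Qed.
End CompMap.

Hint Rewrite @fv_id @fv_vc : ver.

Definition cmpS (C D : DblData) (F0 : C -> D) (F : FunData F0) (A B E : C) (f : Hor A B) (g : Hor B E) : S D :=
  pk (fwd (cmp F f g)).
Definition untS (C D : DblData) (F0 : C -> D) (F : FunData F0) (A : C) : S D := pk (fwd (unt F A)).

Section CmpUnt.
Context {C D : DblData} {F0 : C -> D} {F : FunData F0}.

Lemma cmp_is (A B E : C) (f : Hor A B) (g : Hor B E) :
  Is (cmpS F f g) (fh F f ** fh F g) (fh F (f ** g)) (vid _) (vid _).
Proof. apply pk_is. Qed.

Lemma unt_is (A : C) : Is (untS F A) (hid (F0 A)) (fh F (hid A)) (vid _) (vid _).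
Proof. apply pk_is. Qed.

Context {PD : is_pseudodouble D} {hF : is_psfun F}.

Lemma Iso_cmp (A B E : C) (f : Hor A B) (g : Hor B E) :
  Iso (cmpS F f g) (fh F f ** fh F g) (fh F (f ** g)) (vid _) (vid _).
Proof. apply Iso_giso, cmp_iso, hF. Qed.

Lemma Iso_unt (A : C) : Iso (untS F A) (hid (F0 A)) (fh F (hid A)) (vid _) (vid _).
Proof. apply Iso_giso, unt_iso, hF. Qed.
End CmpUnt.

#[export] Hint Resolve cmp_is unt_is : isdb.
#[export] Hint Resolve Iso_cmp Iso_unt : isodb.

Section CmpUntNat.
Context {C D : DblData} {F0 : C -> D} {F : FunData F0} {hF : is_psfun F}.

Lemma F_cmpS (s t : S C) (A B E A' B' E' : C) (f : Hor A B) (g : Hor B E)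
    (f' : Hor A' B') (g' : Hor B' E') (u : Ver A A') (v v' : Ver B B') (w : Ver E E') :
  Is s f f' u v -> Is t g g' v' w -> v' = v ->
  V (H (Fs F s) (Fs F t)) (cmpS F f' g') = V (cmpS F f g) (Fs F (H s t)).
Proof. apply F_cmp. Qed.

Lemma F_untS (A A' : C) (u : Ver A A') :
  V (sh (fv F u)) (untS F A') = V (untS F A) (Fs F (sh u)).
Proof. apply F_unt. Qed.

Context {hC : is_double C} {hD : is_double D}.

Lemma F_lunitS (A B : C) (f : Hor A B) :
  V (H (untS F A) (sv (fh F f))) (cmpS F (hid A) f) = sv (fh F f).
Proof. apply F_lunit. Qed.

Lemma F_runitS (A B : C) (f : Hor A B) :
  V (H (sv (fh F f)) (untS F B)) (cmpS F f (hid B)) = sv (fh F f).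
Proof. apply F_runit. Qed.

Lemma F_assocS (A B E G : C) (f : Hor A B) (g : Hor B E) (h : Hor E G) :
  V (H (cmpS F f g) (sv (fh F h))) (cmpS F (f ** g) h)
  = V (H (sv (fh F f)) (cmpS F g h)) (cmpS F f (g ** h)).
Proof. apply F_assoc. Qed.
End CmpUntNat.

(** What [is_vps] says of a transformation whose globular cells are identities, stated for families
    of sets of squares, so that structural squares assembled by pasting need not be rebuilt with an
    exact boundary. *)
Record Nat (C D : DblData) (F0 G0 : C -> D) (F : FunData F0) (G : FunData G0)
    (tv : forall A, Ver (F0 A) (G0 A)) (ts : forall A B (f : Hor A B), S D) : Prop := {
  n_is : forall A B (f : Hor A B), Is (ts A B f) (fh F f) (fh G f) (tv A) (tv B);
  n_v : forall A A' (u : Ver A A'), fv F u // tv A' = tv A // fv G u;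
  n_nat : forall (a : S C) (A B A' B' : C) (f : Hor A B) (g : Hor A' B') (u : Ver A A') (v : Ver B B'),
    Is a f g u v -> V (Fs F a) (ts _ _ g) = V (ts _ _ f) (Fs G a);
  n_hc : forall (A B E : C) (f : Hor A B) (g : Hor B E),
    V (cmpS F f g) (ts _ _ (f ** g)) = V (H (ts _ _ f) (ts _ _ g)) (cmpS G f g);
  n_hid : forall A : C, V (untS F A) (ts _ _ (hid A)) = V (sh (tv A)) (untS G A)
}.

Section OfVT.
Context {C D : DblData} {hD : is_double D} {F0 G0 : C -> D} {F : FunData F0} {G : FunData G0}.

Lemma Nat_of_VT (al : VT F G) : Nat F G (tv al) (fun A B f => pk (tsq al f)).
Proof.
  destruct (vt_ok al) as [_ h1 h2 _ _ h3]. split.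
  - intros. apply pk_is.
  - intros. apply tv_nat.
  - intros a A B A' B' f g u v [x ->]. specialize (h3 _ _ _ _ _ _ _ _ x).
    apply (f_equal (@pk _ _ _ _ _ _ _ _ _)) in h3.
    rewrite !pk_gtop, !pk_gbot, !pk_lunit, !pk_lunit', !pk_runit, !pk_runit', <- !H_pk, <- !V_pk, <- !Fs_pk in h3.
    cbn [pcell vps_of_vt psq] in h3. rewrite !pk_castv in h3.
    fold (sh (fv F u // tv al A')) (sh (fv F v // tv al B')) in h3.
    erewrite (Hidr (v := fv F v // tv al B')), (Hidl (u := fv F u // tv al A')) in h3 by
      (first [tinf | symmetry; apply tv_nat]).
    erewrite !Vidl in h3 by tinf. erewrite !Vidr in h3 by tinf. exact h3.
  - intros. specialize (h1 _ _ _ f g). apply pk_sqeq in h1. rewrite <- !V_pk, <- H_pk in h1. exact h1.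
  - intros. specialize (h2 A). apply pk_sqeq in h2. rewrite <- !V_pk in h2. exact h2.
Qed.
End OfVT.

(** * The Kleisli pseudodouble category *)

Section KlS.
Context {D : DblData} {hD : is_double D} {T0 : D -> D} (T : FunData T0) {hT : is_psfun T}.
Variables (muv : forall A : D, Ver (T0 (T0 A)) (T0 A)) (etav : forall A : D, Ver A (T0 A)).
Variables (mus etas : forall (A B : D) (f : Hor A B), S D).
Variables (m n : forall A : D, S D) (mh : forall A : D, Hor (T0 (T0 A)) (T0 A)) (nh : forall A : D, Hor A (T0 A)).
Variables (hm hn : forall (A B : D) (u : Ver A B), S D).

(* The data of the lifted monad, in terms of the companion squares [m], [n]
   exhibiting [mh], [nh] as companions. *)
Record KMonad : Prop := {
  mu_N : Nat (compF T T) T muv mus;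
  eta_N : Nat (idF D) T etav etas;
  mu_av : forall A : D, fv T (muv A) // muv A = muv (T0 A) // muv A;
  mu_as : forall (A B : D) (f : Hor A B), V (Fs T (mus f)) (mus f) = V (mus (fh T f)) (mus f);
  mu_lv : forall A : D, etav (T0 A) // muv A = vid (T0 A);
  mu_ls : forall (A B : D) (f : Hor A B), V (etas (fh T f)) (mus f) = sv (fh T f);
  mu_rv : forall A : D, fv T (etav A) // muv A = vid (T0 A);
  mu_rs : forall (A B : D) (f : Hor A B), V (Fs T (etas f)) (mus f) = sv (fh T f);
  m_iso : forall A, Iso (m A) (hid _) (mh A) (vid _) (muv A);
  n_iso : forall A, Iso (n A) (hid _) (nh A) (vid _) (etav A);
  hm_is : forall (A B : D) (u : Ver A B), Is (hm u) (mh A) (mh B) (fv T (fv T u)) (fv T u);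
  hn_is : forall (A B : D) (u : Ver A B), Is (hn u) (nh A) (nh B) u (fv T u);
  hm_nat : forall (A B : D) (u : Ver A B), V (m A) (hm u) = V (sh (fv T (fv T u))) (m B);
  hn_nat : forall (A B : D) (u : Ver A B), V (n A) (hn u) = V (sh u) (n B);
  mus_iso : forall (A B : D) (f : Hor A B), Iso (mus f) (fh T (fh T f)) (fh T f) (muv A) (muv B);
  etas_iso : forall (A B : D) (f : Hor A B), Iso (etas f) f (fh T f) (etav A) (etav B)
}.

Hypothesis KM : KMonad.

Lemma mus_is (A B : D) (f : Hor A B) : Is (mus f) (fh T (fh T f)) (fh T f) (muv A) (muv B).
Proof. apply (n_is (mu_N KM)). Qed.
Lemma etas_is (A B : D) (f : Hor A B) : Is (etas f) f (fh T f) (etav A) (etav B).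
Proof. apply (n_is (eta_N KM)). Qed.
Lemma m_is A : Is (m A) (hid _) (mh A) (vid _) (muv A).
Proof. apply Iso_is, (m_iso KM). Qed.
Lemma n_is' A : Is (n A) (hid _) (nh A) (vid _) (etav A).
Proof. apply Iso_is, (n_iso KM). Qed.

Lemma hm_is' (A B : D) (u : Ver A B) : Is (hm u) (mh A) (mh B) (fv T (fv T u)) (fv T u).
Proof. apply (hm_is KM). Qed.
Lemma hn_is' (A B : D) (u : Ver A B) : Is (hn u) (nh A) (nh B) u (fv T u).
Proof. apply (hn_is KM). Qed.
Lemma mu_av1 A : fv T (muv A) // muv A = muv (T0 A) // muv A.
Proof. apply (mu_av KM). Qed.
Lemma mu_lv1 A : etav (T0 A) // muv A = vid (T0 A).
Proof. apply (mu_lv KM). Qed.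
Lemma mu_rv1 A : fv T (etav A) // muv A = vid (T0 A).
Proof. apply (mu_rv KM). Qed.

Hint Resolve mus_is etas_is m_is n_is' hm_is' hn_is' : isdb.
Hint Rewrite mu_av1 mu_lv1 mu_rv1 : ver.

Lemma mu_nv A A' (u : Ver A A') : fv T (fv T u) // muv A' = muv A // fv T u.
Proof. apply (n_v (mu_N KM)). Qed.
Lemma eta_nv A A' (u : Ver A A') : u // etav A' = etav A // fv T u.
Proof. apply (n_v (eta_N KM)). Qed.
Lemma mu_nv' A A' B (u : Ver A A') (w : Ver (T0 A') B) :
  fv T (fv T u) // (muv A' // w) = muv A // (fv T u // w).
Proof. rewrite <- !vc_assoc, mu_nv. reflexivity. Qed.
Hint Rewrite mu_nv mu_nv'  : ver.

Lemma mus_nat (a : S D) (A B A' B' : D) (f : Hor A B) (g : Hor A' B') (u : Ver A A') (v : Ver B B') :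
  Is a f g u v -> V (Fs T (Fs T a)) (mus g) = V (mus f) (Fs T a).
Proof.
  intros [x ->]. pose proof (n_nat (mu_N KM) (pk_is x)) as e. rewrite !Fs_pk in *. exact e.
Qed.
Lemma etas_nat (a : S D) (A B A' B' : D) (f : Hor A B) (g : Hor A' B') (u : Ver A A') (v : Ver B B') :
  Is a f g u v -> V a (etas g) = V (etas f) (Fs T a).
Proof.
  intros [x ->]. rewrite <- (n_nat (eta_N KM) (pk_is x)). f_equal. symmetry. apply Fs_pk.
Qed.

Lemma mus_hc (A B E : D) (f : Hor A B) (g : Hor B E) :
  V (cmpS T (fh T f) (fh T g)) (V (Fs T (cmpS T f g)) (mus (f ** g))) = V (H (mus f) (mus g)) (cmpS T f g).
Proof.
  rewrite <- (n_hc (mu_N KM)). unfold cmpS. cbn [cmp compF]. unfold gcomp; cbn [fwd gmap].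
  rewrite pk_gtop, pk_castv, V_assoc, <- Fs_pk. reflexivity.
Qed.

Lemma mus_iso' (A B : D) (f : Hor A B) : Iso (mus f) (fh T (fh T f)) (fh T f) (muv A) (muv B).
Proof. apply (mus_iso KM). Qed.
Lemma etas_iso' (A B : D) (f : Hor A B) : Iso (etas f) f (fh T f) (etav A) (etav B).
Proof. apply (etas_iso KM). Qed.
Lemma m_iso' A : Iso (m A) (hid _) (mh A) (vid _) (muv A).
Proof. apply (m_iso KM). Qed.
Lemma n_iso' A : Iso (n A) (hid _) (nh A) (vid _) (etav A).
Proof. apply (n_iso KM). Qed.
Hint Resolve mus_iso' etas_iso' m_iso' n_iso' : isodb.

Definition cK (A B C : D) (f : Hor A (T0 B)) (g : Hor B (T0 C)) : Hor A (T0 C) := f ** fh T g ** mh C.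
Definition hK (A B : D) (w : Ver A B) (a b : S D) : S D := H a (H (Fs T b) (hm w)).
(* The universal square of the Kleisli composite. *)
Definition R (A B C : D) (f : Hor A (T0 B)) (g : Hor B (T0 C)) : S D :=
  H (sv f) (H (sv (fh T g)) (m C)).

Lemma R_iso (A B C : D) (f : Hor A (T0 B)) (g : Hor B (T0 C)) :
  Iso (R f g) (f ** fh T g) (cK f g) (vid A) (muv C).
Proof.
  unfold R, cK. iso.
Qed.
Lemma R_is (A B C : D) (f : Hor A (T0 B)) (g : Hor B (T0 C)) :
  Is (R f g) (f ** fh T g) (cK f g) (vid A) (muv C).
Proof. apply Iso_is, R_iso. Qed.
Hint Resolve R_is : isdb.
Hint Resolve R_iso : isodb.

Lemma hK_is (A B C A' B' C' : D) (f : Hor A (T0 B)) (g : Hor B (T0 C)) (f' : Hor A' (T0 B')) (g' : Hor B' (T0 C'))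
   (u : Ver A A') (v : Ver B B') (w : Ver C C') a b x y :
  Is a f f' u x -> Is b g g' v y -> x = fv T v -> y = fv T w -> Is (hK w a b) (cK f g) (cK f' g') u (fv T w).
Proof. intros. subst. unfold hK, cK. ty. Qed.

(** The squares [hm] are used only through their pasting with the invertible [m], so functoriality
    is checked after cancelling [m]. *)
Lemma hm_vc (A B C : D) (u : Ver A B) (v : Ver B C) : V (hm u) (hm v) = hm (u // v).
Proof.
  eapply (Iso_cancel (r := m A)); [|apply (m_iso KM)|ty|ty|ty|ty].
  rewrite <- V_assoc, !(hm_nat KM), V_assoc, (hm_nat KM), <- V_assoc, V_sh, !fv_vc. reflexivity.
Qed.

Lemma hm_id (A : D) : hm (vid A) = sv (mh A).
Proof.
  eapply (Iso_cancel (r := m A)); [|apply (m_iso KM)|ty|ty|ty|ty].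
  rewrite (hm_nat KM), !fv_id, sh_vid. erewrite Vidl, Vidr by ty. reflexivity.
Qed.

Lemma hn_vc (A B C : D) (u : Ver A B) (v : Ver B C) : V (hn u) (hn v) = hn (u // v).
Proof.
  eapply (Iso_cancel (r := n A)); [|apply (n_iso KM)|ty|ty|ty|ty].
  rewrite <- V_assoc, !(hn_nat KM), V_assoc, (hn_nat KM), <- V_assoc, V_sh. reflexivity.
Qed.

Lemma hn_id (A : D) : hn (vid A) = sv (nh A).
Proof.
  eapply (Iso_cancel (r := n A)); [|apply (n_iso KM)|ty|ty|ty|ty].
  rewrite (hn_nat KM), sh_vid. erewrite Vidl, Vidr by ty. reflexivity.
Qed.

(** [hm_nat] exchanges the companion unit with the square of the multiplication, so a Kleisli
    composite of squares pasted below [R] becomes an ordinary horizontal composite above it. *)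
Lemma R_nat (A B C A' B' C' : D) (f : Hor A (T0 B)) (g : Hor B (T0 C)) (f' : Hor A' (T0 B')) (g' : Hor B' (T0 C'))
   (u : Ver A A') (v : Ver B B') (w : Ver C C') a b x y :
  Is a f f' u x -> Is b g g' v y -> x = fv T v -> y = fv T w ->
  V (R f g) (hK w a b) = V (H a (Fs T b)) (R f' g').
Proof.
  intros ha hb -> ->. unfold R, hK.
  set (r := V (H a _) _). erewrite !VH by ty. rewrite (hm_nat KM). subst r.
  transitivity (V (H a (H (Fs T b) (sh (fv T (fv T w))))) (H (sv f') (H (sv (fh T g')) (m C')))).
  - erewrite !VH by ty. erewrite Vidl, Vidl by ty. erewrite !Vidr by ty. reflexivity.
  - erewrite (Hidr (s := Fs T b)) by ty. reflexivity.
Qed.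

Lemma hK_vs (A B C A' B' C' A'' B'' C'' : D) (f : Hor A (T0 B)) (g : Hor B (T0 C)) (f' : Hor A' (T0 B')) (g' : Hor B' (T0 C'))
   (f'' : Hor A'' (T0 B'')) (g'' : Hor B'' (T0 C''))
   (u : Ver A A') (v : Ver B B') (w : Ver C C') (u' : Ver A' A'') (v' : Ver B' B'') (w' : Ver C' C'') a b c d :
  Is a f f' u (fv T v) -> Is b g g' v (fv T w) -> Is c f' f'' u' (fv T v') -> Is d g' g'' v' (fv T w') ->
  V (hK w a b) (hK w' c d) = hK (w // w') (V a c) (V b d).
Proof.
  intros. unfold hK. erewrite !VH by ty. rewrite hm_vc. erewrite F_V by tinf. reflexivity.
Qed.

Lemma hK_sv (A B C : D) (f : Hor A (T0 B)) (g : Hor B (T0 C)) : hK (vid C) (sv f) (sv g) = sv (cK f g).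
Proof. unfold hK. rewrite hm_id, F_sv, !H_sv. reflexivity. Qed.

(* The two universal squares on a triple of Kleisli arrows: the associator is the
   unique square carrying [U1] to [U2]. *)
Definition U1 (A B C E : D) (f : Hor A (T0 B)) (g : Hor B (T0 C)) (h : Hor C (T0 E)) : S D :=
  V (H (R f g) (mus h)) (R (cK f g) h).
Definition U2 (A B C E : D) (f : Hor A (T0 B)) (g : Hor B (T0 C)) (h : Hor C (T0 E)) : S D :=
  V (H (sv f) (V (cmpS T g (fh T h)) (Fs T (R g h)))) (R f (cK g h)).

Lemma U1_iso (A B C E : D) (f : Hor A (T0 B)) (g : Hor B (T0 C)) (h : Hor C (T0 E)) :
  Iso (U1 f g h) (f ** fh T g ** fh T (fh T h)) (cK (cK f g) h) (vid A) (muv (T0 E) // muv E).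
Proof.
  unfold U1. iso.
Qed.
Lemma U1_is (A B C E : D) (f : Hor A (T0 B)) (g : Hor B (T0 C)) (h : Hor C (T0 E)) :
  Is (U1 f g h) (f ** fh T g ** fh T (fh T h)) (cK (cK f g) h) (vid A) (muv (T0 E) // muv E).
Proof. apply Iso_is, U1_iso. Qed.

Lemma U2_iso (A B C E : D) (f : Hor A (T0 B)) (g : Hor B (T0 C)) (h : Hor C (T0 E)) :
  Iso (U2 f g h) (f ** fh T g ** fh T (fh T h)) (cK f (cK g h)) (vid A) (muv (T0 E) // muv E).
Proof.
  unfold U2. iso.
Qed.
Lemma U2_is (A B C E : D) (f : Hor A (T0 B)) (g : Hor B (T0 C)) (h : Hor C (T0 E)) :
  Is (U2 f g h) (f ** fh T g ** fh T (fh T h)) (cK f (cK g h)) (vid A) (muv (T0 E) // muv E).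
Proof. apply Iso_is, U2_iso. Qed.
Hint Resolve U1_is U2_is : isdb.

Section Nat3.
Variables (A B C E A' B' C' E' : D) (f : Hor A (T0 B)) (g : Hor B (T0 C)) (h : Hor C (T0 E))
  (f' : Hor A' (T0 B')) (g' : Hor B' (T0 C')) (h' : Hor C' (T0 E'))
  (u : Ver A A') (v : Ver B B') (w : Ver C C') (x : Ver E E') (a b c : S D).
Hypotheses (ha : Is a f f' u (fv T v)) (hb : Is b g g' v (fv T w)) (hc : Is c h h' w (fv T x)).

Lemma U1_nat : V (U1 f g h) (hK x (hK w a b) c) = V (H a (H (Fs T b) (Fs T (Fs T c)))) (U1 f' g' h').
Proof.
  assert (hab : Is (hK w a b) (cK f g) (cK f' g') u (fv T w)) by (eapply hK_is; ty).
  unfold U1. rewrite V_assoc. erewrite R_nat by ty. rewrite <- !V_assoc, <- H_assoc. f_equal.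
  erewrite !VH by ty. erewrite R_nat by ty. erewrite mus_nat by ty. reflexivity.
Qed.

Lemma U2_nat : V (U2 f g h) (hK x a (hK x b c)) = V (H a (H (Fs T b) (Fs T (Fs T c)))) (U2 f' g' h').
Proof.
  assert (hab : Is (hK x b c) (cK g h) (cK g' h') v (fv T x)) by (eapply hK_is; ty).
  unfold U2. rewrite V_assoc. erewrite R_nat by ty. rewrite <- !V_assoc. f_equal.
  erewrite !VH by ty. erewrite Vidl, Vidr by ty. f_equal.
  rewrite (V_assoc (cmpS T g _)). erewrite <- F_V by ty. erewrite R_nat by ty. erewrite F_V by ty.
  rewrite <- !V_assoc. erewrite (F_cmpS (s := b)) by ty. reflexivity.
Qed.
End Nat3.

Variables (ass : forall (A B C E : D) (f : Hor A (T0 B)) (g : Hor B (T0 C)) (h : Hor C (T0 E)), S D)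
  (lu ru : forall (A B : D) (f : Hor A (T0 B)), S D).

(** Universal squares for the unit constraints. By the unit laws of the monad their right sides are
    identities, so they are globular and the unitors are their inverses. *)
Definition LU (A B : D) (f : Hor A (T0 B)) : S D := V (H (n A) (etas f)) (R (nh A) f).
Definition RU (A B : D) (f : Hor A (T0 B)) : S D := V (H (sv f) (V (untS T B) (Fs T (n B)))) (R f (nh B)).

Record KConstr : Prop := {
  ass_is : forall (A B C E : D) (f : Hor A (T0 B)) (g : Hor B (T0 C)) (h : Hor C (T0 E)),
    Is (ass f g h) (cK (cK f g) h) (cK f (cK g h)) (vid A) (vid (T0 E));
  ass_U : forall (A B C E : D) (f : Hor A (T0 B)) (g : Hor B (T0 C)) (h : Hor C (T0 E)),
    V (U1 f g h) (ass f g h) = U2 f g h;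
  lu_is : forall (A B : D) (f : Hor A (T0 B)), Is (lu f) (cK (nh A) f) f (vid A) (vid (T0 B));
  lu_U : forall (A B : D) (f : Hor A (T0 B)), V (LU f) (lu f) = sv f;
  ru_is : forall (A B : D) (f : Hor A (T0 B)), Is (ru f) (cK f (nh B)) f (vid A) (vid (T0 B));
  ru_U : forall (A B : D) (f : Hor A (T0 B)), V (RU f) (ru f) = sv f
}.
Hypothesis KC : KConstr.

Lemma LU_iso (A B : D) (f : Hor A (T0 B)) : Iso (LU f) f (cK (nh A) f) (vid A) (vid (T0 B)).
Proof.
  unfold LU. iso.
Qed.
Lemma RU_iso (A B : D) (f : Hor A (T0 B)) : Iso (RU f) f (cK f (nh B)) (vid A) (vid (T0 B)).
Proof.
  unfold RU. iso.
Qed.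
Lemma RU_is (A B : D) (f : Hor A (T0 B)) : Is (RU f) f (cK f (nh B)) (vid A) (vid (T0 B)).
Proof. apply Iso_is, RU_iso. Qed.

Lemma ass_is' (A B C E : D) (f : Hor A (T0 B)) (g : Hor B (T0 C)) (h : Hor C (T0 E)) :
    Is (ass f g h) (cK (cK f g) h) (cK f (cK g h)) (vid A) (vid (T0 E)).
Proof. apply (ass_is KC). Qed.
Lemma lu_is' (A B : D) (f : Hor A (T0 B)) : Is (lu f) (cK (nh A) f) f (vid A) (vid (T0 B)).
Proof. apply (lu_is KC). Qed.
Lemma ru_is' (A B : D) (f : Hor A (T0 B)) : Is (ru f) (cK f (nh B)) f (vid A) (vid (T0 B)).
Proof. apply (ru_is KC). Qed.
Hint Resolve  RU_is ass_is' lu_is' ru_is' : isdb.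

Lemma ass_nat (A B C E A' B' C' E' : D) (f : Hor A (T0 B)) (g : Hor B (T0 C)) (h : Hor C (T0 E))
  (f' : Hor A' (T0 B')) (g' : Hor B' (T0 C')) (h' : Hor C' (T0 E'))
  (u : Ver A A') (v : Ver B B') (w : Ver C C') (x : Ver E E') (a b c : S D)
  (ha : Is a f f' u (fv T v)) (hb : Is b g g' v (fv T w)) (hc : Is c h h' w (fv T x)) :
  V (hK x (hK w a b) c) (ass f' g' h') = V (ass f g h) (hK x a (hK x b c)).
Proof.
  assert (hab : Is (hK w a b) (cK f g) (cK f' g') u (fv T w)) by (eapply hK_is; ty).
  assert (hbc : Is (hK x b c) (cK g h) (cK g' h') v (fv T x)) by (eapply hK_is; ty).
  assert (h1 : Is (hK x (hK w a b) c) (cK (cK f g) h) (cK (cK f' g') h') u (fv T x)) by (eapply hK_is; ty).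
  assert (h2 : Is (hK x a (hK x b c)) (cK f (cK g h)) (cK f' (cK g' h')) u (fv T x)) by (eapply hK_is; ty).
  eapply (Iso_cancel (r := U1 f g h)); [|apply U1_iso|tinf|reflexivity|tinf|reflexivity].
  rewrite <- !V_assoc, (ass_U KC), (U1_nat ha hb hc), (U2_nat ha hb hc), V_assoc, (ass_U KC). reflexivity.
Qed.

Lemma lu_nat (A B A' B' : D) (f : Hor A (T0 B)) (f' : Hor A' (T0 B')) (u : Ver A A') (v : Ver B B') (a : S D)
  (ha : Is a f f' u (fv T v)) :
  V (hK v (hn u) a) (lu f') = V (lu f) a.
Proof.
  assert (h1 : Is (hK v (hn u) a) (cK (nh A) f) (cK (nh A') f') u (fv T v)) by (eapply hK_is; ty).
  eapply (Iso_cancel (r := LU f)); [|apply LU_iso|tinf|reflexivity|tinf|reflexivity].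
  rewrite <- !V_assoc, (lu_U KC). erewrite (Vidl (s := a)) by ty.
  unfold LU at 1. rewrite (V_assoc (H _ _)). erewrite R_nat by ty. rewrite <- V_assoc.
  erewrite VH by (first [ty | apply eta_nv]). rewrite (hn_nat KM). erewrite <- etas_nat by ty.
  assert (e : H (V (sh u) (n A')) (V a (etas f')) = V a (H (n A') (etas f'))).
  { erewrite <- (Hidl (s := a)) at 2 by ty. erewrite VH by ty. reflexivity. }
  rewrite e, V_assoc, V_assoc, <- (V_assoc (H _ _)). fold (LU f'). rewrite (lu_U KC).
  erewrite Vidr by ty. reflexivity.
Qed.

Lemma ru_nat (A B A' B' : D) (f : Hor A (T0 B)) (f' : Hor A' (T0 B')) (u : Ver A A') (v : Ver B B') (a : S D)
  (ha : Is a f f' u (fv T v)) :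
  V (hK v a (hn v)) (ru f') = V (ru f) a.
Proof.
  assert (h1 : Is (hK v a (hn v)) (cK f (nh B)) (cK f' (nh B')) u (fv T v)) by (eapply hK_is; ty).
  eapply (Iso_cancel (r := RU f)); [|apply RU_iso|tinf|reflexivity|tinf|reflexivity].
  rewrite <- !V_assoc, (ru_U KC). erewrite (Vidl (s := a)) by ty.
  unfold RU at 1. rewrite (V_assoc (H _ _)). erewrite R_nat by ty. rewrite <- V_assoc.
  erewrite VH by ty. erewrite Vidl by ty. rewrite (V_assoc (untS T B)). erewrite <- F_V by ty. rewrite (hn_nat KM).
  erewrite F_V by ty. rewrite <- (V_assoc (untS T B)). rewrite <- F_untS.
  rewrite (V_assoc (sh _)).
  assert (e : H a (V (sh (fv T v)) (V (untS T B') (Fs T (n B')))) = V a (H (sv f') (V (untS T B') (Fs T (n B'))))).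
  { erewrite <- (Hidr (s := a)) at 2 by ty. erewrite VH by ty. erewrite Vidr by ty. reflexivity. }
  rewrite e, V_assoc, V_assoc, <- (V_assoc (H _ _)). fold (RU f'). rewrite (ru_U KC).
  erewrite Vidr by ty. reflexivity.
Qed.

Section Pent.
Variables (A B C E G : D) (f : Hor A (T0 B)) (g : Hor B (T0 C)) (h : Hor C (T0 E)) (k : Hor E (T0 G)).

(** Universal square of the leftmost bracketing of four arrows; its right side is the threefold
    multiplication. Both sides of the pentagon are compared by pasting below it. *)
Definition U4 : S D := V (H (U1 f g h) (V (mus (fh T k)) (mus k))) (R (cK (cK f g) h) k).

Lemma U4_iso : Iso U4 (f ** fh T g ** fh T (fh T h) ** fh T (fh T (fh T k))) (cK (cK (cK f g) h) k)
  (vid A) (muv (T0 (T0 G)) // muv (T0 G) // muv G).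
Proof. unfold U4, U1. iso. Qed.

(** The middle part common to both computations: the compositor of [T] on three arrows, then [T] of
    the universal square on [g], [h], [k]. *)
Definition Z4 : S D :=
  V (H (cmpS T g (fh T h)) (sv (fh T (fh T (fh T k)))))
    (V (cmpS T (g ** fh T h) (fh T (fh T k))) (Fs T (U2 g h k))).

Lemma pent_l :
  V U4 (V (V (hK (vid G) (ass f g h) (sv k)) (ass f (cK g h) k)) (hK (vid G) (sv f) (ass g h k)))
  = V (H (sv f) Z4) (R f (cK g (cK h k))).
Proof.
  transitivity (V (H (U2 f g h) (V (mus (fh T k)) (mus k)))
     (V (R (cK f (cK g h)) k) (V (ass f (cK g h) k) (hK (vid G) (sv f) (ass g h k))))).
  { unfold U4. rewrite !V_assoc, <- (V_assoc (R _ _)). erewrite R_nat by ty. rewrite V_assoc, <- (V_assoc (H _ _)).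
    erewrite VH by ty. rewrite (ass_U KC), F_sv. erewrite (Vidr (s := V (mus _) _)) by ty. reflexivity. }
  transitivity (V (H (sv f) (H (V (cmpS T g (fh T h)) (Fs T (R g h))) (Fs T (mus k))))
     (V (U1 f (cK g h) k) (V (ass f (cK g h) k) (hK (vid G) (sv f) (ass g h k))))).
  (* Associativity of the multiplication at [k] trades [mus (fh T k)] for [Fs T (mus k)], which
     joins [Fs T (R g h)]; the remaining [mus k] completes [U1 f (cK g h) k]. *)
  { rewrite <- (mu_as KM). unfold U1, U2. rewrite <- !V_assoc, <- H_assoc. f_equal. f_equal. f_equal.
    erewrite VH by ty. reflexivity. }
  rewrite <- (V_assoc (U1 _ _ _)), (ass_U KC). unfold U2 at 1. rewrite (V_assoc (H _ _)).
  erewrite R_nat by ty. rewrite <- !V_assoc. erewrite !VH by ty. erewrite !Vidl by ty.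
  f_equal. f_equal. unfold Z4. rewrite <- (ass_U KC). unfold U1. erewrite !F_V by ty.
  rewrite <- !V_assoc. f_equal. f_equal.
  rewrite (V_assoc (H _ _)). erewrite <- F_cmpS by ty. rewrite <- V_assoc. f_equal.
  erewrite VH by ty. erewrite Vidl by ty. reflexivity.
Qed.

Lemma pent_r :
  V U4 (V (ass (cK f g) h k) (ass f g (cK h k))) = V (H (sv f) Z4) (R f (cK g (cK h k))).
Proof.
  transitivity (V (H (H (R f g) (mus h)) (mus (fh T k))) (V (U1 (cK f g) h k) (V (ass (cK f g) h k) (ass f g (cK h k))))).
  { unfold U4, U1. rewrite <- !V_assoc. f_equal. f_equal. f_equal. erewrite VH by ty. reflexivity. }
  rewrite <- (V_assoc (U1 _ _ _)), (ass_U KC). unfold U2 at 1.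
  rewrite !V_assoc, H_assoc, <- (V_assoc (H _ _)). erewrite VH by ty. erewrite Vidr by ty.
  (* The multiplication respects composition and is natural, so it moves past [R h k], where it
     completes [U1 f g (cK h k)]. *)
  rewrite <- (V_assoc (H (mus h) _)), <- mus_hc, !V_assoc. erewrite <- mus_nat by ty.
  rewrite <- !V_assoc.
  transitivity (V (V (H (sv (f ** fh T g)) (V (V (cmpS T (fh T h) (fh T (fh T k))) (Fs T (cmpS T h (fh T k)))) (Fs T (Fs T (R h k)))))
    (U1 f g (cK h k))) (ass f g (cK h k))).
  { unfold U1. rewrite <- !V_assoc. f_equal. f_equal. erewrite VH by ty. erewrite Vidl by ty. reflexivity. }
  rewrite V_assoc, (ass_U KC). unfold U2. rewrite <- V_assoc, <- H_sv, H_assoc. erewrite VH by ty. erewrite Vidl by ty.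
  f_equal. f_equal. unfold Z4, U2. erewrite !F_V by ty. rewrite <- !V_assoc. f_equal.
  rewrite F_assocS.
  rewrite (V_assoc (H _ (cmpS T _ _))). erewrite <- F_cmpS by ty. rewrite F_sv, <- V_assoc.
  erewrite VH by ty. erewrite Vidl by ty. erewrite F_V by ty. rewrite <- V_assoc. reflexivity.
Qed.

Lemma K_pentagon :
  V (V (hK (vid G) (ass f g h) (sv k)) (ass f (cK g h) k)) (hK (vid G) (sv f) (ass g h k))
  = V (ass (cK f g) h k) (ass f g (cK h k)).
Proof.
  eapply (Iso_cancel (r := U4)).
  - rewrite pent_l, pent_r. reflexivity.
  - apply U4_iso.
  - eapply V_is; [eapply V_is|..].
    + eapply hK_is; ty.
    + ty.
    + reflexivity.
    + eapply hK_is; ty.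
    + reflexivity.
  - reflexivity.
  - tinf.
  - reflexivity.
Qed.
End Pent.

Lemma K_triangle (A B C : D) (f : Hor A (T0 B)) (g : Hor B (T0 C)) :
  V (ass f (nh B) g) (hK (vid C) (sv f) (lu g)) = hK (vid C) (ru f) (sv g).
Proof.
  assert (i : Iso (V (H (RU f) (sv (fh T g))) (R (cK f (nh B)) g)) (f ** fh T g) (cK (cK f (nh B)) g)
    (vid A) (muv C)).
  { unfold RU. iso. }
  eapply (Iso_cancel (f := f ** fh T g)); [|exact i|..].
  - transitivity (R f g).
    + transitivity (V (H (H (sv f) (V (untS T B) (Fs T (n B)))) (Fs T (etas g)))
       (V (U1 f (nh B) g) (V (ass f (nh B) g) (hK (vid C) (sv f) (lu g))))).
      (* The identity on [fh T g] is expanded by the right unit law as [T] of the unit over the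
         multiplication, so that the universal square on [f], [nh B], [g] appears. *)
      { rewrite <- (mu_rs KM). unfold RU, U1. rewrite <- !V_assoc. f_equal. f_equal. f_equal.
        erewrite VH by ty. reflexivity. }
      rewrite <- (V_assoc (U1 _ _ _)), (ass_U KC). unfold U2. rewrite V_assoc. erewrite R_nat by ty.
      rewrite <- !V_assoc, H_assoc. erewrite !VH by ty. erewrite !Vidl by ty.
      transitivity (V (H (sv f) (sv (fh T g))) (R f g)); [|rewrite H_sv; ty; erewrite Vidl by ty; reflexivity].
      f_equal. f_equal.
      transitivity (V (H (untS T B) (sv (fh T g))) (V (H (Fs T (n B)) (Fs T (etas g)))
        (V (cmpS T (nh B) (fh T g)) (V (Fs T (R (nh B) g)) (Fs T (lu g)))))).
      { rewrite !V_assoc, <- (V_assoc (H (untS _ _) _)). f_equal. erewrite VH by ty. erewrite Vidl by ty. reflexivity. }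
      rewrite <- (V_assoc (H (Fs T _) _)). erewrite F_cmpS by ty. rewrite V_assoc, <- V_assoc.
      rewrite F_lunitS. erewrite <- !F_V by ty. rewrite <- V_assoc. fold (LU g). rewrite (lu_U KC), F_sv.
      erewrite Vidl by ty. reflexivity.
    + rewrite V_assoc. erewrite R_nat by ty. rewrite <- V_assoc, F_sv. erewrite VH by ty. rewrite (ru_U KC).
      erewrite Vidl by ty. rewrite H_sv. erewrite Vidl by ty. reflexivity.
  - eapply V_is; [ty| eapply hK_is; ty | reflexivity].
  - reflexivity.
  - eapply hK_is; ty.
  - reflexivity.
Qed.

End KlS.

(** * Companion lifts of vertical transformations *)

Section Lift.
Context {C D : DblData} {hD : is_double D} {F0 G0 : C -> D} {F : FunData F0} {G : FunData G0}.
Variables (al : VTData F G) (i : Invertible al) (c : Liftable al).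

(** [Invertible] speaks of squares; the inverse of a 1v-component is the left side of the inverse
    square at an identity 1h-cell. *)
Lemma tv_inverse (A : C) : exists w : Ver (G0 A) (F0 A), tv al A // w = vid _ /\ w // tv al A = vid _.
Proof. destruct (i (hid A)) as [l r s e1 e2 e3 e4 e5 e6]. exists l. split; assumption. Qed.

Lemma Iso_iota (A : C) : Iso (pk (ciota (c A))) (hid _) (ch (c A)) (vid _) (tv al A).
Proof.
  destruct (tv_inverse A) as [w [e1 e2]].
  exact (proj1 (CompS_Iso (CompS_of (companion_ok (c A))) e1 e2)).
Qed.

Lemma pk_lift_hsq (A A' : C) (u : Ver A A') :
  pk (hsq (lift i c) u) = H (V (sh (fv F u)) (pk (ciota (c A')))) (V (pk (ceps (c A))) (sh (fv G u))).
Proof.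
  cbn [hsq lift]. rewrite pk_gtop, pk_gbot, pk_castv, <- H_pk, pk_castv, pk_lunit', pk_runit, <- !V_pk.
  fold (sh (fv F u)) (sh (fv G u)).
  assert (e : fv F u // tv al A' = tv al A // fv G u) by apply tv_nat.
  erewrite Vidl, Vidr by ty. reflexivity.
Qed.

Lemma lift_hsq_is (A A' : C) (u : Ver A A') :
  Is (pk (hsq (lift i c) u)) (ch (c A)) (ch (c A')) (fv F u) (fv G u).
Proof. apply pk_is. Qed.

Lemma lift_hsq_nat (A A' : C) (u : Ver A A') :
  V (pk (ciota (c A))) (pk (hsq (lift i c) u)) = V (sh (fv F u)) (pk (ciota (c A'))).
Proof.
  rewrite pk_lift_hsq.
  assert (e : fv F u // tv al A' = tv al A // fv G u) by apply tv_nat.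
  transitivity (V (H (sh (vid (F0 A))) (pk (ciota (c A))))
    (H (V (sh (fv F u)) (pk (ciota (c A')))) (V (pk (ceps (c A))) (sh (fv G u))))).
  { erewrite Hidl by ty. reflexivity. }
  erewrite VH by ty. rewrite <- (V_assoc (pk (ciota (c A)))), (comp_vS (companion_ok (c A))), V_sh, sh_vid.
  erewrite Vidl, Hidr by ty. reflexivity.
Qed.

Lemma pk_lift_fwd (A B : C) (f : Hor A B) :
  pk (fwd (hcell (lift i c) f)) = H (pk (ciota (c A))) (H (pk (tsq al f)) (pk (ceps (c B)))).
Proof.
  cbn [hcell lift fwd]. rewrite pk_gtop, pk_gbot, <- !H_pk, pk_lunit'. cbn [gh fwd gid]. rewrite <- H_pk, pk_runit.
  fold (sv (ch (c A))). rewrite H_sv.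
  erewrite Vidl, Vidr by ty. reflexivity.
Qed.

(** In the pasted rows the unit at [B] meets its counit and both disappear by the vertical companion
    identity. This equation and [lift_bwd_spec] determine the structure cell, since the squares it
    relates are invertible. *)
Lemma lift_fwd_spec (A B : C) (f : Hor A B) :
  V (H (sv (fh F f)) (pk (ciota (c B)))) (pk (fwd (hcell (lift i c) f)))
  = H (pk (ciota (c A))) (pk (tsq al f)).
Proof.
  rewrite pk_lift_fwd.
  transitivity (V (H (sv (hid (F0 A))) (H (sv (fh F f)) (pk (ciota (c B)))))
    (H (pk (ciota (c A))) (H (pk (tsq al f)) (pk (ceps (c B)))))).
  { f_equal. rewrite <- sh_vid. symmetry. eapply Hidl; ty. }
  erewrite !VH by ty. erewrite !Vidl by ty. rewrite (comp_vS (companion_ok (c B))). erewrite Hidr by ty. reflexivity.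
Qed.

Lemma lift_bwd_spec (A B : C) (f : Hor A B) :
  V (H (pk (ciota (c A))) (pk (tsq al f))) (pk (bwd (hcell (lift i c) f)))
  = H (sv (fh F f)) (pk (ciota (c B))).
Proof.
  cbn [hcell lift bwd]. destruct (i f) as [l r s e1 e2 e3 e4 e5 e6].
  cbn [inv_l inv_r inv_sq inv_l1 inv_r2].
  rewrite pk_gtop, pk_gbot, <- !H_pk, !pk_castv, pk_lunit, <- !V_pk. cbn [gh bwd gid]. rewrite <- H_pk, pk_runit'.
  fold (sv (ch (c A))). rewrite H_sv. fold (sh l) (sh r).
  rewrite <- V_assoc. erewrite (Vidr (s := H _ (pk (tsq _ _)))) by ty.
  erewrite (Vidr (s := H _ (H _ _))) by ty.
  transitivity (V (H (pk (ciota (c A))) (H (pk (tsq al f)) (sh (tv al B))))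
    (H (V (pk (ceps (c A))) (sh l)) (H (pk s) (V (sh r) (pk (ciota (c B))))))).
  { erewrite (Hidr (s := pk (tsq _ _))) by ty. reflexivity. }
  erewrite !VH by ty. rewrite <- !V_assoc, (comp_vS (companion_ok (c A))), !V_sh.
  apply pk_sqeq in e5. rewrite <- V_pk in e5. rewrite e5, e1, e3, !sh_vid. fold (sv (fh F f)).
  erewrite Vidl by ty. rewrite <- sh_vid. erewrite Hidl by ty. reflexivity.
Qed.

Lemma lift_cell_iso (A B : C) (f : Hor A B) : is_giso (hcell (lift i c) f).
Proof.
  assert (k1 : Iso (H (sv (fh F f)) (pk (ciota (c B)))) (fh F f) (fh F f ** ch (c B)) (vid _) (tv al B)).
  { eapply Iso_conv; [eapply Iso_H; [apply Iso_sv|apply Iso_iota|reflexivity]|..]; ty. }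
  assert (k2 : Iso (H (pk (ciota (c A))) (pk (tsq al f))) (fh F f) (ch (c A) ** fh G f) (vid _) (tv al B)).
  { eapply Iso_conv; [eapply Iso_H; [apply Iso_iota|apply Iso_VInv, i|reflexivity]|..]; ty. }
  split; apply pk_sqeq; rewrite <- V_pk.
  - eapply (Iso_cancel (h' := fh F f ** ch (c B))); [|exact k1|tinf|reflexivity|apply pk_is|reflexivity].
    rewrite <- V_assoc, lift_fwd_spec, lift_bwd_spec. symmetry. eapply Vidr; ty.
  - eapply (Iso_cancel (h' := ch (c A) ** fh G f)); [|exact k2|tinf|reflexivity|apply pk_is|reflexivity].
    rewrite <- V_assoc, lift_bwd_spec, lift_fwd_spec. symmetry. eapply Vidr; ty.
Qed.
End Lift.

Section GisoComb.
Context {D : DblData} {P : is_pseudodouble D}.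

Lemma giso_S (A B : D) (f g : Hor A B) (p : Giso f g) :
  is_giso p <-> V (pk (fwd p)) (pk (bwd p)) = sv f /\ V (pk (bwd p)) (pk (fwd p)) = sv g.
Proof. rewrite !V_pk. unfold is_giso, sv. rewrite !pk_sqeq. reflexivity. Qed.

Lemma giso_id (A B : D) (f : Hor A B) : is_giso (gid f).
Proof. apply giso_S. split; apply (Vidl (sv_is f) eq_refl). Qed.

Lemma giso_inv (A B : D) (f g : Hor A B) (p : Giso f g) : is_giso p -> is_giso (ginv p).
Proof. intros [h1 h2]. split; assumption. Qed.

Lemma pk_gcomp (A B : D) (f g h : Hor A B) (p : Giso f g) (q : Giso g h) :
  pk (fwd (gcomp p q)) = V (pk (fwd p)) (pk (fwd q)).
Proof. apply pk_gtop. Qed.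

Lemma pk_gcomp' (A B : D) (f g h : Hor A B) (p : Giso f g) (q : Giso g h) :
  pk (bwd (gcomp p q)) = V (pk (bwd q)) (pk (bwd p)).
Proof. apply pk_gtop. Qed.

Lemma giso_comp (A B : D) (f g h : Hor A B) (p : Giso f g) (q : Giso g h) :
  is_giso p -> is_giso q -> is_giso (gcomp p q).
Proof.
  rewrite !giso_S, pk_gcomp, pk_gcomp'. intros [h1 h2] [k1 k2]. split.
  - rewrite V_assoc, <- (V_assoc (pk (fwd q))), k1. erewrite Vidl by tinf. exact h1.
  - rewrite V_assoc, <- (V_assoc (pk (bwd p))), h2. erewrite Vidl by tinf. exact k2.
Qed.

Lemma giso_gh (A B C : D) (f g : Hor A B) (h k : Hor B C) (p : Giso f g) (q : Giso h k) :
  is_giso p -> is_giso q -> is_giso (gh p q).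
Proof.
  rewrite !giso_S. cbn [gh fwd bwd]. rewrite <- !H_pk. intros [h1 h2] [k1 k2].
  erewrite !VH by tinf. rewrite h1, h2, k1, k2, !H_sv. split; reflexivity.
Qed.
End GisoComb.

Section Slide.
Context {D : DblData} {hD : is_double D}.

(** Both sides equal [H x y]: squares that meet along an identity 1v-cell may be pasted in either
    order. *)
Lemma slide_r (x y : S D) (A B A' : D) (p : Hor A B) (q : Hor A' B) (u : Ver A A')
    (C : D) (c' : Hor B C) (w' : Ver B C) :
  Is x p q u (vid B) -> Is y (hid B) c' (vid B) w' ->
  V (H (sv p) y) (H x (sv c')) = V x (H (sv q) y).
Proof.
  intros hx hy. erewrite VH by ty. erewrite Vidl, Vidr by ty.
  erewrite <- (Hidr (s := x)) at 2 by ty. erewrite VH by ty. rewrite sh_vid.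
  erewrite Vidl, Vidr by ty. reflexivity.
Qed.

Context {E : DblData} {hE : is_double E} {F0 : D -> E} {F : FunData F0} {hF : is_psfun F}.
(** The unitor accounts for the identity 1h-cell on top of [y]; naturality of the compositor brings
    it next to the unitor, and the right unit law of [F] absorbs both. *)
Lemma F_unit_r (y : S D) (A B C : D) (p : Hor A B) (c : Hor B C) (w : Ver B C) :
  Is y (hid B) c (vid B) w ->
  V (H (sv (fh F p)) (V (untS F B) (Fs F y))) (cmpS F p c) = Fs F (H (sv p) y).
Proof.
  intros hy.
  transitivity (V (V (H (sv (fh F p)) (untS F B)) (H (Fs F (sv p)) (Fs F y))) (cmpS F p c)).
  { rewrite F_sv. erewrite VH by ty. erewrite Vidl by ty. reflexivity. }
  rewrite V_assoc. erewrite F_cmpS by ty. rewrite <- V_assoc, F_runitS. erewrite Vidl by ty. reflexivity.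
Qed.
End Slide.

(** * Constraint cells of the lifted monad *)

Section KlOf.
Context {D : DblData} {hD : is_double D}.
Variables (T : VMonad D) (imu : Invertible (mu T)) (cmu : Liftable (mu T))
  (ieta : Invertible (eta T)) (ceta : Liftable (eta T)).

Instance hT : is_psfun T := T_ok T.

Definition muv (A : D) : Ver (T0 T (T0 T A)) (T0 T A) := tv (mu T) A.
Definition etav (A : D) : Ver A (T0 T A) := tv (eta T) A.
Definition mus (A B : D) (f : Hor A B) : S D := pk (tsq (mu T) f).
Definition etas (A B : D) (f : Hor A B) : S D := pk (tsq (eta T) f).
Definition mi (A : D) : S D := pk (ciota (cmu A)).
Definition ni (A : D) : S D := pk (ciota (ceta A)).
Definition mh (A : D) : Hor (T0 T (T0 T A)) (T0 T A) := ch (cmu A).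
Definition nh (A : D) : Hor A (T0 T A) := ch (ceta A).
Definition hm (A B : D) (u : Ver A B) : S D := pk (hsq (lift imu cmu) u).
Definition hn (A B : D) (u : Ver A B) : S D := pk (hsq (lift ieta ceta) u).

Lemma KM : KMonad T muv etav mus etas mi ni mh nh hm hn.
Proof.
  split.
  - apply Nat_of_VT.
  - apply Nat_of_VT.
  - apply mu_assoc_v.
  - intros. unfold mus. rewrite Fs_pk, !V_pk. apply pk_sqeq, mu_assoc_sq.
  - apply mu_lunit_v.
  - intros. unfold mus, etas. rewrite !V_pk. apply pk_sqeq, mu_lunit_sq.
  - apply mu_runit_v.
  - intros. unfold mus, etas. rewrite Fs_pk, !V_pk. apply pk_sqeq, mu_runit_sq.
  - intro. apply (Iso_iota imu cmu).
  - intro. apply (Iso_iota ieta ceta).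
  - intros. apply (lift_hsq_is imu cmu).
  - intros. apply (lift_hsq_is ieta ceta).
  - intros. apply (lift_hsq_nat imu cmu).
  - intros. apply (lift_hsq_nat ieta ceta).
  - intros. exact (Iso_VInv (imu f)).
  - intros. exact (Iso_VInv (ieta f)).
Qed.

Lemma mus_is1 (A B : D) (f : Hor A B) : Is (mus f) (fh T (fh T f)) (fh T f) (muv A) (muv B).
Proof. apply (n_is (mu_N KM)). Qed.
Lemma etas_is1 (A B : D) (f : Hor A B) : Is (etas f) f (fh T f) (etav A) (etav B).
Proof. apply (n_is (eta_N KM)). Qed.
Lemma mi_is A : Is (mi A) (hid _) (mh A) (vid _) (muv A).
Proof. apply Iso_is, (m_iso KM). Qed.
Lemma ni_is A : Is (ni A) (hid _) (nh A) (vid _) (etav A).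
Proof. apply Iso_is, (n_iso KM). Qed.
Hint Resolve mus_is1 etas_is1 mi_is ni_is : isdb.

Let M := lift_monad imu cmu ieta ceta.

Definition ass (A B C E : D) (f : Hor A (T0 T B)) (g : Hor B (T0 T C)) (h : Hor C (T0 T E)) : S D :=
  pk (fwd (kl_assoc (S := M) f g h)).
Definition lu (A B : D) (f : Hor A (T0 T B)) : S D := pk (fwd (kl_lunit (S := M) f)).
Definition ru (A B : D) (f : Hor A (T0 T B)) : S D := pk (fwd (kl_runit (S := M) f)).

Lemma cell_inv (C E : D) (h : Hor C (T0 T E)) :
  V (H (mi C) (mus h)) (pk (bwd (hcell (lift imu cmu) h))) = H (sv (fh T (fh T h))) (mi (T0 T E)).
Proof. exact (lift_bwd_spec imu cmu h). Qed.

(** The associativity modification compares two composite companions and carries the unit of one to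
    the unit of the other. [bwd] appears because [kl_assoc] uses the inverse, which is by conversion
    the forward comparison for the reversed equation. *)
Lemma hm_assoc_spec (E : D) :
  V (V (mi (T0 T E)) (H (sv (mh (T0 T E))) (mi E))) (pk (bwd (hm_assoc M E)))
  = V (V (untS T (T0 T (T0 T E))) (Fs T (mi E))) (H (sv (fh T (mh E))) (mi E)).
Proof.
  pose proof (companion_comp (companion_ok (cmu (T0 T E))) (companion_ok (cmu E))) as k1.
  pose proof (companion_comp (companion_map (F := T) (companion_ok (cmu E))) (companion_ok (cmu E))) as k2.
  pose proof (proj1 (compare_spec (eq_sym (mu_assoc_v T E)) k1 k2)) as e.
  rewrite !pk_comp_iota, pk_map_iota in e.
  exact e.
Qed.

Lemma ass_eq (A B C E : D) (f : Hor A (T0 T B)) (g : Hor B (T0 T C)) (h : Hor C (T0 T E)) :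
  ass f g h = H (sv f) (V (H (sv (fh T g))
    (V (H (pk (bwd (hcell (lift imu cmu) h))) (sv (mh E)))
       (V (H (sv (fh T (fh T h))) (pk (bwd (hm_assoc M E))))
          (H (cmpS T (fh T h) (mh E)) (sv (mh E))))))
    (H (cmpS T g (fh T h ** mh E)) (sv (mh E)))).
Proof.
  unfold ass, kl_assoc. repeat (rewrite pk_gcomp || (cbn [gh gid ginv fwd bwd]; rewrite <- H_pk)).
  rewrite !pk_assoc, !pk_assoc'.
  erewrite !Vidl by ty. reflexivity.
Qed.

(** Below the universal square, the inverse multiplication cell at [h] replaces [mi] beside [mus h]
    by [mi] after [T T h]; the inverse associativity cell replaces the unit for two successive
    multiplications by the one for [T] of the multiplication followed by the multiplication; the
    compositors then collect everything under [T] into the image of [R g h]. *)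
Lemma K_assoc (A B C E : D) (f : Hor A (T0 T B)) (g : Hor B (T0 T C)) (h : Hor C (T0 T E)) :
  V (U1 T mus mi mh f g h) (ass f g h) = U2 T mi mh f g h.
Proof.
  transitivity (V (H (sv f) (H (sv (fh T g)) (V (H (mi C) (mus h)) (H (sv (mh C)) (H (sv (fh T h)) (mi E))))))
    (ass f g h)).
  { f_equal. unfold U1, R, cK. rewrite <- !H_sv, !H_assoc.
    erewrite !VH by ty. erewrite !Vidl by ty. reflexivity. }
  assert (i1 : Is (pk (bwd (hcell (lift imu cmu) h))) (mh C ** fh T h) (fh T (fh T h) ** mh (T0 T E)) (vid _) (vid _))
    by apply pk_is.
  assert (i2 : Is (pk (bwd (hm_assoc M E))) (mh (T0 T E) ** mh E) (fh T (mh E) ** mh E) (vid _) (vid _))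
    by apply pk_is.
  assert (i3 : Is (mus h) (fh T (fh T h)) (fh T h) (muv C) (muv (T0 T E))) by apply mus_is1.
  pose proof (R_is KM g h) as i4.
  assert (e2 : U2 T mi mh f g h = H (sv f) (V (V (cmpS T g (fh T h)) (Fs T (R T mi g h))) (H (sv (fh T (cK T mh g h))) (mi E)))).
  { unfold U2. unfold R at 2. erewrite VH by ty. erewrite Vidl by ty. reflexivity. }
  rewrite e2, ass_eq.
  erewrite VH by ty. erewrite Vidl by ty. f_equal.
  rewrite <- V_assoc. erewrite VH by ty. erewrite Vidl by ty.
  pose proof (mi_is (T0 T E)) as i5. pose proof (mi_is E) as i6.
  transitivity (V (H (sv (fh T g)) (V (H (sv (fh T (fh T h))) (V (untS T (T0 T (T0 T E))) (Fs T (mi E))))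
      (V (cmpS T (fh T h) (mh E)) (H (sv (fh T (fh T h ** mh E))) (mi E)))))
     (H (cmpS T g (fh T h ** mh E)) (sv (mh E)))).
  { f_equal. f_equal.
    rewrite <- V_assoc, (V_assoc (H (mi C) _)).
    rewrite <- (H_assoc (sv (mh C))), H_sv. erewrite slide_r by ty.
    rewrite <- (V_assoc (H (mi C) _)), cell_inv, <- H_sv, H_assoc, (V_assoc (H _ (mi (T0 T E)))).
    rewrite <- (V_assoc (H _ (H _ _))). erewrite (VH (b := H _ _)) by ty. rewrite <- V_assoc.
    erewrite (VH (b := mi (T0 T E))) by ty. rewrite <- (V_assoc (mi _)), hm_assoc_spec. erewrite !(Vidl (s := sv _)) by ty.
    erewrite <- (slide_r (x := cmpS T (fh T h) (mh E))) by ty. rewrite <- V_assoc. f_equal.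
    rewrite <- H_sv, H_assoc. erewrite VH by ty. erewrite Vidl by ty. reflexivity. }
  transitivity (V (V (H (sv (fh T g)) (Fs T (H (sv (fh T h)) (mi E)))) (H (sv (fh T g ** fh T (fh T h ** mh E))) (mi E)))
    (H (cmpS T g (fh T h ** mh E)) (sv (mh E)))).
  { f_equal. rewrite <- H_sv, H_assoc. erewrite (VH (a := sv _) (c := sv _)) by ty. erewrite (Vidl (s := sv _)) by ty.
    rewrite <- V_assoc. erewrite F_unit_r by ty. reflexivity. }
  rewrite V_assoc. erewrite slide_r by ty. rewrite <- V_assoc. f_equal.
  unfold R. rewrite <- F_sv. erewrite F_cmpS by ty. rewrite hc_idr. reflexivity.
Qed.

Lemma hm_lunit_spec (B : D) :
  V (V (ni (T0 T B)) (H (sv (nh (T0 T B))) (mi B))) (pk (fwd (hm_lunit M B))) = sv (hid (T0 T B)).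
Proof.
  pose proof (companion_comp (companion_ok (ceta (T0 T B))) (companion_ok (cmu B))) as k1.
  pose proof (proj1 (compare_spec (mu_lunit_v T B) k1 (companion_id (T0 T B)))) as e.
  rewrite pk_comp_iota in e. rewrite <- sh_vid. exact e.
Qed.

Lemma hm_runit_spec (B : D) :
  V (V (V (untS T B) (Fs T (ni B))) (H (sv (fh T (nh B))) (mi B))) (pk (fwd (hm_runit M B))) = sv (hid (T0 T B)).
Proof.
  pose proof (companion_comp (companion_map (F := T) (companion_ok (ceta B))) (companion_ok (cmu B))) as k1.
  pose proof (proj1 (compare_spec (mu_runit_v T B) k1 (companion_id (T0 T B)))) as e.
  rewrite pk_comp_iota, pk_map_iota in e. rewrite <- sh_vid. exact e.
Qed.

Lemma cell_inv_eta (A B : D) (f : Hor A (T0 T B)) :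
  V (H (ni A) (etas f)) (pk (bwd (hcell (lift ieta ceta) f))) = H (sv f) (ni (T0 T B)).
Proof. exact (lift_bwd_spec ieta ceta f). Qed.

Lemma K_lunit (A B : D) (f : Hor A (T0 T B)) : V (LU T etas mi ni nh f) (lu f) = sv f.
Proof.
  assert (e : lu f = V (H (pk (bwd (hcell (lift ieta ceta) f))) (sv (mh B))) (H (sv f) (pk (fwd (hm_lunit M B))))).
  { unfold lu, kl_lunit. repeat (rewrite pk_gcomp || (cbn [gh gid ginv fwd bwd]; rewrite <- H_pk)).
    rewrite !pk_assoc, !pk_assoc', pk_runit. erewrite !Vidl by ty. erewrite Vidr by ty. reflexivity. }
  assert (i1 : Is (pk (bwd (hcell (lift ieta ceta) f))) (nh A ** fh T f) (f ** nh (T0 T B)) (vid A) (vid (T0 T (T0 T B))))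
    by apply pk_is.
  assert (i2 : Is (pk (fwd (hm_lunit M B))) (nh (T0 T B) ** mh B) (hid (T0 T B)) (vid (T0 T B)) (vid (T0 T B)))
    by apply pk_is.
  rewrite e. unfold LU, R. rewrite <- H_assoc, H_sv, <- (V_assoc _ (H (pk (bwd _)) _)), (V_assoc _ _ (H (pk (bwd _)) _)).
  erewrite slide_r by ty. rewrite <- V_assoc, cell_inv_eta, <- H_sv, H_assoc.
  erewrite (VH (a := sv f)) by ty. erewrite VH by ty. rewrite hm_lunit_spec.
  erewrite !Vidl by ty. rewrite H_sv, hc_idr. reflexivity.
Qed.

Lemma K_runit (A B : D) (f : Hor A (T0 T B)) : V (RU T mi ni nh f) (ru f) = sv f.
Proof.
  assert (e : ru f = H (sv f) (pk (fwd (hm_runit M B)))).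
  { unfold ru, kl_runit. repeat (rewrite pk_gcomp || (cbn [gh gid ginv fwd bwd]; rewrite <- H_pk)).
    rewrite pk_runit. erewrite Vidr by ty. reflexivity. }
  assert (i2 : Is (pk (fwd (hm_runit M B))) (fh T (nh B) ** mh B) (hid (T0 T B)) (vid (T0 T B)) (vid (T0 T B)))
    by apply pk_is.
  rewrite e. unfold RU, R. erewrite !VH by ty. rewrite hm_runit_spec.
  erewrite !Vidl by ty. rewrite H_sv, hc_idr. reflexivity.
Qed.

Lemma KC : KConstr T mus etas mi ni mh nh ass lu ru.
Proof.
  split; intros.
  - apply pk_is.
  - apply K_assoc.
  - apply pk_is.
  - apply K_lunit.
  - apply pk_is.
  - apply K_runit.
Qed.

End KlOf.

(** * Transfer of the laws to Kleisli squares *)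

Section KlBridge.
Context {D : DblData} {hD : is_double D}.
Variables (T : VMonad D) (imu : Invertible (mu T)) (cmu : Liftable (mu T))
  (ieta : Invertible (eta T)) (ceta : Liftable (eta T)).

Existing Instance hT.

Notation M := (lift_monad imu cmu ieta ceta).
Notation K := (Kl M).
Notation hmK := (hm imu cmu).
Notation hnK := (hn ieta ceta).

Definition pkK (A B A' B' : K) (f : Hor A B) (g : Hor A' B') (u : Ver A A') (v : Ver B B')
  (a : Sq f g u v) : S D := @pk D A (T0 T B) A' (T0 T B') f g u (fv T v) a.

Lemma pkK_eq (A B A' B' : K) (f : Hor A B) (g : Hor A' B') (u : Ver A A') (v : Ver B B')
  (a b : Sq f g u v) : pkK a = pkK b -> a = b.
Proof. intro e. exact (pk_eq e). Qed.

(** [T] need not be injective on 1v-cells, so the underlying square in [D] does not determine the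
    right side of a Kleisli square; the boundary equations are therefore separate premises. *)
Lemma pkK_sqeq (A B A' B' : K) (f h : Hor A B) (g k : Hor A' B') (u w : Ver A A') (v x : Ver B B')
  (a : Sq f g u v) (b : Sq h k w x) : f = h -> g = k -> u = w -> v = x -> pkK a = pkK b -> a ~= b.
Proof. intros e1 e2 e3 e4 e. subst. rewrite (pkK_eq e). apply sqeq_refl. Qed.

Lemma pkK_is (A B A' B' : K) (f : Hor A B) (g : Hor A' B') (u : Ver A A') (v : Ver B B')
  (a : Sq f g u v) : @Is D (pkK a) A (T0 T B) A' (T0 T B') f g u (fv T v).
Proof. apply pk_is. Qed.

Lemma pkK_vs (A B A' B' A'' B'' : K) (f : Hor A B) (g : Hor A' B') (h : Hor A'' B'')
    (u : Ver A A') (v : Ver B B') (u' : Ver A' A'') (v' : Ver B' B'')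
    (a : Sq f g u v) (b : Sq g h u' v') : pkK (a /// b) = V (pkK a) (pkK b).
Proof.
  unfold pkK; cbn [Kl raw KlRaw vs]. rewrite V_pk. apply (pk_castv (D := D)).
Qed.

Lemma pkK_hs (A B C A' B' C' : K) (f : Hor A B) (f' : Hor B C)
    (g : Hor A' B') (g' : Hor B' C') (u : Ver A A') (v : Ver B B') (w : Ver C C')
    (a : Sq f g u v) (b : Sq f' g' v w) :
  pkK (a *** b) = hK T hmK w (pkK a) (pkK b).
Proof.
  unfold pkK, hK, hm. rewrite Fs_pk, !H_pk. reflexivity.
Qed.

Lemma pkK_sqv (A B : K) (f : Hor A B) : pkK (sqv f) = @sv D A (T0 T B) f.
Proof. apply (pk_castv (D := D)). Qed.

Lemma pkK_sqh (A B : K) (u : Ver A B) : pkK (sqh u) = hnK u.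
Proof. reflexivity. Qed.

Lemma pkK_castv (A B A' B' : K) (f : Hor A B) (g : Hor A' B')
    (u u' : Ver A A') (v v' : Ver B B') (eu : u = u') (ev : v = v')
    (a : Sq f g u v) : pkK (castv eu ev a) = pkK a.
Proof. destruct eu, ev; reflexivity. Qed.

Lemma pkK_giso (A B : D) (f g : Hor A (T0 T B)) (p : Giso f g) : pkK (fwd (kl_giso (S := M) p)) = pk (fwd p).
Proof. apply (pk_castv (D := D)). Qed.
Lemma pkK_giso' (A B : D) (f g : Hor A (T0 T B)) (p : Giso f g) : pkK (bwd (kl_giso (S := M) p)) = pk (bwd p).
Proof. apply (pk_castv (D := D)). Qed.

Lemma pkK_assoc (A B C E : K) (f : Hor A B) (g : Hor B C) (h : Hor C E) :
  pkK (fwd (assoc f g h)) = ass imu cmu ieta ceta (A := A) (B := B) (C := C) (E := E) f g h.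
Proof. apply pkK_giso. Qed.
Lemma pkK_lunit (A B : K) (f : Hor A B) : pkK (fwd (lunit f)) = lu imu cmu ieta ceta (A := A) (B := B) f.
Proof. apply pkK_giso. Qed.
Lemma pkK_runit (A B : K) (f : Hor A B) : pkK (fwd (runit f)) = ru imu cmu ieta ceta (A := A) (B := B) f.
Proof. apply pkK_giso. Qed.

Lemma kl_giso_ok (A B : D) (f g : Hor A (T0 T B)) (p : Giso f g) : is_giso p -> is_giso (kl_giso (S := M) p).
Proof.
  rewrite giso_S. intros [e1 e2].
  split; (apply pkK_sqeq; [reflexivity|reflexivity|apply vc_idl|apply vc_idl|]);
   rewrite pkK_vs, pkK_sqv, pkK_giso, pkK_giso'; assumption.
Qed.

Lemma hm_assoc_ok A : is_giso (hm_assoc M A).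
Proof.
  exact (proj2 (compare_spec (mu_assoc_v T A)
    (companion_comp (companion_map (F := T) (companion_ok (cmu A))) (companion_ok (cmu A)))
    (companion_comp (companion_ok (cmu (T0 T A))) (companion_ok (cmu A))))).
Qed.
Lemma hm_lunit_ok A : is_giso (hm_lunit M A).
Proof.
  exact (proj2 (compare_spec (mu_lunit_v T A)
    (companion_comp (companion_ok (ceta (T0 T A))) (companion_ok (cmu A))) (companion_id (T0 T A)))).
Qed.
Lemma hm_runit_ok A : is_giso (hm_runit M A).
Proof.
  exact (proj2 (compare_spec (mu_runit_v T A)
    (companion_comp (companion_map (F := T) (companion_ok (ceta A))) (companion_ok (cmu A)))
    (companion_id (T0 T A)))).
Qed.

Theorem Kl_pseudodouble : is_pseudodouble K.
Proof.
  pose proof (double_pseudo hD) as P.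
  pose proof (KM imu cmu ieta ceta) as km. pose proof (KC imu cmu ieta ceta) as kc.
  split.
  - intros. apply pkK_sqeq; [reflexivity|reflexivity|apply vc_idl|apply vc_idl|].
    rewrite pkK_vs, pkK_sqv. exact (Vidl (pkK_is a) eq_refl).
  - intros. apply pkK_sqeq; [reflexivity|reflexivity|apply vc_idr|apply vc_idr|].
    rewrite pkK_vs, pkK_sqv. exact (Vidr (pkK_is a) eq_refl).
  - intros. apply pkK_sqeq; [reflexivity|reflexivity|apply vc_assoc|apply vc_assoc|].
    rewrite !pkK_vs. apply V_assoc.
  - intros. apply pkK_eq. rewrite pkK_vs, !pkK_hs, !pkK_vs.
    exact (hK_vs km (pkK_is a) (pkK_is b) (pkK_is c) (pkK_is d)).
  - intros. apply pkK_eq. rewrite pkK_hs, !pkK_sqv. exact (hK_sv km (f : @Hor D A (T0 T B)) (g : @Hor D B (T0 T C))).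
  - intros. apply pkK_eq. rewrite pkK_vs, !pkK_sqh. exact (hn_vc km (u : @Ver D A B) (v : @Ver D B C)).
  - intros. apply pkK_eq. rewrite pkK_sqh, pkK_sqv. exact (hn_id km (A : D)).
  - intros. apply kl_giso_ok. unfold kl_assoc.
    repeat first [apply giso_comp | apply giso_gh | apply giso_id | apply (assoc_iso P) | apply giso_inv
      | apply hm_assoc_ok | apply (lift_cell_iso imu cmu) | apply (cmp_iso (T_ok T))].
  - intros. apply kl_giso_ok. unfold kl_lunit.
    repeat first [apply giso_comp | apply giso_gh | apply giso_id | apply (assoc_iso P) | apply giso_inv
      | apply hm_lunit_ok | apply (lift_cell_iso ieta ceta) | apply (runit_iso P)].
  - intros. apply kl_giso_ok. unfold kl_runit.
    repeat first [apply giso_comp | apply giso_gh | apply giso_id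
      | apply hm_runit_ok | apply (runit_iso P)].
  - intros. apply pkK_sqeq; [reflexivity|reflexivity| rewrite vc_idl, vc_idr; reflexivity | rewrite vc_idl, vc_idr; reflexivity|].
    rewrite !pkK_vs, !pkK_hs.
    rewrite ?pkK_assoc, ?pkK_lunit, ?pkK_runit.
    exact (ass_nat km kc (pkK_is a) (pkK_is b) (pkK_is c)).
  - intros. apply pkK_sqeq; [reflexivity|reflexivity| rewrite vc_idl, vc_idr; reflexivity | rewrite vc_idl, vc_idr; reflexivity|].
    rewrite !pkK_vs, !pkK_hs, ?pkK_assoc, ?pkK_lunit, ?pkK_runit, pkK_sqh.
    exact (lu_nat km kc (pkK_is a)).
  - intros. apply pkK_sqeq; [reflexivity|reflexivity| rewrite vc_idl, vc_idr; reflexivity | rewrite vc_idl, vc_idr; reflexivity|].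
    rewrite !pkK_vs, !pkK_hs, ?pkK_assoc, ?pkK_lunit, ?pkK_runit, pkK_sqh.
    exact (ru_nat km kc (pkK_is a)).
  - intros. apply pkK_sqeq; [reflexivity|reflexivity| rewrite !vc_idl; reflexivity | rewrite !vc_idl; reflexivity|].
    rewrite !pkK_vs, !pkK_hs, !pkK_sqv, ?pkK_assoc, ?pkK_lunit, ?pkK_runit.
    exact (K_pentagon km kc (f : @Hor D A (T0 T B)) (g : @Hor D B (T0 T C)) (h : @Hor D C (T0 T E)) (k : @Hor D E (T0 T F))).
  - intros. apply pkK_sqeq; [reflexivity|reflexivity| rewrite !vc_idl; reflexivity | rewrite !vc_idl; reflexivity|].
    rewrite !pkK_vs, !pkK_hs, !pkK_sqv, ?pkK_assoc, ?pkK_lunit, ?pkK_runit.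
    exact (K_triangle km kc (f : @Hor D A (T0 T B)) (g : @Hor D B (T0 T C))).
Qed.
End KlBridge.

(** * Strict transformations with pseudodouble target *)

Section Hv.
Context {D : DblData} {P : is_pseudodouble D}.

Lemma lunit_natS (A B A' B' : D) (f : Hor A B) (g : Hor A' B') (u : Ver A A') (v : Ver B B') (a : Sq f g u v) :
  V (pk (bwd (lunit f))) (V (H (sh u) (pk a)) (pk (fwd (lunit g)))) = pk a.
Proof.
  destruct (proj1 (giso_S _) (lunit_iso P f)) as [_ e2].
  pose proof (lunit_nat P a) as e. apply pk_sqeq in e. rewrite <- !V_pk, <- H_pk in e.
  fold (sh u) in e. rewrite e, <- V_assoc, e2. eapply Vidl; [apply pk_is|reflexivity].
Qed.

Lemma runit_natS (A B A' B' : D) (f : Hor A B) (g : Hor A' B') (u : Ver A A') (v : Ver B B') (a : Sq f g u v) :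
  V (pk (bwd (runit f))) (V (H (pk a) (sh v)) (pk (fwd (runit g)))) = pk a.
Proof.
  destruct (proj1 (giso_S _) (runit_iso P f)) as [_ e2].
  pose proof (runit_nat P a) as e. apply pk_sqeq in e. rewrite <- !V_pk, <- H_pk in e.
  fold (sh v) in e. rewrite e, <- V_assoc, e2. eapply Vidl; [apply pk_is|reflexivity].
Qed.

Lemma pk_hv (A B : D) (u v w : Ver A B) (a : Sq (hid A) (hid B) u v) (b : Sq (hid A) (hid B) v w) (x : Ver A B) :
  pk a = sh x -> pk b = sh x -> pk (hv a b) = sh x.
Proof.
  intros e1 e2. unfold hv. rewrite pk_gtop, pk_gbot, <- H_pk, e1, e2. apply lunit_natS.
Qed.
End Hv.

Section StrictVPs.
Context {C D : DblData} {PD : is_pseudodouble D}.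

(** Expressed through [pk], since the two vertical boundaries of an identity cell agree only
    propositionally. The property is closed under composition and whiskering, which reduces [vps_eq]
    to 1v-components and squares. *)
Definition Strict (F0 G0 : C -> D) (F : PreFun F0) (G : PreFun G0) (al : VPs F G) : Prop :=
  forall (A A' : C) (u : Ver A A'), fv F u // pv al A' = pv al A // fv G u /\
    pk (pcell al u) = sh (fv F u // pv al A').

Lemma Strict_vt (F0 G0 : C -> D) (F : PreFun F0) (G : PreFun G0) (al : VTData F G) : Strict al.
Proof. intros A A' u. split; [apply tv_nat|]. cbn [pcell vps_of_vt]. apply pk_castv. Qed.

Lemma Strict_comp (F0 G0 H0 : C -> D) (F : PreFun F0) (G : PreFun G0) (K : PreFun H0)
  (al : VPs F G) (be : VPs G K) : Strict al -> Strict be -> Strict (al //> be).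
Proof.
  intros h1 h2 A A' u. destruct (h1 A A' u) as [e1 k1], (h2 A A' u) as [e2 k2]. cbn [pv vps_comp pcell].
  assert (e : pv al A // (fv G u // pv be A') = fv F u // (pv al A' // pv be A')).
  { rewrite <- !vc_assoc, e1. reflexivity. }
  split; [rewrite <- e, e2, vc_assoc; reflexivity|].
  apply pk_hv; rewrite pk_castv, <- V_pk.
  - rewrite k1. change (pk (sqh (pv be A'))) with (sh (pv be A')). rewrite V_sh, vc_assoc. reflexivity.
  - rewrite k2. change (pk (sqh (pv al A))) with (sh (pv al A)). rewrite V_sh, e. reflexivity.
Qed.

Lemma vps_eq_strict (F0 G0 : C -> D) (F : PreFun F0) (G : PreFun G0) (al be : VPs F G) :
  Strict al -> Strict be -> (forall A, pv al A = pv be A) ->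
  (forall (A B : C) (f : Hor A B), psq al f ~= psq be f) -> vps_eq al be.
Proof.
  intros h1 h2 e1 e2. split; [assumption|assumption|].
  intros A A' u. apply pk_sqeq. rewrite (proj2 (h1 A A' u)), (proj2 (h2 A A' u)), e1. reflexivity.
Qed.

(** The target is a pseudodouble category because the result is applied to Kleisli categories;
    identity cells are absorbed there by naturality of the unitors, [lunit_natS] and
    [runit_natS]. *)
Lemma Strict_is_vps (F0 G0 : C -> D) (F : FunData F0) (G : FunData G0) (al : VTData F G) :
  (forall (A B A' B' : C) (f : Hor A B) (g : Hor A' B') (u : Ver A A') (v : Ver B B') (a : Sq f g u v),
    fsq F a /// tsq al g ~= tsq al f /// fsq G a) ->
  (forall (A B E : C) (f : Hor A B) (g : Hor B E),
    fwd (cmp F f g) /// tsq al (f ** g) ~= (tsq al f *** tsq al g) /// fwd (cmp G f g)) ->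
  (forall A : C, fwd (unt F A) /// tsq al (hid A) ~= sqh (tv al A) /// fwd (unt G A)) ->
  is_vps (F := F) (G := G) al.
Proof.
  intros hn hc hu. split; [ |exact hc|exact hu| | |].
  - intros A A' u. exists (castv (tv_nat al u) eq_refl (sqh (fv F u // tv al A'))).
    pose proof (tv_nat al u) as e. split; apply pk_eq; (erewrite pk_hv; [|apply pk_castv|apply pk_castv]).
    + reflexivity.
    + cbn [pv vps_of_vt]. rewrite <- e. reflexivity.
  - intros A. apply pk_sqeq. rewrite (proj2 (Strict_vt al (vid A))). rewrite fv_id, vc_idl. reflexivity.
  - intros A B E u v. apply pk_sqeq. rewrite (proj2 (Strict_vt al (u // v))). symmetry. apply pk_hv.
    + rewrite pk_castv, <- V_pk, (proj2 (Strict_vt al v)). cbn [pv vps_of_vt].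
      change (pk (sqh (fv F u))) with (sh (fv F u)). rewrite V_sh, fv_vc, vc_assoc. reflexivity.
    + rewrite <- V_pk, (proj2 (Strict_vt al u)). cbn [pv vps_of_vt].
      change (pk (sqh (fv G v))) with (sh (fv G v)). rewrite V_sh, fv_vc, !vc_assoc, tv_nat. reflexivity.
  - intros A B A' B' f g u v a. apply pk_eq. rewrite !pk_gtop, !pk_gbot, <- !H_pk.
    rewrite (proj2 (Strict_vt al u)), (proj2 (Strict_vt al v)). cbn [pv vps_of_vt psq].
    rewrite runit_natS.
    transitivity (pk (tsq al f /// fsq G a)); [apply pk_sqeq, hn|].
    symmetry. rewrite (tv_nat al u). exact (lunit_natS (tsq al f /// fsq G a)).
Qed.
End StrictVPs.

(** The globular cell of a left whiskering is conjugated by the unitor of [K]; on an identity cell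
    the conjugation cancels by naturality of the unitor. *)
Lemma Strict_whl (C D E : DblData) {PE : is_pseudodouble E} (K0 : D -> E) (F0 G0 : C -> D)
    (K : FunData K0) {hK : is_psfun K} (F : PreFun F0) (G : PreFun G0) (al : VPs F G) :
  Strict al -> Strict (whl K al).
Proof.
  intros h A A' u. destruct (h A A' u) as [e k]. cbn [whl pv pcell fv compP].
  split; [rewrite <- !fv_vc, e; reflexivity|].
  rewrite pk_gtop, pk_gbot, pk_castv, <- Fs_pk, k, <- V_assoc, <- F_unt, V_assoc.
  rewrite (proj1 (proj1 (giso_S _) (unt_iso hK (G0 A')))). rewrite <- fv_vc.
  eapply Vidr; [apply sh_is|reflexivity].
Qed.

Lemma Strict_whr (B C D : DblData) (K0 : B -> C) (F0 G0 : C -> D)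
    (F : PreFun F0) (G : PreFun G0) (al : VPs F G) (K : PreFun K0) : Strict al -> Strict (whr al K).
Proof. intros h A A' u. apply (h (K0 A) (K0 A') (fv K u)). Qed.

(** * Functors between Kleisli double categories *)

Section KlFun.
Context {D : DblData} {hD : is_double D}.
Variables (T : VMonad D) (imu : Invertible (mu T)) (cmu : Liftable (mu T))
  (ieta : Invertible (eta T)) (ceta : Liftable (eta T)).

Existing Instance hT.
Notation K := (Kl (lift_monad imu cmu ieta ceta)).
Notation T0 := (T0 T).
Notation muv := (muv T).
Notation etav := (etav T).
Notation mus := (mus T).
Notation etas := (etas T).
Notation mi := (mi cmu).
Notation ni := (ni ceta).
Notation mh := (mh cmu).
Notation nh := (nh ceta).
Notation hmK := (hm imu cmu).
Notation hnK := (hn ieta ceta).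
Notation R := (R T mi).
Notation cK := (cK T mh).
Notation hK := (hK T hmK).
Let km := KM imu cmu ieta ceta.
Let kc := KC imu cmu ieta ceta.

Lemma RK_is (A B C : D) (f : Hor A (T0 B)) (g : Hor B (T0 C)) :
  Is (R f g) (f ** fh T g) (cK f g) (vid A) (muv C).
Proof. exact (R_is km f g). Qed.
Lemma RK_iso (A B C : D) (f : Hor A (T0 B)) (g : Hor B (T0 C)) :
  Iso (R f g) (f ** fh T g) (cK f g) (vid A) (muv C).
Proof. exact (R_iso km f g). Qed.
Lemma ni_iso A : Iso (ni A) (hid _) (nh A) (vid _) (etav A).
Proof. exact (n_iso km A). Qed.
Lemma musK_iso (A B : D) (f : Hor A B) : Iso (mus f) (fh T (fh T f)) (fh T f) (muv A) (muv B).
Proof. exact (mus_iso km f). Qed.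
Lemma hnK_is (A B : D) (u : Ver A B) : Is (hnK u) (nh A) (nh B) u (fv T u).
Proof. exact (hn_is km u). Qed.
Hint Resolve RK_is mi_is ni_is mus_is1 etas_is1  hnK_is : isdb.
Hint Resolve RK_iso  ni_iso musK_iso  : isodb.

(** The part of a distributive law that does not mention the monad structure. It suffices for
    composing and comparing extended functors, so [DLaw] has to be verified only for the functors
    that are actually lifted. *)
Record TNat (F0 : D -> D) (F : FunData F0) (tv : forall A : D, Ver (F0 (T0 A)) (T0 (F0 A)))
    (ts : forall (A B : D) (f : Hor A B), S D) : Prop := {
  t_iso : forall (A B : D) (f : Hor A B), Iso (ts _ _ f) (fh F (fh T f)) (fh T (fh F f)) (tv A) (tv B);
  t_v : forall (A A' : D) (u : Ver A A'), fv F (fv T u) // tv A' = tv A // fv T (fv F u);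
  t_nat : forall (a : S D) (A B A' B' : D) (f : Hor A B) (g : Hor A' B') (u : Ver A A') (v : Ver B B'),
    Is a f g u v -> V (Fs F (Fs T a)) (ts _ _ g) = V (ts _ _ f) (Fs T (Fs F a))
}.

Lemma t_is (F0 : D -> D) (F : FunData F0) tv ts : TNat F tv ts ->
  forall (A B : D) (f : Hor A B), Is (ts _ _ f) (fh F (fh T f)) (fh T (fh F f)) (tv A) (tv B).
Proof. intros h A B f. apply Iso_is, (t_iso h). Qed.

(* The compositor of an extended functor is the unique square carrying [RW1] to
   [RW2]. *)
Definition RW1 (F0 : D -> D) (ts : forall (A B : D) (f : Hor A B), S D)
    (h : forall (A B : D) (f : Hor A (T0 B)), Hor (F0 A) (T0 (F0 B)))
    (U : forall (A B : D) (f : Hor A (T0 B)), S D)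
    (A B C : D) (f : Hor A (T0 B)) (g : Hor B (T0 C)) : S D :=
  V (H (U _ _ f) (V (ts _ _ g) (Fs T (U _ _ g)))) (R (h _ _ f) (h _ _ g)).
Definition RW2 (F0 : D -> D) (F : FunData F0) (U : forall (A B : D) (f : Hor A (T0 B)), S D)
    (A B C : D) (f : Hor A (T0 B)) (g : Hor B (T0 C)) : S D :=
  V (cmpS F f (fh T g)) (V (Fs F (R f g)) (U _ _ (cK f g))).

Section RepDef.
Variables (F0 : D -> D) (HD : @FunData K K F0) (F : FunData F0)
  (tv : forall A : D, Ver (F0 (T0 A)) (T0 (F0 A))) (ts : forall (A B : D) (f : Hor A B), S D)
  (U : forall (A B : D) (f : Hor A (T0 B)), S D).

Definition RhF (A B : D) (f : Hor A (T0 B)) : Hor (F0 A) (T0 (F0 B)) := @fh K K F0 HD A B f.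

(* [HD] restricted along the free functor is [F], up to the invertible squares
   [U f] from [F f] to [HD f] whose right side is the distributive law. *)
Record Rep : Prop := {
  r_v : forall (A B : D) (u : Ver A B), @fv K K F0 HD A B u = fv F u;
  r_iso : forall (A B : D) (f : Hor A (T0 B)), Iso (U f) (fh F f) (RhF f) (vid _) (tv B);
  r_nat : forall (A B A' B' : K) (f : Hor A B) (g : Hor A' B') (u : Ver A A') (v : Ver B B') (a : Sq f g u v),
    V (U (f : @Hor D A (T0 B))) (pkK (fsq HD a)) = V (Fs F (pkK a)) (U (g : @Hor D A' (T0 B')));
  r_cmp : forall (A B C : K) (f : @Hor K A B) (g : @Hor K B C),
    V (RW1 ts RhF U f g) (pkK (fwd (cmp HD f g))) = RW2 F U f g;
  r_unt : forall (A : K),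
    V (ni (F0 A)) (pkK (fwd (unt HD A))) = V (untS F A) (V (Fs F (ni A)) (U (nh A)))
}.
End RepDef.

Record DLaw (F0 : D -> D) (F : FunData F0) (tv : forall A : D, Ver (F0 (T0 A)) (T0 (F0 A)))
    (ts : forall (A B : D) (f : Hor A B), S D) : Prop := {
  d_N : Nat (compF F T) (compF T F) tv ts;
  d_mu_v : forall A, fv F (muv A) // tv A = tv (T0 A) // fv T (tv A) // muv (F0 A);
  d_mu_s : forall (A B : D) (f : Hor A B),
    V (Fs F (mus f)) (ts _ _ f) = V (ts _ _ (fh T f)) (V (Fs T (ts _ _ f)) (mus (fh F f)));
  d_eta_v : forall A, etav (F0 A) = fv F (etav A) // tv A;
  d_eta_s : forall (A B : D) (f : Hor A B), etas (fh F f) = V (Fs F (etas f)) (ts _ _ f);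
  d_iso : forall (A B : D) (f : Hor A B), Iso (ts _ _ f) (fh F (fh T f)) (fh T (fh F f)) (tv A) (tv B)
}.

Lemma TNat_of (F0 : D -> D) (F : FunData F0) tv ts : DLaw F tv ts -> TNat F tv ts.
Proof.
  intros [n _ _ _ _ i]. split.
  - exact i.
  - apply (n_v n).
  - intros a A B A' B' f g u v [x ->].
    pose proof (n_nat n (pk_is x)) as e. rewrite !Fs_pk in *. exact e.
Qed.

Section PsFun.
Variables (F0 : D -> D) (HD : @FunData K K F0) (F : FunData F0)
  (tv : forall A : D, Ver (F0 (T0 A)) (T0 (F0 A))) (ts : forall (A B : D) (f : Hor A B), S D)
  (U : forall (A B : D) (f : Hor A (T0 B)), S D).
Context {psF : is_psfun F}.
Hypotheses (dl : DLaw F tv ts) (rep : Rep HD F tv ts U).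
Let tn := TNat_of dl.
Notation hF := (RhF HD).
Notation W1 := (RW1 ts hF U).
Notation W2 := (RW2 F U).

Lemma ts_is (A B : D) (f : Hor A B) : Is (ts f) (fh F (fh T f)) (fh T (fh F f)) (tv A) (tv B).
Proof. apply (t_is tn). Qed.
Lemma U_iso (A B : D) (f : Hor A (T0 B)) : Iso (U f) (fh F f) (hF f) (vid _) (tv B).
Proof. apply (r_iso rep). Qed.
Lemma U_is (A B : D) (f : Hor A (T0 B)) : Is (U f) (fh F f) (hF f) (vid _) (tv B).
Proof. apply Iso_is, U_iso. Qed.
Lemma ts_iso (A B : D) (f : Hor A B) : Iso (ts f) (fh F (fh T f)) (fh T (fh F f)) (tv A) (tv B).
Proof. apply (d_iso dl). Qed.
Lemma tmu_v A : fv F (muv A) // tv A = tv (T0 A) // (fv T (tv A) // muv (F0 A)).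
Proof. rewrite (d_mu_v dl). apply vc_assoc. Qed.
Lemma tt_v (A A' : D) (u : Ver A A') : fv F (fv T u) // tv A' = tv A // fv T (fv F u).
Proof. apply (t_v tn). Qed.
Hint Resolve ts_is U_is : isdb.
Hint Resolve ts_iso U_iso : isodb.
Hint Rewrite tmu_v tt_v   : ver.

Lemma W1_iso (A B C : D) (f : Hor A (T0 B)) (g : Hor B (T0 C)) :
  Iso (W1 f g) (fh F f ** fh F (fh T g)) (cK (hF f) (hF g)) (vid _) (tv (T0 C) // (fv T (tv C) // muv (F0 C))).
Proof. unfold RW1. iso. Qed.
Lemma W2_iso (A B C : D) (f : Hor A (T0 B)) (g : Hor B (T0 C)) :
  Iso (W2 f g) (fh F f ** fh F (fh T g)) (hF (cK f g)) (vid _) (tv (T0 C) // (fv T (tv C) // muv (F0 C))).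
Proof. unfold RW2. iso. Qed.
Lemma W1_is (A B C : D) (f : Hor A (T0 B)) (g : Hor B (T0 C)) :
  Is (W1 f g) (fh F f ** fh F (fh T g)) (cK (hF f) (hF g)) (vid _) (tv (T0 C) // (fv T (tv C) // muv (F0 C))).
Proof. apply Iso_is, W1_iso. Qed.
Hint Resolve W1_is  : isdb.

Lemma HD_is (A B A' B' : K) (f : Hor A B) (g : Hor A' B') (u : Ver A A') (v : Ver B B') (a : Sq f g u v) :
  @Is D (pkK (fsq HD a)) (F0 A) (T0 (F0 B)) (F0 A') (T0 (F0 B')) (hF f) (hF g) (fv F u) (fv T (fv F v)).
Proof.
  eapply Is_conv; [exact (pkK_is (fsq HD a))|reflexivity|reflexivity|exact (r_v rep u)|].
  exact (f_equal (fv T (A:=_) (B:=_)) (r_v rep v)).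
Qed.
Lemma pkKD_is (A B A' B' : K) (f : Hor A B) (g : Hor A' B') (u : Ver A A') (v : Ver B B')
  (a : Sq f g u v) : @Is D (pkK a) A (T0 B) A' (T0 B') f g u (fv T v).
Proof. apply pk_is. Qed.
Lemma cmpK_is (A B C : K) (f : @Hor K A B) (g : @Hor K B C) :
  @Is D (pkK (fwd (cmp HD f g))) (F0 A) (T0 (F0 C)) (F0 A) (T0 (F0 C)) (cK (hF f) (hF g)) (hF (cK f g)) (vid _) (vid _).
Proof. eapply Is_conv; [apply pkKD_is|..]; try reflexivity. exact (fv_id T (F0 C)). Qed.
Lemma untK_is (A : K) :
  @Is D (pkK (fwd (unt HD A))) (F0 A) (T0 (F0 A)) (F0 A) (T0 (F0 A)) (nh (F0 A)) (hF (nh A)) (vid _) (vid _).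
Proof. eapply Is_conv; [apply pkKD_is|..]; try reflexivity. exact (fv_id T (F0 A)). Qed.
Hint Resolve HD_is pkKD_is cmpK_is untK_is : isdb.

Lemma ts_nat (a : S D) (A B A' B' : D) (f : Hor A B) (g : Hor A' B') (u : Ver A A') (v : Ver B B') :
    Is a f g u v -> V (Fs F (Fs T a)) (ts g) = V (ts f) (Fs T (Fs F a)).
Proof. apply (t_nat tn). Qed.

Section WNat.
Variables (A B C A' B' C' : K) (f : @Hor K A B) (g : @Hor K B C) (f' : @Hor K A' B') (g' : @Hor K B' C')
  (u : @Ver K A A') (v : @Ver K B B') (w : @Ver K C C') (a : Sq f f' u v) (b : Sq g g' v w).

Lemma W1_nat :
  V (W1 f g) (hK (fv F w) (pkK (fsq HD a)) (pkK (fsq HD b)))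
  = V (H (Fs F (pkK a)) (Fs F (Fs T (pkK b)))) (W1 f' g').
Proof.
  unfold RW1. rewrite V_assoc.
  rewrite (R_nat km (HD_is a) (HD_is b) eq_refl eq_refl).
  rewrite <- !V_assoc. f_equal.
  erewrite !VH by ty. rewrite (r_nat rep). f_equal. rewrite V_assoc. erewrite <- F_V by ty. rewrite (r_nat rep).
  erewrite F_V by ty. rewrite <- V_assoc. erewrite <- ts_nat by ty. apply V_assoc.
Qed.

Lemma W2_nat :
  V (W2 f g) (pkK (fsq HD (a *** b))) = V (H (Fs F (pkK a)) (Fs F (Fs T (pkK b)))) (W2 f' g').
Proof.
  assert (e : V (U (cK f g)) (pkK (fsq HD (a *** b))) = V (Fs F (pkK (a *** b))) (U (cK f' g')))
    by exact (r_nat rep (a *** b)).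
  unfold RW2. rewrite !V_assoc, e, pkK_hs.
  assert (i : Is (hK w (pkK a) (pkK b)) (cK f g) (cK f' g') u (fv T w)) by (rewrite <- (pkK_hs a b); exact (pkKD_is (a *** b))).
  rewrite <- (V_assoc (Fs F (R f g))). erewrite <- F_V by ty.
  rewrite (R_nat km (pkKD_is a) (pkKD_is b) eq_refl eq_refl).
  erewrite F_V by ty. rewrite <- !V_assoc. erewrite <- F_cmpS by ty. reflexivity.
Qed.
End WNat.

(** The unit axiom of the law as a transformation, combined with its naturality at the companion
    unit [ni B]; it feeds the right unit law of the extended functor. *)
Lemma Rep_unit_r (B : D) :
  V (V (sh (tv B)) (untS T (F0 B))) (Fs T (V (untS F B) (Fs F (ni B))))
  = V (V (untS F (T0 B)) (Fs F (V (untS T B) (Fs T (ni B))))) (ts (nh B)).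
Proof.
  erewrite !F_V by ty. rewrite !V_assoc. erewrite ts_nat by ty.
  pose proof (n_hid (d_N dl) B) as e. unfold untS in e. cbn [unt compF] in e.
  rewrite !pk_gcomp in e. cbn [gmap fwd] in e. rewrite !pk_castv, <- !Fs_pk in e. fold (untS F B) (untS F (T0 B)) (untS T B) (untS T (F0 B)) in e.
  rewrite <- (V_assoc (untS T _)), <- (V_assoc (sh _)), <- e, !V_assoc. reflexivity.
Qed.

Lemma ts_hc (A B C : D) (g : Hor A B) (h : Hor B C) :
  V (H (ts g) (ts h)) (V (cmpS T (fh F g) (fh F h)) (Fs T (cmpS F g h)))
  = V (cmpS F (fh T g) (fh T h)) (V (Fs F (cmpS T g h)) (ts (g ** h))).
Proof.
  pose proof (n_hc (d_N dl) g h) as e. unfold cmpS in e. cbn [cmp compF] in e.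
  rewrite !pk_gcomp in e. cbn [gmap fwd] in e. rewrite !pk_castv, <- !Fs_pk, V_assoc in e. symmetry. exact e.
Qed.

(** The third factor of the universal square on a triple. [YY_mu] presents it with the
    multiplication first, under [F], and [YY_T] with the multiplication last; they agree by
    compatibility of the law with the multiplication and naturality of the latter. *)
Definition YY (A B : D) (h : Hor A (T0 B)) : S D :=
  V (ts (fh T h)) (V (Fs T (ts h)) (V (mus (fh F h)) (Fs T (U h)))).

Lemma YY_mu (A B : D) (h : Hor A (T0 B)) : V (Fs F (mus h)) (V (ts h) (Fs T (U h))) = YY h.
Proof. unfold YY. rewrite <- !V_assoc. f_equal. rewrite (d_mu_s dl). apply eq_sym, V_assoc. Qed.

Lemma YY_T (A B : D) (h : Hor A (T0 B)) :
  YY h = V (ts (fh T h)) (V (Fs T (V (ts h) (Fs T (U h)))) (mus (hF h))).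
Proof.
  unfold YY. erewrite F_V by ty. rewrite V_assoc. erewrite <- (mus_nat km (a := U h)) by ty. reflexivity.
Qed.

Lemma YY_iso (A B : D) (h : Hor A (T0 B)) :
  Iso (YY h) (fh F (fh T (fh T h))) (fh T (hF h)) (tv (T0 A) // (fv T (tv A) // muv (F0 A)))
    (tv (T0 (T0 B)) // (fv T (tv (T0 B)) // (muv (F0 (T0 B)) // fv T (tv B)))).
Proof. unfold YY. iso. Qed.
Lemma YY_is (A B : D) (h : Hor A (T0 B)) :
  Is (YY h) (fh F (fh T (fh T h))) (fh T (hF h)) (tv (T0 A) // (fv T (tv A) // muv (F0 A)))
    (tv (T0 (T0 B)) // (fv T (tv (T0 B)) // (muv (F0 (T0 B)) // fv T (tv B)))).
Proof. apply Iso_is, YY_iso. Qed.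
Hint Resolve YY_is : isdb.
Hint Resolve YY_iso W1_iso W2_iso : isodb.

Notation assK := (ass imu cmu ieta ceta).
Notation luK := (lu imu cmu ieta ceta).
Notation ruK := (ru imu cmu ieta ceta).
Definition cH (A B C : D) (f : Hor A (T0 B)) (g : Hor B (T0 C)) : S D :=
  pkK (fwd (@cmp K K F0 HD A B C f g)).
Definition uH (A : D) : S D := pkK (fwd (@unt K K F0 HD A)).
Definition aH (A B C E : D) (f : Hor A (T0 B)) (g : Hor B (T0 C)) (h : Hor C (T0 E)) : S D :=
  pkK (fsq HD (fwd (@assoc K A B C E f g h))).
Definition lH (A B : D) (f : Hor A (T0 B)) : S D := pkK (fsq HD (fwd (@lunit K A B f))).
Definition rH (A B : D) (f : Hor A (T0 B)) : S D := pkK (fsq HD (fwd (@runit K A B f))).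

Lemma cH_is (A B C : D) (f : Hor A (T0 B)) (g : Hor B (T0 C)) :
  Is (cH f g) (cK (hF f) (hF g)) (hF (cK f g)) (vid _) (vid _).
Proof. apply cmpK_is. Qed.
Lemma uH_is A : Is (uH A) (nh (F0 A)) (hF (nh A)) (vid _) (vid _).
Proof. apply untK_is. Qed.
Lemma ass_isK (A B C E : D) (f : Hor A (T0 B)) (g : Hor B (T0 C)) (h : Hor C (T0 E)) :
    Is (assK f g h) (cK (cK f g) h) (cK f (cK g h)) (vid A) (vid (T0 E)).
Proof. apply (ass_is kc). Qed.
Lemma lu_isK (A B : D) (f : Hor A (T0 B)) : Is (luK f) (cK (nh A) f) f (vid A) (vid (T0 B)).
Proof. apply (lu_is kc). Qed.
Lemma ru_isK (A B : D) (f : Hor A (T0 B)) : Is (ruK f) (cK f (nh B)) f (vid A) (vid (T0 B)).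
Proof. apply (ru_is kc). Qed.
Lemma HDg_is (A B : D) (f g : Hor A (T0 B)) (a : @Sq K A B A B f g (@vid K A) (@vid K B)) :
  Is (pkK (fsq HD a)) (hF f) (hF g) (vid _) (vid _).
Proof.
  eapply Is_conv; [apply HD_is|reflexivity|reflexivity|exact (fv_id F A)|].
  transitivity (fv T (vid (F0 B))); [exact (f_equal (fv T (A:=_) (B:=_)) (fv_id F B)) | apply fv_id].
Qed.
Hint Resolve cH_is uH_is ass_isK lu_isK ru_isK    : isdb.

Lemma aH_nat (A B C E : D) (f : Hor A (T0 B)) (g : Hor B (T0 C)) (h : Hor C (T0 E)) :
  V (U (cK (cK f g) h)) (aH f g h) = V (Fs F (assK f g h)) (U (cK f (cK g h))).
Proof. unfold aH. rewrite <- pkK_assoc. exact (r_nat rep (fwd (@assoc K A B C E f g h))). Qed.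
Lemma lH_nat (A B : D) (f : Hor A (T0 B)) :
  V (U (cK (nh A) f)) (lH f) = V (Fs F (luK f)) (U f).
Proof. unfold lH. rewrite <- pkK_lunit. exact (r_nat rep (fwd (@lunit K A B f))). Qed.
Lemma rH_nat (A B : D) (f : Hor A (T0 B)) :
  V (U (cK f (nh B))) (rH f) = V (Fs F (ruK f)) (U f).
Proof. unfold rH. rewrite <- pkK_runit. exact (r_nat rep (fwd (@runit K A B f))). Qed.
Lemma cH_eq (A B C : D) (f : Hor A (T0 B)) (g : Hor B (T0 C)) : V (W1 f g) (cH f g) = W2 f g.
Proof. exact (r_cmp rep (f : @Hor K A B) (g : @Hor K B C)). Qed.
Lemma uH_eq (A : D) : V (ni (F0 A)) (uH A) = V (untS F A) (V (Fs F (ni A)) (U (nh A))).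
Proof. exact (r_unt rep (A : K)). Qed.

Section HAssoc.
Variables (A B C E : D) (f : Hor A (T0 B)) (g : Hor B (T0 C)) (h : Hor C (T0 E)).

(** Universal square on the images of three arrows under [HD]; pasted below it, both sides of the
    associativity coherence evaluate to [Z3]. *)
Definition X3 : S D := V (H (W1 f g) (YY h)) (R (cK (hF f) (hF g)) (hF h)).

Lemma X3_iso : Iso X3 (fh F f ** fh F (fh T g) ** fh F (fh T (fh T h))) (cK (cK (hF f) (hF g)) (hF h))
  (vid _) (tv (T0 (T0 E)) // (fv T (tv (T0 E)) // (muv (F0 (T0 E)) // (fv T (tv E) // muv (F0 E))))).
Proof. unfold X3. iso. Qed.

Definition Z3 : S D :=
  V (H (cmpS F f (fh T g)) (sv (fh F (fh T (fh T h)))))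
    (V (cmpS F (f ** fh T g) (fh T (fh T h))) (V (Fs F (U2 T mi mh f g h)) (U (cK f (cK g h))))).

Lemma hassoc_l :
  V X3 (V (V (hK (vid (F0 E)) (cH f g) (sv (hF h))) (cH (cK f g) h)) (aH f g h)) = Z3.
Proof.
  transitivity (V (H (W2 f g) (YY h)) (V (R (hF (cK f g)) (hF h)) (V (cH (cK f g) h) (aH f g h)))).
  { unfold X3. rewrite !V_assoc, <- (V_assoc (R _ _)). erewrite (R_nat km) by ty.
    rewrite V_assoc, <- (V_assoc (H _ _)). erewrite VH by ty. rewrite cH_eq, F_sv.
    erewrite Vidr by ty. reflexivity. }
  transitivity (V (H (cmpS F f (fh T g)) (sv (fh F (fh T (fh T h)))))
    (V (H (Fs F (R f g)) (Fs F (mus h))) (V (W1 (cK f g) h) (V (cH (cK f g) h) (aH f g h))))).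
  { unfold RW1, RW2. rewrite <- !V_assoc. f_equal. f_equal. f_equal. rewrite V_assoc.
    erewrite !VH by ty. erewrite Vidl by ty. rewrite YY_mu, !V_assoc. reflexivity. }
  rewrite <- (V_assoc (W1 _ _)), cH_eq. unfold RW2. rewrite !V_assoc, aH_nat.
  rewrite <- (V_assoc (H (Fs F _) _)). erewrite F_cmpS by ty. unfold Z3. rewrite V_assoc. f_equal. f_equal.
  rewrite <- !V_assoc. f_equal. erewrite <- !F_V by ty.
  f_equal. exact (ass_U kc f g h).
Qed.

Lemma hassoc_r :
  V X3 (V (V (assK (hF f) (hF g) (hF h)) (hK (vid (F0 E)) (sv (hF f)) (cH g h))) (cH f (cK g h))) = Z3.
Proof.
  transitivity (V (H (H (U f) (V (ts g) (Fs T (U g)))) (V (ts (fh T h)) (Fs T (V (ts h) (Fs T (U h))))))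
    (V (U1 T mus mi mh (hF f) (hF g) (hF h)) (V (assK (hF f) (hF g) (hF h)) (V (hK (vid (F0 E)) (sv (hF f)) (cH g h)) (cH f (cK g h)))))).
  { unfold X3, U1, RW1. rewrite YY_T. rewrite <- !V_assoc. f_equal. f_equal. f_equal. f_equal.
    erewrite VH by ty. reflexivity. }
  rewrite <- (V_assoc (U1 _ _ _ _ _ _ _)), (ass_U kc). unfold U2 at 1.
  rewrite (V_assoc (H (sv (hF f)) _)), <- (V_assoc (R (hF f) _)). erewrite (R_nat km) by ty.
  transitivity (V (H (U f) (V (V (H (ts g) (ts (fh T h))) (V (cmpS T (fh F g) (fh F (fh T h))) (Fs T (cmpS F g (fh T h)))))
     (V (Fs T (Fs F (R g h))) (Fs T (U (cK g h)))))) (V (R (hF f) (hF (cK g h))) (cH f (cK g h)))).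
  { rewrite <- !V_assoc. f_equal. f_equal. rewrite H_assoc. erewrite !VH by ty. rewrite !V_assoc.
    erewrite (Vidl (s := sv (hF f))), (Vidr (s := U f)) by ty. f_equal.
    transitivity (V (H (ts g) (ts (fh T h))) (V (H (Fs T (U g)) (Fs T (V (ts h) (Fs T (U h))))) (V (cmpS T (hF g) (fh T (hF h)))
      (V (Fs T (R (hF g) (hF h))) (Fs T (cH g h)))))).
    { rewrite <- !V_assoc. f_equal. f_equal. f_equal. erewrite VH by ty. reflexivity. }
    rewrite <- (V_assoc (H (Fs T _) _)). erewrite F_cmpS by ty. rewrite V_assoc. f_equal. f_equal.
    erewrite <- !F_V by ty. f_equal. rewrite <- V_assoc. fold (W1 g h). exact (cH_eq g h). }
  (* The law respects composition, so [ts g] and [ts (fh T h)] merge into [ts (g ** fh T h)], which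
     naturality moves past [R g h]. *)
  rewrite ts_hc, !V_assoc, <- (V_assoc (ts (g ** fh T h))). erewrite <- ts_nat by ty.
  transitivity (V (H (sv (fh F f)) (V (cmpS F (fh T g) (fh T (fh T h))) (V (Fs F (cmpS T g (fh T h))) (Fs F (Fs T (R g h))))))
     (V (W1 f (cK g h)) (cH f (cK g h)))).
  { unfold RW1. rewrite <- !V_assoc. f_equal. f_equal. erewrite VH by ty. erewrite Vidl by ty. rewrite !V_assoc. reflexivity. }
  rewrite cH_eq. unfold RW2, Z3. rewrite <- V_assoc.
  rewrite <- (V_assoc (H (cmpS F f _) _)), F_assocS. unfold U2. erewrite (F_V (F := F) (t := R f _)) by ty.
  rewrite <- !V_assoc. f_equal. f_equal. rewrite (V_assoc (H _ (cmpS _ _ _))). erewrite <- F_cmpS by ty.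
  rewrite F_sv, <- V_assoc. f_equal. erewrite VH by ty. erewrite Vidl by ty. erewrite F_V by ty.
  rewrite V_assoc. reflexivity.
Qed.

Lemma rep_assoc :
  V (V (hK (vid (F0 E)) (cH f g) (sv (hF h))) (cH (cK f g) h)) (aH f g h)
  = V (V (assK (hF f) (hF g) (hF h)) (hK (vid (F0 E)) (sv (hF f)) (cH g h))) (cH f (cK g h)).
Proof.
  eapply (Iso_cancel (r := X3)); [|apply X3_iso| | | |].
  - rewrite hassoc_l, hassoc_r. reflexivity.
  - eapply V_is; [eapply V_is; [eapply (hK_is km); ty|ty|reflexivity]|ty|reflexivity].
  - reflexivity.
  - eapply V_is; [eapply V_is; [ty|eapply (hK_is km); ty|reflexivity]|ty|reflexivity].
  - reflexivity.
Qed.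
End HAssoc.

Lemma rep_lunit (A B : D) (f : Hor A (T0 B)) :
  V (V (hK (vid (F0 B)) (uH A) (sv (hF f))) (cH (nh A) f)) (lH f) = luK (hF f).
Proof.
  assert (k : Iso (V (U f) (LU T etas mi ni nh (hF f))) (fh F f) (cK (nh (F0 A)) (hF f)) (vid _) (tv B)).
  { eapply Iso_conv; [eapply Iso_V; [apply U_iso|apply (LU_iso km)|reflexivity]|..]; ty. }
  assert (i1 : Is (hK (vid (F0 B)) (uH A) (sv (hF f))) (cK (nh (F0 A)) (hF f)) (cK (hF (nh A)) (hF f)) (vid _) (fv T (vid _))).
  { eapply (hK_is km); ty. }
  eapply (Iso_cancel (r := V (U f) (LU T etas mi ni nh (hF f)))); [|exact k|ty|reflexivity|ty|reflexivity].
  rewrite !V_assoc, (lu_U kc). unfold LU. rewrite V_assoc, <- (V_assoc (R _ _)).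
  erewrite (R_nat km) by ty.
  transitivity (V (H (untS F A) (sv (fh F f))) (V (H (Fs F (ni A)) (Fs F (etas f)))
    (V (W1 (nh A) f) (V (cH (nh A) f) (lH f))))).
  - unfold RW1. rewrite <- !V_assoc. f_equal. f_equal. f_equal.
    transitivity (V (H (ni (F0 A)) (V (U f) (etas (hF f)))) (H (uH A) (Fs T (sv (hF f))))).
    { f_equal. erewrite <- (Hidl (s := U f)) at 1 by ty. erewrite VH by ty. rewrite sh_vid. erewrite Vidl by ty. reflexivity. }
    rewrite F_sv. erewrite VH by ty. rewrite uH_eq. erewrite Vidr by ty.
    (* The unit moves above [U f] by naturality and then splits as [F] of the unit followed by the
       law, which rebuilds [W1 (nh A) f]. *)
    erewrite !VH by ty. erewrite (Vidl (s := Fs F (etas f))) by ty. rewrite (etas_nat km (U_is f)), (d_eta_s dl).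
    rewrite !V_assoc. reflexivity.
  - rewrite <- (V_assoc (W1 _ _)), cH_eq. unfold RW2. rewrite !V_assoc, lH_nat.
    rewrite <- (V_assoc (H (Fs F _) _)). erewrite F_cmpS by ty. rewrite V_assoc, <- V_assoc, F_lunitS.
    rewrite <- (V_assoc (Fs F (R _ _))). erewrite <- F_V by ty.
    rewrite <- (V_assoc (Fs F (H _ _))). erewrite <- F_V by ty.
    assert (e : V (H (ni A) (etas f)) (V (R (nh A) f) (luK f)) = sv f).
    { rewrite <- V_assoc. exact (lu_U kc f). }
    rewrite e, F_sv. erewrite !Vidl, Vidr by ty. reflexivity.
Qed.

Lemma rep_runit (A B : D) (f : Hor A (T0 B)) :
  V (V (hK (vid (F0 B)) (sv (hF f)) (uH B)) (cH f (nh B))) (rH f) = ruK (hF f).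
Proof.
  assert (k : Iso (V (U f) (RU T mi ni nh (hF f))) (fh F f) (cK (hF f) (nh (F0 B))) (vid _) (tv B)).
  { eapply Iso_conv; [eapply Iso_V; [apply U_iso|apply (RU_iso km)|reflexivity]|..]; ty. }
  assert (i1 : Is (hK (vid (F0 B)) (sv (hF f)) (uH B)) (cK (hF f) (nh (F0 B))) (cK (hF f) (hF (nh B))) (vid _) (fv T (vid _))).
  { eapply (hK_is km); ty. }
  eapply (Iso_cancel (r := V (U f) (RU T mi ni nh (hF f)))); [|exact k|ty|reflexivity|ty|reflexivity].
  rewrite !V_assoc, (ru_U kc). unfold RU. rewrite V_assoc, <- (V_assoc (R _ _)).
  erewrite (R_nat km) by ty.
  transitivity (V (H (sv (fh F f)) (V (untS F (T0 B)) (Fs F (V (untS T B) (Fs T (ni B))))))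
    (V (W1 f (nh B)) (V (cH f (nh B)) (rH f)))).
  - unfold RW1. rewrite <- !V_assoc. f_equal. f_equal. f_equal.
    erewrite <- (Hidr (s := U f)) at 1 by ty. erewrite !VH by ty. erewrite !Vidr, Vidl by ty. f_equal.
    rewrite V_assoc, V_assoc. erewrite <- F_V by ty. rewrite uH_eq. erewrite (F_V (F := T) (s := untS F B)) by ty.
    transitivity (V (V (V (sh (tv B)) (untS T (F0 B))) (Fs T (V (untS F B) (Fs F (ni B))))) (Fs T (U (nh B)))).
    { erewrite !F_V by ty. rewrite !V_assoc. reflexivity. }
    rewrite Rep_unit_r, !V_assoc. reflexivity.
  - rewrite <- (V_assoc (W1 _ _)), cH_eq. unfold RW2. rewrite !V_assoc, rH_nat.
    rewrite <- (V_assoc (H _ _)). erewrite F_unit_r by ty.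
    rewrite <- (V_assoc (Fs F (R _ _))). erewrite <- F_V by ty.
    rewrite <- (V_assoc (Fs F (H _ _))). erewrite <- F_V by ty.
    assert (e : V (H (sv f) (V (untS T B) (Fs T (ni B)))) (V (R f (nh B)) (ruK f)) = sv f).
    { rewrite <- V_assoc. exact (ru_U kc f). }
    rewrite e, F_sv. erewrite !Vidl, Vidr by ty. reflexivity.
Qed.

(** [Rep] constrains only the forward compositors and unitors, so their invertibility is asked for
    separately; every other law follows by cancelling [U] or a universal square built from it, or
    [ni] for the unitors. *)
Lemma Rep_psfun :
  (forall (A B C : K) (f : @Hor K A B) (g : @Hor K B C), is_giso (cmp HD f g)) ->
  (forall A : K, is_giso (unt HD A)) -> is_psfun HD.
Proof.
  intros hc hu. split.
  - intros A B A' B' A'' B'' f g h u v u' v' a b.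
    apply pkK_sqeq; [reflexivity|reflexivity|exact (fv_vc HD u u')|exact (fv_vc HD v v')|].
    rewrite pkK_vs.
    eapply (Iso_cancel (r := U (f : @Hor D A (T0 B))));
      [|apply U_iso|exact (HD_is (a /// b))|reflexivity|eapply V_is; [exact (HD_is a)|exact (HD_is b)|reflexivity]|reflexivity].
    rewrite (r_nat rep (a /// b)), pkK_vs, <- V_assoc, (r_nat rep a), V_assoc, (r_nat rep b), <- V_assoc.
    f_equal. eapply F_V; [apply pkKD_is|apply pkKD_is|reflexivity].
  - intros A B f. apply pkK_sqeq; [reflexivity|reflexivity|exact (fv_id HD A)|exact (fv_id HD B)|].
    rewrite pkK_sqv.
    eapply (Iso_cancel (r := U (f : @Hor D A (T0 B))));
      [|apply U_iso|exact (HD_is (sqv f))|reflexivity|apply sv_is|reflexivity].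
    rewrite (r_nat rep (sqv f)), pkK_sqv, F_sv. erewrite Vidl by ty. symmetry. eapply Vidr; ty.
  - exact hc.
  - exact hu.
  - intros A B E A' B' E' f g f' g' u v w a b.
    apply pkK_sqeq; [reflexivity|reflexivity|rewrite vc_idl, vc_idr; reflexivity|rewrite vc_idl, vc_idr; reflexivity|].
    rewrite !pkK_vs, pkK_hs.
    transitivity (V (hK (fv F w) (pkK (fsq HD a)) (pkK (fsq HD b))) (cH f' g')).
    { f_equal. exact (f_equal (fun x => hK x (pkK (fsq HD a)) (pkK (fsq HD b))) (r_v rep w)). }
    eapply (Iso_cancel (r := W1 f g)); [|apply W1_iso| |reflexivity| |reflexivity].
    + rewrite <- V_assoc, (W1_nat a b), V_assoc, cH_eq, <- V_assoc.
      pose proof (W2_nat a b) as e. rewrite <- e. f_equal. symmetry. apply cH_eq.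
    + eapply V_is; [eapply (hK_is km); [apply HD_is|apply HD_is|reflexivity|reflexivity]|apply cH_is|reflexivity].
    + eapply V_is; [apply cH_is|apply (HD_is (a *** b))|reflexivity].
  - intros A A' u.
    apply pkK_sqeq; [reflexivity|reflexivity|rewrite vc_idl, vc_idr; reflexivity|rewrite vc_idl, vc_idr; reflexivity|].
    rewrite !pkK_vs, pkK_sqh.
    transitivity (V (hnK (fv F u)) (uH A')).
    { f_equal. exact (f_equal (fun x => hnK x) (r_v rep u)). }
    eapply (Iso_cancel (r := ni (F0 A))); [|apply ni_iso| |reflexivity| |reflexivity].
    + rewrite <- V_assoc, (hn_nat km), V_assoc, uH_eq.
      transitivity (V (V (untS F A) (V (Fs F (ni A)) (U (nh A)))) (pkK (fsq HD (sqh u))));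
        [|rewrite <- uH_eq; apply V_assoc].
      assert (e : V (U (nh A)) (pkK (fsq HD (sqh u))) = V (Fs F (hnK u)) (U (nh A')))
        by exact (r_nat rep (sqh u)).
      rewrite !V_assoc, e, <- (V_assoc (Fs F (ni A))). erewrite <- F_V by ty. rewrite (hn_nat km).
      erewrite F_V by ty. rewrite <- !V_assoc, F_untS. reflexivity.
    + eapply V_is; [apply hnK_is|apply uH_is|reflexivity].
    + eapply V_is; [apply uH_is|apply (HD_is (sqh u))|reflexivity].
  - intros A B E G f g h.
    apply pkK_sqeq; [reflexivity|reflexivity| | |].
    + rewrite (fv_id HD A : fv HD (vid A) = vid (F0 A)). rewrite !vc_idl. reflexivity.
    + rewrite (fv_id HD G : fv HD (vid G) = vid (F0 G)). rewrite !vc_idl. reflexivity.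
    + rewrite !pkK_vs, !pkK_hs, !pkK_sqv, pkK_assoc. exact (rep_assoc f g h).
  - intros A B f.
    apply pkK_sqeq; [reflexivity|reflexivity| | |].
    + rewrite (fv_id HD A : fv HD (vid A) = vid (F0 A)). rewrite !vc_idl. reflexivity.
    + rewrite (fv_id HD B : fv HD (vid B) = vid (F0 B)). rewrite !vc_idl. reflexivity.
    + rewrite !pkK_vs, !pkK_hs, !pkK_sqv, pkK_lunit. exact (rep_lunit f).
  - intros A B f.
    apply pkK_sqeq; [reflexivity|reflexivity| | |].
    + rewrite (fv_id HD A : fv HD (vid A) = vid (F0 A)). rewrite !vc_idl. reflexivity.
    + rewrite (fv_id HD B : fv HD (vid B) = vid (F0 B)). rewrite !vc_idl. reflexivity.
    + rewrite !pkK_vs, !pkK_hs, !pkK_sqv, pkK_runit. exact (rep_runit f).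
Qed.

End PsFun.

(** Objects, 1h-cells and 1v-cells of the Kleisli category are by conversion those of [D]; restating
    the hypotheses over [D] lets unification proceed. *)
Ltac toD := repeat match goal with
 | x : Ob (raw (Kl (lift_monad _ _ _ _))) |- _ => change (Ob (raw D)) in (type of x)
 | f : @Hor (raw (Kl (lift_monad _ _ _ _))) ?A ?B |- _ => change (@Hor (raw D) A (T0 B)) in (type of f)
 | f : @Ver (raw (Kl (lift_monad _ _ _ _))) ?A ?B |- _ => change (@Ver (raw D) A B) in (type of f)
end.

Lemma Fs_id (s : S D) (A B A' B' : D) (f : Hor A B) (g : Hor A' B') (u : Ver A A') (v : Ver B B') :
  Is s f g u v -> Fs (idF D) s = s.
Proof. intros [x ->]. rewrite Fs_pk. reflexivity. Qed.

Lemma TNat_id : TNat (idF D) (fun A => vid (T0 A)) (fun A B f => sv (fh T f)).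
Proof.
  split.
  - intros. apply Iso_sv.
  - intros. rewrite vc_idl, vc_idr. reflexivity.
  - intros a A B A' B' f g u v h. erewrite (Fs_id (s := Fs T a)) by ty. erewrite (Fs_id h).
    erewrite Vidl, Vidr by ty. reflexivity.
Qed.

(** The identity functor extends itself, with identity law and identity universal squares; it occurs
    as the target of both unitors. *)
Lemma Rep_id : Rep (F0 := fun A : D => A) (idF K) (idF D) (fun A => vid (T0 A)) (fun A B f => sv (fh T f)) (fun A B f => sv f).
Proof.
  split.
  - reflexivity.
  - intros. apply Iso_sv.
  - intros A B A' B' f g u v a. change (fsq (idF K) a) with a. erewrite (Fs_id (pkK_is a)).
    pose proof (pkK_is a) as h. erewrite Vidl, Vidr by ty. reflexivity.
  - intros A B C f g.
    change (pkK (fwd (cmp (idF K) f g))) with (pkK (@sqv K A C (f ** g))). rewrite pkK_sqv.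
    change (@sv D A (T0 C) (f ** g)) with (sv (cK f g)).
    unfold RW1, RW2. cbn [RhF fh pre idF idP]. rewrite F_sv.
    change (cmpS (idF D) (f : @Hor D A (T0 B)) (fh T g)) with (sv ((f : @Hor D A (T0 B)) ** fh T g)).
    erewrite (Fs_id (RK_is _ _)), (Vidl (s := sv (fh T g))) by ty. rewrite H_sv.
    pose proof (RK_is f g) as h.
    erewrite V_assoc. reflexivity.
  - intros A. change (pkK (fwd (unt (idF K) A))) with (pkK (@sqv K A A (hid A))). rewrite pkK_sqv.
    pose proof (Iso_is (ni_iso A)) as h. erewrite (Fs_id h).
    change (untS (idF D) A) with (@sv D A A (@hid D A)).
    erewrite (Vidl (s := V _ _)) by ty. reflexivity.
Qed.

(** * Composites of extended functors *)

Section RepComp.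
Variables (F0 G0 : D -> D) (HD : @FunData K K F0) (KD : @FunData K K G0) (F : FunData F0) (G : FunData G0)
  (tvF : forall A : D, Ver (F0 (T0 A)) (T0 (F0 A))) (tsF : forall (A B : D) (f : Hor A B), S D)
  (UF : forall (A B : D) (f : Hor A (T0 B)), S D)
  (tvG : forall A : D, Ver (G0 (T0 A)) (T0 (G0 A))) (tsG : forall (A B : D) (f : Hor A B), S D)
  (UG : forall (A B : D) (f : Hor A (T0 B)), S D).
Context {psF : is_psfun F} {psG : is_psfun G}.
Hypotheses (tnF : TNat F tvF tsF) (tnG : TNat G tvG tsG) (repF : Rep HD F tvF tsF UF) (repG : Rep KD G tvG tsG UG).

Definition tvC (A : D) : Ver (F0 (G0 (T0 A))) (T0 (F0 (G0 A))) := fv F (tvG A) // tvF (G0 A).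
Definition tsC (A B : D) (f : Hor A B) : S D := V (Fs F (tsG f)) (tsF (fh G f)).
Definition UC (A B : D) (f : Hor A (T0 B)) : S D := V (Fs F (UG f)) (UF (RhF KD f)).

Lemma Fs_comp (s : S D) (A B A' B' : D) (f : Hor A B) (g : Hor A' B') (u : Ver A A') (v : Ver B B') :
  Is s f g u v -> Fs (compF F G) s = Fs F (Fs G s).
Proof. intros [x ->]. rewrite !Fs_pk. reflexivity. Qed.

Lemma tsF_is (A B : D) (f : Hor A B) : Is (tsF f) (fh F (fh T f)) (fh T (fh F f)) (tvF A) (tvF B).
Proof. apply (t_is tnF). Qed.
Lemma tsG_is (A B : D) (f : Hor A B) : Is (tsG f) (fh G (fh T f)) (fh T (fh G f)) (tvG A) (tvG B).
Proof. apply (t_is tnG). Qed.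
Lemma UF_iso (A B : D) (f : Hor A (T0 B)) : Iso (UF f) (fh F f) (RhF HD f) (vid _) (tvF B).
Proof. apply (r_iso repF). Qed.
Lemma UF_is (A B : D) (f : Hor A (T0 B)) : Is (UF f) (fh F f) (RhF HD f) (vid _) (tvF B).
Proof. apply Iso_is, UF_iso. Qed.
Lemma UG_iso (A B : D) (f : Hor A (T0 B)) : Iso (UG f) (fh G f) (RhF KD f) (vid _) (tvG B).
Proof. apply (r_iso repG). Qed.
Lemma UG_is (A B : D) (f : Hor A (T0 B)) : Is (UG f) (fh G f) (RhF KD f) (vid _) (tvG B).
Proof. apply Iso_is, UG_iso. Qed.
Hint Resolve tsF_is tsG_is UF_is UG_is : isdb.
Lemma tsF_iso (A B : D) (f : Hor A B) : Iso (tsF f) (fh F (fh T f)) (fh T (fh F f)) (tvF A) (tvF B).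
Proof. apply (t_iso tnF). Qed.
Lemma tsG_iso (A B : D) (f : Hor A B) : Iso (tsG f) (fh G (fh T f)) (fh T (fh G f)) (tvG A) (tvG B).
Proof. apply (t_iso tnG). Qed.
Hint Resolve UF_iso UG_iso tsF_iso tsG_iso : isodb.
Lemma tF_v (A A' : D) (u : Ver A A') : fv F (fv T u) // tvF A' = tvF A // fv T (fv F u).
Proof. apply (t_v tnF). Qed.
Lemma tF_v' (A A' B : D) (u : Ver A A') (w : Ver _ B) : fv F (fv T u) // (tvF A' // w) = tvF A // (fv T (fv F u) // w).
Proof. rewrite <- !vc_assoc, tF_v. reflexivity. Qed.
Lemma tG_v (A A' : D) (u : Ver A A') : fv G (fv T u) // tvG A' = tvG A // fv T (fv G u).
Proof. apply (t_v tnG). Qed.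
Hint Rewrite tF_v tF_v' tG_v : ver.

Lemma TNat_comp : TNat (compF F G) tvC tsC.
Proof.
  split.
  - intros A B f. unfold tsC, tvC. cbn [fh compF pre compP].
    assert (e : Iso (V (Fs F (tsG f)) (tsF (fh G f))) (fh F (fh G (fh T f))) (fh T (fh F (fh G f)))
      (fv F (tvG A) // tvF (G0 A)) (fv F (tvG B) // tvF (G0 B))) by iso.
    exact e.
  - intros. unfold tvC. cbn [fv compF pre compP].
    rewrite <- vc_assoc, <- fv_vc, tG_v, fv_vc, !vc_assoc, tF_v. reflexivity.
  - intros a A B A' B' f g u v h. unfold tsC.
    erewrite (Fs_comp h), (Fs_comp (s := Fs T a)) by ty. rewrite <- V_assoc. erewrite <- F_V by ty.
    rewrite (t_nat tnG h). erewrite F_V by ty. rewrite !V_assoc. f_equal.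
    eapply (t_nat tnF). ty.
Qed.

(** A composite of extended functors is again characterised by universal squares, [F] of the inner
    one followed by the outer one. Hence associators can be lifted between composites although these
    are not themselves built by the lifting construction. *)
Lemma Rep_comp : Rep (F0 := fun A : D => F0 (G0 A)) (compF HD KD) (compF F G) tvC tsC UC.
Proof.
  split.
  - intros A B u. exact (eq_trans (f_equal (fun x => @fv K K F0 HD (G0 A) (G0 B) x) (r_v repG u)) (r_v repF (fv G u))).
  - intros A B f. unfold UC, tvC.
    assert (e : Iso (V (Fs F (UG f)) (UF (RhF KD f))) (fh F (fh G f)) (RhF HD (RhF KD f)) (vid _) (fv F (tvG B) // tvF (G0 B))) by iso.
    exact e.
  - intros A B A' B' f g u v a.
    transitivity (V (Fs F (UG (f : @Hor D A (T0 B)))) (V (Fs F (pkK (fsq KD a))) (UF (RhF KD (g : @Hor D A' (T0 B')))))).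
    { unfold UC. rewrite V_assoc. f_equal. exact (r_nat repF (fsq KD a)). }
    unfold UC. rewrite <- !V_assoc. f_equal.
    pose proof (pkK_is a) as h. pose proof (pkK_is (fsq KD a)) as h'.
    rewrite (Fs_comp h).
    transitivity (Fs F (V (UG (f : @Hor D A (T0 B))) (pkK (fsq KD a)))).
    { symmetry. eapply F_V; [apply UG_is|exact h'|reflexivity]. }
    rewrite (r_nat repG a). eapply F_V; ty.
  - intros A B C f g.
    transitivity (V (RW1 tsC (RhF (compF HD KD)) UC f g)
      (V (pkK (fwd (@cmp K K F0 HD _ _ _ (RhF KD f) (RhF KD g)))) (pkK (fsq HD (fwd (@cmp K K G0 KD A B C f g)))))).
    { f_equal. cbn [cmp compF]. unfold gcomp, gmap; cbn [fwd].
      unfold gtop. rewrite pkK_castv, pkK_vs, pkK_castv. reflexivity. }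
    transitivity (V (H (Fs F (UG f)) (Fs F (V (tsG g) (Fs T (UG g)))))
     (V (RW1 tsF (RhF HD) UF (RhF KD f) (RhF KD g))
     (V (pkK (fwd (@cmp K K F0 HD _ _ _ (RhF KD f) (RhF KD g)))) (pkK (fsq HD (fwd (@cmp K K G0 KD A B C f g))))))).
    { unfold RW1. rewrite <- !V_assoc. f_equal. f_equal. f_equal. erewrite VH by ty. f_equal.
      unfold tsC, UC. erewrite !F_V by ty. rewrite !V_assoc. f_equal. rewrite <- !V_assoc.
      f_equal. symmetry. eapply (t_nat tnF). ty. }
    rewrite <- (V_assoc (RW1 _ _ _ _ _)).
    assert (e : V (RW1 tsF (RhF HD) UF (RhF KD f) (RhF KD g)) (pkK (fwd (@cmp K K F0 HD _ _ _ (RhF KD f) (RhF KD g))))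
      = RW2 F UF (RhF KD f) (RhF KD g)) by exact (r_cmp repF (RhF KD f : @Hor K _ _) (RhF KD g : @Hor K _ _)).
    assert (e2 : V (UF (cK (RhF KD f) (RhF KD g))) (pkK (fsq HD (fwd (@cmp K K G0 KD A B C f g))))
      = V (Fs F (pkK (fwd (@cmp K K G0 KD A B C f g)))) (UF (RhF KD (cK f g)))) by exact (r_nat repF (fwd (@cmp K K G0 KD A B C f g))).
    rewrite e. unfold RW2 at 1. rewrite !V_assoc, e2.
    assert (i : Is (pkK (fwd (@cmp K K G0 KD A B C f g))) (cK (RhF KD f) (RhF KD g)) (RhF KD (cK f g)) (vid _) (vid _)).
    { eapply Is_conv; [exact (pkK_is _)|..]; try reflexivity. exact (fv_id T (G0 C)). }
    rewrite <- (V_assoc (H _ _)). erewrite F_cmpS by ty. rewrite !V_assoc, <- (V_assoc (Fs F (H _ _))).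
    erewrite <- F_V by ty. rewrite <- (V_assoc (Fs F (V _ _))). erewrite <- F_V by ty.
    assert (e3 : V (V (H (UG f) (V (tsG g) (Fs T (UG g)))) (R (RhF KD f) (RhF KD g)))
       (pkK (fwd (@cmp K K G0 KD A B C f g))) = RW2 G UG f g) by exact (r_cmp repG (f : @Hor K _ _) (g : @Hor K _ _)).
    rewrite e3. unfold RW2, UC. rewrite <- !V_assoc. erewrite !F_V by ty.
    rewrite <- (Fs_comp (RK_is f g)), <- !V_assoc.
    f_equal. f_equal. f_equal. unfold cmpS; cbn [cmp compF]. rewrite pk_gcomp; cbn [gmap fwd]. rewrite pk_castv, Fs_pk. reflexivity.
  - intros A. toD.
    transitivity (V (ni (F0 (G0 A))) (V (pkK (fwd (@unt K K F0 HD (G0 A)))) (pkK (fsq HD (fwd (@unt K K G0 KD A)))))).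
    { f_equal. cbn [unt compF]. unfold gcomp, gmap; cbn [fwd]. unfold gtop. rewrite pkK_castv, pkK_vs, pkK_castv. reflexivity. }
    assert (e : V (UF (nh (G0 A))) (pkK (fsq HD (fwd (@unt K K G0 KD A)))) = V (Fs F (pkK (fwd (@unt K K G0 KD A)))) (UF (RhF KD (nh A))))
      by exact (r_nat repF (fwd (@unt K K G0 KD A))).
    rewrite <- V_assoc, (r_unt repF (G0 A)), !V_assoc, e.
    assert (i : Is (pkK (fwd (@unt K K G0 KD A))) (nh (G0 A)) (RhF KD (nh A)) (vid _) (vid _)).
    { eapply Is_conv; [exact (pkK_is _)|..]; try reflexivity. exact (fv_id T (G0 A)). }
    pose proof (Iso_is (ni_iso A)) as i1. pose proof (Iso_is (ni_iso (G0 A))) as i2.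
    rewrite <- (V_assoc (Fs F (ni _))). erewrite <- F_V by ty.
    rewrite (r_unt repG A). unfold UC. erewrite !F_V by ty. rewrite <- (Fs_comp i1), <- !V_assoc.
    f_equal. f_equal. f_equal. unfold untS; cbn [unt compF]. rewrite pk_gcomp; cbn [gmap fwd]. rewrite pk_castv, Fs_pk. reflexivity.
Qed.
End RepComp.

Lemma Iso_sides_inv (s : S D) (A B A' B' : D) (f : Hor A B) (g : Hor A' B') (u : Ver A A') (v : Ver B B') :
  Iso s f g u v -> exists (r : S D) (u' : Ver A' A) (v' : Ver B' B),
    Is r g f u' v' /\ V s r = sv f /\ V r s = sv g /\
    u // u' = vid A /\ u' // u = vid A' /\ v // v' = vid B /\ v' // v = vid B'.
Proof.
  intros [h (r & u' & v' & k & e1 & e2)]. exists r, u', v'.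
  pose proof (Iso_sides h k e1) as [? ?]. pose proof (Iso_sides k h e2) as [? ?]. tauto.
Qed.

(** The existence counterpart of [Iso_cancel]: the inverse of [s] pasted above [t] solves the
    equation, and the side equations show that it has the prescribed boundary. *)
Lemma Iso_solve (s t : S D) (A B A' B' A'' B'' : D) (f : Hor A B) (g : Hor A' B') (h : Hor A'' B'')
    (u : Ver A A') (v : Ver B B') (u1 : Ver A A'') (v1 : Ver B B'') (u2 : Ver A' A'') (v2 : Ver B' B'') :
  Iso s f g u v -> Is t f h u1 v1 -> u1 = u // u2 -> v1 = v // v2 ->
  exists r, Is r g h u2 v2 /\ V s r = t.
Proof.
  intros i ht e1 e2. destruct (Iso_sides_inv i) as (r & u' & v' & k & k1 & k2 & a1 & a2 & a3 & a4).
  exists (V r t). split.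
  - eapply Is_conv; [eapply V_is; [exact k|exact ht|reflexivity]|reflexivity|reflexivity|..].
    + rewrite e1, <- vc_assoc, a2, vc_idl. reflexivity.
    + rewrite e2, <- vc_assoc, a4, vc_idl. reflexivity.
  - rewrite <- V_assoc, k1. eapply Vidl; [exact ht|reflexivity].
Qed.

(** Solving in both directions gives two squares that are inverse to each other by cancellation.
    Description is used because [Iso] asserts the inverse only as an existence while compositors and
    unitors are data. *)
Lemma giso_solve (s t : S D) (A A' B' : D) (f : Hor A A') (g h : Hor A (T0 B')) (v : Ver A' (T0 B')) (v1 : Ver A' (T0 B')) :
  Iso s f g (vid A) v -> Iso t f h (vid A) v1 -> v = v1 ->
  { p : @Giso K A B' g h | is_giso p /\ V s (pkK (fwd p)) = t }.
Proof.
  intros i j <-. apply constructive_indefinite_description.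
  destruct (@Iso_solve s t _ _ _ _ _ _ f g h _ _ _ _ (vid A) (vid (T0 B')) i (Iso_is j)) as (r & [a ra] & e);
    [ty|ty|].
  destruct (@Iso_solve t s _ _ _ _ _ _ f h g _ _ _ _ (vid A) (vid (T0 B')) j (Iso_is i)) as (r' & [b rb] & e');
    [ty|ty|].
  set (p := {| fwd := a; bwd := b |} : @Giso D A (T0 B') g h).
  assert (e2 : pkK (fwd (kl_giso (S := lift_monad imu cmu ieta ceta) p)) = r)
    by (rewrite ra; exact (pkK_giso imu cmu ieta ceta p)).
  exists (kl_giso (S := lift_monad imu cmu ieta ceta) p). split; [|exact (eq_trans (f_equal (V s) e2) e)].
  apply kl_giso_ok. apply giso_S. unfold p. cbn [fwd bwd]. rewrite <- ra, <- rb. subst r r'. split.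
  - eapply (Iso_cancel (r := s)); [|exact i| ..]; [|tinf|reflexivity|tinf|reflexivity].
    rewrite <- V_assoc, e, e'. symmetry. eapply Vidr; [apply (Iso_is i)|reflexivity].
  - eapply (Iso_cancel (r := t)); [|exact j| ..]; [|tinf|reflexivity|tinf|reflexivity].
    rewrite <- V_assoc, e', e. symmetry. eapply Vidr; [apply (Iso_is j)|reflexivity].
Qed.

(** * Lifting functors along distributive laws *)

Section LiftFun.
Variables (F0 : D -> D) (F : FunData F0)
  (tv : forall A : D, Ver (F0 (T0 A)) (T0 (F0 A))) (ts : forall (A B : D) (f : Hor A B), S D).
Context {psF : is_psfun F}.
Hypotheses (dl : DLaw F tv ts).
Variable (ct : forall A, Companion (tv A)).

Definition ti (A : D) : S D := pk (ciota (ct A)).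
Definition LFh (A B : D) (f : Hor A (T0 B)) : Hor (F0 A) (T0 (F0 B)) := fh F f ** ch (ct B).
Definition LFU (A B : D) (f : Hor A (T0 B)) : S D := H (sv (fh F f)) (ti B).

Lemma ti_iso A : Iso (ti A) (hid _) (ch (ct A)) (vid _) (tv A).
Proof.
  (* The law is invertible on squares; the inverse of [tv A] is read off from the left side at
     [hid A]. *)
  destruct (Iso_sides_inv (d_iso dl (hid A))) as (r & u' & v' & k & k1 & k2 & a1 & a2 & a3 & a4).
  exact (proj1 (CompS_Iso (CompS_of (companion_ok (ct A))) a1 a2)).
Qed.
Lemma LFU_iso (A B : D) (f : Hor A (T0 B)) : Iso (LFU f) (fh F f) (LFh f) (vid _) (tv B).
Proof. pose proof (ti_iso B). unfold LFU, LFh. iso. Qed.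
Lemma LFU_is (A B : D) (f : Hor A (T0 B)) : Is (LFU f) (fh F f) (LFh f) (vid _) (tv B).
Proof. apply Iso_is, LFU_iso. Qed.
Lemma lts_iso (A B : D) (f : Hor A B) : Iso (ts f) (fh F (fh T f)) (fh T (fh F f)) (tv A) (tv B).
Proof. apply (d_iso dl). Qed.
Lemma ltmu_v A : fv F (muv A) // tv A = tv (T0 A) // (fv T (tv A) // muv (F0 A)).
Proof. rewrite (d_mu_v dl). apply vc_assoc. Qed.
Lemma lt_v (A A' : D) (u : Ver A A') : fv F (fv T u) // tv A' = tv A // fv T (fv F u).
Proof. apply (t_v (TNat_of dl)). Qed.
Lemma lteta_v A : fv F (etav A) // tv A = etav (F0 A).
Proof. symmetry. apply (d_eta_v dl). Qed.
Hint Resolve  LFU_is : isdb.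
Hint Resolve lts_iso LFU_iso : isodb.
Hint Rewrite ltmu_v lt_v lteta_v : ver.

(** The image of a square is the solution of the defining equation against the universal squares;
    cancellation makes it unique, so the description picks a determined square. *)
Lemma LF_sq (A B A' B' : K) (f : Hor A B) (g : Hor A' B') (u : Ver A A') (v : Ver B B') (a : Sq f g u v) :
  { b : @Sq K (F0 A) (F0 B) (F0 A') (F0 B') (LFh f) (LFh g) (fv F u) (fv F v) |
    V (LFU f) (pkK b) = V (Fs F (pkK a)) (LFU g) }.
Proof.
  apply constructive_indefinite_description. toD.
  pose proof (pkK_is a) as h.
  destruct (@Iso_solve (LFU f) (V (Fs F (pkK a)) (LFU g)) _ _ _ _ _ _ (fh F f) (LFh f) (LFh g) _ _
    (fv F u // vid _) (fv F (fv T v) // tv B') (fv F u) (fv T (fv F v)) (LFU_iso f)) as (r & [b rb] & e).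
  - ty.
  - ty.
  - ty.
  - exists b. subst r. exact e.
Qed.

Lemma LF_cmp (A B C : K) (f : Hor A B) (g : Hor B C) :
  { p : @Giso K (F0 A) (F0 C) (cK (LFh f) (LFh g)) (LFh (cK (f : @Hor D A (T0 B)) (g : @Hor D B (T0 C)))) |
    is_giso p /\ V (RW1 ts LFh LFU f g) (pkK (fwd p)) = RW2 F LFU f g }.
Proof.
  toD. refine (giso_solve (f := fh F f ** fh F (fh T g)) (v := tv (T0 C) // (fv T (tv C) // muv (F0 C)))
    _ (_ : Iso _ _ _ _ _) eq_refl); [unfold RW1 | unfold RW2]; iso.
Qed.

Lemma LF_unt (A : K) :
  { p : @Giso K (F0 A) (F0 A) (nh (F0 A)) (LFh (nh A)) |
    is_giso p /\ V (ni (F0 A)) (pkK (fwd p)) = V (untS F A) (V (Fs F (ni A)) (LFU (nh A))) }.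
Proof.
  toD. refine (giso_solve (ni_iso (F0 A)) (_ : Iso _ _ _ _ _) eq_refl). iso.
Qed.

Definition LFpre : @PreFun K K F0 :=
  @Build_PreFun K K F0 (fun A B f => LFh f) (fun A B u => fv F u)
    (fun A B A' B' f g u v a => proj1_sig (LF_sq a)).

Definition LF : @FunData K K F0 :=
  {| pre := LFpre;
     fv_id := fun A => fv_id F A;
     fv_vc := fun A B E u v => fv_vc F u v;
     cmp := fun A B C f g => proj1_sig (LF_cmp f g);
     unt := fun A => proj1_sig (LF_unt A) |}.

Lemma LF_Rep : Rep LF F tv ts LFU.
Proof.
  split.
  - reflexivity.
  - exact LFU_iso.
  - intros. apply (proj2_sig (LF_sq a)).
  - intros. apply (proj2_sig (LF_cmp f g)).
  - intros. apply (proj2_sig (LF_unt A)).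
Qed.

Lemma LF_psfun : is_psfun LF.
Proof.
  apply (Rep_psfun dl LF_Rep).
  - intros. apply (proj2_sig (LF_cmp f g)).
  - intros. apply (proj2_sig (LF_unt A)).
Qed.

(* Opaque on purpose: unfolding the construction makes comparing composites of
   lifted functors very slow. *)
Lemma lift_fun : {G : @FunData K K F0 & {U : forall A B : D, Hor A (T0 B) -> S D | Rep G F tv ts U /\ is_psfun G}}.
Proof. exact (existT _ LF (exist _ LFU (conj LF_Rep LF_psfun))). Qed.
End LiftFun.

(** * Lifting vertical transformations *)

(** Restricted along the universal squares, [al] is the family [a] of squares of [D]. When the
    universal squares of the source are invertible this determines the squares of [al]. *)
Definition Lifts (F0 G0 : D -> D) (UF UG : forall (A B : D) (f : Hor A (T0 B)), S D) (P : @PreFun K K F0) (Q : @PreFun K K G0)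
    (al : VPs P Q) (a : forall (A B : D) (f : Hor A B), S D) : Prop :=
  forall (A B : D) (f : Hor A (T0 B)), V (UF _ _ f) (pkK (@psq K K F0 G0 P Q al A B f)) = V (a _ _ f) (UG _ _ f).

Section VTLift.
Variables (F0 G0 : D -> D) (HD : @FunData K K F0) (GD : @FunData K K G0) (F : FunData F0) (G : FunData G0)
  (tvF : forall A : D, Ver (F0 (T0 A)) (T0 (F0 A))) (tsF : forall (A B : D) (f : Hor A B), S D)
  (UF : forall (A B : D) (f : Hor A (T0 B)), S D)
  (tvG : forall A : D, Ver (G0 (T0 A)) (T0 (G0 A))) (tsG : forall (A B : D) (f : Hor A B), S D)
  (UG : forall (A B : D) (f : Hor A (T0 B)), S D).
Context {psF : is_psfun F} {psG : is_psfun G}.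
Variables (av : forall A : D, Ver (F0 A) (G0 A)) (a : forall (A B : D) (f : Hor A B), S D).

(** An invertible morphism of distributive laws: [c_v] and [c_s] say that the transformation
    commutes with the two laws on 1v-components and on squares. *)
Record Compat : Prop := {
  c_tF : TNat F tvF tsF;
  c_tG : TNat G tvG tsG;
  c_N : Nat F G av a;
  c_iso : forall (A B : D) (f : Hor A B), Iso (a f) (fh F f) (fh G f) (av A) (av B);
  c_v : forall A, av (T0 A) // tvG A = tvF A // fv T (av A);
  c_s : forall (A B : D) (f : Hor A B), V (a (fh T f)) (tsG f) = V (tsF f) (Fs T (a f))
}.
Hypotheses (cp : Compat) (repF : Rep HD F tvF tsF UF) (repG : Rep GD G tvG tsG UG).

Lemma a_iso (A B : D) (f : Hor A B) : Iso (a f) (fh F f) (fh G f) (av A) (av B).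
Proof. apply (c_iso cp). Qed.
Lemma a_is (A B : D) (f : Hor A B) : Is (a f) (fh F f) (fh G f) (av A) (av B).
Proof. apply Iso_is, a_iso. Qed.
Lemma vtsF_is (A B : D) (f : Hor A B) : Is (tsF f) (fh F (fh T f)) (fh T (fh F f)) (tvF A) (tvF B).
Proof. apply (t_is (c_tF cp)). Qed.
Lemma vtsG_is (A B : D) (f : Hor A B) : Is (tsG f) (fh G (fh T f)) (fh T (fh G f)) (tvG A) (tvG B).
Proof. apply (t_is (c_tG cp)). Qed.
Lemma vUF_iso (A B : D) (f : Hor A (T0 B)) : Iso (UF f) (fh F f) (RhF HD f) (vid _) (tvF B).
Proof. apply (r_iso repF). Qed.
Lemma vUF_is (A B : D) (f : Hor A (T0 B)) : Is (UF f) (fh F f) (RhF HD f) (vid _) (tvF B).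
Proof. apply Iso_is, vUF_iso. Qed.
Lemma vUG_iso (A B : D) (f : Hor A (T0 B)) : Iso (UG f) (fh G f) (RhF GD f) (vid _) (tvG B).
Proof. apply (r_iso repG). Qed.
Lemma vUG_is (A B : D) (f : Hor A (T0 B)) : Is (UG f) (fh G f) (RhF GD f) (vid _) (tvG B).
Proof. apply Iso_is, vUG_iso. Qed.
Lemma vc_v' A : av (T0 A) // tvG A = tvF A // fv T (av A).
Proof. apply (c_v cp). Qed.
Hint Resolve a_is vtsF_is vtsG_is vUF_is vUG_is : isdb.
Hint Resolve a_iso vUF_iso vUG_iso : isodb.
Hint Rewrite vc_v' : ver.

Lemma lift_sq (A B : K) (f : Hor A B) :
  { b : @Sq K (F0 A) (F0 B) (G0 A) (G0 B) (RhF HD f) (RhF GD f) (av A) (av B) |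
    V (UF (f : @Hor D A (T0 B))) (pkK b) = V (a (f : @Hor D A (T0 B))) (UG (f : @Hor D A (T0 B))) }.
Proof.
  apply constructive_indefinite_description. toD.
  destruct (Iso_solve (t := V (a f) (UG f)) (h := RhF GD f)
    (u1 := av A // vid _) (v1 := av (T0 B) // tvG B) (u2 := av A) (v2 := fv T (av B)) (vUF_iso f)) as (r & [b rb] & e).
  - ty.
  - ty.
  - ty.
  - exists b. subst r. exact e.
Qed.

Lemma vnat (A A' : K) (u : @Ver K A A') : fv HD u // av A' = av A // fv GD u.
Proof.
  transitivity (fv F (u : @Ver D A A') // av A'); [exact (f_equal (fun x => x // av A') (r_v repF u))|].
  transitivity (av A // fv G (u : @Ver D A A')); [exact (n_v (c_N cp) u)|].
  exact (f_equal (fun x => av A // x) (eq_sym (r_v repG u))).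
Qed.

Definition lift_vt : @VTData K K F0 G0 HD GD :=
  @Build_VTData K K F0 G0 HD GD (fun A => av A) (fun A B f => proj1_sig (lift_sq f)) (fun A A' u => vnat u).

Lemma lift_vt_Lifts : Lifts UF UG lift_vt a.
Proof. intros A B f. apply (proj2_sig (@lift_sq A B f)). Qed.

Definition psqS (A B : D) (f : Hor A (T0 B)) : S D := pkK (@tsq K K F0 G0 HD GD lift_vt A B f).

Lemma psqS_eq (A B : D) (f : Hor A (T0 B)) : V (UF f) (psqS f) = V (a f) (UG f).
Proof. exact (lift_vt_Lifts f). Qed.

Lemma psqS_is (A B : D) (f : Hor A (T0 B)) : Is (psqS f) (RhF HD f) (RhF GD f) (av A) (fv T (av B)).
Proof. exact (pkK_is (@tsq K K F0 G0 HD GD lift_vt A B f)). Qed.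
Hint Resolve psqS_is : isdb.

Lemma vtsF_iso (A B : D) (f : Hor A B) : Iso (tsF f) (fh F (fh T f)) (fh T (fh F f)) (tvF A) (tvF B).
Proof. apply (t_iso (c_tF cp)). Qed.
Hint Resolve vtsF_iso : isodb.

Lemma RW1F_iso (A B C : D) (f : Hor A (T0 B)) (g : Hor B (T0 C)) :
  Iso (RW1 tsF (RhF HD) UF f g) (fh F f ** fh F (fh T g)) (cK (RhF HD f) (RhF HD g)) (vid _) (tvF (T0 C) // (fv T (tvF C) // muv (F0 C))).
Proof. unfold RW1. iso. Qed.

(** [c_s] moves the transformation past the laws. With [psq_RW2], which uses compatibility with
    compositors in [D], this gives compatibility of the lift with the compositors that relate [RW1]
    to [RW2]. *)
Lemma psq_RW1 (A B C : D) (f : Hor A (T0 B)) (g : Hor B (T0 C)) :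
  V (RW1 tsF (RhF HD) UF f g) (hK (av C) (psqS f) (psqS g))
  = V (H (a f) (a (fh T g))) (RW1 tsG (RhF GD) UG f g).
Proof.
  unfold RW1. rewrite V_assoc. erewrite (R_nat km) by ty. rewrite <- !V_assoc. f_equal.
  erewrite !VH by ty. rewrite psqS_eq. f_equal.
  rewrite V_assoc. erewrite <- F_V by ty. rewrite psqS_eq. erewrite F_V by ty.
  rewrite <- !V_assoc, (c_s cp). reflexivity.
Qed.

Lemma psq_RW2 (A B C : D) (f : Hor A (T0 B)) (g : Hor B (T0 C)) :
  V (RW2 F UF f g) (psqS (cK f g)) = V (H (a f) (a (fh T g))) (RW2 G UG f g).
Proof.
  unfold RW2. rewrite !V_assoc, psqS_eq.
  rewrite <- (V_assoc (Fs F _)), (n_nat (c_N cp) (RK_is f g)), <- !V_assoc. f_equal. f_equal.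
  apply (n_hc (c_N cp)).
Qed.

Lemma lift_vt_ok : is_vps (F := HD) (G := GD) lift_vt.
Proof.
  pose proof (Kl_pseudodouble imu cmu ieta ceta) as pk0.
  apply Strict_is_vps.
  - intros A B A' B' f g u v x.
    apply pkK_sqeq; [reflexivity|reflexivity|apply vnat|apply vnat|]. rewrite !pkK_vs.
    pose proof (pkK_is x) as hx.
    assert (hF : @Is D (pkK (fsq HD x)) (F0 A) (T0 (F0 B)) (F0 A') (T0 (F0 B')) (RhF HD f) (RhF HD g) (fv F u) (fv T (fv F v))).
    { eapply Is_conv; [exact (pkK_is (fsq HD x))|reflexivity|reflexivity|exact (r_v repF u)|].
      exact (f_equal (fv T (A:=_) (B:=_)) (r_v repF v)). }
    assert (hG : @Is D (pkK (fsq GD x)) (G0 A) (T0 (G0 B)) (G0 A') (T0 (G0 B')) (RhF GD f) (RhF GD g) (fv G u) (fv T (fv G v))).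
    { eapply Is_conv; [exact (pkK_is (fsq GD x))|reflexivity|reflexivity|exact (r_v repG u)|].
      exact (f_equal (fv T (A:=_) (B:=_)) (r_v repG v)). }
    toD.
    eapply (Iso_cancel (r := UF f)); [|apply vUF_iso| |reflexivity| |reflexivity].
    + transitivity (V (V (Fs F (pkK x)) (UF g)) (psqS g)).
      { rewrite <- V_assoc. f_equal. exact (r_nat repF x). }
      rewrite V_assoc, psqS_eq, <- !V_assoc, psqS_eq, (n_nat (c_N cp) hx), !V_assoc. f_equal.
      symmetry. exact (r_nat repG x).
    + eapply V_is; [exact hF|apply psqS_is|reflexivity].
    + eapply V_is; [apply psqS_is|exact hG|reflexivity].
  - intros A B C f g.
    apply pkK_sqeq; [reflexivity|reflexivity|rewrite vc_idl, vc_idr; reflexivity|rewrite vc_idl, vc_idr; reflexivity|].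
    rewrite !pkK_vs, pkK_hs. toD.
    assert (e1 : V (RW1 tsF (RhF HD) UF f g) (pkK (fwd (@cmp K K F0 HD A B C f g))) = RW2 F UF f g)
      by exact (r_cmp repF (f : @Hor K A B) (g : @Hor K B C)).
    assert (e2 : V (RW1 tsG (RhF GD) UG f g) (pkK (fwd (@cmp K K G0 GD A B C f g))) = RW2 G UG f g)
      by exact (r_cmp repG (f : @Hor K A B) (g : @Hor K B C)).
    eapply (Iso_cancel (r := RW1 tsF (RhF HD) UF f g)); [|apply RW1F_iso| |reflexivity| |reflexivity].
    + transitivity (V (RW2 F UF f g) (psqS (cK f g))).
      { rewrite <- e1, V_assoc. reflexivity. }
      rewrite psq_RW2, <- e2, <- V_assoc, <- psq_RW1, V_assoc. reflexivity.
    + eapply V_is; [apply pkK_is|exact (psqS_is (cK f g))|reflexivity].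
    + eapply V_is; [eapply (hK_is km); [apply psqS_is|apply psqS_is|reflexivity|reflexivity]|exact (pkK_is _)|reflexivity].
  - intros A.
    apply pkK_sqeq; [reflexivity|reflexivity|rewrite vc_idl, vc_idr; reflexivity|rewrite vc_idl, vc_idr; reflexivity|].
    rewrite !pkK_vs, pkK_sqh. toD.
    eapply (Iso_cancel (r := ni (F0 A))); [|apply ni_iso| |reflexivity| |reflexivity].
    + transitivity (V (V (untS F A) (V (Fs F (ni A)) (UF (nh A)))) (psqS (nh A))).
      { rewrite <- (r_unt repF A), V_assoc. reflexivity. }
      transitivity (V (V (ni (F0 A)) (hnK (av A))) (pkK (fwd (@unt K K G0 GD A)))); [|apply V_assoc].
      transitivity (V (sh (av A)) (V (untS G A) (V (Fs G (ni A)) (UG (nh A)))));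
        [|rewrite (hn_nat km), V_assoc; f_equal; symmetry; exact (r_unt repG A)].
      rewrite !V_assoc, psqS_eq, <- (V_assoc (Fs F _)), (n_nat (c_N cp) (Iso_is (ni_iso A))).
      rewrite <- !V_assoc. f_equal. f_equal. apply (n_hid (c_N cp)).
    + eapply V_is; [apply pkK_is|exact (psqS_is (nh A))|reflexivity].
    + eapply V_is; [apply hnK_is|exact (pkK_is _)|reflexivity].
Qed.

Definition lift_VT : @VT K K F0 G0 HD GD := {| vt := lift_vt; vt_ok := lift_vt_ok |}.
End VTLift.

(** Two out of three for vertical invertibility; it makes lifted squares invertible, since their
    pasting with a universal square is. *)
Lemma Iso_quot (r s t : S D) (A B A' B' A'' B'' : D) (f : Hor A B) (g : Hor A' B') (h : Hor A'' B'')
    (u : Ver A A') (v : Ver B B') (u1 : Ver A A'') (v1 : Ver B B'') (u2 : Ver A' A'') (v2 : Ver B' B'') :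
  Iso r f g u v -> Iso t f h u1 v1 -> Is s g h u2 v2 -> V r s = t -> Iso s g h u2 v2.
Proof.
  intros ir it hs e. split; [exact hs|].
  destruct (Iso_sides_inv it) as (t' & x & y & k & k1 & k2 & _).
  pose proof (Iso_is ir) as hr.
  exists (V t' r), (x // u), (y // v). split; [tinf|]. split.
  - eapply (Iso_cancel (r := r)); [|exact ir|tinf|reflexivity|tinf|reflexivity].
    rewrite <- V_assoc, e, <- V_assoc, k1. erewrite Vidl, Vidr by tinf. reflexivity.
  - rewrite V_assoc, e. exact k2.
Qed.

(** An inverse in [D] has a right side inverse to [fv T v], which must be of the form [fv T v'] to
    come from a Kleisli square. Hence an inverse of [v] is assumed, and uniqueness of inverses
    identifies the two. *)
Lemma VInv_of (A B A' B' : K) (f : Hor A B) (g : Hor A' B') (u : Ver A A') (v : Ver B B') (a : Sq f g u v) :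
  @Iso D (pkK a) A (T0 B) A' (T0 B') f g u (fv T v) ->
  (exists v', v // v' = vid _ /\ v' // v = vid _) ->
  VInv a.
Proof.
  intros i hv.
  (* [VInv] is data while [Iso] is an existence statement, so the inverse is extracted by
     description. *)
  apply (fun h => proj1_sig (constructive_indefinite_description (fun _ : VInv a => True) h)).
  destruct hv as (v' & e1 & e2).
  destruct (Iso_sides_inv i) as (r & u' & w & k & k1 & k2 & a1 & a2 & a3 & a4).
  assert (w = fv T (v' : @Ver D B' B)) as ->.
  { apply (@vinv_unique D _ _ (fv T (v : @Ver D B B'))); [exact a3|]. rewrite <- fv_vc.
    transitivity (fv T (vid (B' : D))); [f_equal; exact e2|apply fv_id]. }
  destruct k as [b rb]. subst r.
  change (@Sq K A' B' A B g f u' v') in b.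
  unshelve eexists (@Build_VInv K A B A' B' f g u v a u' v' b a1 a2 e1 e2 _ _); [| |exact I].
  - apply pkK_sqeq; [reflexivity|reflexivity|exact a1|exact e1|]. rewrite pkK_vs, pkK_sqv. exact k1.
  - apply pkK_sqeq; [reflexivity|reflexivity|exact a2|exact e2|]. rewrite pkK_vs, pkK_sqv. exact k2.
Qed.

(** * Closure properties and uniqueness of lifts *)

Section LiftsClosure.
Variables (F0 G0 : D -> D) (HD : @FunData K K F0) (GD : @FunData K K G0) (F : FunData F0) (G : FunData G0)
  (tvF : forall A : D, Ver (F0 (T0 A)) (T0 (F0 A))) (tsF : forall (A B : D) (f : Hor A B), S D)
  (UF : forall (A B : D) (f : Hor A (T0 B)), S D)
  (tvG : forall A : D, Ver (G0 (T0 A)) (T0 (G0 A))) (tsG : forall (A B : D) (f : Hor A B), S D)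
  (UG : forall (A B : D) (f : Hor A (T0 B)), S D).
Context {psF : is_psfun F} {psG : is_psfun G}.
Variables (av : forall A : D, Ver (F0 A) (G0 A)) (a : forall (A B : D) (f : Hor A B), S D).
Hypotheses (cp : Compat F G tvF tsF tvG tsG av a) (repF : Rep HD F tvF tsF UF) (repG : Rep GD G tvG tsG UG).

Lemma lift_vt_inv : Invertible (lift_vt cp repF repG).
Proof.
  intros A B f. toD. apply VInv_of.
  - eapply (Iso_quot (r := UF f)); [apply (r_iso repF)| |exact (psqS_is cp repF repG f)|exact (psqS_eq cp repF repG f)].
    eapply Iso_V; [exact (c_iso cp f)|exact (r_iso repG f)|reflexivity].
  - destruct (Iso_sides_inv (c_iso cp (hid B))) as (r & u' & v' & k & k1 & k2 & a1 & a2 & a3 & a4).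
    exists u'. split; assumption.
Qed.

Variables (al : VPs HD GD) (hal : Lifts UF UG al a) (pal : forall A : D, pv al A = av A).

Lemma lal_is (A B : D) (f : Hor A (T0 B)) :
  Is (pkK (@psq K K F0 G0 HD GD al A B f)) (RhF HD f) (RhF GD f) (av A) (fv T (av B)).
Proof.
  eapply Is_conv; [exact (pkK_is (@psq K K F0 G0 HD GD al A B f))|reflexivity|reflexivity|apply pal|].
  exact (f_equal (fv T (A:=_) (B:=_)) (pal B)).
Qed.
Lemma cUF_is (A B : D) (f : Hor A (T0 B)) : Is (UF f) (fh F f) (RhF HD f) (vid _) (tvF B).
Proof. apply Iso_is, (r_iso repF). Qed.
Lemma cUG_is (A B : D) (f : Hor A (T0 B)) : Is (UG f) (fh G f) (RhF GD f) (vid _) (tvG B).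
Proof. apply Iso_is, (r_iso repG). Qed.
Lemma ca_is (A B : D) (f : Hor A B) : Is (a f) (fh F f) (fh G f) (av A) (av B).
Proof. apply Iso_is, (c_iso cp). Qed.
Hint Resolve lal_is cUF_is cUG_is ca_is : isdb.

(** [r_nat] for [LD] moves its universal squares past the image of the square of [al]; what remains
    is [L] applied to the equation defining [al] as a lift. *)
Lemma Lifts_whl (L0 : D -> D) (LD : @FunData K K L0) (L : FunData L0) {psL : is_psfun L}
   (tvL : forall A : D, Ver (L0 (T0 A)) (T0 (L0 A))) (tsL : forall (A B : D) (f : Hor A B), S D)
  (UL : forall (A B : D) (f : Hor A (T0 B)), S D) (repL : Rep LD L tvL tsL UL) :
  Lifts (F0 := fun A : D => L0 (F0 A)) (G0 := fun A : D => L0 (G0 A))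
    (UC HD L UL UF) (UC GD L UL UG) (whl LD al) (fun A B f => Fs L (a f)).
Proof.
  intros A B f. unfold UC.
  assert (iL : forall (A B : D) (f : Hor A (T0 B)), Is (UL A B f) (fh L f) (RhF LD f) (vid _) (tvL B))
    by (intros; apply Iso_is, (r_iso repL)).
  assert (e : V (UL _ _ (RhF HD f)) (pkK (fsq LD (@psq K K F0 G0 HD GD al A B f)))
    = V (Fs L (pkK (@psq K K F0 G0 HD GD al A B f))) (UL _ _ (RhF GD f))) by exact (r_nat repL (@psq K K F0 G0 HD GD al A B f)).
  transitivity (V (Fs L (UF f)) (V (Fs L (pkK (@psq K K F0 G0 HD GD al A B f))) (UL _ _ (RhF GD f)))).
  { rewrite V_assoc. f_equal. exact e. }
  rewrite <- !V_assoc. erewrite <- !F_V by ty. f_equal. f_equal. apply hal.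
Qed.

(** The equation for [al] is used at the arrow [RhF KD f]; naturality of [a] at the universal square
    [UK f] brings the family back to [fh KF f]. *)
Lemma Lifts_whr (K0 : D -> D) (KD : @FunData K K K0) (KF : FunData K0)
   (tvK : forall A : D, Ver (K0 (T0 A)) (T0 (K0 A))) (tsK : forall (A B : D) (f : Hor A B), S D)
  (UK : forall (A B : D) (f : Hor A (T0 B)), S D) (repK : Rep KD KF tvK tsK UK) :
  Lifts (F0 := fun A : D => F0 (K0 A)) (G0 := fun A : D => G0 (K0 A))
    (UC KD F UF UK) (UC KD G UG UK) (whr al KD) (fun A B f => a (fh KF f)).
Proof.
  intros A B f. unfold UC.
  assert (iK : Is (UK A B f) (fh KF f) (RhF KD f) (vid _) (tvK B)) by (apply Iso_is, (r_iso repK)).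
  transitivity (V (Fs F (UK A B f)) (V (a (RhF KD f)) (UG (RhF KD f)))).
  { rewrite V_assoc. f_equal. apply hal. }
  rewrite <- !V_assoc. f_equal. exact (n_nat (c_N cp) iK).
Qed.
End LiftsClosure.

Lemma Lifts_comp (F0 G0 H0 : D -> D) (P : @PreFun K K F0) (Q : @PreFun K K G0) (R : @PreFun K K H0) UF UG UH
  (al : VPs P Q) (be : VPs Q R) a b :
  Lifts UF UG al a -> Lifts UG UH be b -> Lifts UF UH (al //> be) (fun A B f => V (a A B f) (b A B f)).
Proof.
  intros h1 h2 A B f.
  transitivity (V (UF A B f) (V (pkK (@psq K K F0 G0 P Q al A B f)) (pkK (@psq K K G0 H0 Q R be A B f)))).
  { f_equal. exact (pkK_vs (@psq K K F0 G0 P Q al A B f) (@psq K K G0 H0 Q R be A B f)). }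
  rewrite <- V_assoc.
  transitivity (V (V (a A (T0 B) f) (UG A B f)) (pkK (@psq K K G0 H0 Q R be A B f))).
  { f_equal. apply h1. }
  rewrite !V_assoc. f_equal. apply h2.
Qed.

(** The uniqueness of lifts. The universal squares of the two sides may be bracketed differently
    when the functors are threefold composites, so their equality is a premise rather than built
    into the statement. *)
Lemma Lifts_vps_eq (F0 G0 : D -> D) (P : @PreFun K K F0) (Q : @PreFun K K G0) (al be : VPs P Q)
  UF UG UF' UG' a b (x : forall A B : D, Hor A (T0 B) -> Hor (F0 A) (F0 (T0 B))) (t : forall B, Ver (F0 (T0 B)) (T0 (F0 B))) :
  Strict al -> Strict be -> (forall A, pv al A = pv be A) ->
  Lifts UF UG al a -> Lifts UF' UG' be b ->
  (forall A B (f : Hor A (T0 B)), Iso (UF A B f) (x A B f) (@fh K K F0 P A B f : @Hor D (F0 A) (T0 (F0 B))) (vid _) (t B)) ->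
  (forall A B f, UF A B f = UF' A B f) -> (forall A B f, UG A B f = UG' A B f) ->
  (forall A B (f : Hor A (T0 B)), a A (T0 B) f = b A (T0 B) f) -> vps_eq al be.
Proof.
  intros s1 s2 ep h1 h2 i eF eG e. pose proof (Kl_pseudodouble imu cmu ieta ceta).
  apply vps_eq_strict; [assumption..|].
  intros A B f. apply pkK_sqeq; [reflexivity|reflexivity|apply ep|apply ep|]. toD.
  eapply (Iso_cancel (r := UF A B f)); [|apply i| exact (pkK_is (@psq K K F0 G0 P Q al A B f)) |reflexivity|exact (pkK_is
    (@psq K K F0 G0 P Q be A B f))|reflexivity].
  transitivity (V (a A (T0 B) f) (UG A B f)); [apply h1|].
  rewrite e, eF, eG. symmetry. apply h2.
Qed.

(** Functoriality of [F] on vertical pastings makes the universal square of a threefold composite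
    independent of the bracketing. *)
Lemma UC_assoc (F0 G0 K0 : D -> D) (HD : @FunData K K F0) (GD : @FunData K K G0) (KD : @FunData K K K0)
  (F : FunData F0) (G : FunData G0) {psF : is_psfun F} (KF : FunData K0) tvF tsF UF tvG tsG UG tvK tsK UK
  (repF : Rep HD F tvF tsF UF) (repG : Rep GD G tvG tsG UG) (repK : Rep KD KF tvK tsK UK) {psG : is_psfun G} :
  forall (A B : D) (f : Hor A (T0 B)),
  UC (G0 := fun A => G0 (K0 A)) (compF GD KD) F UF (UC KD G UG UK) f
  = UC (F0 := fun A => F0 (G0 A)) KD (compF F G) (UC GD F UF UG) UK f.
Proof.
  intros A B f. unfold UC.
  assert (iK : Is (UK A B f) (fh KF f) (RhF KD f) (vid _) (tvK B)) by (apply Iso_is, (r_iso repK)).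
  assert (iG : Is (UG _ _ (RhF KD f)) (fh G (RhF KD f)) (RhF GD (RhF KD f)) (vid _) (tvG (K0 B))) by (apply Iso_is, (r_iso repG)).
  erewrite (Fs_comp F G iK), F_V by ty. rewrite V_assoc. reflexivity.
Qed.

(** The composite of the two lifts lifts an identity family, and so does the identity, so
    cancellation identifies them. This supplies the inverse laws of inverse centrality. *)
Lemma Lifts_sqv (F0 G0 : D -> D) (P : @FunData K K F0) (Q : @PreFun K K G0) (F : FunData F0) tv ts UF UG
    (repF : Rep P F tv ts UF) (al : VPs P Q) (be : VPs Q P) a b :
  Lifts UF UG al a -> Lifts UG UF be b -> (forall A, pv al A // pv be A = vid _) ->
  (forall A B (f : Hor A (T0 B)), V (a A (T0 B) f) (b A (T0 B) f) = sv (fh F f)) ->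
  forall (A B : K) (f : Hor A B), psq al f /// psq be f ~= sqv (fh P f).
Proof.
  intros h1 h2 ev e A B f. pose proof (Lifts_comp h1 h2 (f : @Hor D A (T0 B))) as h. cbn beta in h.
  rewrite e in h. pose proof (r_iso repF (f : @Hor D A (T0 B))) as i.
  apply pkK_sqeq; [reflexivity|reflexivity|apply ev|apply ev|]. toD.
  eapply (Iso_cancel (r := UF A B f)); [|apply i|exact (pkK_is (@psq K K F0 F0 P P (al //> be) A B f))|reflexivity|exact (pkK_is
    (@sqv K _ _ _))|reflexivity].
  rewrite pkK_sqv. refine (eq_trans h _). erewrite Vidl by (apply (Iso_is i)||reflexivity). symmetry. eapply Vidr; [apply (Iso_is i)|reflexivity].
Qed.

End KlFun.

(** * The tensor product of squares *)

Definition pairS (C D : DblData) (s : S C) (t : S D) : S (Prod C D) := fun x =>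
  exists (A B A' B' : C) (E G E' G' : D) (f : Hor A B) (g : Hor A' B') (u : Ver A A') (v : Ver B B')
    (h : Hor E G) (k : Hor E' G') (w : Ver E E') (y : Ver G G') (a : Sq f g u v) (b : Sq h k w y),
    s (mkSQ a) /\ t (mkSQ b) /\
    x = @mkSQ (Prod C D) (A, E) (B, G) (A', E') (B', G') (f, h) (g, k) (u, w) (v, y) (a, b).

Lemma pairS_pk (C D : DblData) (A B A' B' : C) (E G E' G' : D) (f : Hor A B) (g : Hor A' B') (u : Ver A A') (v : Ver B B')
    (h : Hor E G) (k : Hor E' G') (w : Ver E E') (y : Ver G G') (a : Sq f g u v) (b : Sq h k w y) :
  pairS (pk a) (pk b) = @pk (Prod C D) (A, E) (B, G) (A', E') (B', G') (f, h) (g, k) (u, w) (v, y) (a, b).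
Proof.
  apply set_ext; intro x; split.
  - intros (A1 & B1 & A1' & B1' & E1 & G1 & E1' & G1' & f1 & g1 & u1 & v1 & h1 & k1 & w1 & y1 & a1 & b1 & e1 & e2 & ->).
    unfold pk in *. apply mkSQ_sqeq in e1. apply mkSQ_sqeq in e2. destruct e1, e2. reflexivity.
  - intro e. exists A, B, A', B', E, G, E', G', f, g, u, v, h, k, w, y, a, b. repeat split. exact e.
Qed.

Section Const.
Context {D : DblData} {hD : is_double D}.

Definition constP (X : D) : @PreFun D D (fun _ => X) :=
  {| fh := fun _ _ _ => hid X; fv := fun _ _ _ => vid X; fsq := fun _ _ _ _ _ _ _ _ _ => sqv (hid X) |}.

(** With this functor [- (x) X] and [X (x) -] become composites with the tensor. The compositor is a
    unitor because it must lead from [hid X ** hid X] to [hid X]. *)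
Definition constF (X : D) : @FunData D D (fun _ => X) :=
  {| pre := constP X;
     fv_id := fun _ => eq_refl;
     fv_vc := fun _ _ _ _ _ => eq_sym (vc_idl (vid X));
     cmp := fun _ _ _ _ _ => lunit (hid X);
     unt := fun _ => gid (hid X) |}.
End Const.

Section TensorS.
Context {D : DblData} {hD : is_double D} (M : TensorData D) {hM : is_psfun (ten M)}.

Definition tS (a b : S D) : S D := Fs (ten M) (pairS a b).
Definition uT (X Y : D) : S D := pk (fwd (unt (ten M) (X, Y))).
Definition cT (A B C A' B' C' : D) (f : Hor A B) (f' : Hor A' B') (g : Hor B C) (g' : Hor B' C') : S D :=
  pk (fwd (@cmp _ _ _ (ten M) (A, A') (B, B') (C, C') (f, f') (g, g'))).

Lemma tS_pk (A A' C C' B B' E E' : D) (f : Hor A A') (g : Hor C C') (u : Ver A C)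
    (v : Ver A' C') (h : Hor B B') (k : Hor E E') (w : Ver B E) (x : Ver B' E')
    (a : Sq f g u v) (b : Sq h k w x) : tS (pk a) (pk b) = pk (tensq M a b).
Proof. unfold tS. rewrite pairS_pk, Fs_pk. reflexivity. Qed.

Lemma tS_is (a b : S D) (A A' C C' B B' E E' : D) (f : Hor A A') (g : Hor C C') (u : Ver A C)
    (v : Ver A' C') (h : Hor B B') (k : Hor E E') (w : Ver B E) (x : Ver B' E') :
  Is a f g u v -> Is b h k w x -> Is (tS a b) (tenh M f h) (tenh M g k) (tenv M u w) (tenv M v x).
Proof. intros [y ->] [z ->]. rewrite tS_pk. apply pk_is. Qed.

Lemma tS_V (a b c d : S D) (A A' C C' B B' E E' P P' Q Q' : D) (f : Hor A A') (g g' : Hor C C') (u : Ver A C)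
    (v : Ver A' C') (h : Hor B B') (k k' : Hor E E') (w : Ver B E) (x : Ver B' E')
    (l : Hor P P') (m : Hor Q Q') (u' : Ver C P) (v' : Ver C' P') (w' : Ver E Q) (x' : Ver E' Q') :
  Is a f g u v -> Is b h k w x -> Is c g' l u' v' -> g' = g -> Is d k' m w' x' -> k' = k ->
  V (tS a b) (tS c d) = tS (V a c) (V b d).
Proof.
  intros [xa ->] [xb ->] [xc ->] -> [xd ->] ->. rewrite !V_pk, !tS_pk, V_pk. symmetry.
  apply pk_sqeq. exact (fsq_vs hM (A := (_, _)) (B := (_, _)) (A' := (_, _)) (B' := (_, _)) (A'' := (_, _)) (B'' := (_, _))
    (f := (_, _)) (g := (_, _)) (h := (_, _)) (u := (_, _)) (v := (_, _)) (u' := (_, _)) (v' := (_, _)) (xa, xb) (xc, xd)).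
Qed.

Lemma tS_sv (A A' B B' : D) (f : Hor A A') (g : Hor B B') : tS (sv f) (sv g) = sv (tenh M f g).
Proof. unfold sv at 1 2. rewrite tS_pk. apply pk_sqeq. exact (fsq_sqv hM (A := (_, _)) (B := (_, _)) (f, g)). Qed.

Lemma tenv_vid (A B : D) : tenv M (vid A) (vid B) = vid (ten0 M A B).
Proof. exact (fv_id (ten M) (A, B)). Qed.

Lemma tenv_vc (A B A' B' A'' B'' : D) (u : Ver A A') (u' : Ver A' A'') (v : Ver B B') (v' : Ver B' B'') :
  tenv M (u // u') (v // v') = tenv M u v // tenv M u' v'.
Proof. exact (fv_vc (ten M) (A := (_, _)) (B := (_, _)) (E := (_, _)) (u, v) (u', v')). Qed.

Lemma cT_is (A B C A' B' C' : D) (f : Hor A B) (f' : Hor A' B') (g : Hor B C) (g' : Hor B' C') :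
  Is (cT f f' g g') (tenh M f f' ** tenh M g g') (tenh M (f ** g) (f' ** g')) (vid _) (vid _).
Proof. apply pk_is. Qed.
Lemma uT_is (X Y : D) : Is (uT X Y) (hid (ten0 M X Y)) (tenh M (hid X) (hid Y)) (vid _) (vid _).
Proof. apply pk_is. Qed.
Lemma uT_iso (X Y : D) : Iso (uT X Y) (hid (ten0 M X Y)) (tenh M (hid X) (hid Y)) (vid _) (vid _).
Proof. exact (Iso_giso (unt_iso hM (X, Y))). Qed.

Lemma tS_cT (a b c d : S D) (A A1 A2 A' A1' A2' B B1 B2 B' B1' B2' : D)
   (f : Hor A A1) (g : Hor A1 A2) (f' : Hor A' A1') (g' : Hor A1' A2')
   (h : Hor B B1) (k : Hor B1 B2) (h' : Hor B' B1') (k' : Hor B1' B2')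
   u v v' w x y y' z :
  Is a f h u v -> Is b f' h' x y -> Is c g k v' w -> v' = v -> Is d g' k' y' z -> y' = y ->
  V (H (tS a b) (tS c d)) (cT h h' k k') = V (cT f f' g g') (tS (H a c) (H b d)).
Proof.
  intros [xa ->] [xb ->] [xc ->] -> [xd ->] ->. rewrite !H_pk, !tS_pk, H_pk. unfold cT. rewrite !V_pk. apply pk_sqeq.
  exact (cmp_nat hM (A := (_, _)) (B := (_, _)) (E := (_, _)) (A' := (_, _)) (B' := (_, _)) (E' := (_, _))
    (f := (_, _)) (g := (_, _)) (f' := (_, _)) (g' := (_, _)) (u := (_, _)) (v := (_, _)) (w := (_, _)) (xa, xb) (xc, xd)).
Qed.

Lemma tS_uT (A A' B B' : D) (u : Ver A A') (v : Ver B B') :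
  V (sh (tenv M u v)) (uT A' B') = V (uT A B) (tS (sh u) (sh v)).
Proof.
  unfold sh, uT. rewrite tS_pk, !V_pk. apply pk_sqeq.
  exact (unt_nat hM (A := (_, _)) (A' := (_, _)) (u, v)).
Qed.

Lemma cT_lunit (A B A' B' : D) (f : Hor A B) (f' : Hor A' B') :
  V (H (uT A A') (sv (tenh M f f'))) (cT (hid A) (hid A') f f') = sv (tenh M f f').
Proof.
  pose proof (proj2 (pk_sqeq _ _) (cmp_lunit hM (A := (_, _)) (B := (_, _)) (f, f'))) as e.
  rewrite <- !V_pk, <- H_pk in e.
  change (pk (fsq (ten M) (fwd (lunit ((f, f') : @Hor (Prod D D) (A, A') (B, B'))))))
    with (pk (tensq M (fwd (lunit f)) (fwd (lunit f')))) in e.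
  rewrite <- tS_pk, !pk_lunit, tS_sv in e.
  erewrite Vidr in e; [exact e|eapply V_is; [eapply H_is; [apply uT_is|apply sv_is|reflexivity]|apply cT_is|reflexivity]|].
  rewrite !hc_idl. reflexivity.
Qed.

Lemma cT_runit (A B A' B' : D) (f : Hor A B) (f' : Hor A' B') :
  V (H (sv (tenh M f f')) (uT B B')) (cT f f' (hid B) (hid B')) = sv (tenh M f f').
Proof.
  pose proof (proj2 (pk_sqeq _ _) (cmp_runit hM (A := (_, _)) (B := (_, _)) (f, f'))) as e.
  rewrite <- !V_pk, <- H_pk in e.
  change (pk (fsq (ten M) (fwd (runit ((f, f') : @Hor (Prod D D) (A, A') (B, B'))))))
    with (pk (tensq M (fwd (runit f)) (fwd (runit f')))) in e.
  rewrite <- tS_pk, !pk_runit, tS_sv in e.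
  erewrite Vidr in e; [exact e|eapply V_is; [eapply H_is; [apply sv_is|apply uT_is|reflexivity]|apply cT_is|reflexivity]|].
  rewrite !hc_idr. reflexivity.
Qed.

Lemma cT_assoc (A B E G A' B' E' G' : D) (f : Hor A B) (g : Hor B E) (h : Hor E G)
    (f' : Hor A' B') (g' : Hor B' E') (h' : Hor E' G') :
  V (H (cT f f' g g') (sv (tenh M h h'))) (cT (f ** g) (f' ** g') h h')
  = V (H (sv (tenh M f f')) (cT g g' h h')) (cT f f' (g ** h) (g' ** h')).
Proof.
  pose proof (proj2 (pk_sqeq _ _) (cmp_assoc hM (A := (_, _)) (B := (_, _)) (E := (_, _)) (G := (_, _)) (f, f') (g, g') (h, h'))) as e.
  rewrite <- !V_pk, <- !H_pk in e.
  change (pk (fsq (ten M) (fwd (assoc ((f, f') : @Hor (Prod D D) (A, A') (B, B')) ((g, g') : @Hor (Prod D D) (B, B') (E, E'))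
     ((h, h') : @Hor (Prod D D) (E, E') (G, G'))))))
    with (pk (tensq M (fwd (assoc f g h)) (fwd (assoc f' g' h')))) in e.
  rewrite <- tS_pk, !pk_assoc, tS_sv in e.
  erewrite Vidr in e; [|eapply V_is; [eapply H_is; [apply cT_is|apply sv_is|reflexivity]|apply cT_is|reflexivity]|].
  - refine (eq_trans e _). rewrite V_assoc.
    eapply Vidl; [eapply V_is; [eapply H_is; [apply sv_is|apply cT_is|reflexivity]|apply cT_is|reflexivity]|].
    reflexivity.
  - change (tenh M ((f ** g) ** h) ((f' ** g') ** h') = tenh M (f ** g ** h) (f' ** g' ** h')).
    rewrite !hc_assoc. reflexivity.
Qed.

Hint Resolve cT_is uT_is tS_is : isdb.

(** Interchange writes [uT] beside [uT] in two rows, the lower of which is removed by the left unit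
    law of the tensor. *)
Lemma uT_uT (X Y : D) : V (H (uT X Y) (uT X Y)) (cT (hid X) (hid Y) (hid X) (hid Y)) = uT X Y.
Proof.
  transitivity (V (H (sv (hid (ten0 M X Y))) (uT X Y)) (V (H (uT X Y) (sv (tenh M (hid X) (hid Y)))) (cT (hid X) (hid Y) (hid X) (hid Y)))).
  - rewrite <- V_assoc. f_equal. erewrite VH by ty. erewrite Vidl, Vidr by ty. reflexivity.
  - rewrite cT_lunit, <- sh_vid. erewrite Hidl, Vidr by ty. reflexivity.
Qed.

Definition LFun (X : D) : @FunData D D (fun A => ten0 M X A) := compF (ten M) (pairF (constF X) (idF D)).
Definition RFun (X : D) : @FunData D D (fun A => ten0 M A X) := compF (ten M) (pairF (idF D) (constF X)).

Lemma LFun_Fs (X : D) (s : S D) (A B A' B' : D) (f : Hor A B) (g : Hor A' B') (u : Ver A A') (v : Ver B B') :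
  Is s f g u v -> Fs (LFun X) s = tS (sv (hid X)) s.
Proof. intros [a ->]. unfold sv. rewrite Fs_pk, tS_pk. reflexivity. Qed.
Lemma RFun_Fs (X : D) (s : S D) (A B A' B' : D) (f : Hor A B) (g : Hor A' B') (u : Ver A A') (v : Ver B B') :
  Is s f g u v -> Fs (RFun X) s = tS s (sv (hid X)).
Proof. intros [a ->]. unfold sv. rewrite Fs_pk, tS_pk. reflexivity. Qed.

Lemma LFun_unt (X A : D) : untS (LFun X) A = uT X A.
Proof.
  unfold untS, LFun. cbn [unt compF]. rewrite pk_gcomp. cbn [fwd gmap]. rewrite pk_castv.
  change (pk (fsq (ten M) (fwd (unt (pairF (constF X) (idF D)) A)))) with (pk (tensq M (sqv (hid X)) (sqv (hid A)))).
  rewrite <- tS_pk. fold (sv (hid X)) (sv (hid A)). rewrite tS_sv. eapply Vidr; [apply pk_is|reflexivity].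
Qed.
Lemma RFun_unt (X A : D) : untS (RFun X) A = uT A X.
Proof.
  unfold untS, RFun. cbn [unt compF]. rewrite pk_gcomp. cbn [fwd gmap]. rewrite pk_castv.
  change (pk (fsq (ten M) (fwd (unt (pairF (idF D) (constF X)) A)))) with (pk (tensq M (sqv (hid A)) (sqv (hid X)))).
  rewrite <- tS_pk. fold (sv (hid X)) (sv (hid A)). rewrite tS_sv. eapply Vidr; [apply pk_is|reflexivity].
Qed.

Lemma LFun_cmp (X A B C : D) (f : Hor A B) (g : Hor B C) : cmpS (LFun X) f g = cT (hid X) f (hid X) g.
Proof.
  unfold cmpS, LFun. cbn [cmp compF]. rewrite pk_gcomp. cbn [fwd gmap]. rewrite pk_castv.
  change (pk (fsq (ten M) (fwd (cmp (pairF (constF X) (idF D)) f g)))) with (pk (tensq M (fwd (lunit (hid X))) (sqv (f ** g)))).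
  rewrite <- tS_pk, pk_lunit. fold (sv (f ** g)). rewrite tS_sv. eapply Vidr; [apply cT_is|].
  rewrite hc_idl. reflexivity.
Qed.
Lemma RFun_cmp (X A B C : D) (f : Hor A B) (g : Hor B C) : cmpS (RFun X) f g = cT f (hid X) g (hid X).
Proof.
  unfold cmpS, RFun. cbn [cmp compF]. rewrite pk_gcomp. cbn [fwd gmap]. rewrite pk_castv.
  change (pk (fsq (ten M) (fwd (cmp (pairF (idF D) (constF X)) f g)))) with (pk (tensq M (sqv (f ** g)) (fwd (lunit (hid X))))).
  rewrite <- tS_pk, pk_lunit. fold (sv (f ** g)). rewrite tS_sv. eapply Vidr; [apply cT_is|].
  rewrite hc_idl. reflexivity.
Qed.
End TensorS.

#[export] Hint Resolve cT_is uT_is : isdb.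
#[export] Hint Extern 1 (Is (tS _ _ _) _ _ _ _) => eapply tS_is; inf : isdb.
#[export] Hint Resolve uT_iso : isodb.
Hint Rewrite @tenv_vid : ver.

Lemma tS_iso (D : DblData) {hD : is_double D} (M : TensorData D) {hM : is_psfun (ten M)} (a b : S D) (A A' C C' B B' E E' : D)
  (f : Hor A A') (g : Hor C C') (u : Ver A C)
    (v : Ver A' C') (h : Hor B B') (k : Hor E E') (w : Ver B E) (x : Ver B' E') :
  Iso a f g u v -> Iso b h k w x -> Iso (tS M a b) (tenh M f h) (tenh M g k) (tenv M u w) (tenv M v x).
Proof.
  intros [ha (a' & u' & v' & ka & a1 & a2)] [hb (b' & w' & x' & kb & b1 & b2)].
  split; [tinf|]. exists (tS M a' b'), (tenv M u' w'), (tenv M v' x'). split; [tinf|].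
  erewrite !tS_V by ty. rewrite a1, a2, b1, b2, !(tS_sv (hM := hM)). split; reflexivity.
Qed.
#[export] Hint Extern 1 (Iso (tS _ _ _) _ _ _ _) => eapply tS_iso; isoinf : isodb.

Section TensorFun.
Context {D : DblData} {hD : is_double D} (M : TensorData D) {hM : is_psfun (ten M)}.

Lemma giso_map (C E : DblData) {PE : is_pseudodouble E} (F0 : C -> E) (F : FunData F0) {hF : is_psfun F} (A B : C)
  (f g : Hor A B) (p : Giso f g) : is_giso p -> is_giso (gmap F p).
Proof.
  intros [e1 e2]. apply giso_S. cbn [gmap fwd bwd]. rewrite !pk_castv, <- !Fs_pk.
  apply pk_sqeq in e1, e2. rewrite <- V_pk in e1, e2.
  split; erewrite <- F_V; try apply pk_is; try reflexivity; rewrite ?e1, ?e2; apply F_sv.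
Qed.

Lemma prod_giso_ok (C E : DblData) (p q : Prod C E) (f g : @Hor (Prod C E) p q) (x : Giso (fst f) (fst g)) (y : Giso (snd f) (snd g)) :
  is_giso x -> is_giso y -> is_giso (@prod_giso C E p q f g x y).
Proof.
  destruct p, q, f, g. intros [e1 e2] [e3 e4].
  apply pk_sqeq in e1, e2, e3, e4.
  split; apply pk_sqeq.
  - cbn. fold (@pairS C E).
    transitivity (pairS (pk (fwd x /// bwd x)) (pk (fwd y /// bwd y))); [rewrite pairS_pk; reflexivity|].
    rewrite e1, e3, pairS_pk. reflexivity.
  - transitivity (pairS (pk (bwd x /// fwd x)) (pk (bwd y /// fwd y))); [rewrite pairS_pk; reflexivity|].
    rewrite e2, e4, pairS_pk. reflexivity.
Qed.

Variable X : D.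

Lemma LFun_cmp_ok (A B C : D) (f : Hor A B) (g : Hor B C) : is_giso (cmp (LFun M X) f g).
Proof.
  apply giso_comp; [apply (cmp_iso hM)|]. refine (giso_map (F := ten M) _).
  apply prod_giso_ok; [apply (lunit_iso (double_pseudo hD))|apply giso_id].
Qed.
Lemma LFun_unt_ok (A : D) : is_giso (unt (LFun M X) A).
Proof.
  apply giso_comp; [apply (unt_iso hM)|]. refine (giso_map (F := ten M) _).
  apply prod_giso_ok; apply giso_id.
Qed.
Lemma RFun_cmp_ok (A B C : D) (f : Hor A B) (g : Hor B C) : is_giso (cmp (RFun M X) f g).
Proof.
  apply giso_comp; [apply (cmp_iso hM)|]. refine (giso_map (F := ten M) _).
  apply prod_giso_ok; [apply giso_id|apply (lunit_iso (double_pseudo hD))].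
Qed.
Lemma RFun_unt_ok (A : D) : is_giso (unt (RFun M X) A).
Proof.
  apply giso_comp; [apply (unt_iso hM)|]. refine (giso_map (F := ten M) _).
  apply prod_giso_ok; apply giso_id.
Qed.

Lemma svhid_V : V (sv (hid X)) (sv (hid X)) = sv (hid X).
Proof. eapply Vidl; [apply sv_is|reflexivity]. Qed.
Lemma svhid_H : H (sv (hid X)) (sv (hid X)) = sv (hid X).
Proof. rewrite H_sv, hc_idl. reflexivity. Qed.

(** The pseudofunctor axioms in the language of sets of squares, with the identity constraints of
    [D] already removed; it serves both one-variable tensor functors. *)
Lemma psfun_of_S (F0 : D -> D) (F : FunData F0) :
  (forall (A B C : D) (f : Hor A B) (g : Hor B C), is_giso (cmp F f g)) ->
  (forall A : D, is_giso (unt F A)) ->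
  (forall (a b : S D) (A B A' B' A'' B'' : D) (f : Hor A B) (g : Hor A' B') (h : Hor A'' B'') (u : Ver A A') (v : Ver B B')
    (u' : Ver A' A'') (v' : Ver B' B''), Is a f g u v -> Is b g h u' v' -> Fs F (V a b) = V (Fs F a) (Fs F b)) ->
  (forall (A B : D) (f : Hor A B), Fs F (sv f) = sv (fh F f)) ->
  (forall (a b : S D) (A B C A' B' C' : D) (f : Hor A B) (g : Hor B C) (f' : Hor A' B') (g' : Hor B' C')
    (u : Ver A A') (v : Ver B B') (w : Ver C C'), Is a f f' u v -> Is b g g' v w ->
    V (H (Fs F a) (Fs F b)) (cmpS F f' g') = V (cmpS F f g) (Fs F (H a b))) ->
  (forall (A A' : D) (u : Ver A A'), V (sh (fv F u)) (untS F A') = V (untS F A) (Fs F (sh u))) ->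
  (forall (A B E G : D) (f : Hor A B) (g : Hor B E) (h : Hor E G),
    V (H (cmpS F f g) (sv (fh F h))) (cmpS F (f ** g) h) = V (H (sv (fh F f)) (cmpS F g h)) (cmpS F f (g ** h))) ->
  (forall (A B : D) (f : Hor A B), V (H (untS F A) (sv (fh F f))) (cmpS F (hid A) f) = sv (fh F f)) ->
  (forall (A B : D) (f : Hor A B), V (H (sv (fh F f)) (untS F B)) (cmpS F f (hid B)) = sv (fh F f)) ->
  is_psfun F.
Proof.
  intros gc gu hv hs hc hu ha hl hr. split.
  - intros A B A' B' A'' B'' f g h u v u' v' a b. apply pk_sqeq. rewrite <- V_pk, <- !Fs_pk, <- V_pk.
    eapply hv; apply pk_is.
  - intros A B f. apply pk_sqeq. rewrite <- Fs_pk. apply hs.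
  - exact gc.
  - exact gu.
  - intros A B C A' B' C' f g f' g' u v w a b. apply pk_sqeq. rewrite <- !V_pk, <- H_pk, <- !Fs_pk, <- H_pk.
    eapply hc; apply pk_is.
  - intros A A' u. apply pk_sqeq. rewrite <- !V_pk, <- Fs_pk. apply hu.
  - intros A B E G f g h. apply pk_sqeq. rewrite <- !V_pk, <- !H_pk, <- Fs_pk, !pk_assoc, hs.
    change (V (V (H (cmpS F f g) (sv (fh F h))) (cmpS F (f ** g) h)) (sv (fh F (f ** g ** h)))
      = V (V (sv (fh F f ** fh F g ** fh F h)) (H (sv (fh F f)) (cmpS F g h))) (cmpS F f (g ** h))).
    erewrite Vidr by ty. rewrite V_assoc. erewrite (Vidl (s := V _ _)) by ty. apply ha.
  - intros A B f. apply pk_sqeq. rewrite <- !V_pk, <- !H_pk, <- Fs_pk, !pk_lunit, hs.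
    change (V (V (H (untS F A) (sv (fh F f))) (cmpS F (hid A) f)) (sv (fh F f)) = sv (fh F f)).
    erewrite Vidr by ty. apply hl.
  - intros A B f. apply pk_sqeq. rewrite <- !V_pk, <- !H_pk, <- Fs_pk, !pk_runit, hs.
    change (V (V (H (sv (fh F f)) (untS F B)) (cmpS F f (hid B))) (sv (fh F f)) = sv (fh F f)).
    erewrite Vidr by ty. apply hr.
Qed.

Lemma LFun_psfun : is_psfun (LFun M X).
Proof.
  apply psfun_of_S.
  - exact LFun_cmp_ok.
  - exact LFun_unt_ok.
  - intros. erewrite !LFun_Fs by ty. erewrite tS_V by ty. rewrite svhid_V. reflexivity.
  - intros. erewrite !LFun_Fs by ty. apply (tS_sv (hM := hM)).
  - intros. rewrite !(LFun_cmp (hM := hM)). erewrite !LFun_Fs by ty. erewrite tS_cT by ty. rewrite svhid_H. reflexivity.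
  - intros. rewrite !(LFun_unt (hM := hM)). erewrite LFun_Fs by ty. rewrite <- sh_vid. exact (tS_uT (hM := hM) (vid X) u).
  - intros. rewrite !(LFun_cmp (hM := hM)). pose proof (cT_assoc (hM := hM) (hid X) (hid X) (hid X) f g h) as e.
    rewrite !hc_idl in e. exact e.
  - intros. rewrite (LFun_cmp (hM := hM)), (LFun_unt (hM := hM)). apply (cT_lunit (hM := hM)).
  - intros. rewrite (LFun_cmp (hM := hM)), (LFun_unt (hM := hM)). apply (cT_runit (hM := hM)).
Qed.

Lemma RFun_psfun : is_psfun (RFun M X).
Proof.
  apply psfun_of_S.
  - exact RFun_cmp_ok.
  - exact RFun_unt_ok.
  - intros. erewrite !RFun_Fs by ty. erewrite tS_V by ty. rewrite svhid_V. reflexivity.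
  - intros. erewrite !RFun_Fs by ty. apply (tS_sv (hM := hM)).
  - intros. rewrite !(RFun_cmp (hM := hM)). erewrite !RFun_Fs by ty. erewrite tS_cT by ty. rewrite svhid_H. reflexivity.
  - intros. rewrite !(RFun_unt (hM := hM)). erewrite RFun_Fs by ty. rewrite <- sh_vid. exact (tS_uT (hM := hM) u (vid X)).
  - intros. rewrite !(RFun_cmp (hM := hM)). pose proof (cT_assoc (hM := hM) f g h (hid X) (hid X) (hid X)) as e.
    rewrite !hc_idl in e. exact e.
  - intros. rewrite (RFun_cmp (hM := hM)), (RFun_unt (hM := hM)). apply (cT_lunit (hM := hM)).
  - intros. rewrite (RFun_cmp (hM := hM)), (RFun_unt (hM := hM)). apply (cT_runit (hM := hM)).
Qed.
End TensorFun.

Section FunCmp.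
Context {D : DblData} {hD : is_double D}.

Lemma compF_cmp (B C : DblData) (F0 : B -> C) (G0 : C -> D) (F : FunData F0) (G : FunData G0)
  (A A' A'' : B) (f : Hor A A') (g : Hor A' A'') :
  cmpS (compF G F) f g = V (cmpS G (fh F f) (fh F g)) (Fs G (cmpS F f g)).
Proof. unfold cmpS. cbn [cmp compF]. rewrite pk_gcomp. cbn [fwd gmap]. rewrite pk_castv, Fs_pk. reflexivity. Qed.

Lemma compF_unt (B C : DblData) (F0 : B -> C) (G0 : C -> D) (F : FunData F0) (G : FunData G0) (A : B) :
  untS (compF G F) A = V (untS G (F0 A)) (Fs G (untS F A)).
Proof. unfold untS. cbn [unt compF]. rewrite pk_gcomp. cbn [fwd gmap]. rewrite pk_castv, Fs_pk. reflexivity. Qed.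

Lemma compF_Fs (B C : DblData) (F0 : B -> C) (G0 : C -> D) (F : FunData F0) (G : FunData G0) (s : S B)
  (A E A' E' : B) (f : Hor A E) (g : Hor A' E') (u : Ver A A') (v : Ver E E') :
  Is s f g u v -> Fs (compF G F) s = Fs G (Fs F s).
Proof. intros [x ->]. rewrite !Fs_pk. reflexivity. Qed.

Context (M : TensorData D) {hM : is_psfun (ten M)}.

Lemma tenF_cmp (B : DblData) (F0 G0 : B -> D) (F : FunData F0) (G : FunData G0)
  (A A' A'' : B) (f : Hor A A') (g : Hor A' A'') :
  cmpS (tenF M F G) f g = V (cT M (fh F f) (fh G f) (fh F g) (fh G g)) (tS M (cmpS F f g) (cmpS G f g)).
Proof.
  refine (eq_trans (compF_cmp (pairF F G) (ten M) f g) _).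
  f_equal. unfold tS, cmpS. rewrite pairS_pk. reflexivity.
Qed.

Lemma tenF_unt (B : DblData) (F0 G0 : B -> D) (F : FunData F0) (G : FunData G0) (A : B) :
  untS (tenF M F G) A = V (uT M (F0 A) (G0 A)) (tS M (untS F A) (untS G A)).
Proof.
  refine (eq_trans (compF_unt (pairF F G) (ten M) A) _).
  f_equal. unfold tS, untS. rewrite pairS_pk. reflexivity.
Qed.

Lemma tenF_Fs (B : DblData) (F0 G0 : B -> D) (F : FunData F0) (G : FunData G0) (s : S B)
  (A E A' E' : B) (f : Hor A E) (g : Hor A' E') (u : Ver A A') (v : Ver E E') :
  Is s f g u v -> Fs (tenF M F G) s = tS M (Fs F s) (Fs G s).
Proof. intros [x ->]. rewrite !Fs_pk. rewrite tS_pk. reflexivity. Qed.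

Lemma fst2_cmp (p q r : Prod (Prod D D) D) (f : Hor p q) (g : Hor q r) :
  V (cmpS fstF (fh fstF f) (fh fstF g)) (Fs fstF (cmpS fstF f g)) = sv (fst (fst f) ** fst (fst g)).
Proof. unfold cmpS. rewrite Fs_pk. exact (Vidl (sv_is _) eq_refl). Qed.
Lemma snd2_cmp (p q r : Prod (Prod D D) D) (f : Hor p q) (g : Hor q r) :
  V (cmpS sndF (fh fstF f) (fh fstF g)) (Fs sndF (cmpS fstF f g)) = sv (snd (fst f) ** snd (fst g)).
Proof. unfold cmpS. rewrite Fs_pk. exact (Vidl (sv_is _) eq_refl). Qed.
Lemma fst2_unt (p : Prod (Prod D D) D) :
  V (untS (D := D) fstF (fst p)) (Fs fstF (untS fstF p)) = sv (hid (fst (fst p))).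
Proof. unfold untS. rewrite Fs_pk. exact (Vidl (sv_is _) eq_refl). Qed.
Lemma snd2_unt (p : Prod (Prod D D) D) :
  V (untS (D := D) sndF (fst p)) (Fs sndF (untS fstF p)) = sv (hid (snd (fst p))).
Proof. unfold untS. rewrite Fs_pk. exact (Vidl (sv_is _) eq_refl). Qed.
End FunCmp.

(** * The monoidal constraints on sets of squares *)

Section MonS.
Context {D : DblData} {hD : is_double D} (M : Monoidal D).
Instance hM : is_psfun (ten M) := ten_ok M.
Notation tS := (tS M).
Notation cT := (cT M).
Notation uT := (uT M).

Definition malS (A B C A' B' C' : D) (f : Hor A A') (g : Hor B B') (h : Hor C C') : S D := pk (malsq M f g h).
Definition lamS (A A' : D) (f : Hor A A') : S D := pk (mlamsq M f).
Definition rhoS (A A' : D) (f : Hor A A') : S D := pk (mrhosq M f).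
(** The unit of the tensor is a pseudofunctor on the terminal double category, so [Ih M] is tied to
    [hid (I0 M)] only by this unitor, and to its own square by [cI]. *)
Definition uI : S D := untS (unitF M) tt.
Definition cI : S D := cmpS (unitF M) (A := tt) (B := tt) (E := tt) tt tt.

Lemma malSE (A B C A' B' C' : D) (f : Hor A A') (g : Hor B B') (h : Hor C C') : malS f g h = pk (malsq M f g h).
Proof. reflexivity. Qed.
Lemma lamSE (A A' : D) (f : Hor A A') : lamS f = pk (mlamsq M f).
Proof. reflexivity. Qed.
Lemma rhoSE (A A' : D) (f : Hor A A') : rhoS f = pk (mrhosq M f).
Proof. reflexivity. Qed.

Lemma malS_is (A B C A' B' C' : D) (f : Hor A A') (g : Hor B B') (h : Hor C C') :
  Is (malS f g h) (tenh M (tenh M f g) h) (tenh M f (tenh M g h)) (malv M A B C) (malv M A' B' C').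
Proof. apply pk_is. Qed.
Lemma lamS_is (A A' : D) (f : Hor A A') : Is (lamS f) (tenh M (Ih M) f) f (mlamv M A) (mlamv M A').
Proof. apply pk_is. Qed.
Lemma rhoS_is (A A' : D) (f : Hor A A') : Is (rhoS f) (tenh M f (Ih M)) f (mrhov M A) (mrhov M A').
Proof. apply pk_is. Qed.
Lemma uI_is : Is uI (hid (I0 M)) (Ih M) (vid _) (vid _).
Proof. apply pk_is. Qed.
Lemma cI_is : Is cI (Ih M ** Ih M) (Ih M) (vid _) (vid _).
Proof. apply pk_is. Qed.
Hint Resolve malS_is lamS_is rhoS_is uI_is cI_is : isdb.

Lemma malS_iso (A B C A' B' C' : D) (f : Hor A A') (g : Hor B B') (h : Hor C C') :
  Iso (malS f g h) (tenh M (tenh M f g) h) (tenh M f (tenh M g h)) (malv M A B C) (malv M A' B' C').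
Proof. exact (Iso_VInv (mal_inv M (A := (A, B, C)) (B := (A', B', C')) (f, g, h))). Qed.
Lemma lamS_iso (A A' : D) (f : Hor A A') : Iso (lamS f) (tenh M (Ih M) f) f (mlamv M A) (mlamv M A').
Proof. exact (Iso_VInv (mlam_inv M f)). Qed.
Lemma rhoS_iso (A A' : D) (f : Hor A A') : Iso (rhoS f) (tenh M f (Ih M)) f (mrhov M A) (mrhov M A').
Proof. exact (Iso_VInv (mrho_inv M f)). Qed.
Lemma uI_iso : Iso uI (hid (I0 M)) (Ih M) (vid _) (vid _).
Proof. exact (Iso_giso (unt_iso (unitF_ok M) tt)). Qed.

Lemma malv_nat (A B C A' B' C' : D) (u : Ver A A') (v : Ver B B') (w : Ver C C') :
  tenv M (tenv M u v) w // malv M A' B' C' = malv M A B C // tenv M u (tenv M v w).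
Proof. exact (tv_nat (mal M) (A := (A, B, C)) (A' := (A', B', C')) (u, v, w)). Qed.
Lemma lamv_nat (A A' : D) (u : Ver A A') : tenv M (vid (I0 M)) u // mlamv M A' = mlamv M A // u.
Proof. rewrite <- (fv_id (unitF M) tt : fv (unitF M) (vid (tt : One)) = vid (I0 M)). exact (tv_nat (mlam M) u). Qed.
Lemma rhov_nat (A A' : D) (u : Ver A A') : tenv M u (vid (I0 M)) // mrhov M A' = mrhov M A // u.
Proof. rewrite <- (fv_id (unitF M) tt : fv (unitF M) (vid (tt : One)) = vid (I0 M)). exact (tv_nat (mrho M) u). Qed.

Lemma malS_nat (a b c : S D) (A B C E G L A' B' C' E' G' L' : D) (f : Hor A E) (g : Hor B G) (h : Hor C L)
  (f' : Hor A' E') (g' : Hor B' G') (h' : Hor C' L') u v w x y z :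
  Is a f f' u v -> Is b g g' w x -> Is c h h' y z ->
  V (tS (tS a b) c) (malS f' g' h') = V (malS f g h) (tS a (tS b c)).
Proof.
  intros [a' ->] [b' ->] [c' ->].
  pose proof (n_nat (Nat_of_VT (mal M)) (@pk_is (Prod (Prod D D) D) (A, B, C) (E, G, L) (A', B', C') (E', G', L')
    (f, g, h) (f', g', h') (u, w, y) (v, x, z) (a', b', c'))) as e.
  rewrite !Fs_pk in e. rewrite !tS_pk. exact e.
Qed.

(** The compositors of the two triple tensors are built from projections, whose compositors are
    identities; removing those leaves compositors of the tensor alone. *)
Lemma malS_hc (A B C E G L P Q W : D) (f : Hor A E) (g : Hor B G) (h : Hor C L) (f' : Hor E P) (g' : Hor G Q) (h' : Hor L W) :
  V (cT (tenh M f g) h (tenh M f' g') h') (V (tS (cT f g f' g') (sv (h ** h'))) (malS (f ** f') (g ** g') (h ** h')))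
  = V (H (malS f g h) (malS f' g' h')) (V (cT f (tenh M g h) f' (tenh M g' h')) (tS (sv (f ** f')) (cT g h g' h'))).
Proof.
  pose proof (n_hc (Nat_of_VT (mal M)) ((f, g, h) : @Hor (Prod (Prod D D) D) (A, B, C) (E, G, L))
    ((f', g', h') : @Hor (Prod (Prod D D) D) (E, G, L) (P, Q, W))) as e.
  rewrite !tenF_cmp, !compF_cmp, !fst2_cmp, !snd2_cmp in e.
  assert (e' : V (V (cT (tenh M f g) h (tenh M f' g') h') (tS (V (cT f g f' g') (tS (sv (f ** f')) (sv (g ** g')))) (sv (h ** h'))))
      (malS (f ** f') (g ** g') (h ** h'))
    = V (H (malS f g h) (malS f' g' h')) (V (cT f (tenh M g h) f' (tenh M g' h'))
       (tS (sv (f ** f')) (V (cT g h g' h') (tS (sv (g ** g')) (sv (h ** h'))))))) by exact e.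
  rewrite !(tS_sv (hM := hM)) in e'. erewrite !Vidr in e' by ty. rewrite V_assoc in e'. exact e'.
Qed.

Lemma malS_hid (A B C : D) :
  V (uT (ten0 M A B) C) (V (tS (uT A B) (sv (hid C))) (malS (hid A) (hid B) (hid C)))
  = V (sh (malv M A B C)) (V (uT A (ten0 M B C)) (tS (sv (hid A)) (uT B C))).
Proof.
  pose proof (n_hid (Nat_of_VT (mal M)) ((A, B, C) : Prod (Prod D D) D)) as e.
  rewrite !tenF_unt, !compF_unt, !fst2_unt, !snd2_unt in e.
  assert (e' : V (V (uT (ten0 M A B) C) (tS (V (uT A B) (tS (sv (hid A)) (sv (hid B)))) (sv (hid C)))) (malS (hid A) (hid B) (hid C))
    = V (sh (malv M A B C)) (V (uT A (ten0 M B C)) (tS (sv (hid A)) (V (uT B C) (tS (sv (hid B)) (sv (hid C))))))) by exact e.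
  rewrite !(tS_sv (hM := hM)) in e'. erewrite !Vidr in e' by ty. rewrite V_assoc in e'. exact e'.
Qed.

Lemma unitF_sv : Fs (unitF M) (@sv One tt tt tt) = sv (Ih M).
Proof. exact (F_sv (hF := unitF_ok M) (tt : @Hor One tt tt)). Qed.

Lemma lamS_nat (a : S D) (A B A' B' : D) (f : Hor A B) (g : Hor A' B') (u : Ver A A') (v : Ver B B') :
  Is a f g u v -> V (tS (sv (Ih M)) a) (lamS g) = V (lamS f) a.
Proof.
  intros [x ->]. pose proof (n_nat (Nat_of_VT (mlam M)) (pk_is x)) as e.
  erewrite tenF_Fs in e by apply pk_is. rewrite !Fs_pk in e.
  rewrite <- unitF_sv. unfold sv. rewrite Fs_pk. exact e.
Qed.
Lemma rhoS_nat (a : S D) (A B A' B' : D) (f : Hor A B) (g : Hor A' B') (u : Ver A A') (v : Ver B B') :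
  Is a f g u v -> V (tS a (sv (Ih M))) (rhoS g) = V (rhoS f) a.
Proof.
  intros [x ->]. pose proof (n_nat (Nat_of_VT (mrho M)) (pk_is x)) as e.
  erewrite tenF_Fs in e by apply pk_is. rewrite !Fs_pk in e.
  rewrite <- unitF_sv. unfold sv. rewrite Fs_pk. exact e.
Qed.

Lemma constI_cmp (A B C : D) (f : Hor A B) (g : Hor B C) : cmpS (constI M D) f g = cI.
Proof.
  refine (eq_trans (compF_cmp (bangF D) (unitF M) f g) _).
  transitivity (V cI (Fs (unitF M) (@sv One tt tt tt))); [reflexivity|].
  rewrite unitF_sv. eapply Vidr; [apply cI_is|reflexivity].
Qed.
Lemma constI_unt (A : D) : untS (constI M D) A = uI.
Proof.
  refine (eq_trans (compF_unt (bangF D) (unitF M) A) _).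
  transitivity (V uI (Fs (unitF M) (@sv One tt tt tt))); [reflexivity|].
  rewrite unitF_sv. eapply Vidr; [apply uI_is|reflexivity].
Qed.

Lemma lamS_hc (A B C : D) (f : Hor A B) (g : Hor B C) :
  V (cT (Ih M) f (Ih M) g) (V (tS cI (sv (f ** g))) (lamS (f ** g))) = H (lamS f) (lamS g).
Proof.
  pose proof (n_hc (Nat_of_VT (mlam M)) f g) as e. rewrite tenF_cmp, constI_cmp in e.
  assert (e' : V (V (cT (Ih M) f (Ih M) g) (tS cI (sv (f ** g)))) (lamS (f ** g)) = V (H (lamS f) (lamS g)) (sv (f ** g)))
    by exact e.
  erewrite Vidr in e' by ty. rewrite <- V_assoc. exact e'.
Qed.
Lemma rhoS_hc (A B C : D) (f : Hor A B) (g : Hor B C) :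
  V (cT f (Ih M) g (Ih M)) (V (tS (sv (f ** g)) cI) (rhoS (f ** g))) = H (rhoS f) (rhoS g).
Proof.
  pose proof (n_hc (Nat_of_VT (mrho M)) f g) as e. rewrite tenF_cmp, constI_cmp in e.
  assert (e' : V (V (cT f (Ih M) g (Ih M)) (tS (sv (f ** g)) cI)) (rhoS (f ** g)) = V (H (rhoS f) (rhoS g)) (sv (f ** g)))
    by exact e.
  erewrite Vidr in e' by ty. rewrite <- V_assoc. exact e'.
Qed.
Lemma lamS_hid (A : D) : V (uT (I0 M) A) (V (tS uI (sv (hid A))) (lamS (hid A))) = sh (mlamv M A).
Proof.
  pose proof (n_hid (Nat_of_VT (mlam M)) A) as e. rewrite tenF_unt, constI_unt in e.
  assert (e' : V (V (uT (I0 M) A) (tS uI (sv (hid A)))) (lamS (hid A)) = V (sh (mlamv M A)) (sv (hid A))) by exact e.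
  erewrite Vidr in e' by ty. rewrite <- V_assoc. exact e'.
Qed.
Lemma rhoS_hid (A : D) : V (uT A (I0 M)) (V (tS (sv (hid A)) uI) (rhoS (hid A))) = sh (mrhov M A).
Proof.
  pose proof (n_hid (Nat_of_VT (mrho M)) A) as e. rewrite tenF_unt, constI_unt in e.
  assert (e' : V (V (uT A (I0 M)) (tS (sv (hid A)) uI)) (rhoS (hid A)) = V (sh (mrhov M A)) (sv (hid A))) by exact e.
  erewrite Vidr in e' by ty. rewrite <- V_assoc. exact e'.
Qed.
Lemma uI_cI : V (H uI uI) cI = uI.
Proof.
  pose proof (proj2 (pk_sqeq _ _) (cmp_lunit (unitF_ok M) (A := tt) (B := tt) tt)) as e.
  rewrite <- !V_pk, <- H_pk in e.
  assert (e0 : V (V (H uI (sv (Ih M))) cI) (Fs (unitF M) (@sv One tt tt tt)) = pk (fwd (lunit (Ih M)))).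
  { unfold sv at 2. rewrite Fs_pk. exact e. }
  clear e. rename e0 into e. rewrite unitF_sv in e.
  rewrite pk_lunit in e. erewrite Vidr in e by ty.
  transitivity (V (H (sv (hid (I0 M))) uI) (V (H uI (sv (Ih M))) cI)).
  - rewrite <- V_assoc. f_equal. erewrite VH by ty. erewrite Vidl, Vidr by ty. reflexivity.
  - rewrite e, <- sh_vid. erewrite Hidl, Vidr by ty. reflexivity.
Qed.
End MonS.

#[export] Hint Resolve malS_is lamS_is rhoS_is uI_is cI_is : isdb.
Hint Rewrite @tenv_vc : ver.

(** * The strengths as distributive laws *)

Section StrS.
Context {D : DblData} {hD : is_double D} (M : Monoidal D) (T : VMonad D).
Existing Instance hM.
Existing Instance hT.
Variables (t : LStrength M T) (s : RStrength M T) (hts : Bistrong t s).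
Hypotheses (it : Invertible (lst t)) (is : Invertible (rst s)).
Notation T0 := (T0 T).
Notation tS := (tS M).
Notation cT := (cT M).
Notation uT := (uT M).
Notation malS := (malS M).
Notation lamS := (lamS M).
Notation rhoS := (rhoS M).
Notation uI := (uI M).
Notation Lf := (LFun M).
Notation Rf := (RFun M).
Notation muv := (muv T).
Notation etav := (etav T).
Notation mus := (mus T).
Notation etas := (etas T).

Definition stL (A B A' B' : D) (f : Hor A A') (g : Hor B B') : S D := pk (ltsq t f g).
Definition stR (A B A' B' : D) (f : Hor A A') (g : Hor B B') : S D := pk (rtsq s f g).

Lemma stL_is (A B A' B' : D) (f : Hor A A') (g : Hor B B') :
  Is (stL f g) (tenh M f (fh T g)) (fh T (tenh M f g)) (ltv t A B) (ltv t A' B').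
Proof. apply pk_is. Qed.
Lemma stR_is (A B A' B' : D) (f : Hor A A') (g : Hor B B') :
  Is (stR f g) (tenh M (fh T f) g) (fh T (tenh M f g)) (rtv s A B) (rtv s A' B').
Proof. apply pk_is. Qed.
Lemma stL_iso (A B A' B' : D) (f : Hor A A') (g : Hor B B') :
  Iso (stL f g) (tenh M f (fh T g)) (fh T (tenh M f g)) (ltv t A B) (ltv t A' B').
Proof. exact (Iso_VInv (it (A := (A, B)) (B := (A', B')) (f, g))). Qed.
Lemma stR_iso (A B A' B' : D) (f : Hor A A') (g : Hor B B') :
  Iso (stR f g) (tenh M (fh T f) g) (fh T (tenh M f g)) (rtv s A B) (rtv s A' B').
Proof. exact (Iso_VInv (is (A := (A, B)) (B := (A', B')) (f, g))). Qed.
Hint Resolve stL_is stR_is : isdb.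

Lemma stL_nv (A B A' B' : D) (u : Ver A A') (v : Ver B B') : tenv M u (fv T v) // ltv t A' B' = ltv t A B // fv T (tenv M u v).
Proof. exact (tv_nat (lst t) (A := (A, B)) (A' := (A', B')) (u, v)). Qed.
Lemma stR_nv (A B A' B' : D) (u : Ver A A') (v : Ver B B') : tenv M (fv T u) v // rtv s A' B' = rtv s A B // fv T (tenv M u v).
Proof. exact (tv_nat (rst s) (A := (A, B)) (A' := (A', B')) (u, v)). Qed.

Lemma stL_nat (a b : S D) (A B E G A' B' E' G' : D) (f : Hor A E) (g : Hor B G) (f' : Hor A' E') (g' : Hor B' G') u v w x :
  Is a f f' u v -> Is b g g' w x -> V (tS a (Fs T b)) (stL f' g') = V (stL f g) (Fs T (tS a b)).
Proof.
  intros [a' ->] [b' ->].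
  pose proof (n_nat (Nat_of_VT (lst t)) (@pk_is (Prod D D) (A, B) (E, G) (A', B') (E', G')
    (f, g) (f', g') (u, w) (v, x) (a', b'))) as e.
  rewrite !Fs_pk in e. rewrite !Fs_pk, !tS_pk, Fs_pk. exact e.
Qed.
Lemma stR_nat (a b : S D) (A B E G A' B' E' G' : D) (f : Hor A E) (g : Hor B G) (f' : Hor A' E') (g' : Hor B' G') u v w x :
  Is a f f' u v -> Is b g g' w x -> V (tS (Fs T a) b) (stR f' g') = V (stR f g) (Fs T (tS a b)).
Proof.
  intros [a' ->] [b' ->].
  pose proof (n_nat (Nat_of_VT (rst s)) (@pk_is (Prod D D) (A, B) (E, G) (A', B') (E', G')
    (f, g) (f', g') (u, w) (v, x) (a', b'))) as e.
  rewrite !Fs_pk in e. rewrite !Fs_pk, !tS_pk, Fs_pk. exact e.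
Qed.

Lemma stL_hc (A B E G P Q : D) (f : Hor A E) (g : Hor B G) (f' : Hor E P) (g' : Hor G Q) :
  V (cT f (fh T g) f' (fh T g')) (V (tS (sv (f ** f')) (cmpS T g g')) (stL (f ** f') (g ** g')))
  = V (H (stL f g) (stL f' g')) (V (cmpS T (tenh M f g) (tenh M f' g')) (Fs T (cT f g f' g'))).
Proof.
  pose proof (n_hc (Nat_of_VT (lst t)) ((f, g) : @Hor (Prod D D) (A, B) (E, G)) ((f', g') : @Hor (Prod D D) (E, G) (P, Q))) as e.
  rewrite tenF_cmp, !compF_cmp in e.
  assert (e' : V (V (cT f (fh T g) f' (fh T g')) (tS (sv (f ** f')) (V (cmpS T g g') (Fs T (cmpS sndF ((f, g) : @Hor (Prod D D) (A, B)
    (E, G)) ((f', g') : @Hor (Prod D D) (E, G) (P, Q)))))))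
      (stL (f ** f') (g ** g'))
    = V (H (stL f g) (stL f' g')) (V (cmpS T (tenh M f g) (tenh M f' g')) (Fs T (cT f g f' g')))) by exact e.
  change (cmpS sndF ((f, g) : @Hor (Prod D D) (A, B) (E, G)) ((f', g') : @Hor (Prod D D) (E, G) (P, Q))) with (sv (g ** g')) in e'.
  rewrite F_sv, V_assoc in e'. erewrite (Vidr (s := cmpS T g g')) in e' by ty. exact e'.
Qed.
Lemma stR_hc (A B E G P Q : D) (f : Hor A E) (g : Hor B G) (f' : Hor E P) (g' : Hor G Q) :
  V (cT (fh T f) g (fh T f') g') (V (tS (cmpS T f f') (sv (g ** g'))) (stR (f ** f') (g ** g')))
  = V (H (stR f g) (stR f' g')) (V (cmpS T (tenh M f g) (tenh M f' g')) (Fs T (cT f g f' g'))).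
Proof.
  pose proof (n_hc (Nat_of_VT (rst s)) ((f, g) : @Hor (Prod D D) (A, B) (E, G)) ((f', g') : @Hor (Prod D D) (E, G) (P, Q))) as e.
  rewrite tenF_cmp, !compF_cmp in e.
  assert (e' : V (V (cT (fh T f) g (fh T f') g') (tS (V (cmpS T f f') (Fs T (cmpS fstF ((f, g) : @Hor (Prod D D) (A, B) (E, G))
    ((f', g') : @Hor (Prod D D) (E, G) (P, Q))))) (sv (g ** g'))))
      (stR (f ** f') (g ** g'))
    = V (H (stR f g) (stR f' g')) (V (cmpS T (tenh M f g) (tenh M f' g')) (Fs T (cT f g f' g')))) by exact e.
  change (cmpS fstF ((f, g) : @Hor (Prod D D) (A, B) (E, G)) ((f', g') : @Hor (Prod D D) (E, G) (P, Q))) with (sv (f ** f')) in e'.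
  rewrite F_sv, V_assoc in e'. erewrite (Vidr (s := cmpS T f f')) in e' by ty. exact e'.
Qed.

Lemma stL_hid (A B : D) :
  V (uT A (T0 B)) (V (tS (sv (hid A)) (untS T B)) (stL (hid A) (hid B)))
  = V (sh (ltv t A B)) (V (untS T (ten0 M A B)) (Fs T (uT A B))).
Proof.
  pose proof (n_hid (Nat_of_VT (lst t)) ((A, B) : Prod D D)) as e.
  rewrite tenF_unt, !compF_unt in e.
  assert (e' : V (V (uT A (T0 B)) (tS (sv (hid A)) (V (untS T B) (Fs T (sv (hid B)))))) (stL (hid A) (hid B))
    = V (sh (ltv t A B)) (V (untS T (ten0 M A B)) (Fs T (uT A B)))) by exact e.
  rewrite F_sv, V_assoc in e'. erewrite (Vidr (s := untS T B)) in e' by ty. exact e'.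
Qed.
Lemma stR_hid (A B : D) :
  V (uT (T0 A) B) (V (tS (untS T A) (sv (hid B))) (stR (hid A) (hid B)))
  = V (sh (rtv s A B)) (V (untS T (ten0 M A B)) (Fs T (uT A B))).
Proof.
  pose proof (n_hid (Nat_of_VT (rst s)) ((A, B) : Prod D D)) as e.
  rewrite tenF_unt, !compF_unt in e.
  assert (e' : V (V (uT (T0 A) B) (tS (V (untS T A) (Fs T (sv (hid A)))) (sv (hid B)))) (stR (hid A) (hid B))
    = V (sh (rtv s A B)) (V (untS T (ten0 M A B)) (Fs T (uT A B)))) by exact e.
  rewrite F_sv, V_assoc in e'. erewrite (Vidr (s := untS T A)) in e' by ty. exact e'.
Qed.

Definition tvL (X A : D) : Ver (ten0 M X (T0 A)) (T0 (ten0 M X A)) := ltv t X A.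
Definition tsL (X A B : D) (f : Hor A B) : S D := stL (hid X) f.
Definition tvR (X A : D) : Ver (ten0 M (T0 A) X) (T0 (ten0 M A X)) := rtv s A X.
Definition tsR (X A B : D) (f : Hor A B) : S D := stR f (hid X).

Lemma mu_is2 (A B : D) (f : Hor A B) : Is (mus f) (fh T (fh T f)) (fh T f) (muv A) (muv B).
Proof. apply pk_is. Qed.
Lemma eta_is2 (A B : D) (f : Hor A B) : Is (etas f) f (fh T f) (etav A) (etav B).
Proof. apply pk_is. Qed.
Hint Resolve mu_is2 eta_is2 : isdb.

(** The strength axioms for the monad carry an identity square in the first variable, so they
    specialise to the 1h-cell [hid X]; the law respects composition because [hid X ** hid X] is
    [hid X] by strictness. *)
Lemma DLaw_L (X : D) : DLaw (Lf X) (tvL X) (@tsL X).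
Proof.
  split.
  - split.
    + intros. apply stL_is.
    + intros A A' u. exact (stL_nv (vid X) u).
    + intros a A B A' B' f g u v h. rewrite (compF_Fs T (Lf X) h), (compF_Fs (Lf X) T h).
      erewrite !LFun_Fs by ty. eapply stL_nat; ty.
    + intros A B E f g. rewrite !compF_cmp, !(LFun_cmp (hM := hM M)). erewrite LFun_Fs by ty.
      pose proof (stL_hc (hid X) f (hid X) g) as e. rewrite hc_idl in e. rewrite V_assoc. exact e.
    + intros A. rewrite !compF_unt, !(LFun_unt (hM := hM M)). erewrite LFun_Fs by ty. rewrite V_assoc. apply stL_hid.
  - intros A. exact (lst_mu_v t X A).
  - intros A B f. erewrite LFun_Fs by ty. unfold tsL, stL. change (mus f) with (pk (tsq (mu T) f)). change (mus (fh (Lf X) f)) with (pk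
    (tsq (mu T) (fh (Lf X) f))).
    unfold sv. rewrite tS_pk, Fs_pk, !V_pk. apply pk_sqeq.
    pose proof (lst_mu_sq t (hid X) f) as e. apply pk_sqeq in e. apply pk_sqeq.
    rewrite <- !V_pk, V_assoc in e. rewrite <- !V_pk. exact e.
  - intros A. exact (lst_eta_v t X A).
  - intros A B f. erewrite LFun_Fs by ty. unfold tsL, stL. change (etas f) with (pk (tsq (eta T) f)).
    unfold sv. rewrite tS_pk, V_pk. apply pk_sqeq.
    exact (lst_eta_sq t (hid X) f).
  - intros. apply stL_iso.
Qed.

Lemma DLaw_R (X : D) : DLaw (Rf X) (tvR X) (@tsR X).
Proof.
  split.
  - split.
    + intros. apply stR_is.
    + intros A A' u. exact (stR_nv u (vid X)).
    + intros a A B A' B' f g u v h. rewrite (compF_Fs T (Rf X) h), (compF_Fs (Rf X) T h).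
      erewrite !RFun_Fs by ty. eapply stR_nat; ty.
    + intros A B E f g. rewrite (compF_cmp T (Rf X)), (compF_cmp (Rf X) T), !(RFun_cmp (hM := hM M)). erewrite RFun_Fs by ty.
      pose proof (stR_hc f (hid X) g (hid X)) as e. rewrite (hc_idl (hid X)) in e. rewrite V_assoc. exact e.
    + intros A. rewrite (compF_unt T (Rf X)), (compF_unt (Rf X) T), !(RFun_unt (hM := hM M)). erewrite RFun_Fs by ty. rewrite V_assoc. apply stR_hid.
  - intros A. exact (rst_mu_v s A X).
  - intros A B f. erewrite RFun_Fs by ty. unfold tsR, stR. change (mus f) with (pk (tsq (mu T) f)). change (mus (fh (Rf X) f)) with (pk
    (tsq (mu T) (fh (Rf X) f))).
    unfold sv. rewrite tS_pk, Fs_pk, !V_pk. apply pk_sqeq.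
    pose proof (rst_mu_sq s f (hid X)) as e. apply pk_sqeq in e. apply pk_sqeq.
    rewrite <- !V_pk, V_assoc in e. rewrite <- !V_pk. exact e.
  - intros A. exact (rst_eta_v s A X).
  - intros A B f. erewrite RFun_Fs by ty. unfold tsR, stR. change (etas f) with (pk (tsq (eta T) f)).
    unfold sv. rewrite tS_pk, V_pk. apply pk_sqeq.
    exact (rst_eta_sq s f (hid X)).
  - intros. apply stR_iso.
Qed.

Definition uT' (X Y : D) : S D := pk (bwd (unt (ten M) (X, Y))).

Lemma uT'_is (X Y : D) : Is (uT' X Y) (tenh M (hid X) (hid Y)) (hid (ten0 M X Y)) (vid _) (vid _).
Proof. apply pk_is. Qed.
Lemma uT_uT' (X Y : D) : V (uT X Y) (uT' X Y) = sv (hid (ten0 M X Y)).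
Proof. exact (proj1 (proj1 (giso_S _) (unt_iso (ten_ok M) (X, Y)))). Qed.
Lemma uT'_uT (X Y : D) : V (uT' X Y) (uT X Y) = sv (tenh M (hid X) (hid Y)).
Proof. exact (proj2 (proj1 (giso_S _) (unt_iso (ten_ok M) (X, Y)))). Qed.
Lemma uT'_iso (X Y : D) : Iso (uT' X Y) (tenh M (hid X) (hid Y)) (hid (ten0 M X Y)) (vid _) (vid _).
Proof. split; [apply uT'_is|]. exists (uT X Y), (vid _), (vid _). split; [apply uT_is|]. split; [apply uT'_uT|apply uT_uT']. Qed.
Hint Resolve uT'_is : isdb.
Hint Resolve uT'_iso malS_iso lamS_iso rhoS_iso uI_iso stL_iso stR_iso : isodb.

(** The version of [uT_uT] for inverse unitors, obtained by cancelling the forward ones; it serves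
    [al1], which is corrected by an inverse unitor. *)
Lemma cT_uT' (X Y : D) : V (cT (hid X) (hid Y) (hid X) (hid Y)) (uT' X Y) = H (uT' X Y) (uT' X Y).
Proof.
  eapply (Iso_cancel (r := H (uT X Y) (uT X Y))); [|iso|ty|heq|ty|heq].
  rewrite <- V_assoc, (uT_uT (hM := hM M)), uT_uT'. erewrite VH by ty. rewrite !uT_uT', H_sv, hc_idl. reflexivity.
Qed.

(** * The structural transformations in each variable *)

(** [malS] at [hid Y], [hid Z] ends at [tenh M (hid Y) (hid Z)], whereas the functor tensoring with
    [ten0 M Y Z] uses the identity 1h-cell of that object: hence the inverse unitor below, and
    dually the unitor above in [al3]. In [al2] the fixed variables stay separate. In [lamA] and
    [rhoA], [uI] plays the same part for [Ih M]. *)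
Definition al1 (Y Z A B : D) (f : Hor A B) : S D := V (malS f (hid Y) (hid Z)) (tS (sv f) (uT' Y Z)).
Definition al2 (X Z A B : D) (f : Hor A B) : S D := malS (hid X) f (hid Z).
Definition al3 (X Y A B : D) (f : Hor A B) : S D := V (tS (uT X Y) (sv f)) (malS (hid X) (hid Y) f).
Definition lamA (A B : D) (f : Hor A B) : S D := V (tS uI (sv f)) (lamS f).
Definition rhoA (A B : D) (f : Hor A B) : S D := V (tS (sv f) uI) (rhoS f).
Definition cenL (X X' : D) (v : Ver X X') (A B : D) (f : Hor A B) : S D := tS (sh v) (sv f).
Definition cenR (X X' : D) (v : Ver X X') (A B : D) (f : Hor A B) : S D := tS (sv f) (sh v).

Lemma Nat_al1 (Y Z : D) : Nat (compF (Rf Z) (Rf Y)) (Rf (ten0 M Y Z)) (fun A => malv M A Y Z) (@al1 Y Z).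
Proof.
  unfold al1. split.
  - intros A B f. cbn beta. change (fh (compF (Rf Z) (Rf Y)) f) with (tenh M (tenh M f (hid Y)) (hid Z)).
    change (fh (Rf (ten0 M Y Z)) f) with (tenh M f (hid (ten0 M Y Z))). ty.
  - intros A A' u. pose proof (malv_nat M u (vid Y) (vid Z)) as e. rewrite tenv_vid in e. exact e.
  - intros x A B A' B' f g u v h. rewrite (compF_Fs (Rf Y) (Rf Z) h).
    erewrite !RFun_Fs by ty. rewrite <- V_assoc. erewrite malS_nat by ty. rewrite !V_assoc. f_equal.
    rewrite (tS_sv (hM := hM M)). erewrite !tS_V by ty. erewrite !Vidl, !Vidr by ty. reflexivity.
  - intros A B E f g. rewrite (compF_cmp (Rf Y) (Rf Z)), !(RFun_cmp (hM := hM M)). erewrite RFun_Fs by ty.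
    pose proof (malS_hc M f (hid Y) (hid Z) g (hid Y) (hid Z)) as e. rewrite (hc_idl (hid Y)), (hc_idl (hid Z)) in e.
    change (fh (Rf Y) f) with (tenh M f (hid Y)). change (fh (Rf Y) g) with (tenh M g (hid Y)).
    rewrite V_assoc, <- (V_assoc (tS _ _) (malS _ _ _)), <- (V_assoc (cT _ _ _ _)), e, !V_assoc.
    (* The compositor followed by the inverse unitor is two inverse unitors side by side, one for
       each factor [al1]. *)
    erewrite tS_V by ty. rewrite cT_uT'. erewrite Vidl by ty.
    erewrite <- VH by ty. rewrite V_assoc. f_equal. erewrite tS_cT by ty. rewrite H_sv. reflexivity.
  - intros A. rewrite (compF_unt (Rf Y) (Rf Z)), !(RFun_unt (hM := hM M)). erewrite RFun_Fs by ty.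
    rewrite V_assoc, <- (V_assoc (tS _ _) (malS _ _ _)), <- (V_assoc (uT _ _)), malS_hid, !V_assoc.
    f_equal. erewrite tS_V by ty. rewrite uT_uT'. erewrite Vidl by ty. rewrite (tS_sv (hM := hM M)). erewrite Vidr by ty. reflexivity.
Qed.

Lemma Nat_al2 (X Z : D) : Nat (compF (Rf Z) (Lf X)) (compF (Lf X) (Rf Z)) (fun A => malv M X A Z) (@al2 X Z).
Proof.
  unfold al2. split.
  - intros A B f. apply malS_is.
  - intros A A' u. exact (malv_nat M (vid X) u (vid Z)).
  - intros x A B A' B' f g u v h. rewrite (compF_Fs (Lf X) (Rf Z) h), (compF_Fs (Rf Z) (Lf X) h).
    erewrite !RFun_Fs, !LFun_Fs by ty. eapply malS_nat; ty.
  - intros A B E f g. rewrite (compF_cmp (Lf X) (Rf Z)), (compF_cmp (Rf Z) (Lf X)), !(RFun_cmp (hM := hM M)), !(LFun_cmp (hM := hM M)).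
    erewrite RFun_Fs, LFun_Fs by ty.
    pose proof (malS_hc M (hid X) f (hid Z) (hid X) g (hid Z)) as e. rewrite (hc_idl (hid X)), (hc_idl (hid Z)) in e.
    rewrite V_assoc. exact e.
  - intros A. rewrite (compF_unt (Lf X) (Rf Z)), (compF_unt (Rf Z) (Lf X)), !(RFun_unt (hM := hM M)), !(LFun_unt (hM := hM M)).
    erewrite RFun_Fs, LFun_Fs by ty. rewrite V_assoc. apply malS_hid.
Qed.

Lemma Nat_al3 (X Y : D) : Nat (Lf (ten0 M X Y)) (compF (Lf X) (Lf Y)) (fun A => malv M X Y A) (@al3 X Y).
Proof.
  unfold al3. split.
  - intros A B f. change (fh (compF (Lf X) (Lf Y)) f) with (tenh M (hid X) (tenh M (hid Y) f)).
    change (fh (Lf (ten0 M X Y)) f) with (tenh M (hid (ten0 M X Y)) f). ty.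
  - intros A A' u. pose proof (malv_nat M (vid X) (vid Y) u) as e. rewrite tenv_vid in e. exact e.
  - intros x A B A' B' f g u v h. rewrite (compF_Fs (Lf Y) (Lf X) h).
    erewrite !LFun_Fs by ty. rewrite V_assoc. erewrite <- malS_nat by ty. rewrite <- !V_assoc. f_equal.
    rewrite (tS_sv (hM := hM M)). erewrite !tS_V by ty. erewrite !Vidl, !Vidr by ty. reflexivity.
  - intros A B E f g. rewrite (compF_cmp (Lf Y) (Lf X)), !(LFun_cmp (hM := hM M)). erewrite LFun_Fs by ty.
    pose proof (malS_hc M (hid X) (hid Y) f (hid X) (hid Y) g) as e. rewrite (hc_idl (hid X)), (hc_idl (hid Y)) in e.
    change (fh (Lf Y) f) with (tenh M (hid Y) f). change (fh (Lf Y) g) with (tenh M (hid Y) g).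
    erewrite <- VH by ty. rewrite V_assoc, <- e, <- !V_assoc. f_equal.
    erewrite tS_cT by ty. rewrite V_assoc. erewrite tS_V by ty. rewrite (uT_uT (hM := hM M)), H_sv. erewrite Vidl by ty. reflexivity.
  - intros A. rewrite (compF_unt (Lf Y) (Lf X)), !(LFun_unt (hM := hM M)). erewrite LFun_Fs by ty. apply malS_hid.
Qed.

Lemma Nat_lam : Nat (Lf (I0 M)) (idF D) (fun A => mlamv M A) lamA.
Proof.
  unfold lamA. split.
  - intros A B f. change (fh (Lf (I0 M)) f) with (tenh M (hid (I0 M)) f). change (fh (idF D) f) with f. ty.
  - intros A A' u. exact (lamv_nat M u).
  - intros x A B A' B' f g u v h. rewrite (Fs_id h). erewrite LFun_Fs by ty. rewrite V_assoc. erewrite <- lamS_nat by ty.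
    rewrite <- !V_assoc. f_equal. erewrite !tS_V by ty. erewrite !Vidl, !Vidr by ty. reflexivity.
  - intros A B E f g. rewrite !(LFun_cmp (hM := hM M)).
    change (cmpS (idF D) f g) with (sv (f ** g)). erewrite Vidr by ty. erewrite <- VH by ty.
    rewrite <- (lamS_hc M f g), <- !V_assoc. f_equal. erewrite tS_cT by ty. rewrite V_assoc. erewrite tS_V by ty.
    rewrite uI_cI, H_sv. erewrite Vidr by ty. reflexivity.
  - intros A. rewrite (LFun_unt (hM := hM M)), lamS_hid. symmetry. eapply Vidr; [apply sh_is|reflexivity].
Qed.

Lemma Nat_rho : Nat (Rf (I0 M)) (idF D) (fun A => mrhov M A) rhoA.
Proof.
  unfold rhoA. split.
  - intros A B f. change (fh (Rf (I0 M)) f) with (tenh M f (hid (I0 M))). change (fh (idF D) f) with f. ty.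
  - intros A A' u. exact (rhov_nat M u).
  - intros x A B A' B' f g u v h. rewrite (Fs_id h). erewrite RFun_Fs by ty. rewrite V_assoc. erewrite <- rhoS_nat by ty.
    rewrite <- !V_assoc. f_equal. erewrite !tS_V by ty. erewrite !Vidl, !Vidr by ty. reflexivity.
  - intros A B E f g. rewrite !(RFun_cmp (hM := hM M)).
    change (cmpS (idF D) f g) with (sv (f ** g)). erewrite Vidr by ty. erewrite <- VH by ty.
    rewrite <- (rhoS_hc M f g), <- !V_assoc. f_equal. erewrite tS_cT by ty. rewrite V_assoc. erewrite tS_V by ty.
    rewrite uI_cI, H_sv. erewrite Vidr by ty. reflexivity.
  - intros A. rewrite (RFun_unt (hM := hM M)), rhoS_hid. symmetry. eapply Vidr; [apply sh_is|reflexivity].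
Qed.

Lemma Nat_cenL (X X' : D) (w : Ver X X') : Nat (Lf X) (Lf X') (fun A => tenv M w (vid A)) (cenL w).
Proof.
  unfold cenL. split.
  - intros A B f. change (fh (Lf X) f) with (tenh M (hid X) f). change (fh (Lf X') f) with (tenh M (hid X') f). ty.
  - intros A A' u. change (tenv M (vid X) u // tenv M w (vid A') = tenv M w (vid A) // tenv M (vid X') u).
    rewrite <- !tenv_vc, !vc_idl, !vc_idr. reflexivity.
  - intros x A B A' B' f g u v h. erewrite !LFun_Fs by ty. erewrite !tS_V by ty. erewrite !Vidl, !Vidr by ty. reflexivity.
  - intros A B E f g. rewrite !(LFun_cmp (hM := hM M)). erewrite tS_cT by ty. erewrite Hidl by ty. rewrite H_sv. reflexivity.
  - intros A. rewrite !(LFun_unt (hM := hM M)), (tS_uT (hM := hM M)), sh_vid. reflexivity.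
Qed.

Lemma Nat_cenR (X X' : D) (w : Ver X X') : Nat (Rf X) (Rf X') (fun A => tenv M (vid A) w) (cenR w).
Proof.
  unfold cenR. split.
  - intros A B f. change (fh (Rf X) f) with (tenh M f (hid X)). change (fh (Rf X') f) with (tenh M f (hid X')). ty.
  - intros A A' u. change (tenv M u (vid X) // tenv M (vid A') w = tenv M (vid A) w // tenv M u (vid X')).
    rewrite <- !tenv_vc, !vc_idl, !vc_idr. reflexivity.
  - intros x A B A' B' f g u v h. erewrite !RFun_Fs by ty. erewrite !tS_V by ty. erewrite !Vidl, !Vidr by ty. reflexivity.
  - intros A B E f g. rewrite !(RFun_cmp (hM := hM M)). erewrite tS_cT by ty. erewrite Hidl by ty. rewrite H_sv. reflexivity.
  - intros A. rewrite !(RFun_unt (hM := hM M)), (tS_uT (hM := hM M)), sh_vid. reflexivity.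
Qed.

Lemma Iso_al1 (Y Z A B : D) (f : Hor A B) :
  Iso (al1 Y Z f) (fh (compF (Rf Z) (Rf Y)) f) (fh (Rf (ten0 M Y Z)) f) (malv M A Y Z) (malv M B Y Z).
Proof.
  unfold al1. change (fh (compF (Rf Z) (Rf Y)) f) with (tenh M (tenh M f (hid Y)) (hid Z)).
  change (fh (Rf (ten0 M Y Z)) f) with (tenh M f (hid (ten0 M Y Z))). iso.
Qed.
Lemma Iso_al3 (X Y A B : D) (f : Hor A B) :
  Iso (al3 X Y f) (fh (Lf (ten0 M X Y)) f) (fh (compF (Lf X) (Lf Y)) f) (malv M X Y A) (malv M X Y B).
Proof.
  unfold al3. change (fh (compF (Lf X) (Lf Y)) f) with (tenh M (hid X) (tenh M (hid Y) f)).
  change (fh (Lf (ten0 M X Y)) f) with (tenh M (hid (ten0 M X Y)) f). iso.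
Qed.
Lemma Iso_lam (A B : D) (f : Hor A B) :
  Iso (lamA f) (fh (Lf (I0 M)) f) (fh (idF D) f) (mlamv M A) (mlamv M B).
Proof.
  unfold lamA. change (fh (Lf (I0 M)) f) with (tenh M (hid (I0 M)) f). change (fh (idF D) f) with f. iso.
Qed.
Lemma Iso_rho (A B : D) (f : Hor A B) :
  Iso (rhoA f) (fh (Rf (I0 M)) f) (fh (idF D) f) (mrhov M A) (mrhov M B).
Proof.
  unfold rhoA. change (fh (Rf (I0 M)) f) with (tenh M f (hid (I0 M))). change (fh (idF D) f) with f. iso.
Qed.
Lemma Iso_cenL (X X' : D) (w : Ver X X') (w' : Ver X' X) (A B : D) (f : Hor A B) :
  w // w' = vid _ -> w' // w = vid _ ->
  Iso (cenL w f) (fh (Lf X) f) (fh (Lf X') f) (tenv M w (vid A)) (tenv M w (vid B)).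
Proof. intros e1 e2. exact (tS_iso (hM := hM M) (Iso_sh e1 e2) (Iso_sv f)). Qed.
Lemma Iso_cenR (X X' : D) (w : Ver X X') (w' : Ver X' X) (A B : D) (f : Hor A B) :
  w // w' = vid _ -> w' // w = vid _ ->
  Iso (cenR w f) (fh (Rf X) f) (fh (Rf X') f) (tenv M (vid A) w) (tenv M (vid B) w).
Proof. intros e1 e2. exact (tS_iso (hM := hM M) (Iso_sv f) (Iso_sh e1 e2)). Qed.

Lemma lst_alS (A B C A' B' C' : D) (f : Hor A A') (g : Hor B B') (h : Hor C C') :
  V (malS f g (fh T h)) (V (tS (sv f) (stL g h)) (stL f (tenh M g h))) = V (stL (tenh M f g) h) (Fs T (malS f g h)).
Proof.
  unfold stL, sv. rewrite !malSE, tS_pk, Fs_pk, <- V_assoc, !V_pk. apply pk_sqeq, lst_al_sq.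
Qed.
Lemma rst_alS (A B C A' B' C' : D) (f : Hor A A') (g : Hor B B') (h : Hor C C') :
  V (malS (fh T f) g h) (stR f (tenh M g h)) = V (V (tS (stR f g) (sv h)) (stR (tenh M f g) h)) (Fs T (malS f g h)).
Proof.
  unfold stR, sv. rewrite !malSE, tS_pk, Fs_pk, !V_pk. apply pk_sqeq, rst_al_sq.
Qed.
Lemma bistrongS (A B C A' B' C' : D) (f : Hor A A') (g : Hor B B') (h : Hor C C') :
  V (V (tS (stL f g) (sv h)) (stR (tenh M f g) h)) (Fs T (malS f g h))
  = V (malS f (fh T g) h) (V (tS (sv f) (stR g h)) (stL f (tenh M g h))).
Proof.
  unfold stR, stL, sv. rewrite !malSE, !tS_pk, Fs_pk, <- V_assoc, !V_pk. apply pk_sqeq, (bistrong_sq hts).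
Qed.
Lemma lst_lamS (A A' : D) (f : Hor A A') : lamS (fh T f) = V (stL (Ih M) f) (Fs T (lamS f)).
Proof. unfold stL. rewrite !lamSE, Fs_pk, V_pk. apply pk_sqeq, lst_lam_sq. Qed.
Lemma rst_rhoS (A A' : D) (f : Hor A A') : rhoS (fh T f) = V (stR f (Ih M)) (Fs T (rhoS f)).
Proof. unfold stR. rewrite !rhoSE, Fs_pk, V_pk. apply pk_sqeq, rst_rho_sq. Qed.

Instance L_ok X : is_psfun (Lf X) := LFun_psfun (hM := hM M) X.
Instance R_ok X : is_psfun (Rf X) := RFun_psfun (hM := hM M) X.
Definition tnL X := TNat_of (DLaw_L X).
Definition tnR X := TNat_of (DLaw_R X).

Lemma Compat_al1 (Y Z : D) : Compat (compF (Rf Z) (Rf Y)) (Rf (ten0 M Y Z))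
  (tvC (Rf Z) (tvR Z) (tvR Y)) (tsC (Rf Z) (Rf Y) (tsR Z) (tsR Y)) (tvR (ten0 M Y Z)) (tsR (ten0 M Y Z))
  (fun A => malv M A Y Z) (al1 Y Z).
Proof.
  split.
  - exact (TNat_comp (tnR Z) (tnR Y)).
  - exact (tnR _).
  - apply Nat_al1.
  - exact (Iso_al1 Y Z).
  - intros A. exact (rst_al_v s A Y Z).
  - intros A B f. unfold al1, tsC, tsR. erewrite RFun_Fs by ty.
    (* Naturality of the strength in its second variable carries the inverse unitor past it, after
       which the associativity axiom of the strength applies to what remains. *)
    rewrite V_assoc, <- F_sv. erewrite stR_nat by ty. change (fh (Rf Y) f) with (tenh M f (hid Y)).
    erewrite F_V by ty. rewrite <- !V_assoc, rst_alS. reflexivity.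
Qed.

Lemma Compat_al2 (X Z : D) : Compat (compF (Rf Z) (Lf X)) (compF (Lf X) (Rf Z))
  (tvC (Rf Z) (tvR Z) (tvL X)) (tsC (Rf Z) (Lf X) (tsR Z) (tsL X))
  (tvC (Lf X) (tvL X) (tvR Z)) (tsC (Lf X) (Rf Z) (tsL X) (tsR Z))
  (fun A => malv M X A Z) (al2 X Z).
Proof.
  split.
  - exact (TNat_comp (tnR Z) (tnL X)).
  - exact (TNat_comp (tnL X) (tnR Z)).
  - apply Nat_al2.
  - intros. exact (malS_iso M (hid X) f (hid Z)).
  - intros A. refine (eq_sym (eq_trans (bistrong_v hts X A Z) _)). apply vc_assoc.
  - intros A B f. unfold al2, tsC, tsR, tsL. erewrite LFun_Fs, RFun_Fs by ty.
    symmetry. apply bistrongS.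
Qed.

Lemma Compat_al3 (X Y : D) : Compat (Lf (ten0 M X Y)) (compF (Lf X) (Lf Y))
  (tvL (ten0 M X Y)) (tsL (ten0 M X Y)) (tvC (Lf X) (tvL X) (tvL Y)) (tsC (Lf X) (Lf Y) (tsL X) (tsL Y))
  (fun A => malv M X Y A) (al3 X Y).
Proof.
  split.
  - exact (tnL _).
  - exact (TNat_comp (tnL X) (tnL Y)).
  - apply Nat_al3.
  - exact (Iso_al3 X Y).
  - intros A. refine (eq_trans _ (lst_al_v t X Y A)). symmetry. apply vc_assoc.
  - intros A B f. unfold al3, tsC, tsL. erewrite LFun_Fs by ty. change (fh (Lf Y) f) with (tenh M (hid Y) f).
    rewrite V_assoc, lst_alS, <- V_assoc, <- F_sv. erewrite stL_nat by ty. erewrite F_V by ty. apply V_assoc.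
Qed.

Lemma Compat_lam : Compat (Lf (I0 M)) (idF D) (tvL (I0 M)) (tsL (I0 M)) (fun A => vid (T0 A)) (fun A B f => sv (fh T f))
  (fun A => mlamv M A) lamA.
Proof.
  split.
  - exact (tnL _).
  - exact (TNat_id T).
  - apply Nat_lam.
  - exact Iso_lam.
  - intros A. refine (eq_trans (vc_idr _) _). exact (lst_lam_v t A).
  - intros A B f. unfold lamA, tsL. erewrite (Vidr (g := fh T f)) by ty. rewrite lst_lamS, <- V_assoc, <- F_sv.
    erewrite stL_nat by ty. erewrite F_V by ty. apply V_assoc.
Qed.

Lemma Compat_rho : Compat (Rf (I0 M)) (idF D) (tvR (I0 M)) (tsR (I0 M)) (fun A => vid (T0 A)) (fun A B f => sv (fh T f))
  (fun A => mrhov M A) rhoA.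
Proof.
  split.
  - exact (tnR _).
  - exact (TNat_id T).
  - apply Nat_rho.
  - exact Iso_rho.
  - intros A. refine (eq_trans (vc_idr _) _). exact (rst_rho_v s A).
  - intros A B f. unfold rhoA, tsR. erewrite (Vidr (g := fh T f)) by ty. rewrite rst_rhoS, <- V_assoc, <- F_sv.
    erewrite stR_nat by ty. erewrite F_V by ty. apply V_assoc.
Qed.

Lemma Compat_cenL (X X' : D) (w : Ver X X') (w' : Ver X' X) :
  w // w' = vid _ -> w' // w = vid _ ->
  Compat (Lf X) (Lf X') (tvL X) (tsL X) (tvL X') (tsL X') (fun A => tenv M w (vid A)) (cenL w).
Proof.
  intros e1 e2. split.
  - exact (tnL _).
  - exact (tnL _).
  - apply Nat_cenL.
  - intros. exact (Iso_cenL f e1 e2).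
  - intros A. rewrite <- (fv_id T A). apply stL_nv.
  - intros A B f. unfold cenL, tsL. rewrite <- F_sv. eapply stL_nat; ty.
Qed.

Lemma Compat_cenR (X X' : D) (w : Ver X X') (w' : Ver X' X) :
  w // w' = vid _ -> w' // w = vid _ ->
  Compat (Rf X) (Rf X') (tvR X) (tsR X) (tvR X') (tsR X') (fun A => tenv M (vid A) w) (cenR w).
Proof.
  intros e1 e2. split.
  - exact (tnR _).
  - exact (tnR _).
  - apply Nat_cenR.
  - intros. exact (Iso_cenR f e1 e2).
  - intros A. rewrite <- (fv_id T A). apply stR_nv.
  - intros A B f. unfold cenR, tsR. rewrite <- F_sv. eapply stR_nat; ty.
Qed.

(** * Pentagons and triangles *)

Lemma pentS (A B C E A' B' C' E' : D) (f : Hor A A') (g : Hor B B') (h : Hor C C') (k : Hor E E') :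
  V (tS (malS f g h) (sv k)) (V (malS f (tenh M g h) k) (tS (sv f) (malS g h k)))
  = V (malS (tenh M f g) h k) (malS f g (tenh M h k)).
Proof.
  unfold sv. rewrite !malSE, !tS_pk, <- V_assoc, !V_pk. apply pk_sqeq, m_pentagon_sq.
Qed.
Lemma triS (A B A' B' : D) (f : Hor A A') (g : Hor B B') :
  V (malS f (Ih M) g) (tS (sv f) (lamS g)) = tS (rhoS f) (sv g).
Proof. unfold sv. rewrite malSE, lamSE, rhoSE, !tS_pk, !V_pk. apply pk_sqeq, m_triangle_sq. Qed.
Lemma trilS (A B A' B' : D) (f : Hor A A') (g : Hor B B') :
  V (malS (Ih M) f g) (lamS (tenh M f g)) = tS (lamS f) (sv g).
Proof. unfold sv. rewrite malSE, !lamSE, !tS_pk, !V_pk. apply pk_sqeq, m_triangle_l_sq. Qed.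
Lemma trirS (A B A' B' : D) (f : Hor A A') (g : Hor B B') :
  V (malS f g (Ih M)) (tS (sv f) (rhoS g)) = rhoS (tenh M f g).
Proof. unfold sv. rewrite malSE, !rhoSE, !tS_pk, !V_pk. apply pk_sqeq, m_triangle_r_sq. Qed.

(** The unit axiom of the associator rewritten for inverse unitors. It exchanges the associator at
    identity 1h-cells with the identity square on its component in the form needed for [al1]. *)
Lemma malS_hid' (A B C : D) :
  V (V (tS (uT' A B) (sv (hid C))) (uT' (ten0 M A B) C)) (sh (malv M A B C))
  = V (malS (hid A) (hid B) (hid C)) (V (tS (sv (hid A)) (uT' B C)) (uT' A (ten0 M B C))).
Proof.
  eapply (Iso_cancel (r := V (uT (ten0 M A B) C) (tS (uT A B) (sv (hid C))))); [|iso|ty|heq|ty|heq].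
  transitivity (sh (malv M A B C)).
  - rewrite !V_assoc, <- (V_assoc (tS (uT _ _) _)). erewrite tS_V by ty. rewrite uT_uT'. erewrite Vidl by ty.
    rewrite (tS_sv (hM := hM M)). erewrite (Vidl (s := V (uT' _ _) _)) by ty. rewrite <- V_assoc, uT_uT'.
    eapply Vidl; ty.
  - rewrite V_assoc, <- (V_assoc (tS (uT _ _) _)), <- (V_assoc (uT _ _)), malS_hid, !V_assoc, <- (V_assoc (tS _ (uT _ _))).
    erewrite tS_V by ty. rewrite uT_uT'. erewrite (Vidl (s := sv (hid A))) by ty. rewrite (tS_sv (hM := hM M)).
    erewrite (Vidl (s := uT' _ _)) by ty. rewrite uT_uT'. symmetry. eapply Vidr; ty.
Qed.

Lemma lamS_hid' (Y : D) : V (tS uI (sv (hid Y))) (lamS (hid Y)) = V (uT' (I0 M) Y) (sh (mlamv M Y)).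
Proof. rewrite <- lamS_hid, <- V_assoc, uT'_uT. symmetry. eapply Vidl; ty. Qed.
Lemma rhoS_hid' (Y : D) : V (tS (sv (hid Y)) uI) (rhoS (hid Y)) = V (uT' Y (I0 M)) (sh (mrhov M Y)).
Proof. rewrite <- rhoS_hid, <- V_assoc, uT'_uT. symmetry. eapply Vidl; ty. Qed.

Lemma pent_W (X Y Z A B : D) (f : Hor A B) :
  V (V (Fs (Rf Z) (al1 X Y f)) (al1 (ten0 M X Y) Z f)) (cenR (malv M X Y Z) f)
  = V (al1 Y Z (fh (Rf X) f)) (al1 X (ten0 M Y Z) f).
Proof.
  change (fh (Rf X) f) with (tenh M f (hid X)). unfold al1, cenR. erewrite RFun_Fs by ty.
  transitivity (V (tS (malS f (hid X) (hid Y)) (sv (hid Z))) (V (malS f (tenh M (hid X) (hid Y)) (hid Z))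
    (tS (sv f) (V (V (tS (uT' X Y) (sv (hid Z))) (uT' (ten0 M X Y) Z)) (sh (malv M X Y Z)))))).
  - transitivity (V (tS (malS f (hid X) (hid Y)) (sv (hid Z))) (V (tS (tS (sv f) (uT' X Y)) (sv (hid Z)))
      (V (malS f (hid (ten0 M X Y)) (hid Z)) (V (tS (sv f) (uT' (ten0 M X Y) Z)) (tS (sv f) (sh (malv M X Y Z))))))).
    + rewrite !V_assoc, <- !(V_assoc (tS (malS _ _ _) _)). f_equal. erewrite tS_V by ty. erewrite Vidl by ty. reflexivity.
    + f_equal. rewrite <- V_assoc. erewrite malS_nat by ty. rewrite V_assoc. f_equal. erewrite !tS_V by ty.
      erewrite !Vidl by ty. rewrite V_assoc. reflexivity.
  (* The central structure contributes the identity square on the associator where the pentagon of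
     [D] has [malS] at three identities; inverse unitors convert one into the other. *)
  - rewrite malS_hid'.
    transitivity (V (tS (malS f (hid X) (hid Y)) (sv (hid Z))) (V (malS f (tenh M (hid X) (hid Y)) (hid Z))
      (V (tS (sv f) (malS (hid X) (hid Y) (hid Z))) (V (tS (sv f) (tS (sv (hid X)) (uT' Y Z))) (tS (sv f) (uT' X (ten0 M Y Z))))))).
    + f_equal. f_equal. erewrite !tS_V by ty. erewrite !Vidl by ty. reflexivity.
    + rewrite <- (V_assoc (malS f _ _)), <- (V_assoc (tS (malS _ _ _) _)), pentS, !V_assoc. f_equal.
      rewrite <- !V_assoc. f_equal. erewrite <- malS_nat by ty. rewrite (tS_sv (hM := hM M)). reflexivity.
Qed.

Lemma pent_X (W Y Z A B : D) (f : Hor A B) :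
  V (V (Fs (Rf Z) (al2 W Y f)) (al2 W Z (fh (Rf Y) f))) (Fs (Lf W) (al1 Y Z f))
  = V (al1 Y Z (fh (Lf W) f)) (al2 W (ten0 M Y Z) f).
Proof.
  change (fh (Rf Y) f) with (tenh M f (hid Y)). change (fh (Lf W) f) with (tenh M (hid W) f).
  unfold al1, al2. erewrite RFun_Fs, LFun_Fs by ty.
  transitivity (V (V (tS (malS (hid W) f (hid Y)) (sv (hid Z))) (V (malS (hid W) (tenh M f (hid Y)) (hid Z))
    (tS (sv (hid W)) (malS f (hid Y) (hid Z))))) (tS (sv (hid W)) (tS (sv f) (uT' Y Z)))).
  - rewrite !V_assoc. f_equal. f_equal. erewrite tS_V by ty. erewrite Vidl by ty. reflexivity.
  - rewrite pentS, !V_assoc. f_equal. erewrite <- malS_nat by ty. rewrite (tS_sv (hM := hM M)). reflexivity.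
Qed.

Lemma pent_Y (W X Z A B : D) (f : Hor A B) :
  V (V (Fs (Rf Z) (al3 W X f)) (al2 W Z (fh (Lf X) f))) (Fs (Lf W) (al2 X Z f))
  = V (al2 (ten0 M W X) Z f) (al3 W X (fh (Rf Z) f)).
Proof.
  change (fh (Rf Z) f) with (tenh M f (hid Z)). change (fh (Lf X) f) with (tenh M (hid X) f).
  unfold al3, al2. erewrite RFun_Fs, LFun_Fs by ty.
  transitivity (V (tS (tS (uT W X) (sv f)) (sv (hid Z))) (V (tS (malS (hid W) (hid X) f) (sv (hid Z))) (V (malS (hid W) (tenh M (hid X) f) (hid Z))
    (tS (sv (hid W)) (malS (hid X) f (hid Z)))))).
  - rewrite !V_assoc, <- (V_assoc (tS (tS _ _) _)). f_equal. erewrite tS_V by ty. erewrite Vidl by ty. reflexivity.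
  - rewrite pentS, <- !V_assoc. f_equal. erewrite malS_nat by ty. rewrite (tS_sv (hM := hM M)). reflexivity.
Qed.

Lemma pent_Z (W X Y A B : D) (f : Hor A B) :
  V (V (cenL (malv M W X Y) f) (al3 W (ten0 M X Y) f)) (Fs (Lf W) (al3 X Y f))
  = V (al3 (ten0 M W X) Y f) (al3 W X (fh (Lf Y) f)).
Proof.
  change (fh (Lf Y) f) with (tenh M (hid Y) f). unfold al3, cenL. erewrite LFun_Fs by ty.
  transitivity (V (tS (V (sh (malv M W X Y)) (V (uT W (ten0 M X Y)) (tS (sv (hid W)) (uT X Y)))) (sv f))
    (V (malS (hid W) (tenh M (hid X) (hid Y)) f) (tS (sv (hid W)) (malS (hid X) (hid Y) f)))).
  - transitivity (V (tS (sh (malv M W X Y)) (sv f)) (V (tS (uT W (ten0 M X Y)) (sv f)) (V (malS (hid W) (hid (ten0 M X Y)) f)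
      (V (tS (sv (hid W)) (tS (uT X Y) (sv f))) (tS (sv (hid W)) (malS (hid X) (hid Y) f)))))).
    + rewrite !V_assoc. f_equal. f_equal. f_equal. erewrite tS_V by ty. erewrite Vidl by ty. reflexivity.
    + rewrite <- (V_assoc (malS _ _ _)). erewrite <- malS_nat by ty. rewrite <- !V_assoc. f_equal. f_equal.
      erewrite !tS_V by ty. erewrite !Vidl by ty. reflexivity.
  (* Dually, the identity square on the associator becomes [malS] at identities by means of the
     unitors, so that the pentagon of [D] applies. *)
  - rewrite <- malS_hid.
    transitivity (V (tS (uT (ten0 M W X) Y) (sv f)) (V (tS (tS (uT W X) (sv (hid Y))) (sv f)) (V (tS (malS (hid W) (hid X) (hid Y)) (sv f))
      (V (malS (hid W) (tenh M (hid X) (hid Y)) f) (tS (sv (hid W)) (malS (hid X) (hid Y) f)))))).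
    + rewrite <- !V_assoc. f_equal. f_equal. erewrite !tS_V by ty. erewrite !Vidl by ty. reflexivity.
    + rewrite pentS, !V_assoc. f_equal. rewrite <- !V_assoc. f_equal. erewrite malS_nat by ty. rewrite (tS_sv (hM := hM M)). reflexivity.
Qed.

Lemma tri_W (Y A B : D) (f : Hor A B) :
  V (al1 (I0 M) Y f) (cenR (mlamv M Y) f) = Fs (Rf Y) (rhoA f).
Proof.
  (* Behind the inverse unitor, the identity square on the left unitor equals [uI] followed by
     [lamS] at an identity; this introduces the 1h-cell [Ih M], at which the triangle of [D] is
     available. *)
  unfold al1, cenR, rhoA. erewrite RFun_Fs by ty. rewrite V_assoc. erewrite tS_V by ty. rewrite <- lamS_hid'.
  transitivity (V (malS f (hid (I0 M)) (hid Y)) (V (tS (sv f) (tS uI (sv (hid Y)))) (tS (sv f) (lamS (hid Y))))).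
  - f_equal. erewrite tS_V by ty. reflexivity.
  - rewrite <- V_assoc. erewrite <- malS_nat by ty. rewrite V_assoc, triS. erewrite tS_V by ty. erewrite Vidl by ty. reflexivity.
Qed.

Lemma tri_Y (W A B : D) (f : Hor A B) :
  V (al3 W (I0 M) f) (Fs (Lf W) (lamA f)) = cenL (mrhov M W) f.
Proof.
  unfold al3, cenL, lamA. erewrite LFun_Fs by ty.
  transitivity (V (tS (uT W (I0 M)) (sv f)) (V (malS (hid W) (hid (I0 M)) f) (V (tS (sv (hid W)) (tS uI (sv f))) (tS (sv (hid W)) (lamS f))))).
  - rewrite V_assoc. f_equal. f_equal. erewrite tS_V by ty. erewrite Vidl by ty. reflexivity.
  - rewrite <- (V_assoc (malS _ _ _)). erewrite <- malS_nat by ty. rewrite V_assoc, triS. erewrite !tS_V by ty.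
    rewrite rhoS_hid. erewrite !Vidl by ty. reflexivity.
Qed.

Lemma tri_lW (Y A B : D) (f : Hor A B) :
  V (al2 (I0 M) Y f) (lamA (fh (Rf Y) f)) = Fs (Rf Y) (lamA f).
Proof.
  change (fh (Rf Y) f) with (tenh M f (hid Y)). unfold al2, lamA. erewrite RFun_Fs by ty.
  rewrite <- V_assoc, <- (tS_sv (hM := hM M) f (hid Y)). erewrite <- malS_nat by ty. rewrite V_assoc, trilS.
  erewrite tS_V by ty. erewrite Vidl by ty. reflexivity.
Qed.

Lemma tri_lY (W A B : D) (f : Hor A B) :
  V (al3 (I0 M) W f) (lamA (fh (Lf W) f)) = cenL (mlamv M W) f.
Proof.
  change (fh (Lf W) f) with (tenh M (hid W) f). unfold al3, lamA, cenL.
  rewrite V_assoc, <- (V_assoc (malS _ _ _)), <- (tS_sv (hM := hM M) (hid W) f). erewrite <- malS_nat by ty.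
  rewrite V_assoc, trilS. erewrite !tS_V by ty. rewrite lamS_hid. erewrite !Vidl by ty. reflexivity.
Qed.

Lemma tri_rW (Y A B : D) (f : Hor A B) :
  V (al1 Y (I0 M) f) (cenR (mrhov M Y) f) = rhoA (fh (Rf Y) f).
Proof.
  change (fh (Rf Y) f) with (tenh M f (hid Y)). unfold al1, rhoA, cenR. rewrite V_assoc. erewrite tS_V by ty.
  rewrite <- rhoS_hid'.
  transitivity (V (malS f (hid Y) (hid (I0 M))) (V (tS (sv f) (tS (sv (hid Y)) uI)) (tS (sv f) (rhoS (hid Y))))).
  - f_equal. erewrite tS_V by ty. reflexivity.
  - rewrite <- V_assoc. erewrite <- malS_nat by ty. rewrite V_assoc, trirS, (tS_sv (hM := hM M)). reflexivity.
Qed.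

Lemma tri_rY (W A B : D) (f : Hor A B) :
  V (al2 W (I0 M) f) (Fs (Lf W) (rhoA f)) = rhoA (fh (Lf W) f).
Proof.
  change (fh (Lf W) f) with (tenh M (hid W) f). unfold al2, rhoA. erewrite LFun_Fs by ty.
  transitivity (V (malS (hid W) f (hid (I0 M))) (V (tS (sv (hid W)) (tS (sv f) uI)) (tS (sv (hid W)) (rhoS f)))).
  - f_equal. erewrite tS_V by ty. erewrite Vidl by ty. reflexivity.
  - rewrite <- V_assoc. erewrite <- malS_nat by ty. rewrite V_assoc, trirS, (tS_sv (hM := hM M)). reflexivity.
Qed.

End StrS.

(** * The premonoidal structure *)

Section Prem.
Context {D : DblData} {hD : is_double D} (M : Monoidal D) (T : VMonad D).
Existing Instances hM hT L_ok R_ok.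
Variables (t : LStrength M T) (s : RStrength M T) (hts : Bistrong t s)
  (it : Invertible (lst t)) (ct : Liftable (lst t)) (is : Invertible (rst s)) (cs : Liftable (rst s))
  (imu : Invertible (mu T)) (cmu : Liftable (mu T)) (ieta : Invertible (eta T)) (ceta : Liftable (eta T)).
Notation K := (Kl (lift_monad imu cmu ieta ceta)).
Notation T0 := (T0 T).
Notation Lf := (LFun M).
Notation Rf := (RFun M).
Notation tL X := (tnL it X).
Notation tR X := (tnR is X).

Definition ltS (X : D) := lift_fun imu cmu ieta ceta (F := Lf X) (DLaw_L it X) (fun Y => ct (X, Y)).
Definition rtS (X : D) := lift_fun imu cmu ieta ceta (F := Rf X) (DLaw_R is X) (fun Y => cs (Y, X)).
Definition ltK (X : D) : @FunData K K (fun Y => ten0 M X Y) := projT1 (ltS X).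
Definition rtK (X : D) : @FunData K K (fun Y => ten0 M Y X) := projT1 (rtS X).
Definition UL (X A B : D) : Hor A (T0 B) -> S D := proj1_sig (projT2 (ltS X)) A B.
Definition UR (X A B : D) : Hor A (T0 B) -> S D := proj1_sig (projT2 (rtS X)) A B.

Lemma repL (X : D) : Rep (ltK X) (Lf X) (tvL t X) (tsL t X) (UL X).
Proof. exact (proj1 (proj2_sig (projT2 (ltS X)))). Qed.
Lemma repR (X : D) : Rep (rtK X) (Rf X) (tvR s X) (tsR s X) (UR X).
Proof. exact (proj1 (proj2_sig (projT2 (rtS X)))). Qed.
Lemma ltK_ok (X : D) : is_psfun (ltK X).
Proof. exact (proj2 (proj2_sig (projT2 (ltS X)))). Qed.
Lemma rtK_ok (X : D) : is_psfun (rtK X).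
Proof. exact (proj2 (proj2_sig (projT2 (rtS X)))). Qed.

Definition binK : Binoidal K :=
  @Build_Binoidal K (fun X Y => ten0 M X Y) ltK rtK ltK_ok rtK_ok.

Lemma repRR (Y Z : D) : Rep (compF (rtK Z) (rtK Y)) (compF (Rf Z) (Rf Y)) (tvC (Rf Z) (tvR s Z) (tvR s Y))
  (tsC (Rf Z) (Rf Y) (tsR s Z) (tsR s Y)) (UC (rtK Y) (Rf Z) (UR Z) (UR Y)).
Proof. exact (Rep_comp (tR Z) (tR Y) (repR Z) (repR Y)). Qed.
Lemma repRL (X Z : D) : Rep (compF (rtK Z) (ltK X)) (compF (Rf Z) (Lf X)) (tvC (Rf Z) (tvR s Z) (tvL t X))
  (tsC (Rf Z) (Lf X) (tsR s Z) (tsL t X)) (UC (ltK X) (Rf Z) (UR Z) (UL X)).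
Proof. exact (Rep_comp (tR Z) (tL X) (repR Z) (repL X)). Qed.
Lemma repLR (X Z : D) : Rep (compF (ltK X) (rtK Z)) (compF (Lf X) (Rf Z)) (tvC (Lf X) (tvL t X) (tvR s Z))
  (tsC (Lf X) (Rf Z) (tsL t X) (tsR s Z)) (UC (rtK Z) (Lf X) (UL X) (UR Z)).
Proof. exact (Rep_comp (tL X) (tR Z) (repL X) (repR Z)). Qed.
Lemma repLL (X Y : D) : Rep (compF (ltK X) (ltK Y)) (compF (Lf X) (Lf Y)) (tvC (Lf X) (tvL t X) (tvL t Y))
  (tsC (Lf X) (Lf Y) (tsL t X) (tsL t Y)) (UC (ltK Y) (Lf X) (UL X) (UL Y)).
Proof. exact (Rep_comp (tL X) (tL Y) (repL X) (repL Y)). Qed.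
Notation repI := (Rep_id imu cmu ieta ceta).

Definition al1K (Y Z : D) := lift_VT (Compat_al1 is Y Z) (repRR Y Z) (repR _).
Definition al2K (X Z : D) := lift_VT (Compat_al2 hts it is X Z) (repRL X Z) (repLR X Z).
Definition al3K (X Y : D) := lift_VT (Compat_al3 it X Y) (repL _) (repLL X Y).
Definition lamK := lift_VT (Compat_lam it) (repL _) repI.
Definition rhoK := lift_VT (Compat_rho is) (repR _) repI.

Section Central.
Variables (X X' : D) (w : Ver X X') (w' : Ver X' X).
Hypotheses (e1 : w // w' = vid X) (e2 : w' // w = vid X').

Definition cenLK := lift_VT (Compat_cenL it e1 e2) (repL X) (repL X').
Definition cenRK := lift_VT (Compat_cenR is e1 e2) (repR X) (repR X').

Definition cenK : @Central K binK X X' w :=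
  @Build_Central K binK X X' w cenLK cenRK (vt_ok cenLK) (vt_ok cenRK)
    (fun C => eq_sym (r_v (repR C) w)) (fun C => eq_sym (r_v (repL C) w)).
End Central.

Lemma cenL_V (X X' : D) (w : Ver X X') (w' : Ver X' X) (A B : D) (f : Hor A B) :
  w // w' = vid X -> V (cenL M w f) (cenL M w' f) = sv (fh (Lf X) f).
Proof. intros e. unfold cenL. erewrite tS_V by ty. rewrite V_sh, e, sh_vid. erewrite Vidl by ty. rewrite (tS_sv (hM := hM M)). reflexivity. Qed.
Lemma cenR_V (X X' : D) (w : Ver X X') (w' : Ver X' X) (A B : D) (f : Hor A B) :
  w // w' = vid X -> V (cenR M w f) (cenR M w' f) = sv (fh (Rf X) f).
Proof. intros e. unfold cenR. erewrite tS_V by ty. rewrite V_sh, e, sh_vid. erewrite Vidl by ty. rewrite (tS_sv (hM := hM M)). reflexivity. Qed.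

(** The inverse laws hold for the squares of [D] and pass to the lifts by [Lifts_sqv]. The
    definition is transparent so that the central structure it contains reduces to [cenLK] and
    [cenRK]. *)
Definition icenK (X X' : D) (w : Ver X X') (w' : Ver X' X) (e1 : w // w' = vid X) (e2 : w' // w = vid X') :
  @InvCentral K binK X X' w.
Proof.
  refine (@Build_InvCentral K binK X X' w w' e1 e2 (cenK e1 e2) (cenK e2 e1) _ _ _ _).
  - refine (Lifts_sqv (repL X) (lift_vt_Lifts _ _ _) (lift_vt_Lifts _ _ _) _ (fun A B f => cenL_V f e1)).
    intros A. exact (eq_trans (eq_sym (tenv_vc M w w' (vid A) (vid A))) (eq_trans (f_equal2 (fun x y => tenv M x y) e1 (vc_idl _)) (tenv_vid M X A))).
  - refine (Lifts_sqv (repL X') (lift_vt_Lifts _ _ _) (lift_vt_Lifts _ _ _) _ (fun A B f => cenL_V f e2)).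
    intros A. exact (eq_trans (eq_sym (tenv_vc M w' w (vid A) (vid A))) (eq_trans (f_equal2 (fun x y => tenv M x y) e2 (vc_idl _))
      (tenv_vid M X' A))).
  - refine (Lifts_sqv (repR X) (lift_vt_Lifts _ _ _) (lift_vt_Lifts _ _ _) _ (fun A B f => cenR_V f e1)).
    intros A. exact (eq_trans (eq_sym (tenv_vc M (vid A) (vid A) w w')) (eq_trans (f_equal2 (fun x y => tenv M x y) (vc_idl _) e1) (tenv_vid M A X))).
  - refine (Lifts_sqv (repR X') (lift_vt_Lifts _ _ _) (lift_vt_Lifts _ _ _) _ (fun A B f => cenR_V f e2)).
    intros A. exact (eq_trans (eq_sym (tenv_vc M (vid A) (vid A) w' w)) (eq_trans (f_equal2 (fun x y => tenv M x y) (vc_idl _) e2)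
      (tenv_vid M A X'))).
Defined.

(** The inverse of the component is the left side of the inverse square at an identity 1h-cell, and
    likewise for the other two structural cells. *)
Definition lam_cenK (X : D) : @InvCentral K binK _ _ (mlamv M X) :=
  icenK (inv_l1 (mlam_inv M (hid X))) (inv_l2 (mlam_inv M (hid X))).
Definition rho_cenK (X : D) : @InvCentral K binK _ _ (mrhov M X) :=
  icenK (inv_l1 (mrho_inv M (hid X))) (inv_l2 (mrho_inv M (hid X))).
Definition al_cenK (X Y Z : D) : @InvCentral K binK _ _ (malv M X Y Z) :=
  icenK (inv_l1 (mal_inv M (A := (X, Y, Z)) (B := (X, Y, Z)) (hid X, hid Y, hid Z)))
    (inv_l2 (mal_inv M (A := (X, Y, Z)) (B := (X, Y, Z)) (hid X, hid Y, hid Z))).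

Lemma UC_id_l (F0 : D -> D) (HD : @FunData K K F0) (F : FunData F0) tv ts UF (repF : Rep HD F tv ts UF) (A B : D) (f : Hor A (T0 B)) :
  UC (F0 := fun A => A) HD (idF D) (fun A B f => sv f) UF f = UF A B f.
Proof. unfold UC. pose proof (r_iso repF f) as i. rewrite (Fs_id (Iso_is i)). eapply Vidr; [apply (Iso_is i)|reflexivity]. Qed.
Lemma UC_id_r (F0 : D -> D) (HD : @FunData K K F0) (F : FunData F0) tv ts UF (repF : Rep HD F tv ts UF) {psF : is_psfun F} (A B : D)
  (f : Hor A (T0 B)) :
  UC (G0 := fun A => A) (idF K) F UF (fun A B f => sv f) f = UF A B f.
Proof. unfold UC. pose proof (r_iso repF f) as i. rewrite F_sv. eapply Vidl; [apply (Iso_is i)|reflexivity]. Qed.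

Instance Kl_ok : is_pseudodouble K := Kl_pseudodouble imu cmu ieta ceta.
Existing Instances ltK_ok rtK_ok.

Section CentralFacts.
Variables (X X' : D) (w : Ver X X') (w' : Ver X' X).
Hypotheses (e1 : w // w' = vid X) (e2 : w' // w = vid X').
Lemma cen_r_strict : Strict (cen_r (icenK e1 e2)).
Proof. exact (Strict_vt (cenRK e1 e2)). Qed.
Lemma cen_l_strict : Strict (cen_l (icenK e1 e2)).
Proof. exact (Strict_vt (cenLK e1 e2)). Qed.
Lemma cen_r_Lifts : Lifts (UR X) (UR X') (cen_r (icenK e1 e2)) (cenR M w).
Proof. exact (lift_vt_Lifts (Compat_cenR is e1 e2) (repR X) (repR X')). Qed.
Lemma cen_l_Lifts : Lifts (UL X) (UL X') (cen_l (icenK e1 e2)) (cenL M w).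
Proof. exact (lift_vt_Lifts (Compat_cenL it e1 e2) (repL X) (repL X')). Qed.
End CentralFacts.

Lemma al1_Lifts Y Z : Lifts (UC (rtK Y) (Rf Z) (UR Z) (UR Y)) (UR (ten0 M Y Z)) (al1K Y Z) (al1 M Y Z).
Proof. apply lift_vt_Lifts. Qed.
Lemma al2_Lifts X Z : Lifts (UC (ltK X) (Rf Z) (UR Z) (UL X)) (UC (rtK Z) (Lf X) (UL X) (UR Z)) (al2K X Z) (al2 M X Z).
Proof. apply lift_vt_Lifts. Qed.
Lemma al3_Lifts X Y : Lifts (UL (ten0 M X Y)) (UC (ltK Y) (Lf X) (UL X) (UL Y)) (al3K X Y) (al3 M X Y).
Proof. apply lift_vt_Lifts. Qed.

Lemma fvL (X A B : D) (u : Ver A B) : @fv K K _ (ltK X) A B u = tenv M (vid X) u.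
Proof. exact (r_v (repL X) u). Qed.
Lemma fvR (X A B : D) (u : Ver A B) : @fv K K _ (rtK X) A B u = tenv M u (vid X).
Proof. exact (r_v (repR X) u). Qed.

Lemma lam_Lifts : Lifts (UL (I0 M)) (fun A B f => sv f) lamK (lamA M).
Proof. apply lift_vt_Lifts. Qed.
Lemma rho_Lifts : Lifts (UR (I0 M)) (fun A B f => sv f) rhoK (rhoA M).
Proof. apply lift_vt_Lifts. Qed.

Notation rfl := (fun _ => eq_refl).
Notation sl X := (Strict_whl (hK := ltK_ok X)).
Notation sr X := (Strict_whl (hK := rtK_ok X)).
Notation st x := (Strict_vt x).
Notation sc := Strict_comp.

Lemma Lifts_conv (F0 G0 : D -> D) (P : @PreFun K K F0) (Q : @PreFun K K G0) (al : VPs P Q) UF UG UF' UG' a :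
  Lifts UF UG al a -> (forall A B (f : Hor A (T0 B)), UF A B f = UF' A B f) -> (forall A B (f : Hor A (T0 B)), UG A B f = UG' A B f) ->
  Lifts UF' UG' al a.
Proof. intros h e1 e2 A B f. rewrite <- e1, <- e2. apply h. Qed.

(** This is the pattern of all ten coherence laws: both sides are strict and lift composite families
    of [D], these families agree by the one-variable law proved there, and the universal squares
    agree up to bracketing. *)
Lemma pentagon_W X Y Z :
  vps_eq (whl (rtK Z) (al1K X Y) //> al1K (ten0 M X Y) Z //> cen_r (al_cenK X Y Z))
           (whr (al1K Y Z) (rtK X) //> al1K X (ten0 M Y Z)).
Proof.
  refine (Lifts_vps_eq
   (sc (sc (sr Z (st (al1K X Y))) (st (al1K (ten0 M X Y) Z))) (cen_r_strict _ _))
   (sc (Strict_whr (rtK X) (st (al1K Y Z))) (st (al1K X (ten0 M Y Z)))) _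
   (Lifts_comp (Lifts_comp (Lifts_whl (Compat_al1 is X Y) (repRR X Y) (repR _) (al1_Lifts X Y) rfl (psL := R_ok M Z) (repR Z))
     (al1_Lifts (ten0 M X Y) Z)) (cen_r_Lifts _ _))
   (Lifts_comp (Lifts_whr (Compat_al1 is Y Z) (al1_Lifts Y Z) (repR X)) (al1_Lifts X (ten0 M Y Z)))
   (fun A B f => r_iso (Rep_comp (tR Z) (TNat_comp (psF := R_ok M Y) (tR Y) (tR X)) (repR Z) (repRR X Y)) f)
   (fun A B f => UC_assoc (psF := R_ok M Z) (psG := R_ok M Y) (repR Z) (repR Y) (repR X) f)
   (fun A B f => eq_refl) (fun A B f => pent_W M X Y Z f)).
  (* The functor [rtK Z] is opaque, so its action on 1v-cells is identified with tensoring through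
     [fvR]. *)
  intros W. pose proof (m_pentagon_v M W X Y Z) as e. rewrite <- fvR in e. exact e.
Qed.
Lemma pentagon_X W Y Z :
  vps_eq (whl (rtK Z) (al2K W Y) //> whr (al2K W Z) (rtK Y) //> whl (ltK W) (al1K Y Z))
           (whr (al1K Y Z) (ltK W) //> al2K W (ten0 M Y Z)).
Proof.
  refine (Lifts_vps_eq
   (sc (sc (sr Z (st (al2K W Y))) (Strict_whr (rtK Y) (st (al2K W Z)))) (sl W (st (al1K Y Z))))
   (sc (Strict_whr (ltK W) (st (al1K Y Z))) (st (al2K W (ten0 M Y Z)))) _
   (Lifts_comp (Lifts_comp
     (Lifts_whl (Compat_al2 hts it is W Y) (repRL W Y) (repLR W Y) (al2_Lifts W Y) rfl (psL := R_ok M Z) (repR Z))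
     (* Whiskering on the right brackets the universal squares of both ends differently from the
        neighbouring lifts; [UC_assoc] rebrackets them so that the three lifts compose. *)
     (Lifts_conv (Lifts_whr (Compat_al2 hts it is W Z) (al2_Lifts W Z) (repR Y))
       (fun A B f => eq_sym (UC_assoc (psF := R_ok M Z) (psG := L_ok M W) (repR Z) (repL W) (repR Y) f))
       (fun A B f => eq_sym (UC_assoc (psF := L_ok M W) (psG := R_ok M Z) (repL W) (repR Z) (repR Y) f))))
     (Lifts_whl (Compat_al1 is Y Z) (repRR Y Z) (repR _) (al1_Lifts Y Z) rfl (psL := L_ok M W) (repL W)))
   (Lifts_comp (Lifts_whr (Compat_al1 is Y Z) (al1_Lifts Y Z) (repL W)) (al2_Lifts W (ten0 M Y Z)))
   (fun A B f => r_iso (Rep_comp (tR Z) (TNat_comp (psF := R_ok M Y) (tR Y) (tL W)) (repR Z) (repRL W Y)) f)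
   (fun A B f => UC_assoc (psF := R_ok M Z) (psG := R_ok M Y) (repR Z) (repR Y) (repL W) f)
   (fun A B f => eq_refl) (fun A B f => pent_X M W Y Z f)).
  intros X. pose proof (m_pentagon_v M W X Y Z) as e. rewrite <- fvR, <- fvL in e. exact e.
Qed.

Lemma pentagon_Y W X Z :
  vps_eq (whl (rtK Z) (al3K W X) //> whr (al2K W Z) (ltK X) //> whl (ltK W) (al2K X Z))
           (al2K (ten0 M W X) Z //> whr (al3K W X) (rtK Z)).
Proof.
  refine (Lifts_vps_eq
   (sc (sc (sr Z (st (al3K W X))) (Strict_whr (ltK X) (st (al2K W Z)))) (sl W (st (al2K X Z))))
   (sc (st (al2K (ten0 M W X) Z)) (Strict_whr (rtK Z) (st (al3K W X)))) _
   (Lifts_comp (Lifts_comp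
     (Lifts_whl (Compat_al3 it W X) (repL _) (repLL W X) (al3_Lifts W X) rfl (psL := R_ok M Z) (repR Z))
     (Lifts_conv (Lifts_whr (Compat_al2 hts it is W Z) (al2_Lifts W Z) (repL X))
       (fun A B f => eq_sym (UC_assoc (psF := R_ok M Z) (psG := L_ok M W) (repR Z) (repL W) (repL X) f))
       (fun A B f => eq_sym (UC_assoc (psF := L_ok M W) (psG := R_ok M Z) (repL W) (repR Z) (repL X) f))))
     (Lifts_whl (Compat_al2 hts it is X Z) (repRL X Z) (repLR X Z) (al2_Lifts X Z) rfl (psL := L_ok M W) (repL W)))
   (Lifts_comp (al2_Lifts (ten0 M W X) Z) (Lifts_whr (Compat_al3 it W X) (al3_Lifts W X) (repR Z)))
   (fun A B f => r_iso (repRL (ten0 M W X) Z) f)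
   (fun A B f => eq_refl)
   (fun A B f => UC_assoc (psF := L_ok M W) (psG := L_ok M X) (repL W) (repL X) (repR Z) f)
   (fun A B f => pent_Y M W X Z f)).
  intros Y. pose proof (m_pentagon_v M W X Y Z) as e. rewrite <- fvR, <- fvL in e. exact e.
Qed.

Lemma pentagon_Z W X Y :
  vps_eq (cen_l (al_cenK W X Y) //> al3K W (ten0 M X Y) //> whl (ltK W) (al3K X Y))
           (al3K (ten0 M W X) Y //> whr (al3K W X) (ltK Y)).
Proof.
  refine (Lifts_vps_eq
   (sc (sc (cen_l_strict _ _) (st (al3K W (ten0 M X Y)))) (sl W (st (al3K X Y))))
   (sc (st (al3K (ten0 M W X) Y)) (Strict_whr (ltK Y) (st (al3K W X)))) _
   (Lifts_comp (Lifts_comp (cen_l_Lifts _ _) (al3_Lifts W (ten0 M X Y)))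
     (Lifts_whl (Compat_al3 it X Y) (repL _) (repLL X Y) (al3_Lifts X Y) rfl (psL := L_ok M W) (repL W)))
   (Lifts_comp (al3_Lifts (ten0 M W X) Y) (Lifts_whr (Compat_al3 it W X) (al3_Lifts W X) (repL Y)))
   (fun A B f => r_iso (repL _) f)
   (fun A B f => eq_refl)
   (fun A B f => UC_assoc (psF := L_ok M W) (psG := L_ok M X) (repL W) (repL X) (repL Y) f)
   (fun A B f => pent_Z M W X Y f)).
  intros Z. pose proof (m_pentagon_v M W X Y Z) as e. rewrite <- (fvL W) in e. exact e.
Qed.

Lemma triangle_W Y : vps_eq (al1K (I0 M) Y //> cen_r (lam_cenK Y)) (whl (rtK Y) rhoK).
Proof.
  refine (Lifts_vps_eq (sc (st (al1K (I0 M) Y)) (cen_r_strict _ _)) (sr Y (st rhoK)) _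
   (Lifts_comp (al1_Lifts (I0 M) Y) (cen_r_Lifts _ _))
   (Lifts_whl (Compat_rho is) (repR _) repI rho_Lifts rfl (psL := R_ok M Y) (repR Y))
   (fun A B f => r_iso (repRR _ _) f)
   (fun A B f => eq_refl)
   (fun A B f => eq_sym (UC_id_r (psF := R_ok M Y) (repR Y) f))
   (fun A B f => tri_W M Y f)).
  intros W. pose proof (m_triangle_v M W Y) as e. rewrite <- (fvR Y) in e. exact e.
Qed.

Lemma triangle_Y W : vps_eq (al3K W (I0 M) //> whl (ltK W) lamK) (cen_l (rho_cenK W)).
Proof.
  refine (Lifts_vps_eq (sc (st (al3K W (I0 M))) (sl W (st lamK))) (cen_l_strict _ _) _
   (Lifts_comp (al3_Lifts W (I0 M)) (Lifts_whl (Compat_lam it) (repL _) repI lam_Lifts rfl (psL := L_ok M W) (repL W)))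
   (cen_l_Lifts _ _)
   (fun A B f => r_iso (repL _) f)
   (fun A B f => eq_refl)
   (fun A B f => UC_id_r (psF := L_ok M W) (repL W) f)
   (fun A B f => tri_Y M W f)).
  intros Y. pose proof (m_triangle_v M W Y) as e. rewrite <- fvL in e. exact e.
Qed.

Lemma triangle_l_W Y : vps_eq (al2K (I0 M) Y //> whr lamK (rtK Y)) (whl (rtK Y) lamK).
Proof.
  refine (Lifts_vps_eq (sc (st (al2K (I0 M) Y)) (Strict_whr (rtK Y) (st lamK))) (sr Y (st lamK)) _
   (Lifts_comp (al2_Lifts (I0 M) Y) (Lifts_whr (Compat_lam it) lam_Lifts (repR Y)))
   (Lifts_whl (Compat_lam it) (repL _) repI lam_Lifts rfl (psL := R_ok M Y) (repR Y))
   (fun A B f => r_iso (repRL _ _) f)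
   (fun A B f => eq_refl)
   (fun A B f => eq_trans (UC_id_l (repR Y) f) (eq_sym (UC_id_r (psF := R_ok M Y) (repR Y) f)))
   (fun A B f => tri_lW M Y f)).
  intros W. pose proof (m_triangle_l_v M W Y) as e. rewrite <- fvR in e. exact e.
Qed.

Lemma triangle_l_Y W : vps_eq (al3K (I0 M) W //> whr lamK (ltK W)) (cen_l (lam_cenK W)).
Proof.
  refine (Lifts_vps_eq (sc (st (al3K (I0 M) W)) (Strict_whr (ltK W) (st lamK))) (cen_l_strict _ _) _
   (Lifts_comp (al3_Lifts (I0 M) W) (Lifts_whr (Compat_lam it) lam_Lifts (repL W)))
   (cen_l_Lifts _ _)
   (fun A B f => r_iso (repL _) f)
   (fun A B f => eq_refl)
   (fun A B f => UC_id_l (repL W) f)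
   (fun A B f => tri_lY M W f)).
  intros Y. exact (m_triangle_l_v M W Y).
Qed.

Lemma triangle_r_W Y : vps_eq (al1K Y (I0 M) //> cen_r (rho_cenK Y)) (whr rhoK (rtK Y)).
Proof.
  refine (Lifts_vps_eq (sc (st (al1K Y (I0 M))) (cen_r_strict _ _)) (Strict_whr (rtK Y) (st rhoK)) _
   (Lifts_comp (al1_Lifts Y (I0 M)) (cen_r_Lifts _ _))
   (Lifts_whr (Compat_rho is) rho_Lifts (repR Y))
   (fun A B f => r_iso (repRR _ _) f)
   (fun A B f => eq_refl)
   (fun A B f => eq_sym (UC_id_l (repR Y) f))
   (fun A B f => tri_rW M Y f)).
  intros W. exact (m_triangle_r_v M W Y).
Qed.

Lemma triangle_r_Y W : vps_eq (al2K W (I0 M) //> whl (ltK W) rhoK) (whr rhoK (ltK W)).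
Proof.
  refine (Lifts_vps_eq (sc (st (al2K W (I0 M))) (sl W (st rhoK))) (Strict_whr (ltK W) (st rhoK)) _
   (Lifts_comp (al2_Lifts W (I0 M)) (Lifts_whl (Compat_rho is) (repR _) repI rho_Lifts rfl (psL := L_ok M W) (repL W)))
   (Lifts_whr (Compat_rho is) rho_Lifts (repL W))
   (fun A B f => r_iso (repRL _ _) f)
   (fun A B f => eq_refl)
   (fun A B f => eq_trans (UC_id_r (psF := L_ok M W) (repL W) f) (eq_sym (UC_id_l (repL W) f)))
   (fun A B f => tri_rY M W f)).
  intros Y. pose proof (m_triangle_r_v M W Y) as e. rewrite <- fvL in e. exact e.
Qed.

Definition Kl_premonoidal : Premonoidal K :=
  @Build_Premonoidal K binK (I0 M) lamK rhoK (malv M) al1K al2K al3K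
    (fun _ _ _ => eq_refl) (fun _ _ _ => eq_refl) (fun _ _ _ => eq_refl)
    (lift_vt_inv _ _ _) (lift_vt_inv _ _ _) (fun _ _ => lift_vt_inv _ _ _) (fun _ _ => lift_vt_inv _ _ _)
    (fun _ _ => lift_vt_inv _ _ _) lam_cenK rho_cenK al_cenK
    pentagon_W pentagon_X pentagon_Y pentagon_Z triangle_W triangle_Y triangle_l_W triangle_l_Y
    triangle_r_W triangle_r_Y.
End Prem.

Theorem theorem10p32 (D : DblData) (hD : is_double D) (M : Monoidal D) (T : VMonad D)
    (t : LStrength M T) (s : RStrength M T) (hts : Bistrong t s)
    (ial : Invertible (mal M)) (cal : Liftable (mal M))
    (ilam : Invertible (mlam M)) (clam : Liftable (mlam M))
    (irho : Invertible (mrho M)) (crho : Liftable (mrho M))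
    (it : Invertible (lst t)) (ct : Liftable (lst t))
    (is : Invertible (rst s)) (cs : Liftable (rst s))
    (imu : Invertible (mu T)) (cmu : Liftable (mu T))
    (ieta : Invertible (eta T)) (ceta : Liftable (eta T)) :
  is_pseudodouble (Kl (lift_monad imu cmu ieta ceta)) /\
  inhabited (Premonoidal (Kl (lift_monad imu cmu ieta ceta))).
Proof.
  split; [exact (Kl_pseudodouble imu cmu ieta ceta)|].
  exact (inhabits (Kl_premonoidal hts it ct is cs imu cmu ieta ceta)).
Qed.
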